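(* Let $\sigma>0$, let $f:\mathbb{R}^3\to\mathbb{R}$, $(t,x,y)\mapsto f(t,x,y)$, be a $C^1$ function that is $\sigma$-periodic in $t$, and let $\alpha,\eta\in\mathbb{R}$. For $\varepsilon\in\mathbb{R}$ consider the discontinuous differential equation $$\ddot{x}+\alpha\,\mathrm{sign}(x)=\eta x+\varepsilon f(t,x,\dot{x}).\qquad(\ast)$$ Suppose that for some $i\in\{1,4,7,9\}$ the parameters $\alpha$ and $\eta$ satisfy condition (C$i$) and that $\sigma/2\in\mathcal{I}_i$. Let $v$ be the corresponding inverse half-period function and let $M$ be the Melnikov-like function (all defined in the context). Then, for each $\phi^*\in[0,\sigma]$ such that $M(\phi^* )=0$ and $M'(\phi^* )\neq 0$, there exist $\overline{\varepsilon}>0$ and a unique smooth branch $x_\varepsilon(t)$, $\varepsilon\in(-\overline{\varepsilon},\overline{\varepsilon})$, of isolated $\sigma$-periodic solutions of the differential equation $(\ast)$ satisfying $(x_0(\phi^* ),\dot{x}_0(\phi^* ))=(0,v(\sigma/2))$.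
   Context: Solutions. Solutions of $(\ast)$ are understood in the Filippov sense: writing $\dot x=y$, they are the Filippov solutions of the first-order system $\dot x=y$, $\dot y=\eta x-\alpha\,\mathrm{sign}(x)+\varepsilon f(t,x,y)$, which is discontinuous on $\Sigma=\{x=0\}$. Solutions crossing $\Sigma$ transversally (i.e. at points with $y\neq0$) are concatenations of solutions of the smooth systems $\dot x=y,\ \dot y=\eta x-\alpha+\varepsilon f(t,x,y)$ in $x\ge 0$ and $\dot x=y,\ \dot y=\eta x+\alpha+\varepsilon f(t,x,y)$ in $x\le 0$. Notation. For $\eta<0$ put $\omega=\sqrt{-\eta}>0$. The conditions on the parameters are: (C1) $\eta>0$ and $\alpha>0$; (C4) $\eta=0$ and $\alpha>0$; (C7) $\eta<0$ and $\alpha>0$; (C9) $\eta<0$ and $\alpha<0$. The corresponding intervals are $\mathcal{I}_1=(0,\infty)$, $\mathcal{I}_4=(0,\infty)$, $\mathcal{I}_7=(0,\pi/\omega)$, $\mathcal{I}_9=(\pi/\omega,2\pi/\omega)$. (In these cases $\mathcal I_i$ is the image of the half-period function of the period annulus of the unperturbed system, and $v$ below is the inverse of that function.) The function $v$ is defined on $\mathcal{I}_i$ by - (C1): $v(s)=\frac{\alpha}{\sqrt{\eta}}\tanh\left(\frac{\sqrt{\eta}\,s}{2}\right)$; - (C4): $v(s)=\frac{\alpha s}{2}$; - (C7) and (C9): $v(s)=\frac{\alpha}{\omega}\tan\left(\frac{\omega s}{2}\right)$. The function $\Gamma(t,y_0)\in\mathbb{R}^2$ is the solution of $\dot x=y$,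 $\dot y=\eta x-\alpha$ with initial condition $(0,y_0)$ at $t=0$: - $\eta>0$: $\Gamma(t,y_0)=\left(\frac{\alpha(1-\cosh(\sqrt{\eta}t))+\sqrt{\eta}\,y_0\sinh(\sqrt{\eta}t)}{\eta},\ y_0\cosh(\sqrt{\eta}t)-\frac{\alpha\sinh(\sqrt{\eta}t)}{\sqrt{\eta}}\right)$; - $\eta=0$: $\Gamma(t,y_0)=\left(ty_0-\frac{\alpha t^2}{2},\ y_0-\alpha t\right)$; - $\eta<0$: $\Gamma(t,y_0)=\left(\frac{\alpha(\cos(\omega t)-1)+\omega y_0\sin(\omega t)}{\omega^2},\ y_0\cos(\omega t)-\frac{\alpha\sin(\omega t)}{\omega}\right)$. Let $R(x,y)=(-x,y)$, and - $\eta>0$: $U(t,s)=-\frac{\alpha}{\sqrt{\eta}}\,\mathrm{sech}\left(\frac{\sqrt{\eta}\,s}{2}\right)\sinh\left(\frac{\sqrt{\eta}(2t-s)}{2}\right)$; - $\eta=0$: $U(t,s)=-\frac{\alpha(2t-s)}{2}$; - $\eta<0$: $U(t,s)=-\frac{\alpha}{\omega}\sec\left(\frac{\omega s}{2}\right)\sin\left(\frac{\omega(2t-s)}{2}\right)$. The Melnikov-like function $M:\mathbb{R}\to\mathbb{R}$ is $$M(\phi)=\int_0^{\sigma/2}U\left(t,\tfrac{\sigma}{2}\right)\Big(f\big(\phi+t,\Gamma(t,v(\tfrac{\sigma}{2}))\big)+f\big(\phi-t,R\,\Gamma(t,v(\tfrac{\sigma}{2}))\big)\Big)\,dt,$$ where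 $f(s,(x,y))$ means $f(s,x,y)$.
   Formalization: The periodic solutions x_ε are claimed to be isolated only for ε ≠ 0: at ε = 0 the equation is autonomous and the time translates of x_0 are σ-periodic solutions arbitrarily close to x_0, so x_0 is never isolated. *)

(* Defs.v *)
From Stdlib Require Import Reals.
From Coquelicot Require Import Coquelicot.
Open Scope R_scope.

Definition null_set (E : R -> Prop) : Prop :=
  forall e : R, 0 < e ->
  exists u v : nat -> R,
    (forall n, u n <= v n) /\
    (forall t, E t -> exists n, u n < t < v n) /\
    ex_series (fun n => v n - u n) /\
    Series (fun n => v n - u n) <= e.

Definition almost_everywhere (P : R -> Prop) : Prop :=
  null_set (fun t => ~ P t).

(* Absolute continuity on every compact interval [a, b].  The nonoverlapping
   intervals [u 0, v 0], ..., [u n, v n] are listed from left to right. *)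
Definition locally_AC (g : R -> R) : Prop :=
  forall a b e : R, 0 < e ->
  exists d : R, 0 < d /\
  forall (n : nat) (u v : nat -> R),
    a <= u 0%nat -> v n <= b ->
    (forall i, (i <= n)%nat -> u i <= v i) ->
    (forall i, (i < n)%nat -> v i <= u (S i)) ->
    sum_f_R0 (fun i => v i - u i) n < d ->
    sum_f_R0 (fun i => Rabs (g (v i) - g (u i))) n < e.

(* Values at (t, p) of the Filippov set-valued field of the piecewise system
   given by Zp on {x > 0} and Zm on {x < 0}, both continuous up to {x = 0}:
   on {x = 0} it is the segment joining the two one-sided limits. *)
Definition filippov_set (Zp Zm : R -> R * R -> R * R)
    (t : R) (p w : R * R) : Prop :=
  (0 < fst p -> w = Zp t p) /\
  (fst p < 0 -> w = Zm t p) /\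
  (fst p = 0 -> exists l : R, 0 <= l <= 1 /\
     w = (l * fst (Zp t p) + (1 - l) * fst (Zm t p),
          l * snd (Zp t p) + (1 - l) * snd (Zm t p))).

Definition filippov_solution (Zp Zm : R -> R * R -> R * R)
    (x y : R -> R) : Prop :=
  locally_AC x /\ locally_AC y /\
  almost_everywhere (fun t => exists w : R * R,
    is_derive x t (fst w) /\ is_derive y t (snd w) /\
    filippov_set Zp Zm t (x t, y t) w).

(* The field (y, eta x - alpha s + eps f(t, x, y)), where s is the value
   taken by sign(x). *)
Definition oscillator_field (eta alpha : R) (f : R -> R -> R -> R)
    (eps s t : R) (p : R * R) : R * R :=
  (snd p, eta * fst p - alpha * s + eps * f t (fst p) (snd p)).

Definition oscillator_solution (eta alpha : R) (f : R -> R -> R -> R)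
    (eps : R) (x : R -> R) : Prop :=
  filippov_solution (oscillator_field eta alpha f eps 1)
                    (oscillator_field eta alpha f eps (-1))
                    x (Derive x).

Definition periodic_solution (sigma eta alpha : R) (f : R -> R -> R -> R)
    (eps : R) (x : R -> R) : Prop :=
  oscillator_solution eta alpha f eps x /\
  forall t, x (t + sigma) = x t.

(* Some tube around the closed curve (t, x(t), x'(t)) contains no other
   sigma-periodic solution of the same equation. *)
Definition isolated_periodic_solution (sigma eta alpha : R)
    (f : R -> R -> R -> R) (eps : R) (x : R -> R) : Prop :=
  periodic_solution sigma eta alpha f eps x /\
  exists d : R, 0 < d /\
  forall z : R -> R,
    periodic_solution sigma eta alpha f eps z ->
    (forall t, Rabs (z t - x t) < d /\ Rabs (Derive z t - Derive x t) < d) ->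
    forall t, z t = x t.

Definition C1_R3 (f : R -> R -> R -> R) : Prop :=
  (forall t x y,
     ex_derive (fun s => f s x y) t /\
     ex_derive (fun s => f t s y) x /\
     ex_derive (fun s => f t x s) y) /\
  (forall q : R * R * R,
     continuous (fun p : R * R * R =>
       Derive (fun s => f s (snd (fst p)) (snd p)) (fst (fst p))) q /\
     continuous (fun p : R * R * R =>
       Derive (fun s => f (fst (fst p)) s (snd p)) (snd (fst p))) q /\
     continuous (fun p : R * R * R =>
       Derive (fun s => f (fst (fst p)) (snd (fst p)) s) (snd p)) q).

Definition C1_strip (eb : R) (x : R -> R -> R) : Prop :=
  forall eps t, Rabs eps < eb ->
    ex_derive (fun e => x e t) eps /\
    ex_derive (fun s => x eps s) t /\
    continuity_2d_pt (fun e s => Derive (fun e' => x e' s) e) eps t /\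
    continuity_2d_pt (fun e s => Derive (fun s' => x e s') s) eps t.

Inductive param_case : Set := C1 | C4 | C7 | C9.

Definition param_cond (c : param_case) (eta alpha : R) : Prop :=
  match c with
  | C1 => 0 < eta /\ 0 < alpha
  | C4 => eta = 0 /\ 0 < alpha
  | C7 => eta < 0 /\ 0 < alpha
  | C9 => eta < 0 /\ alpha < 0
  end.

Definition omega (eta : R) : R := sqrt (- eta).

Definition half_period_range (c : param_case) (eta s : R) : Prop :=
  match c with
  | C1 | C4 => 0 < s
  | C7 => 0 < s < PI / omega eta
  | C9 => PI / omega eta < s < 2 * PI / omega eta
  end.

Definition half_period_inv (c : param_case) (eta alpha s : R) : R :=
  match c with
  | C1 => alpha / sqrt eta * tanh (sqrt eta * s / 2)
  | C4 => alpha * s / 2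
  | C7 | C9 => alpha / omega eta * tan (omega eta * s / 2)
  end.

Definition sign_cases {A : Type} (eta : R) (pos zero neg : A) : A :=
  if Rlt_dec 0 eta then pos else if Rlt_dec eta 0 then neg else zero.

Definition Gamma (eta alpha t y0 : R) : R * R :=
  sign_cases eta
    ((alpha * (1 - cosh (sqrt eta * t)) + sqrt eta * y0 * sinh (sqrt eta * t))
       / eta,
     y0 * cosh (sqrt eta * t) - alpha * sinh (sqrt eta * t) / sqrt eta)
    (t * y0 - alpha * t ^ 2 / 2,
     y0 - alpha * t)
    ((alpha * (cos (omega eta * t) - 1)
        + omega eta * y0 * sin (omega eta * t)) / omega eta ^ 2,
     y0 * cos (omega eta * t) - alpha * sin (omega eta * t) / omega eta).

Definition reflect (p : R * R) : R * R := (- fst p, snd p).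

Definition U (eta alpha t s : R) : R :=
  sign_cases eta
    (- (alpha / sqrt eta) * / cosh (sqrt eta * s / 2)
       * sinh (sqrt eta * (2 * t - s) / 2))
    (- (alpha * (2 * t - s) / 2))
    (- (alpha / omega eta) * / cos (omega eta * s / 2)
       * sin (omega eta * (2 * t - s) / 2)).

Definition melnikov (c : param_case) (sigma eta alpha : R)
    (f : R -> R -> R -> R) (phi : R) : R :=
  RInt (fun t =>
    let p := Gamma eta alpha t (half_period_inv c eta alpha (sigma / 2)) in
    U eta alpha t (sigma / 2) *
      (f (phi + t) (fst p) (snd p) +
       f (phi - t) (fst (reflect p)) (snd (reflect p))))
    0 (sigma / 2).

(* Isolation is required for eps <> 0 only: at eps = 0 the equation is
   autonomous and every time translate of x 0 is again sigma-periodic. *)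
Definition smooth_branch (sigma eta alpha : R) (f : R -> R -> R -> R)
    (phi y0 eb : R) (x : R -> R -> R) : Prop :=
  C1_strip eb x /\
  (forall eps, Rabs eps < eb ->
     periodic_solution sigma eta alpha f eps (x eps)) /\
  (forall eps, Rabs eps < eb -> eps <> 0 ->
     isolated_periodic_solution sigma eta alpha f eps (x eps)) /\
  x 0 phi = 0 /\ Derive (x 0) phi = y0.

(* Main.v *)
Require Import Defs.
From Stdlib Require Import Reals Lra Lia Psatz ZArith Cantor Classical FunctionalExtensionality.
From Coquelicot Require Import Coquelicot.
Open Scope R_scope.
(** Write h = sigma / 2.  Without perturbation, the orbit through (0, v) at time
    phi spends a time h in x > 0, crosses x = 0 with velocity - v, and comes back
    by symmetry after another time h; it has period sigma.  The proof continues
    this orbit in eps by a contraction argument that also controls smoothness.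

    A nearby orbit is described by a state: eps, the length tau of its phase in
    x > 0 (the other phase lasts 2 h - tau), the time cPhi at which it enters
    x > 0, its velocity cY0 there, and the values of f along it in the two
    phases, each parametrized by [0, 1].  The phase in x < 0 is run backwards in
    time and reflected, so that both phases start at the same crossing and obey
    the same equation x'' = eta x - alpha + eps g.  Since the forcing g belongs to
    the state, variation of constants with S' = C, C' = eta S, Q' = S gives the
    two phases X s, Y s by explicit integrals, for all signs of eta at once.  A
    state comes from a sigma-periodic orbit when both phases arrive at x = 0,
    arrive with the same velocity, and have the recorded forcing
    ([periodic_state]).

    At eps = 0 the two arrival velocities agree for every phase phi; this is the
    degeneracy that the Melnikov function resolves.  Once both phases arrive at
    x = 0, the velocity mismatch is eps times an explicit quantity
    ([arrival_velocity]), so the matching equation may be divided by eps without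
    losing a derivative.  The quotient [closing_defect], evaluated on the
    unperturbed orbit with phase phi, equals - (S h)^2 / v times M phi
    ([closing_defect_melnikov]).  Hence M phi = 0 makes the unperturbed state a
    fixed point of the Newton-type map [newton_map], and M' phi <> 0 makes its
    phase row well defined.  The derivative of that map at the unperturbed state
    is nilpotent, so it contracts in a weighted sup norm ([rows_contract]), and
    its fixed points form a branch that is strictly differentiable in eps
    ([branch_strictly_differentiable], [branch_of_states]).

    Each fixed point is a closed orbit whose two phases keep their signs near the
    unperturbed ones ([closed_branch]), and so a periodic Filippov solution
    ([periodic_solution_of_closed]).  In each phase the orbit is strictly
    differentiable in (eps, t); along the moving curve of switching times both
    pieces vanish and have the same velocity, which forces their eps-derivatives to
    agree as well ([sd2_along_zero_curve]).  The pieces therefore glue to a function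
    that is strictly differentiable everywhere, hence C1 ([position_at_sd2],
    [C1_strip_of_sd2]).

    Conversely, a Filippov solution is a classical one while it stays on one side
    of x = 0, because an absolutely continuous function with an almost everywhere
    given continuous derivative is C1 ([AC_ae_derive_continuous]).  For eps <> 0, a
    sigma-periodic solution close to the unperturbed orbit crosses x = 0
    transversally exactly twice per period, and its state is a fixed point of
    [newton_map] near the unperturbed one; so it belongs to the branch
    ([tube_uniqueness]).  This gives isolation.  At eps = 0 the crossing data (0, v)
    determine the solution ([unperturbed_uniqueness]), and a second branch through
    the same data cannot leave the tube, so it agrees with the first by connectedness
    of the parameter interval ([branch_uniqueness]). *)

(** * Real-variable preliminaries *)

(** Equalities produced by integral lemmas are stated in the carrier of a
    normed module, where ring and field do not recognize the type. *)
Ltac eq_in_R := match goal with |- ?a = ?b => change (@eq R a b) end.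

Lemma continuous_Rplus (f g : R -> R) (x : R) :
  continuous f x -> continuous g x -> continuous (fun y => f y + g y) x.
Proof. apply (continuous_plus (V := R_NormedModule)). Qed.

Lemma continuous_Rminus (f g : R -> R) (x : R) :
  continuous f x -> continuous g x -> continuous (fun y => f y - g y) x.
Proof. apply (continuous_minus (V := R_NormedModule)). Qed.

Lemma continuous_Rscal (c : R) (f : R -> R) (x : R) :
  continuous f x -> continuous (fun y => c * f y) x.
Proof. apply (continuous_scal_r (V := R_NormedModule)). Qed.

Lemma continuous_Rmult (f g : R -> R) (x : R) :
  continuous f x -> continuous g x -> continuous (fun y => f y * g y) x.
Proof. apply (continuous_mult (K := R_AbsRing)). Qed.

Lemma is_derive_Rconst (c x : R) : is_derive (fun _ : R => c) x 0.
Proof. apply (is_derive_const (V := R_NormedModule)). Qed.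

Lemma is_derive_Rminus (f g : R -> R) (x df dg : R) :
  is_derive f x df -> is_derive g x dg -> is_derive (fun y => f y - g y) x (df - dg).
Proof. apply (is_derive_minus (V := R_NormedModule)). Qed.

Lemma is_derive_Rcomp (f g : R -> R) (x df dg : R) :
  is_derive f (g x) df -> is_derive g x dg -> is_derive (fun y => f (g y)) x (dg * df).
Proof. apply (is_derive_comp (V := R_NormedModule)). Qed.

(** Radii small enough for several local estimates at once. *)
Lemma below2 a b : 0 < a -> 0 < b -> exists d, 0 < d /\ d <= a /\ d <= b.
Proof.
  intros Ha Hb. exists (Rmin a b).
  split; [apply Rmin_glb_lt; assumption|split; [apply Rmin_l|apply Rmin_r]].
Qed.

Lemma below3 a b c : 0 < a -> 0 < b -> 0 < c ->
  exists d, 0 < d /\ d <= a /\ d <= b /\ d <= c.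
Proof.
  intros Ha Hb Hc. destruct (below2 a b Ha Hb) as [d [Hd [H1 H2]]].
  destruct (below2 d c Hd Hc) as [d' [Hd' H']]. exists d'. lra.
Qed.

Lemma below4 a b c x : 0 < a -> 0 < b -> 0 < c -> 0 < x ->
  exists d, 0 < d /\ d <= a /\ d <= b /\ d <= c /\ d <= x.
Proof.
  intros Ha Hb Hc Hx. destruct (below3 a b c Ha Hb Hc) as [d [Hd H1]].
  destruct (below2 d x Hd Hx) as [d' [Hd' H']]. exists d'. lra.
Qed.

Lemma below5 a b c x y : 0 < a -> 0 < b -> 0 < c -> 0 < x -> 0 < y ->
  exists d, 0 < d /\ d <= a /\ d <= b /\ d <= c /\ d <= x /\ d <= y.
Proof.
  intros Ha Hb Hc Hx Hy. destruct (below3 a b c Ha Hb Hc) as [d [Hd H1]].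
  destruct (below3 d x y Hd Hx Hy) as [d' [Hd' H']]. exists d'. lra.
Qed.

Lemma continuous_eps_delta (f : R -> R) x :
  continuous f x <->
  forall e, 0 < e -> exists d, 0 < d /\
    forall y, Rabs (y - x) < d -> Rabs (f y - f x) < e.
Proof.
  split.
  - intros H e He. apply continuity_pt_filterlim in H.
    destruct (H e He) as [d [Hd H']]. exists d. split; [exact Hd|].
    intros y Hy. destruct (Req_dec y x) as [->|Hn].
    + rewrite Rminus_diag, Rabs_R0. exact He.
    + apply (H' y). split; [split; [exact I|congruence]|exact Hy].
  - intros H. apply continuity_pt_filterlim. intros e He.
    destruct (H e He) as [d [Hd H']]. exists d. split; [exact Hd|].
    intros y [_ Hy]. apply H'. exact Hy.
Qed.

(** Compactness of [a, b] in the form used throughout: a relation between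
    endpoints that holds on all short intervals around each point and composes
    holds on [a, b]. The supremum of the endpoints reached from a can be
    passed. *)
Lemma interval_induction (P : R -> R -> Prop) a b : a <= b ->
  (forall t, a <= t <= b -> exists d, 0 < d /\
     forall u v, a <= u -> u <= t -> t <= v -> v <= b ->
       t - u < d -> v - t < d -> P u v) ->
  (forall u v w, a <= u -> u <= v -> v <= w -> w <= b ->
     P u v -> P v w -> P u w) ->
  P a b.
Proof.
  intros Hab Hloc Htr.
  set (E := fun x => a <= x <= b /\ P a x).
  assert (Ea : E a).
  { destruct (Hloc a ltac:(lra)) as [d [Hd H]].
    split; [lra|]. apply H; lra. }
  destruct (completeness E) as [m [Hub Hlub]].
  { exists b. intros x [Hx _]. lra. }
  { exists a. exact Ea. }
  assert (Hm : a <= m <= b).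
  { split; [apply Hub, Ea|]. apply Hlub. intros x [Hx _]. lra. }
  destruct (Hloc m Hm) as [d [Hd H]].
  assert (Hx : exists x, E x /\ m - d < x).
  { destruct (classic (exists x, E x /\ m - d < x)) as [Hy|Hn]; [exact Hy|].
    exfalso. assert (m <= m - d); [|lra].
    apply Hlub. intros x Ex. apply Rnot_lt_le. intros Hlt. apply Hn. exists x. auto. }
  destruct Hx as [x [[Hx Px] Hxm]].
  assert (x <= m) by (apply Hub; split; auto).
  set (v := Rmin b (m + d / 2)).
  assert (Hv : m <= v /\ v <= b /\ v <= m + d / 2).
  { unfold v. repeat split; [apply Rmin_glb; lra|apply Rmin_l|apply Rmin_r]. }
  assert (Pv : P a v).
  { apply Htr with x; try lra; auto. apply H; lra. }
  assert (v <= m) by (apply Hub; split; [lra|exact Pv]).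
  destruct (Rle_dec b (m + d / 2)) as [Hb|Hb].
  - unfold v in Pv. rewrite Rmin_left in Pv; auto.
  - exfalso. unfold v in *. rewrite Rmin_right in *; lra.
Qed.

Lemma uniform_on_interval (Q : R -> R -> Prop) a b : a <= b ->
  (forall u d d', 0 < d' -> d' <= d -> Q u d -> Q u d') ->
  (forall t, a <= t <= b -> exists d, 0 < d /\
     forall u, a <= u <= b -> Rabs (u - t) < d -> Q u d) ->
  exists d, 0 < d /\ forall u, a <= u <= b -> Q u d.
Proof.
  intros Hab Hmon Hloc.
  apply (interval_induction
    (fun p q => exists d, 0 < d /\ forall u, p <= u <= q -> Q u d) a b Hab).
  - intros t Ht. destruct (Hloc t Ht) as [d [Hd H]]. exists d. split; [exact Hd|].
    intros p q Hap Hpt Htq Hqb Hp Hq. exists d. split; [exact Hd|].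
    intros u Hu. apply H; [lra|]. apply Rabs_def1; lra.
  - intros p q r _ Hpq Hqr _ [d1 [Hd1 H1]] [d2 [Hd2 H2]].
    assert (Hmin : 0 < Rmin d1 d2) by (apply Rmin_glb_lt; assumption).
    exists (Rmin d1 d2). split; [exact Hmin|]. intros u Hu.
    destruct (Rle_dec u q).
    + apply Hmon with d1; [exact Hmin|apply Rmin_l|apply H1; lra].
    + apply Hmon with d2; [exact Hmin|apply Rmin_r|apply H2; lra].
Qed.

Lemma lipschitz_of_local (g : R -> R) (K : R) :
  (forall t, exists d, 0 < d /\ forall u v, t - d < u -> u <= t -> t <= v -> v < t + d ->
     Rabs (g v - g u) <= K * (v - u)) ->
  forall u v, u <= v -> Rabs (g v - g u) <= K * (v - u).
Proof.
  intros H a b Hab.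
  apply (interval_induction (fun u v => Rabs (g v - g u) <= K * (v - u)) a b Hab).
  - intros t _. destruct (H t) as [d [Hd Hd']]. exists d. split; [exact Hd|].
    intros. apply Hd'; lra.
  - intros u v w _ _ _ _ H1 H2.
    replace (g w - g u) with ((g w - g v) + (g v - g u)) by ring.
    eapply Rle_trans; [apply Rabs_triang|]. lra.
Qed.

Lemma sum_f_R0_scal (K : R) (a : nat -> R) n :
  sum_f_R0 (fun i => K * a i) n = K * sum_f_R0 a n.
Proof. induction n; simpl; [reflexivity|]. rewrite IHn. ring. Qed.

(** The orbits built below are Lipschitz together with their velocities; this
    gives them the regularity of Filippov solutions. *)
Lemma lipschitz_locally_AC (g : R -> R) K :
  (forall u v, u <= v -> Rabs (g v - g u) <= K * (v - u)) -> locally_AC g.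
Proof.
  intros H a b e He.
  assert (HK : 0 <= K).
  { generalize (H 0 1 ltac:(lra)) (Rabs_pos (g 1 - g 0)). lra. }
  exists (e / (K + 1)). split; [apply Rdiv_lt_0_compat; lra|].
  intros n u v _ _ Huv _ Hs.
  apply Rle_lt_trans with (K * sum_f_R0 (fun i => v i - u i) n).
  - rewrite <- sum_f_R0_scal. apply sum_Rle. intros i Hi. apply H, Huv, Hi.
  - assert (Hp : 0 <= sum_f_R0 (fun i => v i - u i) n).
    { rewrite <- (sum_eq_R0 (fun _ => 0) n) by reflexivity.
      apply sum_Rle. intros i Hi. specialize (Huv i Hi). lra. }
    apply Rle_lt_trans with ((K + 1) * sum_f_R0 (fun i => v i - u i) n); [nra|].
    apply (Rmult_lt_compat_l (K + 1)) in Hs; [|lra].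
    replace ((K + 1) * (e / (K + 1))) with e in Hs by (field; lra). exact Hs.
Qed.

Lemma locally_AC_continuous (g : R -> R) : locally_AC g -> forall t, continuous g t.
Proof.
  intros H t. apply continuous_eps_delta. intros e He.
  destruct (H (t - 1) (t + 1) e He) as [d [Hd H']].
  exists (Rmin d 1). split; [apply Rmin_glb_lt; lra|]. intros y Hy.
  assert (H0 : Rabs (y - t) < d) by (eapply Rlt_le_trans; [exact Hy|apply Rmin_l]).
  assert (H1 : Rabs (y - t) < 1) by (eapply Rlt_le_trans; [exact Hy|apply Rmin_r]).
  apply Rabs_def2 in H0, H1.
  destruct (Rle_dec t y).
  - apply (H' 0%nat (fun _ => t) (fun _ => y)); simpl; intros; (lra || lia).
  - rewrite Rabs_minus_sym.
    apply (H' 0%nat (fun _ => y) (fun _ => t)); simpl; intros; (lra || lia).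
Qed.

Lemma is_derive_continuous (f : R -> R) x l : is_derive f x l -> continuous f x.
Proof.
  intros H. apply (ex_derive_continuous (V := R_NormedModule)). exists l. exact H.
Qed.

(** * Absolutely continuous functions with an almost everywhere given derivative *)

Definition AC_on (a b : R) (g : R -> R) : Prop :=
  forall e, 0 < e -> exists d : R, 0 < d /\
  forall (n : nat) (u v : nat -> R),
    a <= u 0%nat -> v n <= b ->
    (forall i, (i <= n)%nat -> u i <= v i) ->
    (forall i, (i < n)%nat -> v i <= u (S i)) ->
    sum_f_R0 (fun i => v i - u i) n < d ->
    sum_f_R0 (fun i => Rabs (g (v i) - g (u i))) n < e.

(** The part of each [u n, v n] to the left of t, summed: an increasing
    function of t that grows at least like t while t runs inside an interval of
    the family, and whose total growth is at most the total length of the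
    family. *)
Definition covered_length (u v : nat -> R) (t : R) : R :=
  Series (fun n => Rmax 0 (Rmin (v n) t - u n)).

Lemma ordered_family_bounds (n : nat) (u v : nat -> R) :
  (forall i, (i <= n)%nat -> u i <= v i) ->
  (forall i, (i < n)%nat -> v i <= u (S i)) ->
  forall i, (i <= n)%nat -> u 0%nat <= u i /\ v i <= v n.
Proof.
  intros H1 H2 i Hi. split.
  - induction i; [lra|]. apply Rle_trans with (u i); [apply IHi; lia|].
    apply Rle_trans with (v i); [apply H1; lia|apply H2; lia].
  - remember (n - i)%nat as k. revert i Hi Heqk. induction k; intros i Hi Hk.
    + replace i with n by lia. lra.
    + apply Rle_trans with (u (S i)); [apply H2; lia|].
      apply Rle_trans with (v (S i)); [apply H1; lia|]. apply IHk; lia.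
Qed.

Lemma AC_on_minus a b f g K : AC_on a b f ->
  (forall u v, a <= u -> u <= v -> v <= b -> Rabs (g v - g u) <= K * (v - u)) ->
  AC_on a b (fun t => f t - g t).
Proof.
  intros Hf Hg e He. destruct (Hf (e / 2) ltac:(lra)) as [d [Hd H]].
  set (K' := Rabs K + 1). assert (HK' : 0 < K') by (unfold K'; generalize (Rabs_pos K); lra).
  exists (Rmin d (e / 2 / K')). split.
  { apply Rmin_glb_lt; [lra|]. apply Rdiv_lt_0_compat; lra. }
  intros n u v Ha Hb H1 H2 Hs.
  assert (Hs1 : sum_f_R0 (fun i => v i - u i) n < d)
    by (eapply Rlt_le_trans; [exact Hs|apply Rmin_l]).
  assert (Hs2 : sum_f_R0 (fun i => v i - u i) n < e / 2 / K')
    by (eapply Rlt_le_trans; [exact Hs|apply Rmin_r]).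
  specialize (H n u v Ha Hb H1 H2 Hs1).
  apply Rle_lt_trans with
    (sum_f_R0 (fun i => Rabs (f (v i) - f (u i)) + K' * (v i - u i)) n).
  - apply sum_Rle. intros i Hi.
    destruct (ordered_family_bounds n u v H1 H2 i Hi) as [B1 B2].
    specialize (H1 i Hi). specialize (Hg (u i) (v i)).
    replace (f (v i) - g (v i) - (f (u i) - g (u i)))
      with ((f (v i) - f (u i)) - (g (v i) - g (u i))) by ring.
    eapply Rle_trans; [apply Rabs_triang|]. rewrite Rabs_Ropp.
    apply Rplus_le_compat_l. eapply Rle_trans; [apply Hg; lra|].
    apply Rmult_le_compat_r; [lra|]. unfold K'. generalize (Rle_abs K); lra.
  - rewrite sum_plus, sum_f_R0_scal.
    apply (Rmult_lt_compat_l K') in Hs2; [|lra].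
    replace (K' * (e / 2 / K')) with (e / 2) in Hs2 by (field; lra). lra.
Qed.

Lemma Series_ge_term (a : nat -> R) m :
  (forall n, 0 <= a n) -> ex_series a -> a m <= Series a.
Proof.
  intros Hp Ha.
  assert (Hs : forall n, 0 <= sum_n a n).
  { induction n; [rewrite sum_O; apply Hp|]. rewrite sum_Sn.
    apply Rplus_le_le_0_compat; auto. }
  apply Rle_trans with (sum_n a m).
  - destruct m; [rewrite sum_O; apply Rle_refl|]. rewrite sum_Sn.
    change (a (S m) <= sum_n a m + a (S m)). specialize (Hs m). lra.
  - apply (is_lim_seq_incr_compare (sum_n a)).
    + apply (Series_correct a Ha).
    + intros n. rewrite sum_Sn. change (sum_n a n <= sum_n a n + a (S n)).
      specialize (Hp (S n)). lra.
Qed.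

Section covered.
Context (u v : nat -> R) (Huv : forall n, u n <= v n)
  (Hser : ex_series (fun n => v n - u n)).

Lemma covered_term_bounds n t : 0 <= Rmax 0 (Rmin (v n) t - u n) <= v n - u n.
Proof.
  split; [apply Rmax_l|]. apply Rmax_lub; [specialize (Huv n); lra|].
  generalize (Rmin_l (v n) t). lra.
Qed.

Lemma covered_ex t : ex_series (fun n => Rmax 0 (Rmin (v n) t - u n)).
Proof.
  apply (ex_series_le (K := R_AbsRing) (V := R_CompleteNormedModule))
    with (b := fun n => v n - u n); [|exact Hser].
  intros n. destruct (covered_term_bounds n t). 
  change norm with Rabs. simpl. rewrite Rabs_pos_eq; lra.
Qed.

Lemma covered_length_incr s t m : s <= t -> u m < s -> t < v m ->
  t - s <= covered_length u v t - covered_length u v s.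
Proof.
  intros Hst Hs Ht. unfold covered_length.
  rewrite <- Series_minus by apply covered_ex.
  eapply Rle_trans; [|apply (Series_ge_term _ m)].
  - simpl. rewrite !Rmin_right, !Rmax_right; lra.
  - intros n. assert (Rmax 0 (Rmin (v n) s - u n) <= Rmax 0 (Rmin (v n) t - u n)); [|lra].
    apply Rle_max_compat_l. generalize (Rle_min_compat_l _ _ (v n) Hst). lra.
  - apply (ex_series_minus (V := R_NormedModule)); apply covered_ex.
Qed.

Lemma covered_length_le s t :
  covered_length u v t - covered_length u v s <= Series (fun n => v n - u n).
Proof.
  assert (covered_length u v t <= Series (fun n => v n - u n)).
  { apply Series_le; [intros; apply covered_term_bounds|exact Hser]. }
  assert (0 <= covered_length u v s); [|lra].
  eapply Rle_trans; [|apply (Series_ge_term _ 0%nat); [|apply covered_ex]];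
    intros; apply Rmax_l.
Qed.
End covered.

Lemma derive_zero_local (G : R -> R) t e : 0 < e -> is_derive G t 0 ->
  exists d, 0 < d /\ forall y, Rabs (y - t) < d -> Rabs (G y - G t) <= e * Rabs (y - t).
Proof.
  intros He H. apply is_derive_Reals in H. destruct (H e He) as [d Hd].
  exists d. split; [apply cond_pos|]. intros y Hy.
  destruct (Req_dec y t) as [->|Hn].
  - rewrite !Rminus_diag, Rabs_R0. lra.
  - specialize (Hd (y - t) ltac:(lra) Hy).
    replace (t + (y - t)) with y in Hd by ring.
    replace (G y - G t) with (((G y - G t) / (y - t) - 0) * (y - t)) by (field; lra).
    rewrite Rabs_mult. apply Rmult_le_compat_r; [apply Rabs_pos|lra].
Qed.

(** The family a 0, ..., a n followed by b 0, b 1, ...; these are the n + 1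
    first terms because sum_f_R0 sums up to and including n. *)
Definition append (n : nat) (a b : nat -> R) (i : nat) : R :=
  if (i <=? n)%nat then a i else b (i - S n)%nat.

Lemma append_l n a b i : (i <= n)%nat -> append n a b i = a i.
Proof. intros H. unfold append. rewrite (proj2 (Nat.leb_le i n) H). reflexivity. Qed.

Lemma append_r n a b i : append n a b (S n + i) = b i.
Proof.
  unfold append. rewrite (proj2 (Nat.leb_gt (S n + i) n)) by lia. f_equal. lia.
Qed.

Lemma sum_append (h : R -> R -> R) n m (u v u' v' : nat -> R) :
  sum_f_R0 (fun i => h (append n u u' i) (append n v v' i)) (S n + m) =
  sum_f_R0 (fun i => h (u i) (v i)) n + sum_f_R0 (fun i => h (u' i) (v' i)) m.
Proof.
  rewrite (tech2 _ n) by lia. f_equal.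
  - apply sum_eq. intros i Hi. rewrite !append_l by exact Hi. reflexivity.
  - replace (S n + m - S n)%nat with m by lia.
    apply sum_eq. intros i _. rewrite !append_r. reflexivity.
Qed.

(** Where G' = 0, short intervals contribute at most e times their length; the
    remaining null set is covered by a family of total length below the modulus
    of absolute continuity for e, and the increments of G over the pieces lying
    in that family sum to less than e. Interval induction glues the two kinds
    of pieces into one ordered family, and the covered length bounds the total
    length of the second kind although the covering intervals may overlap. *)
Lemma AC_derive_zero_constant (G : R -> R) (P : R -> Prop) a b : a <= b ->
  AC_on a b G -> almost_everywhere P ->
  (forall t, a <= t <= b -> P t -> is_derive G t 0) ->
  G b = G a.
Proof.
  intros Hab HAC Hae HP.
  apply cond_eq. intros e0 He0.
  set (e := e0 / (b - a + 2)).
  assert (He : 0 < e) by (apply Rdiv_lt_0_compat; lra).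
  (* the null set is covered with total length d / 2 *)
  destruct (HAC e He) as [d [Hd HAC']].
  destruct (Hae (d / 2) ltac:(lra)) as [cu [cv [Hc1 [Hc2 [Hc3 Hc4]]]]].
  set (L := covered_length cu cv).
  assert (Hfam : exists n u v, a <= u 0%nat /\ v n <= b /\
    (forall i, (i <= n)%nat -> u i <= v i) /\
    (forall i, (i < n)%nat -> v i <= u (S i)) /\
    sum_f_R0 (fun i => v i - u i) n <= L b - L a /\
    Rabs (G b - G a) <= e * (b - a) + sum_f_R0 (fun i => Rabs (G (v i) - G (u i))) n).
  { apply (interval_induction (fun s t => exists n u v, s <= u 0%nat /\ v n <= t /\
    (forall i, (i <= n)%nat -> u i <= v i) /\
    (forall i, (i < n)%nat -> v i <= u (S i)) /\
    sum_f_R0 (fun i => v i - u i) n <= L t - L s /\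
    Rabs (G t - G s) <= e * (t - s) + sum_f_R0 (fun i => Rabs (G (v i) - G (u i))) n)
      a b Hab).
    - intros t Ht. destruct (classic (P t)) as [Pt|nPt].
      + destruct (derive_zero_local G t e He (HP t Ht Pt)) as [r [Hr H]].
        exists r. split; [exact Hr|]. intros p q _ Hp Hq _ Hpr Hqr.
        exists 0%nat, (fun _ => p), (fun _ => p). simpl.
        repeat split; try lra; try (intros; lra).
        * rewrite Rminus_diag.
          assert (L p <= L q); [|lra].
          apply Series_le; [|apply covered_ex; auto].
          intros n. split; [apply Rmax_l|]. apply Rle_max_compat_l.
          generalize (Rle_min_compat_l p q (cv n)). lra.
        * rewrite Rminus_diag, Rabs_R0, Rplus_0_r.
          replace (G q - G p) with ((G q - G t) - (G p - G t)) by ring.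
          eapply Rle_trans; [apply Rabs_triang|]. rewrite Rabs_Ropp.
          generalize (H q) (H p). rewrite (Rabs_pos_eq (q - t)), (Rabs_left1 (p - t)) by lra.
          intros H1 H2. specialize (H1 ltac:(lra)). specialize (H2 ltac:(lra)). lra.
      + destruct (Hc2 t nPt) as [m Hm].
        exists (Rmin (t - cu m) (cv m - t)). split; [apply Rmin_glb_lt; lra|].
        intros p q _ Hp Hq _ Hpr Hqr.
        generalize (Rmin_l (t - cu m) (cv m - t)) (Rmin_r (t - cu m) (cv m - t)). intros M1 M2.
        exists 0%nat, (fun _ => p), (fun _ => q). simpl.
        repeat split; try lra; try (intros; lra); try (intros; lia).
        * apply covered_length_incr with m; auto; lra.
        * assert (0 <= e * (q - p)) by (apply Rmult_le_pos; lra). lra.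
    - intros p q r _ Hpq Hqr _
        [n [u [v [A1 [A2 [A3 [A4 [A5 A6]]]]]]]] [m [u' [v' [B1 [B2 [B3 [B4 [B5 B6]]]]]]]].
      exists (S n + m)%nat, (append n u u'), (append n v v').
      repeat split.
      + rewrite append_l by lia. exact A1.
      + rewrite append_r. exact B2.
      + intros i Hi. destruct (Nat.le_gt_cases i n) as [Hin|Hin].
        * rewrite !append_l by exact Hin. auto.
        * replace i with (S n + (i - S n))%nat by lia. rewrite !append_r. apply B3. lia.
      + intros i Hi. destruct (Nat.lt_trichotomy i n) as [Hin|[->|Hin]].
        * rewrite !append_l by lia. auto.
        * rewrite append_l by lia. replace (S n) with (S n + 0)%nat at 1 by lia.
          rewrite append_r. lra.
        * replace (S i) with (S n + (S (i - S n)))%nat by lia. rewrite append_r.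
          replace i with (S n + (i - S n))%nat at 1 by lia. rewrite append_r.
          apply B4. lia.
      + rewrite (sum_append (fun x y => y - x)). lra.
      + rewrite (sum_append (fun x y => Rabs (G y - G x))).
        replace (G r - G p) with ((G r - G q) + (G q - G p)) by ring.
        eapply Rle_trans; [apply Rabs_triang|].
        replace (r - p) with ((r - q) + (q - p)) by ring. lra. }
  destruct Hfam as [n [u [v [A1 [A2 [A3 [A4 [A5 A6]]]]]]]].
  assert (Hlen : sum_f_R0 (fun i => v i - u i) n < d).
  { eapply Rle_lt_trans; [exact A5|].
    eapply Rle_lt_trans; [apply covered_length_le; auto|]. lra. }
  specialize (HAC' n u v A1 A2 A3 A4 Hlen).
  apply Rle_lt_trans with (e * (b - a + 1)); [lra|].
  replace e0 with (e * (b - a + 2)) by (unfold e; field; lra).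
  apply Rmult_lt_compat_l; lra.
Qed.

Lemma is_derive_RInt_continuous (k : R -> R) a t :
  (forall x, continuous k x) -> is_derive (fun x => RInt k a x) t (k t).
Proof.
  intros Hk. apply (is_derive_RInt k _ a); [|apply Hk].
  apply filter_forall. intros x. apply (RInt_correct (V := R_CompleteNormedModule)).
  apply ex_RInt_continuous. intros; apply Hk.
Qed.

(** Subtract the primitive of k: the difference is absolutely continuous with
    derivative zero almost everywhere, so it is constant. This turns the almost
    everywhere equation of a Filippov solution into an ordinary one. *)
Lemma AC_ae_derive_continuous (g k : R -> R) (P : R -> Prop) a b :
  locally_AC g -> almost_everywhere P -> (forall t, continuous k t) ->
  (forall t, a < t < b -> P t -> is_derive g t (k t)) ->
  forall t, a < t < b -> is_derive g t (k t).
Proof.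
  intros HAC Hae Hk HP t Ht.
  set (lo := (a + t) / 2).
  set (I := (fun x => RInt k lo x) : R -> R).
  assert (HI : forall x, is_derive I x (k x)).
  { intros x. apply (is_derive_RInt_continuous k lo x Hk). }
  assert (Heq : forall x, lo <= x < b -> g x = I x + g lo).
  { intros x Hx.
    assert (Hbd : exists K, forall y, lo <= y <= x -> Rabs (k y) <= K).
    { destruct (continuity_ab_maj (fun y => Rabs (k y)) lo x) as [M [HM _]].
      - lra.
      - intros c Hc. apply continuity_pt_filterlim, continuous_Rabs_comp, Hk.
      - exists (Rabs (k M)). exact HM. }
    destruct Hbd as [K HK].
    assert (Hc : (fun y => g y - I y) x = (fun y => g y - I y) lo).
    { apply (AC_derive_zero_constant (fun y => g y - I y) P lo x); [lra| |exact Hae|].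
      - apply AC_on_minus with K; [intros e He; apply HAC, He|].
        intros u v Hu Huv Hv.
        destruct (MVT_gen I u v k) as [c [Hc1 Hc2]].
        + intros; apply HI.
        + intros y _. apply continuity_pt_filterlim, is_derive_continuous with (k y), HI.
        + rewrite Rmin_left, Rmax_right in Hc1 by lra.
          rewrite Hc2, Rabs_mult, (Rabs_pos_eq (v - u)) by lra.
          apply Rmult_le_compat_r; [lra|apply HK; lra].
      - intros y Hy Py. replace 0 with (k y - k y) by ring.
        apply (is_derive_Rminus g I y (k y) (k y)).
        + apply HP; [unfold lo in *; lra|exact Py].
        + apply HI. }
    simpl in Hc. assert (I lo = 0) by (apply (RInt_point (V := R_CompleteNormedModule))). lra. }
  apply is_derive_ext_loc with (fun x => I x + g lo).
  - assert (0 < Rmin (t - lo) (b - t)) by (apply Rmin_glb_lt; unfold lo; lra).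
    exists (mkposreal _ H). intros y Hy. symmetry. apply Heq.
    change (Rabs (y - t) < Rmin (t - lo) (b - t)) in Hy.
    generalize (Rmin_l (t - lo) (b - t)) (Rmin_r (t - lo) (b - t)).
    apply Rabs_def2 in Hy. lra.
  - rewrite <- (Rplus_0_r (k t)).
    apply (is_derive_plus (V := R_NormedModule) I (fun _ => g lo) t (k t) 0); [apply HI|].
    apply is_derive_Rconst.
Qed.

(** * Fixed points depending on a parameter *)

(** Distance at most d in the sup norm weighted by w. A bound by d instead of
    the norm itself lets unbounded families of coordinates be compared without
    a supremum. *)
Definition wnear {T : Type} (w : T -> R) (d : R) (p q : T -> R) : Prop :=
  forall i, Rabs (p i - q i) <= w i * d.

Lemma wnear_sym {T} (w : T -> R) d p q : wnear w d p q -> wnear w d q p.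
Proof. intros H i. rewrite Rabs_minus_sym. apply H. Qed.

Lemma wnear_trans {T} (w : T -> R) d1 d2 p q s :
  wnear w d1 p q -> wnear w d2 q s -> wnear w (d1 + d2) p s.
Proof.
  intros H1 H2 i. replace (p i - s i) with ((p i - q i) + (q i - s i)) by ring.
  eapply Rle_trans; [apply Rabs_triang|]. specialize (H1 i). specialize (H2 i). lra.
Qed.

Lemma wnear_le {T} (w : T -> R) d1 d2 p q : (forall i, 0 < w i) ->
  d1 <= d2 -> wnear w d1 p q -> wnear w d2 p q.
Proof.
  intros Hw Hd H i. eapply Rle_trans; [apply H|].
  apply Rmult_le_compat_l; [specialize (Hw i); lra|exact Hd].
Qed.

Lemma wnear_refl {T} (w : T -> R) d p : (forall i, 0 < w i) -> 0 <= d -> wnear w d p p.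
Proof.
  intros Hw Hd i. rewrite Rminus_diag, Rabs_R0. apply Rmult_le_pos; [|exact Hd].
  specialize (Hw i). lra.
Qed.

Lemma half_pow_pos n : 0 < / 2 ^ n.
Proof. apply Rinv_0_lt_compat, pow_lt. lra. Qed.

Lemma half_pow_S n : / 2 ^ S n = / 2 ^ n / 2.
Proof. simpl. field. apply pow_nonzero. lra. Qed.

Lemma half_pow_lim c : is_lim_seq (fun n => c * / 2 ^ n) 0.
Proof.
  replace (Finite 0) with (Rbar_mult (Finite c) (Finite 0))
    by (simpl; f_equal; ring).
  apply is_lim_seq_scal_l.
  apply is_lim_seq_ext with (fun n => (/ 2) ^ n).
  - intros n. apply pow_inv.
  - apply is_lim_seq_geom. rewrite Rabs_pos_eq; lra.
Qed.

Lemma half_pow_small c e : 0 < e -> exists N, forall n, (N <= n)%nat -> c * / 2 ^ n < e.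
Proof.
  intros He. generalize (half_pow_lim c). intros H.
  apply is_lim_seq_spec in H. destruct (H (mkposreal e He)) as [N HN].
  exists N. intros n Hn. specialize (HN n Hn). simpl in HN.
  apply Rabs_def2 in HN. lra.
Qed.

Lemma le_epsilon_mult x y k : (forall e, 0 < e -> x <= y + k * e) -> x <= y.
Proof.
  intros H. apply Rle_plus_epsilon. intros e He.
  assert (Hk : 0 < Rabs k + 1) by (generalize (Rabs_pos k); lra).
  specialize (H (e / (Rabs k + 1)) ltac:(apply Rdiv_lt_0_compat; lra)).
  eapply Rle_trans; [exact H|]. apply Rplus_le_compat_l.
  replace e with ((Rabs k + 1) * (e / (Rabs k + 1))) at 2 by (field; lra).
  apply Rmult_le_compat_r; [|generalize (Rle_abs k); lra].
  apply Rlt_le, Rdiv_lt_0_compat; lra.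
Qed.

(** An a priori bound d0 improves to d0 / 2 + c, then to d0 / 4 + c / 2 + c,
    and so on; the limit is 2 c. *)
Lemma wnear_halving {T} (w : T -> R) c d0 p q : 
  wnear w d0 p q ->
  (forall d, wnear w d p q -> wnear w (d / 2 + c) p q) ->
  wnear w (2 * c) p q.
Proof.
  intros H0 Hs.
  assert (H : forall n, wnear w (2 * c + (d0 - 2 * c) * / 2 ^ n) p q).
  { induction n.
    - simpl. replace (2 * c + (d0 - 2 * c) * / 1) with d0 by field. exact H0.
    - rewrite half_pow_S. specialize (Hs _ IHn).
      replace (2 * c + (d0 - 2 * c) * (/ 2 ^ n / 2))
        with ((2 * c + (d0 - 2 * c) * / 2 ^ n) / 2 + c)
        by (field; apply pow_nonzero; lra). exact Hs. }
  intros i.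
  apply (is_lim_seq_le (fun _ => Rabs (p i - q i))
    (fun n => w i * (2 * c) + (w i * (d0 - 2 * c)) * / 2 ^ n)
    (Finite (Rabs (p i - q i))) (Finite (w i * (2 * c)))).
  - intros n. specialize (H n i). lra.
  - apply is_lim_seq_const.
  - replace (Finite (w i * (2 * c))) with (Finite (w i * (2 * c) + 0)) by (f_equal; ring).
    apply is_lim_seq_plus'; [apply is_lim_seq_const|apply half_pow_lim].
Qed.

(** The fixed points of F e, for e near 0, in a space of real families that is
    never named as a normed space: T indexes the coordinates and [good] is a
    linear subspace closed under weighted uniform limits. *)
Section Contraction.
Context {T : Type} (w : T -> R) (good : (T -> R) -> Prop)
  (F : R -> (T -> R) -> T -> R) (p0 : T -> R) (r L : R).
Context (w_pos : forall i, 0 < w i) (r_pos : 0 < r) (L_pos : 0 <= L)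
  (good_comb : forall a b p q, good p -> good q -> good (fun i => a * p i + b * q i))
  (good_lim : forall (u : nat -> T -> R) p, (forall n, good (u n)) ->
     (forall e, 0 < e -> exists N, forall n, (N <= n)%nat -> wnear w e (u n) p) -> good p)
  (good_p0 : good p0)
  (good_F : forall e p, good p -> good (F e p))
  (F_base : forall i, F 0 p0 i = p0 i)
  (F_contr : forall e1 e2 p q d, Rabs e1 <= r -> Rabs e2 <= r ->
     good p -> good q -> wnear w r p p0 -> wnear w r q p0 -> wnear w d p q ->
     wnear w (d / 2 + L * Rabs (e1 - e2)) (F e1 p) (F e2 q)).

(** Small enough for the iterates, which drift by at most 2 L |e| from p0, to
    stay in the ball of radius r / 2, on which strict differentiability is
    available. *)
Definition contraction_radius : R := r / (4 * L + 4).
Let rho := contraction_radius.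

Lemma contraction_radius_pos : 0 < rho.
Proof. apply Rdiv_lt_0_compat; lra. Qed.

Lemma contraction_radius_le : rho <= r /\ 2 * L * rho <= r / 2.
Proof.
  assert (H : rho * (4 * L + 4) = r) by (unfold rho, contraction_radius; field; lra).
  generalize contraction_radius_pos. nra.
Qed.

Lemma small_parameter e : Rabs e <= rho -> Rabs e <= r /\ 0 <= 2 * L * Rabs e <= r / 2.
Proof.
  intros He. destruct contraction_radius_le. generalize (Rabs_pos e). intros. nra.
Qed.

Definition iterate (e : R) (n : nat) : T -> R := Nat.iter n (F e) p0.

Lemma good_iterate e n : good (iterate e n).
Proof. induction n; simpl; auto. Qed.

(** The two bounds are carried by the same induction: the first keeps the
    iterates in the ball where F contracts, the second is what contraction
    gives. *)
Lemma iterate_bounds e n : Rabs e <= rho ->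
  wnear w (2 * L * Rabs e * (1 - / 2 ^ n)) (iterate e n) p0 /\
  wnear w (L * Rabs e * / 2 ^ n) (iterate e (S n)) (iterate e n).
Proof.
  intros He. destruct (small_parameter e He) as [He1 He2].
  assert (Hr : forall n, 2 * L * Rabs e * (1 - / 2 ^ n) <= r).
  { intros m. generalize (half_pow_pos m). nra. }
  induction n as [|n [IH1 IH2]].
  - split.
    + simpl. replace (2 * L * Rabs e * (1 - / 1)) with 0 by field.
      apply wnear_refl; [exact w_pos|lra].
    + simpl. intros i. rewrite <- (F_base i).
      assert (HF : wnear w (0 / 2 + L * Rabs (e - 0)) (F e p0) (F 0 p0)).
      { apply F_contr; auto; try (rewrite Rabs_R0; lra);
          apply wnear_refl; auto; lra. }
      specialize (HF i). rewrite Rminus_0_r in HF.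
      replace (L * Rabs e * / 1) with (0 / 2 + L * Rabs e) by field. exact HF.
  - assert (IH3 : wnear w (2 * L * Rabs e * (1 - / 2 ^ S n)) (iterate e (S n)) p0).
    { replace (2 * L * Rabs e * (1 - / 2 ^ S n)) with
        (L * Rabs e * / 2 ^ n + 2 * L * Rabs e * (1 - / 2 ^ n))
        by (rewrite half_pow_S; field; apply pow_nonzero; lra).
      apply wnear_trans with (iterate e n); assumption. }
    split; [exact IH3|].
    replace (L * Rabs e * / 2 ^ S n) with (L * Rabs e * / 2 ^ n / 2 + L * Rabs (e - e))
      by (rewrite half_pow_S, Rminus_diag, Rabs_R0; field; apply pow_nonzero; lra).
    apply (F_contr e e (iterate e (S n)) (iterate e n)); auto using good_iterate.
    + apply wnear_le with (2 := Hr (S n)); auto.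
    + apply wnear_le with (2 := Hr n); auto.
Qed.

Lemma iterate_cauchy e n m : Rabs e <= rho ->
  wnear w (2 * L * Rabs e * (/ 2 ^ n - / 2 ^ (n + m))) (iterate e (n + m)) (iterate e n).
Proof.
  intros He. induction m.
  - rewrite Nat.add_0_r, Rminus_diag, Rmult_0_r. apply wnear_refl; [exact w_pos|lra].
  - rewrite Nat.add_succ_r.
    replace (2 * L * Rabs e * (/ 2 ^ n - / 2 ^ S (n + m))) with
      (L * Rabs e * / 2 ^ (n + m) + 2 * L * Rabs e * (/ 2 ^ n - / 2 ^ (n + m)))
      by (rewrite half_pow_S; field; split; apply pow_nonzero; lra).
    apply wnear_trans with (iterate e (n + m)); [|exact IHm].
    apply iterate_bounds. exact He.
Qed.

Definition branch (e : R) (i : T) : R := real (Lim_seq (fun n => iterate e n i)).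

Lemma branch_is_lim e i : Rabs e <= rho ->
  is_lim_seq (fun n => iterate e n i) (branch e i).
Proof.
  intros He. apply Lim_seq_correct'. apply ex_lim_seq_cauchy_corr.
  intros [eps Heps]. simpl.
  destruct (half_pow_small (2 * (w i * (2 * L * Rabs e))) eps Heps) as [N HN].
  exists N.
  assert (H : forall n, (N <= n)%nat ->
    Rabs (iterate e n i - iterate e N i) < eps / 2).
  { intros n Hn. replace n with (N + (n - N))%nat by lia.
    eapply Rle_lt_trans; [apply iterate_cauchy, He|].
    specialize (HN N (Nat.le_refl N)).
    generalize (half_pow_pos (N + (n - N))). intros Hp.
    assert (0 <= w i * (2 * L * Rabs e)).
    { destruct (small_parameter e He). apply Rmult_le_pos; [|lra].
      specialize (w_pos i). lra. }
    nra. }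
  intros n m Hn Hm.
  replace (iterate e n i - iterate e m i) with
    ((iterate e n i - iterate e N i) - (iterate e m i - iterate e N i)) by ring.
  eapply Rle_lt_trans; [apply Rabs_triang|]. rewrite Rabs_Ropp.
  generalize (H n Hn) (H m Hm). lra.
Qed.

Lemma branch_near_iterate e n : Rabs e <= rho ->
  wnear w (2 * L * Rabs e * / 2 ^ n) (branch e) (iterate e n).
Proof.
  intros He i.
  apply (is_lim_seq_le (fun m => Rabs (iterate e (n + m) i - iterate e n i))
    (fun _ => w i * (2 * L * Rabs e * / 2 ^ n))
    (Finite (Rabs (branch e i - iterate e n i))) (Finite (w i * (2 * L * Rabs e * / 2 ^ n)))).
  - intros m. eapply Rle_trans; [apply iterate_cauchy, He|].
    apply Rmult_le_compat_l; [specialize (w_pos i); lra|].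
    destruct (small_parameter e He). generalize (half_pow_pos (n + m)). nra.
  - apply (is_lim_seq_abs _ (Finite (branch e i - iterate e n i))).
    apply is_lim_seq_minus'; [|apply is_lim_seq_const].
    apply is_lim_seq_ext with (fun m => iterate e (m + n) i).
    + intros m. f_equal. apply Nat.add_comm.
    + apply (is_lim_seq_incr_n (fun m => iterate e m i) n), branch_is_lim, He.
  - apply is_lim_seq_const.
Qed.

Lemma good_branch e : Rabs e <= rho -> good (branch e).
Proof.
  intros He. apply good_lim with (iterate e); [apply good_iterate|].
  intros eps Heps. destruct (half_pow_small (2 * L * Rabs e) eps Heps) as [N HN].
  exists N. intros n Hn. apply wnear_sym.
  apply wnear_le with (3 := branch_near_iterate e n He); auto.
  apply Rlt_le, HN, Hn.
Qed.

Lemma branch_near_base e : Rabs e <= rho -> wnear w (r / 2) (branch e) p0.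
Proof.
  intros He. apply wnear_le with (2 * L * Rabs e * / 2 ^ 0); auto.
  - destruct (small_parameter e He). simpl. lra.
  - apply (branch_near_iterate e 0 He).
Qed.

Lemma branch_in_ball e : Rabs e <= rho -> wnear w r (branch e) p0.
Proof. intros He. apply wnear_le with (3 := branch_near_base e He); auto; lra. Qed.

Lemma branch_fixed e : Rabs e <= rho -> forall i, F e (branch e) i = branch e i.
Proof.
  intros He i. destruct (small_parameter e He) as [He1 He2].
  apply cond_eq. intros eps Heps.
  destruct (half_pow_small (w i * (2 * (2 * L * Rabs e))) eps Heps) as [N HN].
  specialize (HN N (Nat.le_refl N)).
  assert (H1 : wnear w (2 * L * Rabs e * / 2 ^ N / 2 + L * Rabs (e - e))
    (F e (branch e)) (F e (iterate e N))).
  { apply F_contr; auto using good_branch, good_iterate, branch_in_ball.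
    - apply wnear_le with (3 := proj1 (iterate_bounds e N He)); auto.
      generalize (half_pow_pos N). nra.
    - apply branch_near_iterate, He. }
  assert (H2 := branch_near_iterate e (S N) He). apply wnear_sym in H2.
  assert (H3 := wnear_trans w _ _ _ _ _ H1 H2 i).
  eapply Rle_lt_trans; [exact H3|]. eapply Rle_lt_trans; [|exact HN].
  rewrite half_pow_S, Rminus_diag, Rabs_R0.
  replace (w i * (2 * (2 * L * Rabs e)) * / 2 ^ N) with
    (w i * (2 * (2 * L * Rabs e) * / 2 ^ N)) by ring.
  apply Rmult_le_compat_l; [specialize (w_pos i); lra|].
  generalize (half_pow_pos N). nra.
Qed.

Lemma fixed_points_lipschitz e1 e2 p q : Rabs e1 <= r -> Rabs e2 <= r ->
  good p -> good q -> wnear w r p p0 -> wnear w r q p0 ->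
  (forall i, F e1 p i = p i) -> (forall i, F e2 q i = q i) ->
  wnear w (2 * (L * Rabs (e1 - e2))) p q.
Proof.
  intros He1 He2 Gp Gq Bp Bq Fp Fq.
  apply wnear_halving with (r + r).
  - apply wnear_trans with p0; [exact Bp|apply wnear_sym, Bq].
  - intros d Hd i. rewrite <- (Fp i), <- (Fq i).
    apply F_contr; auto.
Qed.

Lemma fixed_point_unique e p q : Rabs e <= r ->
  good p -> good q -> wnear w r p p0 -> wnear w r q p0 ->
  (forall i, F e p i = p i) -> (forall i, F e q i = q i) ->
  forall i, p i = q i.
Proof.
  intros He Gp Gq Bp Bq Fp Fq i.
  assert (H := fixed_points_lipschitz e e p q He He Gp Gq Bp Bq Fp Fq i).
  rewrite Rminus_diag, Rabs_R0, !Rmult_0_r in H.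
  generalize (Rabs_pos (p i - q i)). intros H1.
  apply Rminus_diag_uniq. destruct (Req_dec (p i - q i) 0) as [|Hn]; [assumption|].
  apply Rabs_no_R0 in Hn. lra.
Qed.

Lemma branch_lipschitz e1 e2 : Rabs e1 <= rho -> Rabs e2 <= rho ->
  wnear w (2 * (L * Rabs (e1 - e2))) (branch e1) (branch e2).
Proof.
  intros H1 H2. destruct (small_parameter e1 H1), (small_parameter e2 H2).
  apply fixed_points_lipschitz; auto using good_branch, branch_in_ball, branch_fixed.
Qed.

Context (F_strict : forall e0 p, Rabs e0 < r -> good p -> wnear w (r / 2) p p0 ->
  exists (A : (T -> R) -> T -> R) (b : T -> R),
    (forall a c p q i, good p -> good q ->
       A (fun j => a * p j + c * q j) i = a * A p i + c * A q i) /\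
    forall om, 0 < om -> exists dl, 0 < dl /\
      forall e1 e2 q1 q2 d, good q1 -> good q2 ->
        Rabs (e1 - e0) <= dl -> Rabs (e2 - e0) <= dl ->
        wnear w dl q1 p -> wnear w dl q2 p -> wnear w d q1 q2 ->
        forall i, Rabs (F e1 q1 i - F e2 q2 i - A (fun j => 1 * q1 j + -1 * q2 j) i
                        - b i * (e1 - e2)) <= w i * (om * (d + Rabs (e1 - e2)))).

Definition zero_vector : T -> R := fun _ => 0.

(** A linear map that approximates F e0 to first order inherits its contraction
    factor: compare p with p + t h and divide by t. *)
Lemma derivative_contracts e0 p (A : (T -> R) -> T -> R) (b : T -> R) :
  Rabs e0 < r -> good p -> wnear w (r / 2) p p0 ->
  (forall a c p q i, good p -> good q ->
     A (fun j => a * p j + c * q j) i = a * A p i + c * A q i) ->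
  (forall om, 0 < om -> exists dl, 0 < dl /\
      forall e1 e2 q1 q2 d, good q1 -> good q2 ->
        Rabs (e1 - e0) <= dl -> Rabs (e2 - e0) <= dl ->
        wnear w dl q1 p -> wnear w dl q2 p -> wnear w d q1 q2 ->
        forall i, Rabs (F e1 q1 i - F e2 q2 i - A (fun j => 1 * q1 j + -1 * q2 j) i
                        - b i * (e1 - e2)) <= w i * (om * (d + Rabs (e1 - e2)))) ->
  forall h d, good h -> 0 <= d -> wnear w d h zero_vector ->
    wnear w (d / 2) (A h) zero_vector.
Proof.
  intros He0 Gp Bp HA HS h d Gh Hd Bh i. unfold zero_vector. rewrite Rminus_0_r.
  apply le_epsilon_mult with (w i * d). intros om Hom.
  destruct (HS om Hom) as [dl [Hdl HS']].
  set (t := Rmin (dl / (d + 1)) (r / 2 / (d + 1))).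
  assert (Ht : 0 < t).
  { apply Rmin_glb_lt; apply Rdiv_lt_0_compat; lra. }
  assert (Ht1 : t * d <= dl).
  { apply Rle_trans with (dl / (d + 1) * (d + 1)).
    - apply Rmult_le_compat; try lra. apply Rmin_l.
    - right. field. lra. }
  assert (Ht2 : t * d <= r / 2).
  { apply Rle_trans with (r / 2 / (d + 1) * (d + 1)).
    - apply Rmult_le_compat; try lra. apply Rmin_r.
    - right. field. lra. }
  set (q := fun j => 1 * p j + t * h j).
  assert (Gq : good q) by (apply good_comb; assumption).
  assert (Bq : wnear w (t * d) q p).
  { intros j. unfold q. replace (1 * p j + t * h j - p j) with (t * (h j - zero_vector j))
      by (unfold zero_vector; ring).
    rewrite Rabs_mult, (Rabs_pos_eq t) by lra. specialize (Bh j). nra. }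
  assert (H1 := HS' e0 e0 q p (t * d) Gq Gp).
  rewrite Rminus_diag, Rabs_R0 in H1.
  specialize (H1 ltac:(lra) ltac:(lra)
    (wnear_le w _ _ _ _ w_pos Ht1 Bq) (wnear_refl w dl p w_pos ltac:(lra)) Bq i).
  assert (H2 : wnear w (t * d / 2 + L * Rabs (e0 - e0)) (F e0 q) (F e0 p)).
  { apply F_contr; auto; try lra.
    - apply wnear_le with (t * d + r / 2); auto; [lra|].
      apply wnear_trans with p; assumption.
    - apply wnear_le with (r / 2); auto; lra. }
  specialize (H2 i). rewrite Rminus_diag, Rabs_R0 in H2.
  replace (A (fun j => 1 * q j + -1 * p j) i) with (t * A h i) in H1.
  2:{ replace (fun j => 1 * q j + -1 * p j) with (fun j => t * h j + 0 * h j).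
      - rewrite HA by assumption. ring.
      - apply functional_extensionality. intros j. unfold q. ring. }
  assert (H3 : Rabs (t * A h i) <= w i * (t * d / 2) + w i * (om * (t * d))).
  { replace (t * A h i) with ((F e0 q i - F e0 p i)
      - (F e0 q i - F e0 p i - t * A h i - b i * 0)) by ring.
    eapply Rle_trans; [apply Rabs_triang|]. rewrite Rabs_Ropp.
    rewrite Rplus_0_r in H1. rewrite Rmult_0_r, Rplus_0_r in H2. lra. }
  rewrite Rabs_mult, (Rabs_pos_eq t) in H3 by lra.
  apply Rmult_le_reg_l with t; [exact Ht|]. lra.
Qed.

Definition quotient (e1 e2 : R) (i : T) : R := (branch e1 i - branch e2 i) / (e1 - e2).

Lemma good_quotient e1 e2 : Rabs e1 <= rho -> Rabs e2 <= rho -> good (quotient e1 e2).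
Proof.
  intros H1 H2.
  replace (quotient e1 e2) with
    (fun i => / (e1 - e2) * branch e1 i + - / (e1 - e2) * branch e2 i).
  - apply good_comb; apply good_branch; assumption.
  - apply functional_extensionality. intros i. unfold quotient, Rdiv. ring.
Qed.

(** The difference quotients of the branch are bounded by 2 L and almost solve
    the linear equation q = A q + b; since A contracts, two almost solutions
    are close. *)
Lemma quotient_cauchy e0 om : Rabs e0 < rho -> 0 < om -> exists dl, 0 < dl /\
  forall e1 e2 e3 e4, Rabs (e1 - e0) <= dl -> Rabs (e2 - e0) <= dl ->
    Rabs (e3 - e0) <= dl -> Rabs (e4 - e0) <= dl -> e1 <> e2 -> e3 <> e4 ->
    wnear w om (quotient e1 e2) (quotient e3 e4).
Proof.
  intros He0 Hom. destruct contraction_radius_le as [Hr1 Hr2].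
  destruct (F_strict e0 (branch e0)) as [A [b [HA HS]]].
  { lra. } { apply good_branch; lra. } { apply branch_near_base; lra. }
  set (om' := om / (8 * L + 4)).
  assert (Hom' : 0 < om') by (apply Rdiv_lt_0_compat; lra).
  assert (Eom : om = 2 * (2 * (om' * (2 * L + 1)))) by (unfold om'; field; lra).
  destruct (HS om' Hom') as [dl [Hdl HS']].
  set (dl' := Rmin (rho - Rabs e0) (Rmin dl (dl / (2 * L + 1)))).
  assert (Hdl' : 0 < dl').
  { apply Rmin_glb_lt; [lra|]. apply Rmin_glb_lt; [lra|]. apply Rdiv_lt_0_compat; lra. }
  assert (Hd1 : dl' <= rho - Rabs e0) by apply Rmin_l.
  assert (Hd2 : dl' <= dl) by (eapply Rle_trans; [apply Rmin_r|apply Rmin_l]).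
  assert (Hd3 : 2 * L * dl' <= dl).
  { apply Rle_trans with ((2 * L + 1) * (dl / (2 * L + 1))); [|right; field; lra].
    apply Rmult_le_compat; try lra. eapply Rle_trans; [apply Rmin_r|apply Rmin_r]. }
  assert (Hsm : forall e, Rabs (e - e0) <= dl' -> Rabs e <= rho /\ wnear w dl (branch e) (branch e0)).
  { intros e He. assert (Rabs e <= rho).
    { replace e with ((e - e0) + e0) by ring.
      eapply Rle_trans; [apply Rabs_triang|]. lra. }
    split; [assumption|].
    apply wnear_le with (2 * (L * Rabs (e - e0))); auto; [nra|].
    apply branch_lipschitz; lra. }
  assert (Hlin : forall e1 e2, Rabs (e1 - e0) <= dl' -> Rabs (e2 - e0) <= dl' -> e1 <> e2 ->
    wnear w (2 * L) (quotient e1 e2) zero_vector /\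
    wnear w (om' * (2 * L + 1)) (quotient e1 e2) (fun i => A (quotient e1 e2) i + b i)).
  { intros e1 e2 H1 H2 Hne.
    destruct (Hsm e1 H1) as [R1 B1]. destruct (Hsm e2 H2) as [R2 B2].
    assert (HL := branch_lipschitz e1 e2 R1 R2).
    assert (Hp : 0 < Rabs (e1 - e2)) by (apply Rabs_pos_lt; lra).
    split; intros i.
    - unfold zero_vector, quotient, Rdiv. rewrite Rminus_0_r, Rabs_mult, Rabs_inv by lra.
      apply Rmult_le_reg_r with (Rabs (e1 - e2)); [exact Hp|].
      rewrite Rmult_assoc, Rinv_l, Rmult_1_r by lra.
      specialize (HL i). lra.
    - specialize (HS' e1 e2 (branch e1) (branch e2) (2 * (L * Rabs (e1 - e2)))
        (good_branch e1 R1) (good_branch e2 R2) ltac:(lra) ltac:(lra) B1 B2 HL i).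
      rewrite !branch_fixed in HS' by assumption.
      replace (A (fun j => 1 * branch e1 j + -1 * branch e2 j) i) with
        ((e1 - e2) * A (quotient e1 e2) i) in HS'.
      2:{ replace (fun j => 1 * branch e1 j + -1 * branch e2 j) with
            (fun j => (e1 - e2) * quotient e1 e2 j + 0 * quotient e1 e2 j).
          - rewrite HA by (apply good_quotient; assumption). ring.
          - apply functional_extensionality. intros j. unfold quotient. field. lra. }
      apply Rmult_le_reg_r with (Rabs (e1 - e2)); [exact Hp|].
      rewrite <- Rabs_mult.
      replace ((quotient e1 e2 i - (A (quotient e1 e2) i + b i)) * (e1 - e2)) with
        (branch e1 i - branch e2 i - (e1 - e2) * A (quotient e1 e2) i - b i * (e1 - e2))
        by (unfold quotient; field; lra).
      eapply Rle_trans; [exact HS'|]. right. ring. }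
  exists dl'. split; [exact Hdl'|].
  intros e1 e2 e3 e4 H1 H2 H3 H4 N1 N2.
  destruct (Hlin e1 e2 H1 H2 N1) as [Q1 Q1']. destruct (Hlin e3 e4 H3 H4 N2) as [Q2 Q2'].
  destruct (Hsm e1 H1) as [R1 _]. destruct (Hsm e2 H2) as [R2 _].
  destruct (Hsm e3 H3) as [R3 _]. destruct (Hsm e4 H4) as [R4 _].
  assert (G1 := good_quotient e1 e2 R1 R2). assert (G2 := good_quotient e3 e4 R3 R4).
  rewrite Eom. apply wnear_halving with (2 * L + 2 * L).
  - apply wnear_trans with zero_vector; [exact Q1|apply wnear_sym, Q2].
  - intros d Hd i.
    set (h := fun j => 1 * quotient e1 e2 j + -1 * quotient e3 e4 j).
    assert (Gh : good h) by (apply good_comb; assumption).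
    assert (Hd0 : 0 <= d).
    { specialize (Hd i). generalize (Rabs_pos (quotient e1 e2 i - quotient e3 e4 i)).
      specialize (w_pos i). nra. }
    assert (Bh : wnear w d h zero_vector).
    { intros j. specialize (Hd j). unfold h, zero_vector.
      replace (1 * quotient e1 e2 j + -1 * quotient e3 e4 j - 0)
        with (quotient e1 e2 j - quotient e3 e4 j) by ring. exact Hd. }
    assert (HAh := derivative_contracts e0 (branch e0) A b ltac:(lra)
      (good_branch e0 ltac:(lra)) (branch_near_base e0 ltac:(lra)) HA HS h d Gh Hd0 Bh i).
    unfold h in HAh. rewrite HA in HAh by assumption. unfold zero_vector in HAh.
    specialize (Q1' i). specialize (Q2' i). simpl in Q1', Q2'.
    replace (quotient e1 e2 i - quotient e3 e4 i) with
      ((quotient e1 e2 i - (A (quotient e1 e2) i + b i))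
       - (quotient e3 e4 i - (A (quotient e3 e4) i + b i))
       + (1 * A (quotient e1 e2) i + -1 * A (quotient e3 e4) i - 0)) by ring.
    eapply Rle_trans; [apply Rabs_triang|].
    eapply Rle_trans; [apply Rplus_le_compat_r, Rabs_triang|]. rewrite Rabs_Ropp. lra.
Qed.

(** The limit of the difference quotients exists by the Cauchy property, which
    compares quotients over arbitrary pairs of parameters near e0; hence the
    derivative is strict. *)
Theorem branch_strictly_differentiable e0 : Rabs e0 < rho ->
  exists xi, good xi /\ forall om, 0 < om -> exists dl, 0 < dl /\
    forall e1 e2, Rabs (e1 - e0) <= dl -> Rabs (e2 - e0) <= dl ->
    forall i, Rabs (branch e1 i - branch e2 i - xi i * (e1 - e2))
              <= w i * (om * Rabs (e1 - e2)).
Proof.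
  intros He0.
  (* the steps are kept positive, so that each quotient is defined *)
  set (h := fun n : nat => (rho - Rabs e0) * / 2 ^ n).
  assert (Hh : forall n, 0 < h n <= rho - Rabs e0).
  { intros n. unfold h. generalize (half_pow_pos n). intros Hp. split; [nra|].
    assert (/ 2 ^ n <= 1); [|nra]. rewrite <- Rinv_1. apply Rinv_le_contravar; [lra|].
    apply pow_R1_Rle. lra. }
  set (q := fun n => quotient (e0 + h n) e0).
  assert (Hq : forall om, 0 < om -> exists dl, 0 < dl /\ exists N, forall n, (N <= n)%nat ->
    forall e1 e2, Rabs (e1 - e0) <= dl -> Rabs (e2 - e0) <= dl -> e1 <> e2 ->
    wnear w om (quotient e1 e2) (q n)).
  { intros om Hom. destruct (quotient_cauchy e0 om He0 Hom) as [dl [Hdl H]].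
    exists dl. split; [exact Hdl|].
    destruct (half_pow_small (rho - Rabs e0) dl Hdl) as [N HN].
    exists N. intros n Hn e1 e2 H1 H2 Hne. specialize (HN n Hn). destruct (Hh n).
    fold (h n) in HN.
    apply H; auto; try lra.
    - replace (e0 + h n - e0) with (h n) by ring. rewrite Rabs_pos_eq; lra.
    - rewrite Rminus_diag, Rabs_R0. lra. }
  set (xi := fun i => real (Lim_seq (fun n => q n i))).
  assert (Hnn : forall om, 0 < om -> exists N, forall n m, (N <= n)%nat -> (N <= m)%nat ->
    wnear w om (q n) (q m)).
  { intros om Hom. destruct (Hq om Hom) as [dl [Hdl [N HN]]].
    destruct (half_pow_small (rho - Rabs e0) dl Hdl) as [N' HN'].
    exists (Nat.max N N'). intros n m Hn Hm.
    specialize (HN' n ltac:(lia)). fold (h n) in HN'. destruct (Hh n).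
    apply HN; try lia; try lra.
    - replace (e0 + h n - e0) with (h n) by ring. rewrite Rabs_pos_eq; lra.
    - rewrite Rminus_diag, Rabs_R0. lra. }
  assert (Hlim : forall i, is_lim_seq (fun n => q n i) (xi i)).
  { intros i. apply Lim_seq_correct'. apply ex_lim_seq_cauchy_corr. intros [eps Heps].
    destruct (Hnn (eps / 2 / w i)) as [N HN].
    { specialize (w_pos i). apply Rdiv_lt_0_compat; lra. }
    exists N. intros n m Hn Hm. specialize (HN n m Hn Hm i). simpl.
    replace (w i * (eps / 2 / w i)) with (eps / 2) in HN
      by (field; specialize (w_pos i); lra). lra. }
  assert (Hto : forall om p, (exists N, forall n, (N <= n)%nat -> wnear w om p (q n)) ->
    wnear w om p xi).
  { intros om p [N HN] i.
    apply (is_lim_seq_le_loc (fun n => Rabs (p i - q n i)) (fun _ => w i * om)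
      (Finite (Rabs (p i - xi i))) (Finite (w i * om))).
    - exists N. intros n Hn. apply HN, Hn.
    - apply (is_lim_seq_abs _ (Finite (p i - xi i))).
      apply is_lim_seq_minus'; [apply is_lim_seq_const|apply Hlim].
    - apply is_lim_seq_const. }
  exists xi. split.
  - apply good_lim with q.
    + intros n. destruct (Hh n). apply good_quotient; [|lra].
      eapply Rle_trans; [apply Rabs_triang|]. rewrite (Rabs_pos_eq (h n)); lra.
    + intros om Hom. destruct (Hnn om Hom) as [N HN]. exists N. intros n Hn.
      apply Hto. exists N. intros m Hm. apply HN; assumption.
  - intros om Hom. destruct (Hq om Hom) as [dl [Hdl [N HN]]].
    exists dl. split; [exact Hdl|]. intros e1 e2 H1 H2 i.
    destruct (Req_dec e1 e2) as [->|Hne].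
    + rewrite !Rminus_diag, Rabs_R0, !Rmult_0_r, Rminus_0_r, Rabs_R0. lra.
    + assert (Hx : wnear w om (quotient e1 e2) xi).
      { apply Hto. exists N. intros n Hn. apply HN; assumption. }
      specialize (Hx i).
      replace (branch e1 i - branch e2 i - xi i * (e1 - e2)) with
        ((quotient e1 e2 i - xi i) * (e1 - e2)) by (unfold quotient; field; lra).
      rewrite Rabs_mult. generalize (Rabs_pos (e1 - e2)). nra.
Qed.

End Contraction.

(** * C1 functions of three variables *)

Lemma C1_R3_intro (f f1 f2 f3 : R -> R -> R -> R) :
  (forall t x y, is_derive (fun s => f s x y) t (f1 t x y)) ->
  (forall t x y, is_derive (fun s => f t s y) x (f2 t x y)) ->
  (forall t x y, is_derive (fun s => f t x s) y (f3 t x y)) ->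
  (forall q : R * R * R, continuous (fun p : R * R * R => f1 (fst (fst p)) (snd (fst p)) (snd p)) q) ->
  (forall q : R * R * R, continuous (fun p : R * R * R => f2 (fst (fst p)) (snd (fst p)) (snd p)) q) ->
  (forall q : R * R * R, continuous (fun p : R * R * R => f3 (fst (fst p)) (snd (fst p)) (snd p)) q) ->
  C1_R3 f.
Proof.
  intros H1 H2 H3 K1 K2 K3. split.
  - intros t x y. repeat split; eexists; eauto.
  - intros q. repeat split.
    + eapply continuous_ext; [|apply K1]. intros p. symmetry. apply is_derive_unique, H1.
    + eapply continuous_ext; [|apply K2]. intros p. symmetry. apply is_derive_unique, H2.
    + eapply continuous_ext; [|apply K3]. intros p. symmetry. apply is_derive_unique, H3.
Qed.

Definition in_box (d : R) (a1 a2 a3 b1 b2 b3 : R) : Prop :=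
  Rabs (a1 - b1) < d /\ Rabs (a2 - b2) < d /\ Rabs (a3 - b3) < d.

Lemma continuous_R3_eps_delta (h : R * R * R -> R) q1 q2 q3 e :
  continuous h (q1, q2, q3) -> 0 < e -> exists d, 0 < d /\ forall p1 p2 p3,
    in_box d p1 p2 p3 q1 q2 q3 -> Rabs (h (p1, p2, p3) - h (q1, q2, q3)) < e.
Proof.
  intros Hc He.
  destruct (Hc (fun y => Rabs (y - h (q1, q2, q3)) < e)) as [d Hd].
  { exists (mkposreal e He). intros y Hy. exact Hy. }
  exists d. split; [apply cond_pos|]. intros p1 p2 p3 [H1 [H2 H3]].
  apply (Hd (p1, p2, p3)). repeat split; assumption.
Qed.

Lemma continuous_R3_comp (h : R * R * R -> R) (g1 g2 g3 : R -> R) u :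
  continuous h (g1 u, g2 u, g3 u) ->
  continuous g1 u -> continuous g2 u -> continuous g3 u ->
  continuous (fun v => h (g1 v, g2 v, g3 v)) u.
Proof.
  intros Hh H1 H2 H3. apply continuous_eps_delta. intros e He.
  destruct (continuous_R3_eps_delta h _ _ _ e Hh He) as [d [Hd H]].
  destruct (proj1 (continuous_eps_delta g1 u) H1 d Hd) as [d1 [Hd1 H1']].
  destruct (proj1 (continuous_eps_delta g2 u) H2 d Hd) as [d2 [Hd2 H2']].
  destruct (proj1 (continuous_eps_delta g3 u) H3 d Hd) as [d3 [Hd3 H3']].
  exists (Rmin d1 (Rmin d2 d3)). split; [repeat apply Rmin_glb_lt; assumption|].
  intros y Hy. apply Rmin_Rgt in Hy. destruct Hy as [Hy1 Hy2].
  apply Rmin_Rgt in Hy2. destruct Hy2. apply H. repeat split; auto.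
Qed.

Section C1.
Context (f : R -> R -> R -> R) (hf : C1_R3 f).

Definition pd1 t x y := Derive (fun s => f s x y) t.
Definition pd2 t x y := Derive (fun s => f t s y) x.
Definition pd3 t x y := Derive (fun s => f t x s) y.

Lemma increment_strict_1d (g : R -> R) (D : R -> R) (l om a b : R) :
  (forall s, is_derive g s (D s)) ->
  (forall s, Rmin b a <= s <= Rmax b a -> Rabs (D s - l) <= om) ->
  Rabs (g a - g b - l * (a - b)) <= om * Rabs (a - b).
Proof.
  intros Hg HD.
  destruct (MVT_gen g b a D) as [c [Hc1 Hc2]].
  - intros; apply Hg.
  - intros s _. apply continuity_pt_filterlim, is_derive_continuous with (D s), Hg.
  - rewrite Hc2. replace (D c * (a - b) - l * (a - b)) with ((D c - l) * (a - b)) by ring.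
    rewrite Rabs_mult. apply Rmult_le_compat_r; [apply Rabs_pos|auto].
Qed.

Lemma between_box a b s q d : Rabs (a - q) < d -> Rabs (b - q) < d ->
  Rmin b a <= s <= Rmax b a -> Rabs (s - q) < d.
Proof.
  intros Ha Hb [H1 H2]. apply Rabs_def2 in Ha, Hb.
  apply Rabs_def1; revert H1 H2; unfold Rmin, Rmax; destruct (Rle_dec b a); lra.
Qed.

(** Change one argument at a time and apply the mean value theorem. The partial
    derivatives are taken at a third point p, so that the estimate can be made
    uniform along a curve of base points. *)
Lemma C1_strict q1 q2 q3 om : 0 < om -> exists d, 0 < d /\
  forall p1 p2 p3 a1 a2 a3 b1 b2 b3,
    in_box d p1 p2 p3 q1 q2 q3 -> in_box d a1 a2 a3 q1 q2 q3 -> in_box d b1 b2 b3 q1 q2 q3 ->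
    Rabs (f a1 a2 a3 - f b1 b2 b3 - (pd1 p1 p2 p3 * (a1 - b1) + pd2 p1 p2 p3 * (a2 - b2)
          + pd3 p1 p2 p3 * (a3 - b3)))
    <= om * (Rabs (a1 - b1) + Rabs (a2 - b2) + Rabs (a3 - b3)).
Proof.
  intros Hom. destruct hf as [Hd Hc]. specialize (Hc (q1, q2, q3)).
  destruct Hc as [Hc1 [Hc2 Hc3]].
  assert (Hom2 : 0 < om / 2) by lra.
  destruct (continuous_R3_eps_delta _ _ _ _ _ Hc1 Hom2) as [d1 [Hd1 H1]].
  destruct (continuous_R3_eps_delta _ _ _ _ _ Hc2 Hom2) as [d2 [Hd2 H2]].
  destruct (continuous_R3_eps_delta _ _ _ _ _ Hc3 Hom2) as [d3 [Hd3 H3]].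
  simpl in H1, H2, H3.
  exists (Rmin d1 (Rmin d2 d3)). split; [repeat apply Rmin_glb_lt; assumption|].
  intros p1 p2 p3 a1 a2 a3 b1 b2 b3 Hp Ha Hb.
  assert (Hm : forall c1 c2 c3, in_box (Rmin d1 (Rmin d2 d3)) c1 c2 c3 q1 q2 q3 ->
    in_box d1 c1 c2 c3 q1 q2 q3 /\ in_box d2 c1 c2 c3 q1 q2 q3 /\ in_box d3 c1 c2 c3 q1 q2 q3).
  { intros c1 c2 c3 [K1 [K2 K3]]. apply Rmin_Rgt in K1, K2, K3.
    destruct K1 as [K1 K1'], K2 as [K2 K2'], K3 as [K3 K3'].
    apply Rmin_Rgt in K1', K2', K3'. unfold in_box. tauto. }
  destruct (Hm _ _ _ Hp) as [P1 [P2 P3]].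
  destruct Ha as [A1 [A2 A3]]. destruct Hb as [B1 [B2 B3]].
  assert (E1 : Rabs (f a1 a2 a3 - f b1 a2 a3 - pd1 p1 p2 p3 * (a1 - b1)) <= om * Rabs (a1 - b1)).
  { apply (increment_strict_1d (fun s => f s a2 a3) (fun s => pd1 s a2 a3)).
    - intros s. exact (Derive_correct (fun s => f s a2 a3) s (proj1 (Hd s a2 a3))).
    - intros s Hs. assert (Hbx := between_box _ _ _ _ _ A1 B1 Hs).
      destruct (Hm s a2 a3) as [Q1 _]; [repeat split; assumption|].
      specialize (H1 _ _ _ P1) as X. specialize (H1 _ _ _ Q1) as Y.
      unfold pd1. apply Rabs_def2 in X, Y. apply Rabs_le. lra. }
  assert (E2 : Rabs (f b1 a2 a3 - f b1 b2 a3 - pd2 p1 p2 p3 * (a2 - b2)) <= om * Rabs (a2 - b2)).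
  { apply (increment_strict_1d (fun s => f b1 s a3) (fun s => pd2 b1 s a3)).
    - intros s. exact (Derive_correct (fun s => f b1 s a3) s (proj1 (proj2 (Hd b1 s a3)))).
    - intros s Hs. assert (Hbx := between_box _ _ _ _ _ A2 B2 Hs).
      destruct (Hm b1 s a3) as [_ [Q1 _]]; [repeat split; assumption|].
      specialize (H2 _ _ _ P2) as X. specialize (H2 _ _ _ Q1) as Y.
      unfold pd2. apply Rabs_def2 in X, Y. apply Rabs_le. lra. }
  assert (E3 : Rabs (f b1 b2 a3 - f b1 b2 b3 - pd3 p1 p2 p3 * (a3 - b3)) <= om * Rabs (a3 - b3)).
  { apply (increment_strict_1d (fun s => f b1 b2 s) (fun s => pd3 b1 b2 s)).
    - intros s. exact (Derive_correct (fun s => f b1 b2 s) s (proj2 (proj2 (Hd b1 b2 s)))).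
    - intros s Hs. assert (Hbx := between_box _ _ _ _ _ A3 B3 Hs).
      destruct (Hm b1 b2 s) as [_ [_ Q1]]; [repeat split; assumption|].
      specialize (H3 _ _ _ P3) as X. specialize (H3 _ _ _ Q1) as Y.
      unfold pd3. apply Rabs_def2 in X, Y. apply Rabs_le. lra. }
  replace (f a1 a2 a3 - f b1 b2 b3 - (pd1 p1 p2 p3 * (a1 - b1) + pd2 p1 p2 p3 * (a2 - b2)
          + pd3 p1 p2 p3 * (a3 - b3))) with
    ((f a1 a2 a3 - f b1 a2 a3 - pd1 p1 p2 p3 * (a1 - b1))
     + (f b1 a2 a3 - f b1 b2 a3 - pd2 p1 p2 p3 * (a2 - b2))
     + (f b1 b2 a3 - f b1 b2 b3 - pd3 p1 p2 p3 * (a3 - b3))) by ring.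
  eapply Rle_trans; [apply Rabs_triang|].
  eapply Rle_trans; [apply Rplus_le_compat_r, Rabs_triang|]. lra.
Qed.

Lemma C1_continuous (q : R * R * R) :
  continuous (fun p : R * R * R => f (fst (fst p)) (snd (fst p)) (snd p)) q.
Proof.
  destruct q as [[q1 q2] q3].
  destruct (C1_strict q1 q2 q3 1 ltac:(lra)) as [d [Hd H]].
  intros P [e He].
  set (K := Rabs (pd1 q1 q2 q3) + Rabs (pd2 q1 q2 q3) + Rabs (pd3 q1 q2 q3) + 3).
  assert (HK : 0 < K).
  { unfold K. generalize (Rabs_pos (pd1 q1 q2 q3)) (Rabs_pos (pd2 q1 q2 q3))
      (Rabs_pos (pd3 q1 q2 q3)). lra. }
  assert (Hr : 0 < Rmin d (e / K)).
  { apply Rmin_glb_lt; [exact Hd|]. apply Rdiv_lt_0_compat; [apply cond_pos|exact HK]. }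
  exists (mkposreal _ Hr). intros [[p1 p2] p3] [[H1 H2] H3].
  change (Rabs (p1 - q1) < Rmin d (e / K)) in H1.
  change (Rabs (p2 - q2) < Rmin d (e / K)) in H2.
  change (Rabs (p3 - q3) < Rmin d (e / K)) in H3.
  apply Rmin_Rgt in H1, H2, H3. apply He. simpl.
  change (Rabs (f p1 p2 p3 - f q1 q2 q3) < e).
  assert (Hz : in_box d q1 q2 q3 q1 q2 q3)
    by (unfold in_box; rewrite !Rminus_diag, Rabs_R0; lra).
  specialize (H q1 q2 q3 p1 p2 p3 q1 q2 q3 Hz).
  specialize (H ltac:(unfold in_box; tauto) Hz).
  set (m := Rmax (Rabs (p1 - q1)) (Rmax (Rabs (p2 - q2)) (Rabs (p3 - q3)))).
  assert (Hm : m < e / K) by (repeat apply Rmax_lub_lt; tauto).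
  assert (M1 : Rabs (p1 - q1) <= m) by apply Rmax_l.
  assert (M2 : Rabs (p2 - q2) <= m) by (eapply Rle_trans; [apply Rmax_l|apply Rmax_r]).
  assert (M3 : Rabs (p3 - q3) <= m) by (eapply Rle_trans; [apply Rmax_r|apply Rmax_r]).
  apply (Rmult_lt_compat_r K) in Hm; [|exact HK].
  replace (e / K * K) with (pos e) in Hm by (field; lra).
  eapply Rle_lt_trans; [|exact Hm].
  replace (f p1 p2 p3 - f q1 q2 q3) with
    ((f p1 p2 p3 - f q1 q2 q3 - (pd1 q1 q2 q3 * (p1 - q1) + pd2 q1 q2 q3 * (p2 - q2)
       + pd3 q1 q2 q3 * (p3 - q3)))
     + (pd1 q1 q2 q3 * (p1 - q1) + pd2 q1 q2 q3 * (p2 - q2) + pd3 q1 q2 q3 * (p3 - q3))) by ring.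
  eapply Rle_trans; [apply Rabs_triang|].
  eapply Rle_trans; [apply Rplus_le_compat_l;
    eapply Rle_trans; [apply Rabs_triang|apply Rplus_le_compat_r, Rabs_triang]|].
  rewrite !Rabs_mult.
  assert (T1 := Rmult_le_compat_l _ _ _ (Rabs_pos (pd1 q1 q2 q3)) M1).
  assert (T2 := Rmult_le_compat_l _ _ _ (Rabs_pos (pd2 q1 q2 q3)) M2).
  assert (T3 := Rmult_le_compat_l _ _ _ (Rabs_pos (pd3 q1 q2 q3)) M3).
  unfold K. lra.
Qed.

Lemma C1_comp_continuous (g1 g2 g3 : R -> R) u :
  continuous g1 u -> continuous g2 u -> continuous g3 u ->
  continuous (fun v => f (g1 v) (g2 v) (g3 v)) u.
Proof.
  intros. apply (continuous_R3_comp
    (fun p => f (fst (fst p)) (snd (fst p)) (snd p)) g1 g2 g3 u); auto.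
  apply C1_continuous.
Qed.

End C1.

(** * States and strictly differentiable families *)

(** An orbit near the unperturbed one, without reference to time: the
    parameter, the length of the phase in x > 0, the time and velocity of the
    entry into x > 0, and the forcing cG s u met at the fraction u of phase s,
    where s is true for the phase in x > 0. Keeping the forcing as an unknown
    makes the phases explicit integrals, so that no nonlinear flow has to be
    constructed or differentiated. *)
Inductive coord : Set := cEps | cTau | cPhi | cY0 | cG (s : bool) (u : R).
Definition state : Type := coord -> R.

(** Phases live on [0, 1]; composing with clamp extends them to R, so that
    continuity and integrability need no side conditions. *)
Definition clamp (u : R) : R := Rmax 0 (Rmin 1 u).

Lemma clamp_range u : 0 <= clamp u <= 1.
Proof.
  unfold clamp. split; [apply Rmax_l|]. apply Rmax_lub; [lra|apply Rmin_l].
Qed.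

Lemma clamp_id u : 0 <= u <= 1 -> clamp u = u.
Proof. intros H. unfold clamp. rewrite Rmin_right, Rmax_right; lra. Qed.

Lemma clamp_idem u : clamp (clamp u) = clamp u.
Proof. apply clamp_id, clamp_range. Qed.

Lemma clamp_lipschitz u v : Rabs (clamp u - clamp v) <= Rabs (u - v).
Proof.
  unfold clamp, Rmax, Rmin.
  destruct (Rle_dec 1 u), (Rle_dec 1 v);
    repeat match goal with |- context [Rle_dec ?a ?b] => destruct (Rle_dec a b) end;
    unfold Rabs; repeat destruct Rcase_abs; lra.
Qed.

Lemma clamp_continuous u : continuous clamp u.
Proof.
  apply continuous_eps_delta. intros e He. exists e. split; [exact He|].
  intros y Hy. eapply Rle_lt_trans; [apply clamp_lipschitz|exact Hy].
Qed.

(** The forcing is continuous and constant outside [0, 1], that is, determined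
    by a continuous function on [0, 1]. *)
Definition good (z : state) : Prop :=
  forall s, (forall u, continuous (fun v => z (cG s v)) u) /\
            (forall u, z (cG s u) = z (cG s (clamp u))).

Definition bounded_by (d : R) (z : state) : Prop := forall i, Rabs (z i) <= d.
Definition near (d : R) (p q : state) : Prop := forall i, Rabs (p i - q i) <= d.
Definition comb (a : R) (p : state) (b : R) (q : state) : state :=
  fun j => a * p j + b * q j.

Lemma continuous_lin (a b : R) (f g : R -> R) u : continuous f u -> continuous g u ->
  continuous (fun v => a * f v + b * g v) u.
Proof.
  intros Hf Hg. apply continuous_Rplus.
  - apply (continuous_Rscal a f u Hf).
  - apply (continuous_Rscal b g u Hg).
Qed.

Lemma good_comb a b p q : good p -> good q -> good (comb a p b q).
Proof.
  intros Hp Hq s. destruct (Hp s) as [P1 P2]. destruct (Hq s) as [Q1 Q2]. split.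
  - intros u. apply continuous_lin; auto.
  - intros u. unfold comb. rewrite P2, Q2. reflexivity.
Qed.

(** Strict differentiability at z0 of a function of the state that also depends
    on a fraction u of a phase, uniformly in u, with derivative L. The estimate
    compares two states p and q, which is what contraction and smooth
    dependence on eps require. *)
Record strict_diff (z0 : state) (G L : R -> state -> R) : Prop := {
  sd_continuous : forall z, good z -> forall u, continuous (fun v => G v z) u;
  sd_clamp : forall z, good z -> forall u, G u z = G (clamp u) z;
  sd_lin_continuous : forall z, good z -> forall u, continuous (fun v => L v z) u;
  sd_linear : forall a b p q u, good p -> good q ->
    L u (comb a p b q) = a * L u p + b * L u q;
  sd_bounded : exists K, 0 <= K /\ forall u z d, good z -> bounded_by d z ->
    Rabs (L u z) <= K * d;
  sd_strict : forall om, 0 < om -> exists dl, 0 < dl /\ forall p q d u,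
    good p -> good q -> near dl p z0 -> near dl q z0 -> near d p q ->
    Rabs (G u p - G u q - L u (comb 1 p (-1) q)) <= om * d }.

Definition sdiff z0 G := exists L, strict_diff z0 G L.

Lemma near_d_nonneg d p q : near d p q -> 0 <= d.
Proof. intros H. specialize (H cEps). generalize (Rabs_pos (p cEps - q cEps)). lra. Qed.

Lemma near_comb d p q : near d p q -> bounded_by d (comb 1 p (-1) q).
Proof. intros H i. unfold comb. replace (1 * p i + -1 * q i) with (p i - q i) by ring. apply H. Qed.

Lemma near_refl d z : 0 <= d -> near d z z.
Proof. intros H i. rewrite Rminus_diag, Rabs_R0. exact H. Qed.

Lemma near_le d d' p q : d <= d' -> near d p q -> near d' p q.
Proof. intros H N i. specialize (N i). lra. Qed.

Lemma strict_diff_lipschitz z0 G L : strict_diff z0 G L ->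
  exists K dl, 0 <= K /\ 0 < dl /\ forall p q d u,
    good p -> good q -> near dl p z0 -> near dl q z0 -> near d p q ->
    Rabs (G u p - G u q) <= K * d.
Proof.
  intros H. destruct (sd_bounded _ _ _ H) as [K [HK HL]].
  destruct (sd_strict _ _ _ H 1 ltac:(lra)) as [dl [Hdl HS]].
  exists (K + 1), dl. split; [lra|]. split; [exact Hdl|].
  intros p q d u Gp Gq Np Nq Npq.
  specialize (HS p q d u Gp Gq Np Nq Npq).
  specialize (HL u _ d (good_comb 1 (-1) p q Gp Gq) (near_comb _ _ _ Npq)).
  replace (G u p - G u q) with
    ((G u p - G u q - L u (comb 1 p (-1) q)) + L u (comb 1 p (-1) q)) by ring.
  eapply Rle_trans; [apply Rabs_triang|]. lra.
Qed.

Lemma bounded_on_01 (g : R -> R) : (forall u, continuous g u) ->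
  exists K, 0 <= K /\ forall u, 0 <= u <= 1 -> Rabs (g u) <= K.
Proof.
  intros H. destruct (continuity_ab_maj (fun y => Rabs (g y)) 0 1) as [M [HM _]].
  - lra.
  - intros c _. apply continuity_pt_filterlim, continuous_Rabs_comp, H.
  - exists (Rabs (g M)). split; [apply Rabs_pos|exact HM].
Qed.

Lemma strict_diff_coord z0 (c : coord) : strict_diff z0 (fun _ z => z c) (fun _ z => z c).
Proof.
  split.
  - intros. apply continuous_const.
  - reflexivity.
  - intros. apply continuous_const.
  - reflexivity.
  - exists 1. split; [lra|]. intros u z d _ H. rewrite Rmult_1_l. apply H.
  - intros om Hom. exists 1. split; [lra|]. intros p q d u _ _ _ _ H.
    unfold comb. replace (p c - q c - (1 * p c + -1 * q c)) with 0 by ring.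
    rewrite Rabs_R0. apply Rmult_le_pos; [lra|]. apply near_d_nonneg with p q, H.
Qed.

Lemma strict_diff_force z0 s :
  strict_diff z0 (fun u z => z (cG s u)) (fun u z => z (cG s u)).
Proof.
  split.
  - intros z Hz. apply Hz.
  - intros z Hz. apply Hz.
  - intros z Hz. apply Hz.
  - reflexivity.
  - exists 1. split; [lra|]. intros u z d _ H. rewrite Rmult_1_l. apply H.
  - intros om Hom. exists 1. split; [lra|]. intros p q d u _ _ _ _ H.
    unfold comb. match goal with |- Rabs ?x <= _ => replace x with 0 by ring end.
    rewrite Rabs_R0. apply Rmult_le_pos; [lra|]. apply near_d_nonneg with p q, H.
Qed.

Lemma strict_diff_param z0 (g : R -> R) : (forall u, continuous g u) ->
  strict_diff z0 (fun u _ => g (clamp u)) (fun _ _ => 0).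
Proof.
  intros Hg. split.
  - intros z _ u. apply (continuous_comp clamp g); [apply clamp_continuous|apply Hg].
  - intros z _ u. rewrite clamp_idem. reflexivity.
  - intros. apply continuous_const.
  - intros. ring.
  - exists 0. split; [lra|]. intros. rewrite Rabs_R0. lra.
  - intros om Hom. exists 1. split; [lra|]. intros p q d u _ _ _ _ H.
    rewrite Rminus_diag, Rminus_0_r, Rabs_R0. apply Rmult_le_pos; [lra|].
    apply near_d_nonneg with p q, H.
Qed.

Lemma strict_diff_at z0 G L u0 : strict_diff z0 G L ->
  strict_diff z0 (fun _ => G u0) (fun _ => L u0).
Proof.
  intros [H1 H2 H3 H4 [K [HK H5]] H6]. split.
  - intros. apply continuous_const.
  - reflexivity.
  - intros. apply continuous_const.
  - auto.
  - exists K. split; auto.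
  - intros om Hom. destruct (H6 om Hom) as [dl [Hdl H]]. exists dl. split; [exact Hdl|].
    intros. apply H; assumption.
Qed.

(** The chain rule for a C1 function f of three such functions. Uniformity in u
    comes from compactness of [0, 1] applied to the estimate of [C1_strict].
    All the operations on families reduce to this rule. *)
Lemma strict_diff_comp z0 (f : R -> R -> R -> R) G1 G2 G3 L1 L2 L3 : C1_R3 f -> good z0 ->
  strict_diff z0 G1 L1 -> strict_diff z0 G2 L2 -> strict_diff z0 G3 L3 ->
  strict_diff z0 (fun u z => f (G1 u z) (G2 u z) (G3 u z))
    (fun u z => pd1 f (G1 u z0) (G2 u z0) (G3 u z0) * L1 u z
              + pd2 f (G1 u z0) (G2 u z0) (G3 u z0) * L2 u z
              + pd3 f (G1 u z0) (G2 u z0) (G3 u z0) * L3 u z).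
Proof.
  intros hf Gz D1 D2 D3.
  set (D := fun (pd : (R -> R -> R -> R) -> R -> R -> R -> R) u => pd f (G1 u z0) (G2 u z0) (G3 u z0)).
  assert (Hcont : forall u, continuous (D pd1) u /\ continuous (D pd2) u /\ continuous (D pd3) u).
  { intros u. destruct hf as [_ Hc]. specialize (Hc (G1 u z0, G2 u z0, G3 u z0)).
    destruct Hc as [C1' [C2' C3']].
    assert (X1 := sd_continuous _ _ _ D1 z0 Gz u). assert (X2 := sd_continuous _ _ _ D2 z0 Gz u).
    assert (X3 := sd_continuous _ _ _ D3 z0 Gz u).
    split; [|split].
    - exact (continuous_R3_comp _ _ _ _ _ C1' X1 X2 X3).
    - exact (continuous_R3_comp _ _ _ _ _ C2' X1 X2 X3).
    - exact (continuous_R3_comp _ _ _ _ _ C3' X1 X2 X3). }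
  assert (Hcl : forall pd u, D pd u = D pd (clamp u)).
  { intros pd u. unfold D. rewrite (sd_clamp _ _ _ D1 _ Gz u), (sd_clamp _ _ _ D2 _ Gz u),
      (sd_clamp _ _ _ D3 _ Gz u). reflexivity. }
  assert (Hbd : exists M, 0 <= M /\ forall u, Rabs (D pd1 u) <= M /\ Rabs (D pd2 u) <= M /\ Rabs (D pd3 u) <= M).
  { destruct (bounded_on_01 (D pd1)) as [M1 [P1 B1]]; [apply Hcont|].
    destruct (bounded_on_01 (D pd2)) as [M2 [P2 B2]]; [apply Hcont|].
    destruct (bounded_on_01 (D pd3)) as [M3 [P3 B3]]; [apply Hcont|].
    exists (M1 + M2 + M3). split; [lra|]. intros u.
    rewrite (Hcl pd1 u), (Hcl pd2 u), (Hcl pd3 u).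
    specialize (B1 _ (clamp_range u)). specialize (B2 _ (clamp_range u)).
    specialize (B3 _ (clamp_range u)). lra. }
  destruct Hbd as [M [HM Hbd]].
  split.
  - intros z Hz u. apply C1_comp_continuous; [exact hf| | |];
      [apply (sd_continuous _ _ _ D1)|apply (sd_continuous _ _ _ D2)|apply (sd_continuous _ _ _ D3)]; exact Hz.
  - intros z Hz u. rewrite (sd_clamp _ _ _ D1 _ Hz u), (sd_clamp _ _ _ D2 _ Hz u),
      (sd_clamp _ _ _ D3 _ Hz u). reflexivity.
  - intros z Hz u. destruct (Hcont u) as [C1' [C2' C3']].
    apply continuous_Rplus; [apply continuous_Rplus|].
    + apply continuous_Rmult; [exact C1'|apply (sd_lin_continuous _ _ _ D1 z Hz)].
    + apply continuous_Rmult; [exact C2'|apply (sd_lin_continuous _ _ _ D2 z Hz)].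
    + apply continuous_Rmult; [exact C3'|apply (sd_lin_continuous _ _ _ D3 z Hz)].
  - intros a b p q u Hp Hq.
    rewrite (sd_linear _ _ _ D1), (sd_linear _ _ _ D2), (sd_linear _ _ _ D3) by assumption. ring.
  - destruct (sd_bounded _ _ _ D1) as [K1 [P1 B1]]. destruct (sd_bounded _ _ _ D2) as [K2 [P2 B2]].
    destruct (sd_bounded _ _ _ D3) as [K3 [P3 B3]].
    exists (M * (K1 + K2 + K3)). split; [apply Rmult_le_pos; lra|].
    intros u z d Hz Hd. destruct (Hbd u) as [M1 [M2 M3]].
    specialize (B1 u z d Hz Hd). specialize (B2 u z d Hz Hd). specialize (B3 u z d Hz Hd).
    eapply Rle_trans; [apply Rabs_triang|].
    eapply Rle_trans; [apply Rplus_le_compat_r, Rabs_triang|]. rewrite !Rabs_mult.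
    assert (T1 := Rmult_le_compat _ _ _ _ (Rabs_pos _) (Rabs_pos _) M1 B1).
    assert (T2 := Rmult_le_compat _ _ _ _ (Rabs_pos _) (Rabs_pos _) M2 B2).
    assert (T3 := Rmult_le_compat _ _ _ _ (Rabs_pos _) (Rabs_pos _) M3 B3).
    unfold D in *. lra.
  - intros om Hom.
    destruct (strict_diff_lipschitz _ _ _ D1) as [K1 [e1 [PK1 [Pe1 Lip1]]]].
    destruct (strict_diff_lipschitz _ _ _ D2) as [K2 [e2 [PK2 [Pe2 Lip2]]]].
    destruct (strict_diff_lipschitz _ _ _ D3) as [K3 [e3 [PK3 [Pe3 Lip3]]]].
    set (K := K1 + K2 + K3 + 1).
    assert (PK : 1 <= K) by (unfold K; lra).
    set (om1 := om / 2 / (3 * K)). set (om2 := om / 2 / (3 * M + 1)).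
    assert (Hom1 : 0 < om1) by (apply Rdiv_lt_0_compat; lra).
    assert (Hom2 : 0 < om2) by (apply Rdiv_lt_0_compat; lra).
    (* the estimate for f, with one radius r for all base points on the curve *)
    destruct (uniform_on_interval (fun u d => forall a1 a2 a3 b1 b2 b3,
       in_box d a1 a2 a3 (G1 u z0) (G2 u z0) (G3 u z0) ->
       in_box d b1 b2 b3 (G1 u z0) (G2 u z0) (G3 u z0) ->
       Rabs (f a1 a2 a3 - f b1 b2 b3 - (D pd1 u * (a1 - b1) + D pd2 u * (a2 - b2)
          + D pd3 u * (a3 - b3)))
       <= om1 * (Rabs (a1 - b1) + Rabs (a2 - b2) + Rabs (a3 - b3))) 0 1) as [r [Hr HU]].
    { lra. }
    { intros u d d' Hd' Hdd H a1 a2 a3 b1 b2 b3 [A1 [A2 A3]] [B1 [B2 B3]].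
      apply H; unfold in_box; lra. }
    { intros t Ht.
      destruct (C1_strict f hf (G1 t z0) (G2 t z0) (G3 t z0) om1 Hom1) as [d [Hd H]].
      destruct (proj1 (continuous_eps_delta _ t) (sd_continuous _ _ _ D1 z0 Gz t) (d / 2) ltac:(lra)) as [d1 [Hd1 X1]].
      destruct (proj1 (continuous_eps_delta _ t) (sd_continuous _ _ _ D2 z0 Gz t) (d / 2) ltac:(lra)) as [d2 [Hd2 X2]].
      destruct (proj1 (continuous_eps_delta _ t) (sd_continuous _ _ _ D3 z0 Gz t) (d / 2) ltac:(lra)) as [d3 [Hd3 X3]].
      exists (Rmin (d / 2) (Rmin d1 (Rmin d2 d3))). split; [repeat apply Rmin_glb_lt; lra|].
      intros u _ Hu a1 a2 a3 b1 b2 b3 HA HB.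
      assert (Hmin : Rabs (u - t) < d1 /\ Rabs (u - t) < d2 /\ Rabs (u - t) < d3).
      { apply Rmin_Rgt in Hu. destruct Hu as [_ Hu]. apply Rmin_Rgt in Hu. destruct Hu as [Y1 Hu].
        apply Rmin_Rgt in Hu. tauto. }
      destruct Hmin as [Y1 [Y2 Y3]]. specialize (X1 u Y1). specialize (X2 u Y2). specialize (X3 u Y3).
      assert (Hin : forall c1 c2 c3, in_box (Rmin (d / 2) (Rmin d1 (Rmin d2 d3))) c1 c2 c3
         (G1 u z0) (G2 u z0) (G3 u z0) -> in_box d c1 c2 c3 (G1 t z0) (G2 t z0) (G3 t z0)).
      { intros c1 c2 c3 [Z1 [Z2 Z3]]. generalize (Rmin_l (d / 2) (Rmin d1 (Rmin d2 d3))). intros Hm.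
        apply Rabs_def2 in X1, X2, X3, Z1, Z2, Z3.
        repeat split; apply Rabs_def1; lra. }
      apply (H (G1 u z0) (G2 u z0) (G3 u z0)); auto.
      unfold in_box. lra. }
    destruct (sd_strict _ _ _ D1 om2 Hom2) as [g1 [Pg1 S1]].
    destruct (sd_strict _ _ _ D2 om2 Hom2) as [g2 [Pg2 S2]].
    destruct (sd_strict _ _ _ D3 om2 Hom2) as [g3 [Pg3 S3]].
    destruct (below4 (r / (2 * K)) e1 e2 e3) as [dl' [Pdl' [Q0' [Q1' [Q2' Q3']]]]];
      try assumption; [apply Rdiv_lt_0_compat; lra|].
    destruct (below4 dl' g1 g2 g3) as [dl [Pdl [Q0 [Q4 [Q5 Q6]]]]]; try assumption.
    assert (Q1 : dl <= e1) by lra. assert (Q2 : dl <= e2) by lra. assert (Q3 : dl <= e3) by lra.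
    apply Rle_trans with (2 := Q0') in Q0.
    exists dl. split; [exact Pdl|]. intros p q d u Gp Gq Np Nq Npq.
    assert (Hd := near_d_nonneg _ _ _ Npq).
    assert (Hbox : forall z, good z -> near dl z z0 ->
      in_box r (G1 u z) (G2 u z) (G3 u z) (G1 u z0) (G2 u z0) (G3 u z0)).
    { intros z Hz Nz.
      assert (R1 := Lip1 z z0 dl u Hz Gz (near_le _ _ _ _ Q1 Nz) (near_refl _ _ (Rlt_le _ _ Pe1)) Nz).
      assert (R2 := Lip2 z z0 dl u Hz Gz (near_le _ _ _ _ Q2 Nz) (near_refl _ _ (Rlt_le _ _ Pe2)) Nz).
      assert (R3 := Lip3 z z0 dl u Hz Gz (near_le _ _ _ _ Q3 Nz) (near_refl _ _ (Rlt_le _ _ Pe3)) Nz).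
      assert (K * dl <= r / 2).
      { apply Rle_trans with (K * (r / (2 * K))); [apply Rmult_le_compat_l; lra|].
        right. field. lra. }
      assert (K1 * dl <= K * dl) by (apply Rmult_le_compat_r; unfold K; lra).
      assert (K2 * dl <= K * dl) by (apply Rmult_le_compat_r; unfold K; lra).
      assert (K3 * dl <= K * dl) by (apply Rmult_le_compat_r; unfold K; lra).
      unfold in_box. lra. }
    specialize (HU (clamp u) (clamp_range u)).
    rewrite <- !Hcl, <- (sd_clamp _ _ _ D1 z0 Gz), <- (sd_clamp _ _ _ D2 z0 Gz),
      <- (sd_clamp _ _ _ D3 z0 Gz) in HU.
    specialize (HU _ _ _ _ _ _ (Hbox p Gp Np) (Hbox q Gq Nq)).
    specialize (S1 p q d u Gp Gq (near_le _ _ _ _ Q4 Np) (near_le _ _ _ _ Q4 Nq) Npq).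
    specialize (S2 p q d u Gp Gq (near_le _ _ _ _ Q5 Np) (near_le _ _ _ _ Q5 Nq) Npq).
    specialize (S3 p q d u Gp Gq (near_le _ _ _ _ Q6 Np) (near_le _ _ _ _ Q6 Nq) Npq).
    specialize (Lip1 p q d u Gp Gq (near_le _ _ _ _ Q1 Np) (near_le _ _ _ _ Q1 Nq) Npq).
    specialize (Lip2 p q d u Gp Gq (near_le _ _ _ _ Q2 Np) (near_le _ _ _ _ Q2 Nq) Npq).
    specialize (Lip3 p q d u Gp Gq (near_le _ _ _ _ Q3 Np) (near_le _ _ _ _ Q3 Nq) Npq).
    destruct (Hbd u) as [M1 [M2 M3]].
    set (h := comb 1 p (-1) q) in *. unfold D in *.
    set (c1 := pd1 f (G1 u z0) (G2 u z0) (G3 u z0)) in *.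
    set (c2 := pd2 f (G1 u z0) (G2 u z0) (G3 u z0)) in *.
    set (c3 := pd3 f (G1 u z0) (G2 u z0) (G3 u z0)) in *.
    assert (T1 := Rmult_le_compat _ _ _ _ (Rabs_pos _) (Rabs_pos _) M1 S1). rewrite <- Rabs_mult in T1.
    assert (T2 := Rmult_le_compat _ _ _ _ (Rabs_pos _) (Rabs_pos _) M2 S2). rewrite <- Rabs_mult in T2.
    assert (T3 := Rmult_le_compat _ _ _ _ (Rabs_pos _) (Rabs_pos _) M3 S3). rewrite <- Rabs_mult in T3.
    match goal with |- Rabs ?x <= _ => replace x with
      ((f (G1 u p) (G2 u p) (G3 u p) - f (G1 u q) (G2 u q) (G3 u q)
        - (c1 * (G1 u p - G1 u q) + c2 * (G2 u p - G2 u q) + c3 * (G3 u p - G3 u q)))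
       + (c1 * (G1 u p - G1 u q - L1 u h) + c2 * (G2 u p - G2 u q - L2 u h)
          + c3 * (G3 u p - G3 u q - L3 u h))) by ring end.
    eapply Rle_trans; [apply Rabs_triang|].
    assert (Rabs (c1 * (G1 u p - G1 u q - L1 u h) + c2 * (G2 u p - G2 u q - L2 u h)
          + c3 * (G3 u p - G3 u q - L3 u h)) <= 3 * M * (om2 * d)).
    { eapply Rle_trans; [apply Rabs_triang|].
      eapply Rle_trans; [apply Rplus_le_compat_r, Rabs_triang|]. lra. }
    assert (3 * M * (om2 * d) <= om / 2 * d).
    { assert (om2 * (3 * M + 1) = om / 2) by (unfold om2; field; lra). nra. }
    assert (om1 * (Rabs (G1 u p - G1 u q) + Rabs (G2 u p - G2 u q) + Rabs (G3 u p - G3 u q))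
      <= om / 2 * d).
    { apply Rle_trans with (om1 * (3 * K * d)).
      - apply Rmult_le_compat_l; [lra|]. unfold K. nra.
      - right. unfold om1. field. unfold K. lra. }
    lra.
Qed.

Lemma ex_RInt_cont (f : R -> R) a b : (forall u, continuous f u) -> ex_RInt f a b.
Proof. intros H. apply (ex_RInt_continuous (V := R_CompleteNormedModule)). intros; apply H. Qed.

Lemma RInt_lin (a b : R) (f g : R -> R) x y :
  (forall u, continuous f u) -> (forall u, continuous g u) ->
  RInt (fun v => a * f v + b * g v) x y = a * RInt f x y + b * RInt g x y.
Proof.
  intros Hf Hg.
  assert (Ef := ex_RInt_cont f x y Hf). assert (Eg := ex_RInt_cont g x y Hg).
  apply is_RInt_unique.
  apply (is_RInt_plus (V := R_NormedModule) (fun v => a * f v) (fun v => b * g v) x y).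
  - apply (is_RInt_scal (V := R_NormedModule) f x y a), (RInt_correct (V := R_CompleteNormedModule)), Ef.
  - apply (is_RInt_scal (V := R_NormedModule) g x y b), (RInt_correct (V := R_CompleteNormedModule)), Eg.
Qed.

Lemma RInt_clamp_bound (f : R -> R) u B : (forall v, continuous f v) ->
  (forall v, Rabs (f v) <= B) -> Rabs (RInt f 0 (clamp u)) <= B.
Proof.
  intros Hf HB. destruct (clamp_range u).
  eapply Rle_trans; [apply (abs_RInt_le_const f 0 (clamp u) B); auto|].
  - apply ex_RInt_cont, Hf.
  - assert (0 <= B) by (eapply Rle_trans; [apply Rabs_pos|apply (HB 0)]).
    nra.
Qed.

(** The estimate is uniform in u, so it survives integration over an interval
    of length at most 1. *)
Lemma strict_diff_RInt z0 G L : good z0 -> strict_diff z0 G L ->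
  strict_diff z0 (fun u z => RInt (fun v => G v z) 0 (clamp u))
                 (fun u z => RInt (fun v => L v z) 0 (clamp u)).
Proof.
  intros Gz [H1 H2 H3 H4 [K [HK H5]] H6].
  assert (Hc : forall (g : R -> R) u, (forall v, continuous g v) ->
    continuous (fun u => RInt g 0 (clamp u) : R) u).
  { intros g u Hg. apply (continuous_comp clamp (fun x => RInt g 0 x)); [apply clamp_continuous|].
    apply (is_derive_continuous (fun x => RInt g 0 x) (clamp u) (g (clamp u))).
    apply (is_derive_RInt (V := R_NormedModule) g _ 0); [|apply Hg].
    apply filter_forall. intros x. apply (RInt_correct (V := R_CompleteNormedModule)), ex_RInt_cont, Hg. }
  split.
  - intros z Hz u. apply Hc. auto.
  - intros z Hz u. rewrite clamp_idem. reflexivity.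
  - intros z Hz u. apply Hc. auto.
  - intros a b p q u Hp Hq. rewrite <- RInt_lin by auto.
    apply RInt_ext. intros x _. apply H4; assumption.
  - exists K. split; [exact HK|]. intros u z d Hz Hd.
    apply RInt_clamp_bound; [auto|]. intros v. auto.
  - intros om Hom. destruct (H6 om Hom) as [dl [Hdl H]]. exists dl. split; [exact Hdl|].
    intros p q d u Gp Gq Np Nq Npq.
    assert (Gh := good_comb 1 (-1) p q Gp Gq).
    replace (RInt (fun v => G v p) 0 (clamp u) - RInt (fun v => G v q) 0 (clamp u)
       - RInt (fun v => L v (comb 1 p (-1) q)) 0 (clamp u)) with
      (RInt (fun v => 1 * (1 * G v p + (-1) * G v q) + (-1) * L v (comb 1 p (-1) q)) 0 (clamp u)).
    + apply RInt_clamp_bound.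
      * intros v. apply (continuous_lin 1 (-1) (fun v => 1 * G v p + (-1) * G v q)); [|auto].
        apply continuous_lin; auto.
      * intros v.
        replace (1 * (1 * G v p + -1 * G v q) + -1 * L v (comb 1 p (-1) q)) with
          (G v p - G v q - L v (comb 1 p (-1) q)) by ring. auto.
    + rewrite (RInt_lin 1 (-1) (fun v => 1 * G v p + (-1) * G v q)); auto.
      * rewrite RInt_lin by auto.
        eq_in_R. ring.
      * intros v. apply continuous_lin; auto.
Qed.

Section sdiff.
Context (z0 : state) (Gz : good z0).

Lemma sdiff_comp f G1 G2 G3 : C1_R3 f -> sdiff z0 G1 -> sdiff z0 G2 -> sdiff z0 G3 ->
  sdiff z0 (fun u z => f (G1 u z) (G2 u z) (G3 u z)).
Proof.
  intros hf [L1 H1] [L2 H2] [L3 H3]. eexists. apply strict_diff_comp; eauto.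
Qed.

Lemma sdiff_param g : (forall u, continuous g u) -> sdiff z0 (fun u _ => g (clamp u)).
Proof. intros H. eexists. apply strict_diff_param, H. Qed.

Lemma sdiff_const c : sdiff z0 (fun _ _ => c).
Proof. apply (sdiff_param (fun _ => c)). intros. apply continuous_const. Qed.

Lemma sdiff_coord c : sdiff z0 (fun _ z => z c).
Proof. eexists. apply strict_diff_coord. Qed.

Lemma sdiff_force s : sdiff z0 (fun u z => z (cG s u)).
Proof. eexists. apply strict_diff_force. Qed.

Lemma sdiff_at G u0 : sdiff z0 G -> sdiff z0 (fun _ => G u0).
Proof. intros [L H]. eexists. apply strict_diff_at, H. Qed.

Lemma sdiff_RInt G : sdiff z0 G -> sdiff z0 (fun u z => RInt (fun v => G v z) 0 (clamp u)).
Proof. intros [L H]. eexists. apply strict_diff_RInt; eauto. Qed.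

Lemma sdiff_scalar (g g' : R -> R) G : (forall x, is_derive g x (g' x)) ->
  (forall x, continuous g' x) -> sdiff z0 G -> sdiff z0 (fun u z => g (G u z)).
Proof.
  intros Hg Hg' HG. apply (sdiff_comp (fun t _ _ => g t) G (fun _ _ => 0) (fun _ _ => 0));
    auto using sdiff_const.
  apply (C1_R3_intro _ (fun t _ _ => g' t) (fun _ _ _ => 0) (fun _ _ _ => 0)); intros.
  - apply Hg.
  - apply is_derive_Rconst.
  - apply is_derive_Rconst.
  - apply (continuous_comp (fun p : R * R * R => fst (fst p)) g'); [|apply Hg'].
    apply (continuous_comp fst fst); apply continuous_fst.
  - apply continuous_const.
  - apply continuous_const.
Qed.

Lemma sdiff_plus G H : sdiff z0 G -> sdiff z0 H -> sdiff z0 (fun u z => G u z + H u z).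
Proof.
  intros HG HH. apply (sdiff_comp (fun t x _ => t + x) G H (fun _ _ => 0)); auto using sdiff_const.
  apply (C1_R3_intro _ (fun _ _ _ => 1) (fun _ _ _ => 1) (fun _ _ _ => 0)); intros;
    try apply continuous_const; auto_derive; auto; ring.
Qed.

Lemma sdiff_mult G H : sdiff z0 G -> sdiff z0 H -> sdiff z0 (fun u z => G u z * H u z).
Proof.
  intros HG HH. apply (sdiff_comp (fun t x _ => t * x) G H (fun _ _ => 0)); auto using sdiff_const.
  apply (C1_R3_intro _ (fun _ x _ => x) (fun t _ _ => t) (fun _ _ _ => 0)); intros;
    try apply continuous_const; try (auto_derive; auto; ring).
  - apply (continuous_comp fst snd); [apply continuous_fst|apply continuous_snd].
  - apply (continuous_comp fst fst); apply continuous_fst.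
Qed.

Lemma sdiff_minus G H : sdiff z0 G -> sdiff z0 H -> sdiff z0 (fun u z => G u z - H u z).
Proof.
  intros HG HH. apply (sdiff_plus G (fun u z => - H u z)); [exact HG|].
  apply (sdiff_scalar Ropp (fun _ => -1)); [| |exact HH].
  - intros x. auto_derive; auto; ring.
  - intros. apply continuous_const.
Qed.
End sdiff.

(** Derivatives at the unperturbed state can thus be computed one direction at
    a time, by one-variable calculus. *)
Lemma strict_diff_directional z0 G L p u : strict_diff z0 G L -> good z0 -> good p ->
  bounded_by 1 p -> is_derive (fun t => G u (comb 1 z0 t p)) 0 (L u p).
Proof.
  intros H Gz Gp Bp. apply is_derive_Reals. intros e He.
  destruct (sd_strict _ _ _ H (e / 2) ltac:(lra)) as [dl [Hdl HS]].
  exists (mkposreal dl Hdl). intros t Ht Htd. simpl in Htd. rewrite Rplus_0_l.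
  assert (E0 : comb 1 z0 0 p = z0) by (apply functional_extensionality; intros j; unfold comb; ring).
  rewrite E0.
  assert (Np : near (Rabs t) (comb 1 z0 t p) z0).
  { intros j. unfold comb. replace (1 * z0 j + t * p j - z0 j) with (t * p j) by ring.
    rewrite Rabs_mult. specialize (Bp j). generalize (Rabs_pos t). nra. }
  specialize (HS (comb 1 z0 t p) z0 (Rabs t) u (good_comb 1 t z0 p Gz Gp) Gz
    (near_le _ _ _ _ (Rlt_le _ _ Htd) Np) (near_refl _ _ (Rlt_le _ _ Hdl)) Np).
  replace (comb 1 (comb 1 z0 t p) (-1) z0) with (comb t p 0 p) in HS
    by (apply functional_extensionality; intros j; unfold comb; ring).
  rewrite (sd_linear _ _ _ H) in HS by assumption.
  assert (Hp : 0 < Rabs t) by (apply Rabs_pos_lt, Ht).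
  apply Rmult_lt_reg_r with (Rabs t); [exact Hp|]. rewrite <- Rabs_mult.
  replace (((G u (comb 1 z0 t p) - G u z0) / t - L u p) * t) with
    (G u (comb 1 z0 t p) - G u z0 - (t * L u p + 0 * L u p)) by (field; exact Ht).
  eapply Rle_lt_trans; [exact HS|]. nra.
Qed.

(** * The fundamental solutions of the linear part *)

(** The solutions of S' = C, C' = eta S, Q' = S with S 0 = 0, C 0 = 1, Q 0 = 0.
    The unperturbed phase is y0 S - alpha Q, and the identities between these
    three functions replace all case distinctions on the sign of eta in the
    study of the dynamics. *)
Definition Sf (eta t : R) : R :=
  sign_cases eta (sinh (sqrt eta * t) / sqrt eta) t (sin (omega eta * t) / omega eta).
Definition Cf (eta t : R) : R :=
  sign_cases eta (cosh (sqrt eta * t)) 1 (cos (omega eta * t)).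
Definition Qf (eta t : R) : R :=
  sign_cases eta ((cosh (sqrt eta * t) - 1) / eta) (t ^ 2 / 2)
    ((1 - cos (omega eta * t)) / omega eta ^ 2).

Lemma sign_cases_elim (eta : R) (P : Prop) :
  (0 < eta -> 0 < sqrt eta -> sqrt eta * sqrt eta = eta ->
     (forall A (a b c : A), sign_cases eta a b c = a) -> P) ->
  (eta = 0 -> (forall A (a b c : A), sign_cases eta a b c = b) -> P) ->
  (eta < 0 -> 0 < omega eta -> omega eta * omega eta = - eta ->
     (forall A (a b c : A), sign_cases eta a b c = c) -> P) -> P.
Proof.
  intros Hp Hz Hn. destruct (Rtotal_order 0 eta) as [H|[H|H]].
  - apply Hp; auto.
    + apply sqrt_lt_R0, H.
    + apply sqrt_sqrt. lra.
    + intros. unfold sign_cases. destruct (Rlt_dec 0 eta); [reflexivity|lra].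
  - apply Hz; auto. intros. unfold sign_cases.
    destruct (Rlt_dec 0 eta); [lra|]. destruct (Rlt_dec eta 0); [lra|reflexivity].
  - apply Hn; auto; unfold omega.
    + apply sqrt_lt_R0. lra.
    + apply sqrt_sqrt. lra.
    + intros. unfold sign_cases.
      destruct (Rlt_dec 0 eta); [lra|]. destruct (Rlt_dec eta 0); [reflexivity|lra].
Qed.

Lemma cosh2_sinh2 x : cosh x * cosh x - sinh x * sinh x = 1.
Proof.
  unfold cosh, sinh. replace 1 with (exp x * exp (- x)); [field|].
  rewrite <- exp_plus. replace (x + - x) with 0 by ring. apply exp_0.
Qed.

Lemma sinh_minus x y : sinh (x - y) = sinh x * cosh y - cosh x * sinh y.
Proof.
  unfold cosh, sinh. replace (- (x - y)) with (- x + y) by ring. unfold Rminus.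
  rewrite !exp_plus. field.
Qed.

Lemma cosh_minus x y : cosh (x - y) = cosh x * cosh y - sinh x * sinh y.
Proof.
  unfold cosh, sinh. replace (- (x - y)) with (- x + y) by ring. unfold Rminus.
  rewrite !exp_plus. field.
Qed.

Section SCQ.
Context (eta : R).

Ltac cases_on_sign :=
  apply (sign_cases_elim eta);
  [intros Hs Hr Hrr E|intros Hs E|intros Hs Hr Hrr E].

Lemma Sf_derive t : is_derive (Sf eta) t (Cf eta t).
Proof.
  unfold Cf. cases_on_sign; rewrite E.
  - apply is_derive_ext with (fun t => sinh (sqrt eta * t) / sqrt eta).
    { intros. unfold Sf. rewrite E. reflexivity. }
    unfold sinh, cosh. auto_derive; [auto|]. field. lra.
  - apply is_derive_ext with (fun t => t).
    { intros. unfold Sf. rewrite E. reflexivity. }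
    auto_derive; auto.
  - apply is_derive_ext with (fun t => sin (omega eta * t) / omega eta).
    { intros. unfold Sf. rewrite E. reflexivity. }
    auto_derive; [auto|]. field. lra.
Qed.

Lemma Cf_derive t : is_derive (Cf eta) t (eta * Sf eta t).
Proof.
  unfold Sf. cases_on_sign; rewrite E.
  - apply is_derive_ext with (fun t => cosh (sqrt eta * t)).
    { intros. unfold Cf. rewrite E. reflexivity. }
    unfold sinh, cosh. auto_derive; [auto|]. set (r := sqrt eta) in *. rewrite <- Hrr. field. lra.
  - apply is_derive_ext with (fun t => 1).
    { intros. unfold Cf. rewrite E. reflexivity. }
    auto_derive; auto. rewrite Hs. ring.
  - apply is_derive_ext with (fun t => cos (omega eta * t)).
    { intros. unfold Cf. rewrite E. reflexivity. }
    auto_derive; [auto|]. set (w := omega eta) in *; clearbody w; replace eta with (- (w * w)) by lra. field. lra.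
Qed.

Lemma Qf_derive t : is_derive (Qf eta) t (Sf eta t).
Proof.
  unfold Sf. cases_on_sign; rewrite E.
  - apply is_derive_ext with (fun t => (cosh (sqrt eta * t) - 1) / eta).
    { intros. unfold Qf. rewrite E. reflexivity. }
    unfold sinh, cosh. auto_derive; [auto|].
    set (r := sqrt eta) in *. rewrite <- Hrr. field. lra.
  - apply is_derive_ext with (fun t => t ^ 2 / 2).
    { intros. unfold Qf. rewrite E. reflexivity. }
    auto_derive; auto. field.
  - apply is_derive_ext with (fun t => (1 - cos (omega eta * t)) / omega eta ^ 2).
    { intros. unfold Qf. rewrite E. reflexivity. }
    auto_derive; [auto|]. field. lra.
Qed.

Lemma Sf_0 : Sf eta 0 = 0.
Proof.
  unfold Sf. cases_on_sign; rewrite E; rewrite ?Rmult_0_r.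
  - rewrite sinh_0. field. lra.
  - reflexivity.
  - rewrite sin_0. field. lra.
Qed.

Lemma Cf_0 : Cf eta 0 = 1.
Proof.
  unfold Cf. cases_on_sign; rewrite E; rewrite ?Rmult_0_r.
  - apply cosh_0.
  - reflexivity.
  - apply cos_0.
Qed.

Lemma Qf_0 : Qf eta 0 = 0.
Proof.
  unfold Qf. cases_on_sign; rewrite E; rewrite ?Rmult_0_r.
  - rewrite cosh_0. field. lra.
  - field.
  - rewrite cos_0. field. lra.
Qed.

Lemma Cf_Sf_pythagoras t : Cf eta t * Cf eta t - eta * (Sf eta t * Sf eta t) = 1.
Proof.
  unfold Cf, Sf. cases_on_sign; rewrite !E.
  - rewrite <- (cosh2_sinh2 (sqrt eta * t)). set (r := sqrt eta) in *. rewrite <- Hrr. field. lra.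
  - rewrite Hs. ring.
  - generalize (sin2_cos2 (omega eta * t)). unfold Rsqr. intros H. rewrite <- H.
    set (w := omega eta) in *; clearbody w; replace eta with (- (w * w)) by lra. field. lra.
Qed.

Lemma Cf_Qf t : Cf eta t = 1 + eta * Qf eta t.
Proof.
  unfold Cf, Qf. cases_on_sign; rewrite !E.
  - field. lra.
  - rewrite Hs. ring.
  - set (w := omega eta) in *; clearbody w; replace eta with (- (w * w)) by lra. field. lra.
Qed.

Lemma Qf_Cf t : Qf eta t * (1 + Cf eta t) = Sf eta t * Sf eta t.
Proof.
  generalize (Cf_Sf_pythagoras t). unfold Cf, Sf, Qf. cases_on_sign; rewrite !E; intros H.
  - apply Rmult_eq_reg_l with eta; [|lra].
    replace (eta * (sinh (sqrt eta * t) / sqrt eta * (sinh (sqrt eta * t) / sqrt eta)))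
      with (cosh (sqrt eta * t) * cosh (sqrt eta * t) - 1) by lra. field. lra.
  - field.
  - apply Rmult_eq_reg_l with eta; [|lra].
    replace (eta * (sin (omega eta * t) / omega eta * (sin (omega eta * t) / omega eta)))
      with (cos (omega eta * t) * cos (omega eta * t) - 1) by lra.
    set (w := omega eta) in *; clearbody w; replace eta with (- (w * w)) by lra. field. lra.
Qed.

Lemma Sf_minus a b : Sf eta (a - b) = Sf eta a * Cf eta b - Cf eta a * Sf eta b.
Proof.
  unfold Cf, Sf. cases_on_sign; rewrite !E.
  - rewrite Rmult_minus_distr_l, sinh_minus. field. lra.
  - ring.
  - rewrite Rmult_minus_distr_l, sin_minus. field. lra.
Qed.

Lemma Cf_minus a b : Cf eta (a - b) = Cf eta a * Cf eta b - eta * (Sf eta a * Sf eta b).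
Proof.
  unfold Cf, Sf. cases_on_sign; rewrite !E.
  - rewrite Rmult_minus_distr_l, cosh_minus. set (r := sqrt eta) in *. rewrite <- Hrr. field. lra.
  - rewrite Hs. ring.
  - rewrite Rmult_minus_distr_l, cos_minus.
    set (w := omega eta) in *; clearbody w; replace eta with (- (w * w)) by lra. field. lra.
Qed.

Lemma Sf_opp t : Sf eta (- t) = - Sf eta t.
Proof. replace (- t) with (0 - t) by ring. rewrite Sf_minus, Sf_0, Cf_0. ring. Qed.

Lemma Cf_opp t : Cf eta (- t) = Cf eta t.
Proof. replace (- t) with (0 - t) by ring. rewrite Cf_minus, Sf_0, Cf_0. ring. Qed.

Lemma Sf_double a : Sf eta (2 * a) = 2 * (Sf eta a * Cf eta a).
Proof.
  replace (2 * a) with (a - - a) by ring. rewrite Sf_minus, Sf_opp, Cf_opp. ring.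
Qed.

Lemma Cf_double a : 1 + Cf eta (2 * a) = 2 * (Cf eta a * Cf eta a).
Proof.
  replace (2 * a) with (a - - a) by ring. rewrite Cf_minus, Sf_opp, Cf_opp.
  generalize (Cf_Sf_pythagoras a). lra.
Qed.

Lemma Qf_double a : Qf eta (2 * a) = 2 * (Sf eta a * Sf eta a).
Proof.
  unfold Sf, Qf. cases_on_sign; rewrite !E.
  - replace (sqrt eta * (2 * a)) with (sqrt eta * a - - (sqrt eta * a)) by ring.
    rewrite cosh_minus. generalize (cosh2_sinh2 (sqrt eta * a)).
    replace (cosh (- (sqrt eta * a))) with (cosh (sqrt eta * a))
      by (unfold cosh; rewrite Ropp_involutive; field).
    replace (sinh (- (sqrt eta * a))) with (- sinh (sqrt eta * a))
      by (unfold sinh; rewrite Ropp_involutive; field).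
    intros H. replace (cosh (sqrt eta * a) * cosh (sqrt eta * a)) with
      (1 + sinh (sqrt eta * a) * sinh (sqrt eta * a)) by lra.
    set (r := sqrt eta) in *. rewrite <- Hrr. field. lra.
  - field.
  - replace (omega eta * (2 * a)) with (2 * (omega eta * a)) by ring.
    rewrite cos_2a_sin. field. lra.
Qed.

Lemma Sf_continuous t : continuous (Sf eta) t.
Proof. exact (is_derive_continuous _ _ _ (Sf_derive t)). Qed.

Lemma Cf_continuous t : continuous (Cf eta) t.
Proof. exact (is_derive_continuous _ _ _ (Cf_derive t)). Qed.

Lemma Qf_continuous t : continuous (Qf eta) t.
Proof. exact (is_derive_continuous _ _ _ (Qf_derive t)). Qed.

Lemma Gamma_SCQ alpha t y0 : Gamma eta alpha t y0 =
  (y0 * Sf eta t - alpha * Qf eta t, y0 * Cf eta t - alpha * Sf eta t).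
Proof.
  unfold Gamma, Sf, Cf, Qf. cases_on_sign; rewrite !E; f_equal.
  - set (r := sqrt eta) in *. rewrite <- Hrr. field. lra.
  - field. lra.
  - field.
  - field.
  - field. lra.
  - field. lra.
Qed.

Lemma U_Sf alpha t s : U eta alpha t s = - (alpha / Cf eta (s / 2)) * Sf eta (t - s / 2).
Proof.
  unfold U, Sf, Cf. cases_on_sign; rewrite !E.
  - replace (sqrt eta * (2 * t - s) / 2) with (sqrt eta * (t - s / 2)) by field.
    replace (sqrt eta * s / 2) with (sqrt eta * (s / 2)) by field.
    assert (0 < cosh (sqrt eta * (s / 2))).
    { unfold cosh. generalize (exp_pos (sqrt eta * (s / 2))) (exp_pos (- (sqrt eta * (s / 2)))). lra. }
    field. lra.
  - field.
  - replace (omega eta * (2 * t - s) / 2) with (omega eta * (t - s / 2)) by field.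
    replace (omega eta * s / 2) with (omega eta * (s / 2)) by field.
    unfold Rdiv. ring.
Qed.
End SCQ.

(** * The half-period *)

(** What the four conditions on the parameters and their intervals have in
    common: S is positive on (0, h / 2] and alpha C is positive at h / 2. This
    makes the unperturbed phase and its initial velocity v positive. *)
Record half_period_data (eta alpha h v : R) : Prop := {
  hp_pos : 0 < h;
  hp_S : forall s, 0 < s -> s <= h / 2 -> 0 < Sf eta s;
  hp_C : 0 < alpha * Cf eta (h / 2);
  hp_v : v = alpha * Sf eta (h / 2) / Cf eta (h / 2) }.

(** In the last case omega h / 2 lies in the second quadrant, so cos < 0 and
    alpha < 0 compensate. *)
Lemma half_period_data_of_case c eta alpha h :
  param_cond c eta alpha -> half_period_range c eta h ->
  half_period_data eta alpha h (half_period_inv c eta alpha h).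
Proof.
  intros Hc Hr.
  assert (Hneg : eta < 0 -> 0 < h -> omega eta * h < 2 * PI -> 0 < alpha * cos (omega eta * (h / 2)) ->
    half_period_data eta alpha h (alpha / omega eta * tan (omega eta * h / 2))).
  { intros He Hh Hw Hcos. assert (Hom : 0 < omega eta) by (apply sqrt_lt_R0; lra).
    assert (E : forall A (a b c : A), sign_cases eta a b c = c).
    { intros. unfold sign_cases. destruct (Rlt_dec 0 eta); [lra|].
      destruct (Rlt_dec eta 0); [reflexivity|lra]. }
    split; [exact Hh| | |]; unfold Sf, Cf; rewrite ?E.
    - intros s H1 H2. rewrite E. apply Rdiv_lt_0_compat; [|exact Hom].
      apply sin_gt_0; nra.
    - exact Hcos.
    - unfold tan. replace (omega eta * h / 2) with (omega eta * (h / 2)) by field.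
      assert (cos (omega eta * (h / 2)) <> 0).
      { intros H0. rewrite H0 in Hcos. lra. }
      field. lra. }
  destruct c; simpl in *; destruct Hc as [He Ha].
  - assert (Hr' : 0 < sqrt eta) by (apply sqrt_lt_R0; lra).
    assert (E : forall A (a b c : A), sign_cases eta a b c = a).
    { intros. unfold sign_cases. destruct (Rlt_dec 0 eta); [reflexivity|lra]. }
    assert (Hcosh : forall x, 0 < cosh x).
    { intros x. unfold cosh. generalize (exp_pos x) (exp_pos (- x)). lra. }
    split; [exact Hr| | |]; unfold Sf, Cf; rewrite ?E.
    + intros s H1 _. rewrite E. apply Rdiv_lt_0_compat; [|exact Hr'].
      rewrite <- sinh_0. apply sinh_lt. nra.
    + apply Rmult_lt_0_compat; auto.
    + unfold tanh. replace (sqrt eta * h / 2) with (sqrt eta * (h / 2)) by field.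
      field. split; [lra|]. specialize (Hcosh (sqrt eta * (h / 2))). lra.
  - assert (E : forall A (a b c : A), sign_cases eta a b c = b).
    { intros. unfold sign_cases. destruct (Rlt_dec 0 eta); [lra|].
      destruct (Rlt_dec eta 0); [lra|reflexivity]. }
    split; [exact Hr| | |]; unfold Sf, Cf; rewrite ?E.
    + intros s H1 _. rewrite E. exact H1.
    + lra.
    + field.
  - assert (Hom : 0 < omega eta) by (apply sqrt_lt_R0; lra).
    destruct Hr as [H1 H2]. apply (Rmult_lt_compat_l (omega eta)) in H2; [|exact Hom].
    replace (omega eta * (PI / omega eta)) with PI in H2 by (field; lra).
    generalize PI_RGT_0. intros HPI.
    apply Hneg; try lra. apply Rmult_lt_0_compat; [exact Ha|]. apply cos_gt_0; nra.
  - assert (Hom : 0 < omega eta) by (apply sqrt_lt_R0; lra).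
    destruct Hr as [H1 H2]. generalize PI_RGT_0. intros HPI.
    assert (Hh : 0 < h).
    { apply Rlt_trans with (PI / omega eta); [|exact H1]. apply Rdiv_lt_0_compat; lra. }
    apply (Rmult_lt_compat_l (omega eta)) in H1, H2; try exact Hom.
    replace (omega eta * (PI / omega eta)) with PI in H1 by (field; lra).
    replace (omega eta * (2 * PI / omega eta)) with (2 * PI) in H2 by (field; lra).
    apply Hneg; try lra.
    assert (cos (omega eta * (h / 2)) < 0) by (apply cos_lt_0; lra).
    nra.
Qed.

Section Unperturbed.
Context (eta alpha h v : R) (D : half_period_data eta alpha h v).

Lemma hp_C_neq : Cf eta (h / 2) <> 0.
Proof. intros H. generalize (hp_C _ _ _ _ D). rewrite H. lra. Qed.

Lemma hp_alpha_C : 0 < alpha / Cf eta (h / 2).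
Proof.
  generalize (hp_C _ _ _ _ D) hp_C_neq. intros H Hn.
  replace (alpha / Cf eta (h / 2)) with
    (alpha * Cf eta (h / 2) * / (Cf eta (h / 2) * Cf eta (h / 2))) by (field; exact Hn).
  apply Rmult_lt_0_compat; [exact H|]. apply Rinv_0_lt_compat. nra.
Qed.

Lemma hp_S_half : 0 < Sf eta (h / 2).
Proof. apply (hp_S _ _ _ _ D); generalize (hp_pos _ _ _ _ D); lra. Qed.

Lemma hp_v_pos : 0 < v.
Proof.
  rewrite (hp_v _ _ _ _ D).
  replace (alpha * Sf eta (h / 2) / Cf eta (h / 2)) with (alpha / Cf eta (h / 2) * Sf eta (h / 2))
    by (field; apply hp_C_neq).
  apply Rmult_lt_0_compat; [apply hp_alpha_C|apply hp_S_half].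
Qed.

Lemma Sf_full : Sf eta h = 2 * (Sf eta (h / 2) * Cf eta (h / 2)).
Proof. replace h with (2 * (h / 2)) at 1 by field. apply Sf_double. Qed.

Lemma hp_S_full_neq : Sf eta h <> 0.
Proof.
  rewrite Sf_full. generalize hp_C_neq hp_S_half. intros H1 H2 H3.
  apply H1. apply Rmult_eq_reg_l with (Sf eta (h / 2)); lra.
Qed.

(** The unperturbed phase returns to x = 0 after time h. *)
Lemma hp_closing : v * Sf eta h = alpha * Qf eta h.
Proof.
  rewrite Sf_full. replace h with (2 * (h / 2)) at 3 by field.
  rewrite Qf_double, (hp_v _ _ _ _ D). field. apply hp_C_neq.
Qed.

(** The unperturbed phase arrives with velocity - v. *)
Lemma hp_arrival : v * Cf eta h - alpha * Sf eta h = - v.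
Proof.
  assert (E : 1 + Cf eta h = 2 * (Cf eta (h / 2) * Cf eta (h / 2))).
  { replace h with (2 * (h / 2)) at 1 by field. apply Cf_double. }
  replace (Cf eta h) with (2 * (Cf eta (h / 2) * Cf eta (h / 2)) - 1) by lra.
  rewrite Sf_full, (hp_v _ _ _ _ D). field. apply hp_C_neq.
Qed.

(** The position factors as a positive constant times S (s/2) S ((h - s)/2). *)
Lemma hp_positive s : 0 < s < h -> 0 < v * Sf eta s - alpha * Qf eta s.
Proof.
  intros Hs.
  replace (v * Sf eta s - alpha * Qf eta s) with
    (2 * (alpha / Cf eta (h / 2)) * (Sf eta (s / 2) * Sf eta (h / 2 - s / 2))).
  - apply Rmult_lt_0_compat; [generalize hp_alpha_C; lra|].
    apply Rmult_lt_0_compat; apply (hp_S _ _ _ _ D); lra.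
  - rewrite Sf_minus. replace s with (2 * (s / 2)) at 4 5 by field.
    rewrite Sf_double, Qf_double, (hp_v _ _ _ _ D). field. apply hp_C_neq.
Qed.

(** The Melnikov kernel U is, up to the factor - v / S h, the combination of S
    and C that appears in the velocity mismatch of the two phases. *)
Lemma hp_kernel t :
  U eta alpha t h * Sf eta h = - v * ((1 + Cf eta h) * Sf eta t - Sf eta h * Cf eta t).
Proof.
  rewrite U_Sf, Sf_minus.
  assert (E : 1 + Cf eta h = 2 * (Cf eta (h / 2) * Cf eta (h / 2))).
  { replace h with (2 * (h / 2)) at 1 by field. apply Cf_double. }
  rewrite E, Sf_full, (hp_v _ _ _ _ D). field. apply hp_C_neq.
Qed.
End Unperturbed.

(** * Periodic orbits as fixed points *)

(** The sign of x in phase s; also the direction of time, because the phase in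
    x < 0 is run backwards. *)
Definition sg (s : bool) : R := if s then 1 else -1.

Section Rows.
Context (eta alpha h v : R) (f : R -> R -> R -> R) (phi0 : R).

Definition phase_length (s : bool) (z : state) : R := if s then z cTau else 2 * h - z cTau.
Local Notation tau := phase_length.

(** With S_moment, the two integrals of the variation of constants formula,
    after S (t - w) and C (t - w) have been expanded by the addition formulas,
    so that the upper limit leaves the integrand. *)
Definition C_moment (s : bool) (u : R) (z : state) : R :=
  RInt (fun w => Cf eta (tau s z * clamp w) * z (cG s w)) 0 (clamp u).
Local Notation IC := C_moment.
Definition S_moment (s : bool) (u : R) (z : state) : R :=
  RInt (fun w => Sf eta (tau s z * clamp w) * z (cG s w)) 0 (clamp u).
Local Notation IS := S_moment.

(** The solution of x'' = eta x - alpha + eps g from (0, cY0) at the fraction u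
    of the phase, by variation of constants. *)
Definition position_profile (s : bool) (u : R) (z : state) : R :=
  z cY0 * Sf eta (tau s z * clamp u) - alpha * Qf eta (tau s z * clamp u)
  + z cEps * (tau s z * (Sf eta (tau s z * clamp u) * IC s u z
                         - Cf eta (tau s z * clamp u) * IS s u z)).
Local Notation X := position_profile.
Definition velocity_profile (s : bool) (u : R) (z : state) : R :=
  z cY0 * Cf eta (tau s z * clamp u) - alpha * Sf eta (tau s z * clamp u)
  + z cEps * (tau s z * (Cf eta (tau s z * clamp u) * IC s u z
                         - eta * (Sf eta (tau s z * clamp u) * IS s u z))).
Local Notation Y := velocity_profile.

(** The forcing actually met along phase s; the state is consistent when it
    equals the recorded forcing. The sign sg s comes from reflecting the phase
    in x < 0. *)
Definition force_profile (s : bool) (u : R) (z : state) : R :=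
  sg s * f (z cPhi + sg s * (tau s z * clamp u)) (sg s * X s u z) (Y s u z).
Local Notation N := force_profile.

(** Multiplied by eps, this is S tau times the sum of the initial and arrival
    velocities of phase s; see [arrival_velocity]. *)
Definition closing_moment (s : bool) (z : state) : R :=
  tau s z * ((1 + Cf eta (tau s z)) * RInt (fun w => Sf eta (tau s z * clamp w) * N s w z) 0 (clamp 1)
             - Sf eta (tau s z) * RInt (fun w => Cf eta (tau s z * clamp w) * N s w z) 0 (clamp 1)).
Local Notation B := closing_moment.

(** The mismatch of the arrival velocities, divided by eps and multiplied by S
    (tau true) S (tau false) to clear denominators. *)
Definition closing_defect (z : state) : R :=
  Sf eta (tau false z) * B true z - Sf eta (tau true z) * B false z.
Local Notation E3 := closing_defect.

Definition orbit_x (t : R) : R := v * Sf eta t - alpha * Qf eta t.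
Local Notation x0 := orbit_x.
Definition orbit_y (t : R) : R := v * Cf eta t - alpha * Sf eta t.
Local Notation y0 := orbit_y.

Definition melnikov_SCQ (phi : R) : R :=
  RInt (fun t => U eta alpha t h * (f (phi + t) (x0 t) (y0 t) + f (phi - t) (- x0 t) (y0 t))) 0 h.
Local Notation Mel := melnikov_SCQ.

(** The derivative of the closing defect in the phase direction at the
    unperturbed state. *)
Definition kappa : R := - (Sf eta h * Sf eta h / v) * Derive Mel phi0.

(** A Newton step for the three scalar equations, with the derivative frozen at
    the unperturbed orbit: there the arrival position of phase s has derivative
    - sg s * v in tau and S h in cY0, and the closing defect has derivative
    kappa in cPhi. The forcing is replaced by the one actually met, and eps by
    the parameter. *)
Definition newton_map (e : R) (z : state) (i : coord) : R :=
  match i with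
  | cEps => e
  | cTau => z cTau + (X true 1 z - X false 1 z) * / (2 * v)
  | cPhi => z cPhi - E3 z * / kappa
  | cY0 => z cY0 - (X true 1 z + X false 1 z) * / (2 * Sf eta h)
  | cG s u => N s u z
  end.
Local Notation F := newton_map.

(** The unperturbed orbit with phase phi0. *)
Definition base_state : state := fun i =>
  match i with
  | cEps => 0 | cTau => h | cPhi => phi0 | cY0 => v
  | cG s u => sg s * f (phi0 + sg s * (h * clamp u)) (sg s * x0 (h * clamp u)) (y0 (h * clamp u))
  end.
Local Notation base := base_state.

Context (hf : C1_R3 f) (D : half_period_data eta alpha h v)
  (M0 : Mel phi0 = 0) (M1 : Derive Mel phi0 <> 0).

(** * Strict differentiability of the equations *)

Section RowsSmooth.
Context (z0 : state) (Gz : good z0).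

Lemma sdiff_clamp : sdiff z0 (fun u _ => clamp u).
Proof. apply (sdiff_param z0 (fun u => u)). intros; apply continuous_id. Qed.

Lemma sdiff_Sf G : sdiff z0 G -> sdiff z0 (fun u z => Sf eta (G u z)).
Proof. apply (sdiff_scalar z0 Gz (Sf eta) (Cf eta) G (Sf_derive eta) (Cf_continuous eta)). Qed.

Lemma sdiff_Cf G : sdiff z0 G -> sdiff z0 (fun u z => Cf eta (G u z)).
Proof.
  apply (sdiff_scalar z0 Gz (Cf eta) (fun t => eta * Sf eta t)); [apply Cf_derive|].
  intros x. exact (continuous_Rscal eta (Sf eta) x (Sf_continuous eta x)).
Qed.

Lemma sdiff_Qf G : sdiff z0 G -> sdiff z0 (fun u z => Qf eta (G u z)).
Proof. apply (sdiff_scalar z0 Gz (Qf eta) (Sf eta) G (Qf_derive eta) (Sf_continuous eta)). Qed.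

Lemma sdiff_tau s : sdiff z0 (fun _ z => tau s z).
Proof.
  destruct s; simpl.
  - apply sdiff_coord.
  - apply sdiff_minus; auto; [apply sdiff_const|apply sdiff_coord].
Qed.

Lemma sdiff_tau_clamp s : sdiff z0 (fun u z => tau s z * clamp u).
Proof. apply sdiff_mult; auto using sdiff_tau, sdiff_clamp. Qed.

Lemma sdiff_IC s : sdiff z0 (IC s).
Proof.
  apply (sdiff_RInt z0 Gz (fun w z => Cf eta (tau s z * clamp w) * z (cG s w))).
  apply sdiff_mult; auto using sdiff_Cf, sdiff_tau_clamp, sdiff_force.
Qed.

Lemma sdiff_IS s : sdiff z0 (IS s).
Proof.
  apply (sdiff_RInt z0 Gz (fun w z => Sf eta (tau s z * clamp w) * z (cG s w))).
  apply sdiff_mult; auto using sdiff_Sf, sdiff_tau_clamp, sdiff_force.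
Qed.

Lemma sdiff_X s : sdiff z0 (X s).
Proof.
  unfold X. apply (sdiff_plus z0 Gz).
  - apply (sdiff_minus z0 Gz); apply (sdiff_mult z0 Gz);
      auto using sdiff_coord, sdiff_const, sdiff_Sf, sdiff_Qf, sdiff_tau_clamp.
  - apply (sdiff_mult z0 Gz); [apply sdiff_coord|].
    apply (sdiff_mult z0 Gz); [apply sdiff_tau|].
    apply (sdiff_minus z0 Gz); apply (sdiff_mult z0 Gz);
      auto using sdiff_Cf, sdiff_Sf, sdiff_tau_clamp, sdiff_IC, sdiff_IS.
Qed.

Lemma sdiff_Y s : sdiff z0 (Y s).
Proof.
  unfold Y. apply (sdiff_plus z0 Gz).
  - apply (sdiff_minus z0 Gz); apply (sdiff_mult z0 Gz);
      auto using sdiff_coord, sdiff_const, sdiff_Sf, sdiff_Cf, sdiff_tau_clamp.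
  - apply (sdiff_mult z0 Gz); [apply sdiff_coord|].
    apply (sdiff_mult z0 Gz); [apply sdiff_tau|].
    apply (sdiff_minus z0 Gz); apply (sdiff_mult z0 Gz);
      auto using sdiff_Cf, sdiff_Sf, sdiff_tau_clamp, sdiff_IC, sdiff_IS, sdiff_const.
    apply (sdiff_mult z0 Gz); auto using sdiff_Sf, sdiff_tau_clamp, sdiff_IS.
Qed.

Lemma sdiff_N s : sdiff z0 (N s).
Proof.
  unfold N. apply (sdiff_mult z0 Gz); [apply sdiff_const|].
  apply (sdiff_comp z0 Gz f); [exact hf| |apply (sdiff_mult z0 Gz)|]; auto using sdiff_const, sdiff_X, sdiff_Y.
  apply (sdiff_plus z0 Gz); [apply sdiff_coord|]. apply (sdiff_mult z0 Gz); auto using sdiff_const, sdiff_tau_clamp.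
Qed.

Lemma sdiff_B s : sdiff z0 (fun _ z => B s z).
Proof.
  unfold B. apply (sdiff_mult z0 Gz); [apply sdiff_tau|].
  apply (sdiff_minus z0 Gz); apply (sdiff_mult z0 Gz).
  - apply (sdiff_plus z0 Gz); auto using sdiff_const, sdiff_Cf, sdiff_tau.
  - apply (sdiff_at z0 (fun u z => RInt (fun w => Sf eta (tau s z * clamp w) * N s w z) 0 (clamp u)) 1).
    apply (sdiff_RInt z0 Gz (fun w z => Sf eta (tau s z * clamp w) * N s w z)).
    apply (sdiff_mult z0 Gz); auto using sdiff_Sf, sdiff_tau_clamp, sdiff_N.
  - auto using sdiff_Sf, sdiff_tau.
  - apply (sdiff_at z0 (fun u z => RInt (fun w => Cf eta (tau s z * clamp w) * N s w z) 0 (clamp u)) 1).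
    apply (sdiff_RInt z0 Gz (fun w z => Cf eta (tau s z * clamp w) * N s w z)).
    apply (sdiff_mult z0 Gz); auto using sdiff_Cf, sdiff_tau_clamp, sdiff_N.
Qed.

Lemma sdiff_E3 : sdiff z0 (fun _ z => E3 z).
Proof.
  unfold E3. apply (sdiff_minus z0 Gz); apply (sdiff_mult z0 Gz); auto using sdiff_B, sdiff_Sf, sdiff_tau.
Qed.

Lemma sdiff_X1 s : sdiff z0 (fun _ z => X s 1 z).
Proof. apply (sdiff_at z0 (X s) 1), sdiff_X. Qed.

Lemma sdiff_rowTau : sdiff z0 (fun _ z => F 0 z cTau).
Proof.
  simpl. apply (sdiff_plus z0 Gz); [apply sdiff_coord|].
  apply (sdiff_mult z0 Gz); [|apply sdiff_const].
  apply (sdiff_minus z0 Gz); apply sdiff_X1.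
Qed.

Lemma sdiff_rowY0 : sdiff z0 (fun _ z => F 0 z cY0).
Proof.
  simpl. apply (sdiff_minus z0 Gz); [apply sdiff_coord|].
  apply (sdiff_mult z0 Gz); [|apply sdiff_const].
  apply (sdiff_plus z0 Gz); apply sdiff_X1.
Qed.

Lemma sdiff_rowPhi : sdiff z0 (fun _ z => F 0 z cPhi).
Proof.
  simpl. apply (sdiff_minus z0 Gz); [apply sdiff_coord|].
  apply (sdiff_mult z0 Gz); [apply sdiff_E3|apply sdiff_const].
Qed.

(** The rows of [newton_map] are built from coordinates by sums, products,
    integrals and composition with C1 functions, f among them. The last clause
    makes the entries of the derivative computable by one-variable calculus. *)
Lemma rows_strict : exists A : state -> state,
  (forall a b p q i, good p -> good q -> A (comb a p b q) i = a * A p i + b * A q i) /\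
  (exists K, 0 <= K /\ forall z d i, good z -> 0 <= d -> bounded_by d z -> Rabs (A z i) <= K * d) /\
  (forall om, 0 < om -> exists dl, 0 < dl /\ forall e1 e2 p q d,
    good p -> good q -> near dl p z0 -> near dl q z0 -> near d p q -> forall i,
    Rabs (F e1 p i - F e2 q i - A (comb 1 p (-1) q) i
          - (match i with cEps => 1 | _ => 0 end) * (e1 - e2)) <= om * d) /\
  (forall i p, i <> cEps -> good p -> bounded_by 1 p ->
     is_derive (fun t => F 0 (comb 1 z0 t p) i) 0 (A p i)).
Proof.
  destruct sdiff_rowTau as [LT HT]. destruct sdiff_rowY0 as [LY HY].
  destruct sdiff_rowPhi as [LP HP]. destruct (sdiff_N true) as [Lt Ht].
  destruct (sdiff_N false) as [Lf Hf].
  exists (fun z i => match i with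
    | cEps => 0 | cTau => LT 0 z | cPhi => LP 0 z | cY0 => LY 0 z
    | cG s u => if s then Lt u z else Lf u z end).
  split; [|split; [|split]].
  - intros a b p q i Gp Gq. destruct i as [| | | |[|] u].
    + ring.
    + apply (sd_linear _ _ _ HT); assumption.
    + apply (sd_linear _ _ _ HP); assumption.
    + apply (sd_linear _ _ _ HY); assumption.
    + apply (sd_linear _ _ _ Ht); assumption.
    + apply (sd_linear _ _ _ Hf); assumption.
  - destruct (sd_bounded _ _ _ HT) as [K1 [P1 B1]]. destruct (sd_bounded _ _ _ HY) as [K2 [P2 B2]].
    destruct (sd_bounded _ _ _ HP) as [K3 [P3 B3]]. destruct (sd_bounded _ _ _ Ht) as [K4 [P4 B4]].
    destruct (sd_bounded _ _ _ Hf) as [K5 [P5 B5]].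
    exists (K1 + K2 + K3 + K4 + K5). split; [lra|]. intros z d i Gzz Hd Bd.
    specialize (B1 0 z d Gzz Bd). specialize (B2 0 z d Gzz Bd). specialize (B3 0 z d Gzz Bd).
    assert (T1 := Rmult_le_pos _ _ P1 Hd). assert (T2 := Rmult_le_pos _ _ P2 Hd).
    assert (T3 := Rmult_le_pos _ _ P3 Hd). assert (T4 := Rmult_le_pos _ _ P4 Hd).
    assert (T5 := Rmult_le_pos _ _ P5 Hd).
    destruct i as [| | | |[|] u]; try lra.
    + rewrite Rabs_R0. lra.
    + specialize (B4 u z d Gzz Bd). lra.
    + specialize (B5 u z d Gzz Bd). lra.
  - intros om Hom.
    destruct (sd_strict _ _ _ HT om Hom) as [d1 [P1 B1]].
    destruct (sd_strict _ _ _ HY om Hom) as [d2 [P2 B2]].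
    destruct (sd_strict _ _ _ HP om Hom) as [d3 [P3 B3]].
    destruct (sd_strict _ _ _ Ht om Hom) as [d4 [P4 B4]].
    destruct (sd_strict _ _ _ Hf om Hom) as [d5 [P5 B5]].
    destruct (below5 d1 d2 d3 d4 d5) as [dl [Pdl [Q1 [Q2 [Q3 [Q4 Q5]]]]]]; try assumption.
    exists dl. split; [exact Pdl|].
    intros e1 e2 p q d Gp Gq Np Nq Npq i.
    assert (Hd := near_d_nonneg _ _ _ Npq).
    destruct i as [| | | |[|] u]; rewrite ?Rmult_0_l, ?Rminus_0_r.
    + simpl. replace (e1 - e2 - 1 * (e1 - e2)) with 0 by ring. rewrite Rabs_R0.
      apply Rmult_le_pos; lra.
    + apply (B1 p q d 0 Gp Gq); auto; eapply near_le; eauto.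
    + apply (B3 p q d 0 Gp Gq); auto; eapply near_le; eauto.
    + apply (B2 p q d 0 Gp Gq); auto; eapply near_le; eauto.
    + apply (B4 p q d u Gp Gq); auto; eapply near_le; eauto.
    + apply (B5 p q d u Gp Gq); auto; eapply near_le; eauto.
  - intros j p Hi Gp Bp. destruct j as [| | | |[|] u].
    + congruence.
    + apply (strict_diff_directional _ _ _ p 0 HT); assumption.
    + apply (strict_diff_directional _ _ _ p 0 HP); assumption.
    + apply (strict_diff_directional _ _ _ p 0 HY); assumption.
    + apply (strict_diff_directional _ _ _ p u Ht); assumption.
    + apply (strict_diff_directional _ _ _ p u Hf); assumption.
Qed.
End RowsSmooth.

(** * The equations at the unperturbed orbit *)

Lemma X_unforced s u z : z cEps = 0 ->
  X s u z = z cY0 * Sf eta (tau s z * clamp u) - alpha * Qf eta (tau s z * clamp u).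
Proof. intros H. unfold X. rewrite H. ring. Qed.

Lemma Y_unforced s u z : z cEps = 0 ->
  Y s u z = z cY0 * Cf eta (tau s z * clamp u) - alpha * Sf eta (tau s z * clamp u).
Proof. intros H. unfold Y. rewrite H. ring. Qed.

(** At eps = 0 the recorded forcing does not act on the phases. This is why the
    derivative at the unperturbed state vanishes in all forcing directions. *)
Lemma rows_unforced e p q i : p cEps = 0 -> q cEps = 0 -> p cTau = q cTau ->
  p cPhi = q cPhi -> p cY0 = q cY0 -> F e p i = F e q i.
Proof.
  intros Ep Eq ET EP EY.
  assert (Etau : forall s, tau s p = tau s q) by (intros [|]; simpl; rewrite ET; reflexivity).
  assert (EX : forall s u, X s u p = X s u q).
  { intros. rewrite !X_unforced, Etau, EY by assumption. reflexivity. }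
  assert (EN : forall s u, N s u p = N s u q).
  { intros. unfold N. rewrite EX, !Y_unforced, Etau, EY, EP by assumption. reflexivity. }
  assert (EB : forall s, B s p = B s q).
  { intros. unfold B. rewrite Etau. f_equal. f_equal; f_equal; apply RInt_ext; intros;
      rewrite EN; reflexivity. }
  case i; intros; simpl; rewrite ?EX, ?EN; unfold E3; rewrite ?EB, ?Etau, ?EY, ?EP, ?ET; reflexivity.
Qed.

Lemma xy0_continuous t : continuous x0 t /\ continuous y0 t.
Proof.
  assert (HS := Sf_continuous eta t). assert (HC := Cf_continuous eta t). assert (HQ := Qf_continuous eta t). split.
  - unfold x0. apply continuous_Rminus;
      apply continuous_Rscal; assumption.
  - unfold y0. apply continuous_Rminus;
      apply continuous_Rscal; assumption.
Qed.

Lemma x0_continuous t : continuous x0 t.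
Proof. exact (proj1 (xy0_continuous t)). Qed.

Lemma y0_continuous t : continuous y0 t.
Proof. exact (proj2 (xy0_continuous t)). Qed.

Lemma continuous_affine a b t : continuous (fun x : R => a + b * x) t.
Proof.
  apply (is_derive_continuous _ _ b). auto_derive; auto; ring.
Qed.

Lemma base_force_continuous s (g : R -> R) u : continuous g u ->
  continuous (fun w => sg s * f (phi0 + sg s * (h * g w)) (sg s * x0 (h * g w)) (y0 (h * g w))) u.
Proof.
  intros Hg.
  assert (Hh : continuous (fun w => h * g w) u)
    by apply (continuous_Rscal h g u Hg).
  apply continuous_Rscal.
  apply (C1_comp_continuous f hf).
  - exact (continuous_comp (fun w => h * g w) (fun x => phi0 + sg s * x) u Hh (continuous_affine _ _ _)).
  - apply continuous_Rscal.
    exact (continuous_comp (fun w => h * g w) x0 u Hh (x0_continuous _)).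
  - exact (continuous_comp (fun w => h * g w) y0 u Hh (y0_continuous _)).
Qed.

Lemma good_base : good base.
Proof.
  intros s. split.
  - intros u. apply base_force_continuous, clamp_continuous.
  - intros u. simpl. rewrite clamp_idem. reflexivity.
Qed.

Definition unit_vector (c : coord) : state := fun i =>
  match c, i with
  | cEps, cEps | cTau, cTau | cPhi, cPhi | cY0, cY0 => 1
  | _, _ => 0
  end.

Lemma good_unit c : good (unit_vector c).
Proof.
  intros s. split; intros u; destruct c; simpl; try reflexivity; apply continuous_const.
Qed.

Lemma bounded_unit c : bounded_by 1 (unit_vector c).
Proof. intros i. destruct c, i; simpl; rewrite ?Rabs_R0, ?Rabs_R1; lra. Qed.

Lemma tau_base s : tau s base = h.
Proof. destruct s; simpl; lra. Qed.

Lemma clamp_1 : clamp 1 = 1.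
Proof. apply clamp_id. lra. Qed.

(** At eps = 0 the phases do not depend on phi, so only the times at which f is
    evaluated move: the closing moments are integrals of f along the
    unperturbed orbit, and the kernel is the one of M by [hp_kernel]. The
    second term of M is the phase in x < 0. *)
Lemma closing_defect_melnikov phi : E3 (comb 1 base (phi - phi0) (unit_vector cPhi)) =
  - (Sf eta h * Sf eta h / v) * Mel phi.
Proof.
  set (z := comb 1 base (phi - phi0) (unit_vector cPhi)).
  assert (Zt : forall s, tau s z = h) by (intros [|]; unfold z, comb; simpl; ring).
  assert (Zp : z cPhi = phi) by (unfold z, comb; simpl; ring).
  assert (Zy : z cY0 = v) by (unfold z, comb; simpl; ring).
  assert (Ze : z cEps = 0) by (unfold z, comb; simpl; ring).
  assert (EN : forall s u, N s u z = sg s * f (phi + sg s * (h * clamp u)) (sg s * x0 (h * clamp u)) (y0 (h * clamp u))).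
  { intros s u. unfold N. rewrite X_unforced, Y_unforced, Zt, Zp, Zy by exact Ze. reflexivity. }
  set (k := fun t => (1 + Cf eta h) * Sf eta t - Sf eta h * Cf eta t).
  assert (Hk : forall t, continuous k t).
  { intros t. assert (HS := Sf_continuous eta t). assert (HC := Cf_continuous eta t). assert (HQ := Qf_continuous eta t).
    apply continuous_Rminus;
      apply continuous_Rscal; assumption. }
  set (g := fun (s : bool) t => sg s * f (phi + sg s * t) (sg s * x0 t) (y0 t)).
  assert (Hg : forall s t, continuous (g s) t).
  { intros s t. apply continuous_Rscal. apply (C1_comp_continuous f hf).
    - apply continuous_affine.
    - exact (continuous_Rscal (sg s) x0 t (x0_continuous t)).
    - apply y0_continuous. }
  assert (Hhc : forall (q : R -> R), (forall t, continuous q t) -> forall w, continuous (fun w => q (h * clamp w)) w).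
  { intros q Hq w. apply (continuous_comp (fun w => h * clamp w) q); [|apply Hq].
    apply continuous_Rscal, clamp_continuous. }
  assert (EB : forall s, B s z = RInt (fun t => k t * g s t) 0 h).
  { intros s. unfold B. rewrite Zt.
    replace (RInt (fun w => Sf eta (h * clamp w) * N s w z) 0 (clamp 1)) with
      (RInt (fun w => Sf eta (h * clamp w) * g s (h * clamp w)) 0 (clamp 1))
      by (apply RInt_ext; intros; rewrite EN; reflexivity).
    replace (RInt (fun w => Cf eta (h * clamp w) * N s w z) 0 (clamp 1)) with
      (RInt (fun w => Cf eta (h * clamp w) * g s (h * clamp w)) 0 (clamp 1))
      by (apply RInt_ext; intros; rewrite EN; reflexivity).
    match goal with |- h * (?a * ?b - ?c * ?d) = _ =>
      replace (h * (a * b - c * d)) with ((h * a) * b + (- (h * c)) * d) by ring end.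
    rewrite <- RInt_lin.
    - rewrite clamp_1.
      transitivity (RInt (fun w => scal h (k (h * w + 0) * g s (h * w + 0))) 0 1).
      + apply RInt_ext. intros w Hw. rewrite Rmin_left, Rmax_right in Hw by lra.
        rewrite clamp_id, Rplus_0_r by lra. unfold k, scal; simpl; unfold mult; simpl. ring.
      + eapply eq_trans;
          [apply (RInt_comp_lin (V := R_CompleteNormedModule) (fun t => k t * g s t) h 0 0 1)|].
        * apply ex_RInt_cont. intros t. apply continuous_Rmult; [apply Hk|apply Hg].
        * f_equal; ring.
    - intros w. apply continuous_Rmult.
      + apply (Hhc (Sf eta) (Sf_continuous eta)).
      + apply (Hhc (g s)), Hg.
    - intros w. apply continuous_Rmult.
      + apply (Hhc (Cf eta) (Cf_continuous eta)).
      + apply (Hhc (g s)), Hg. }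
  assert (Hv : v <> 0) by (generalize (hp_v_pos _ _ _ _ D); lra).
  assert (HS := hp_S_full_neq _ _ _ _ D).
  unfold E3. rewrite !Zt, !EB, <- Rmult_minus_distr_l.
  replace (- (Sf eta h * Sf eta h / v) * Mel phi) with (Sf eta h * (- (Sf eta h / v) * Mel phi))
    by (field; exact Hv).
  f_equal.
  replace (RInt (fun t => k t * g true t) 0 h - RInt (fun t => k t * g false t) 0 h) with
    (RInt (fun t => 1 * (k t * g true t) + (-1) * (k t * g false t)) 0 h).
  2:{ rewrite RInt_lin.
      - eq_in_R. ring.
      - intros t. apply continuous_Rmult; [apply Hk|apply Hg].
      - intros t. apply continuous_Rmult; [apply Hk|apply Hg]. }
  unfold Mel. set (J := fun t => f (phi + t) (x0 t) (y0 t) + f (phi - t) (- x0 t) (y0 t)).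
  assert (EU : forall t, U eta alpha t h = - (v / Sf eta h) * k t).
  { intros t. apply Rmult_eq_reg_r with (Sf eta h); [|exact HS].
    rewrite (hp_kernel _ _ _ _ D). unfold k. field. exact HS. }
  symmetry.
  eapply eq_trans; [symmetry;
    apply (RInt_scal (V := R_CompleteNormedModule) (fun t => U eta alpha t h * J t) 0 h (- (Sf eta h / v)))|].
  - apply ex_RInt_cont. intros t. apply continuous_Rmult.
    + apply continuous_ext with (fun t => - (v / Sf eta h) * k t); [intros; symmetry; apply EU|].
      apply continuous_Rscal, Hk.
    + apply continuous_ext with (fun t => 1 * g true t + (-1) * g false t).
      * intros x. unfold g, J, sg. rewrite !Rmult_1_l.
        replace (phi + -1 * x) with (phi - x) by ring. replace (-1 * x0 x) with (- x0 x) by ring. eq_in_R. ring.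
      * apply continuous_lin; apply Hg.
  - apply RInt_ext. intros t _. rewrite EU. unfold scal; simpl; unfold mult; simpl.
    unfold g, J, sg. rewrite !Rmult_1_l.
    replace (phi + -1 * t) with (phi - t) by ring. replace (-1 * x0 t) with (- x0 t) by ring.
    eq_in_R. field. split; assumption.
Qed.

Lemma kappa_neq : kappa <> 0.
Proof.
  unfold kappa. generalize (hp_v_pos _ _ _ _ D) (hp_S_full_neq _ _ _ _ D). intros Hv HS.
  apply Rmult_integral_contrapositive_currified; [|exact M1].
  apply Ropp_neq_0_compat. unfold Rdiv.
  apply Rmult_integral_contrapositive_currified; [|apply Rinv_neq_0_compat; lra].
  apply Rmult_integral_contrapositive_currified; exact HS.
Qed.

Lemma comb_base_0 p : comb 1 base 0 p = base.
Proof. apply functional_extensionality. intros i. unfold comb. ring. Qed.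

Lemma X1_base s : X s 1 base = 0.
Proof.
  rewrite X_unforced, tau_base, clamp_1, Rmult_1_r by reflexivity.
  simpl. rewrite (hp_closing _ _ _ _ D). ring.
Qed.

Lemma F_base i : F 0 base i = base i.
Proof.
  destruct i; simpl.
  - reflexivity.
  - rewrite !X1_base. ring.
  - assert (H := closing_defect_melnikov phi0). rewrite Rminus_diag, comb_base_0, M0 in H. rewrite H. ring.
  - rewrite !X1_base. ring.
  - unfold N. rewrite X_unforced, Y_unforced, tau_base by reflexivity. reflexivity.
Qed.

Lemma good_F e z : good z -> good (F e z).
Proof.
  intros Gz s. destruct (sdiff_N z Gz s) as [L HL]. split.
  - intros u. simpl. apply (sd_continuous _ _ _ HL z Gz).
  - intros u. simpl. apply (sd_clamp _ _ _ HL z Gz).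
Qed.

(** * The derivative at the unperturbed orbit *)

Lemma x0_derive t : is_derive x0 t (y0 t).
Proof.
  unfold x0, y0.
  apply (is_derive_Rminus (fun t => v * Sf eta t) (fun t => alpha * Qf eta t)).
  - apply (is_derive_scal (Sf eta) t v). apply Sf_derive.
  - apply (is_derive_scal (Qf eta) t alpha). apply Qf_derive.
Qed.

Lemma y0_derive t : is_derive y0 t (eta * x0 t - alpha).
Proof.
  replace (eta * x0 t - alpha) with (v * (eta * Sf eta t) - alpha * Cf eta t)
    by (unfold x0; rewrite Cf_Qf; ring).
  unfold y0.
  apply (is_derive_Rminus (fun t => v * Cf eta t) (fun t => alpha * Sf eta t)).
  - apply (is_derive_scal (Cf eta) t v). apply Cf_derive.
  - apply (is_derive_scal (Sf eta) t alpha). apply Sf_derive.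
Qed.

Lemma y0_h : y0 h = - v.
Proof. apply (hp_arrival _ _ _ _ D). Qed.

(** A is determined, outside the row of eps, by its directional derivatives.
    With the coordinates grouped as eps, then cTau and cY0, then cPhi, then the
    forcing, each of these rows only involves earlier groups; the weights below
    exploit this triangular form. *)
Section BaseDerivative.
Context (A : state -> state)
  (A_derive : forall i p, i <> cEps -> good p -> bounded_by 1 p ->
     is_derive (fun t => F 0 (comb 1 base t p) i) 0 (A p i)).

Lemma base_derivative_value i p l : i <> cEps -> good p -> bounded_by 1 p ->
  is_derive (fun t => F 0 (comb 1 base t p) i) 0 l -> A p i = l.
Proof.
  intros Hi Gp Bp Hl. rewrite <- (is_derive_unique _ _ _ Hl).
  symmetry. apply is_derive_unique. apply A_derive; assumption.
Qed.

Lemma base_derivative_force i p : i <> cEps -> good p -> bounded_by 1 p ->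
  p cEps = 0 -> p cTau = 0 -> p cPhi = 0 -> p cY0 = 0 -> A p i = 0.
Proof.
  intros Hi Gp Bp P1 P2 P3 P4. apply base_derivative_value; auto.
  apply is_derive_ext with (fun _ => F 0 base i).
  - intros t. apply rows_unforced; unfold comb; rewrite ?P1, ?P2, ?P3, ?P4; simpl; ring.
  - apply is_derive_Rconst.
Qed.

Lemma X1_direction s t c : c <> cEps -> X s 1 (comb 1 base t (unit_vector c)) =
  (v + t * unit_vector c cY0) * Sf eta (h + sg s * (t * unit_vector c cTau))
  - alpha * Qf eta (h + sg s * (t * unit_vector c cTau)).
Proof.
  intros Hc. rewrite X_unforced by (unfold comb; destruct c; simpl; try ring; congruence).
  rewrite clamp_1, Rmult_1_r.
  replace (tau s (comb 1 base t (unit_vector c))) with (h + sg s * (t * unit_vector c cTau)).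
  - unfold comb. simpl. rewrite Rmult_1_l. reflexivity.
  - destruct s; unfold comb; simpl; ring.
Qed.

Lemma Derive_x0 t : Derive x0 t = y0 t.
Proof. apply is_derive_unique, x0_derive. Qed.

Lemma base_derivative_Tau c : c = cTau \/ c = cY0 \/ c = cPhi ->
  A (unit_vector c) cTau = 0.
Proof.
  intros Hc. assert (Hv := hp_v_pos _ _ _ _ D).
  assert (Hne : c <> cEps) by (destruct Hc as [->|[->| ->]]; congruence).
  apply base_derivative_value; [congruence|apply good_unit|apply bounded_unit|].
  destruct Hc as [->|Hc].
  - apply is_derive_ext with (fun t => h + t + (x0 (h + t) - x0 (h - t)) * / (2 * v)).
    + intros t. simpl F. rewrite !X1_direction by congruence. unfold comb; simpl.
      unfold x0. rewrite !Rmult_0_r, !Rplus_0_r, !Rmult_1_r, !Rmult_1_l.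
      replace (h + -1 * t) with (h - t) by ring. reflexivity.
    + auto_derive.
      * repeat split; eexists; apply x0_derive.
      * rewrite !Rplus_0_r, Ropp_0, Rplus_0_r.
        change (Derive (fun x => x0 x) h) with (Derive x0 h).
        rewrite Derive_x0, y0_h. field. lra.
  - apply is_derive_ext with (fun _ => h); [|apply is_derive_Rconst].
    intros t. simpl F. rewrite !X1_direction by exact Hne.
    destruct Hc as [->| ->]; unfold comb; simpl; rewrite !Rmult_0_r; ring.
Qed.

Lemma base_derivative_Y0 c : c = cTau \/ c = cY0 \/ c = cPhi ->
  A (unit_vector c) cY0 = 0.
Proof.
  intros Hc. assert (HS := hp_S_full_neq _ _ _ _ D).
  assert (Hne : c <> cEps) by (destruct Hc as [->|[->| ->]]; congruence).
  apply base_derivative_value; [congruence|apply good_unit|apply bounded_unit|].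
  destruct Hc as [->|Hc].
  - apply is_derive_ext with (fun t => v - (x0 (h + t) + x0 (h - t)) * / (2 * Sf eta h)).
    + intros t. simpl F. rewrite !X1_direction by congruence. unfold comb; simpl.
      unfold x0. rewrite !Rmult_0_r, !Rplus_0_r, !Rmult_1_r, !Rmult_1_l.
      replace (h + -1 * t) with (h - t) by ring. reflexivity.
    + auto_derive.
      * repeat split; eexists; apply x0_derive.
      * rewrite !Rplus_0_r, Ropp_0, Rplus_0_r. ring.
  - apply is_derive_ext with (fun _ => alpha * Qf eta h * / Sf eta h); [|apply is_derive_Rconst].
    intros t. simpl F. rewrite !X1_direction by exact Hne.
    assert (Hcl := hp_closing _ _ _ _ D).
    destruct Hc as [->| ->]; unfold comb; simpl; rewrite !Rmult_0_r, !Rplus_0_r.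
    + eq_in_R. field. exact HS.
    + rewrite Hcl. replace (1 * v) with (alpha * Qf eta h * / Sf eta h).
      2:{ rewrite <- Hcl. field. exact HS. }
      eq_in_R. ring.
Qed.

(** The closing defect as a function of phi is a multiple of M, and kappa was
    chosen so that the Newton step removes its derivative. *)
Lemma base_derivative_Phi : A (unit_vector cPhi) cPhi = 0.
Proof.
  assert (Hd := A_derive cPhi (unit_vector cPhi) ltac:(congruence) (good_unit _) (bounded_unit _)).
  set (a := A (unit_vector cPhi) cPhi) in *.
  set (g := fun t => F 0 (comb 1 base t (unit_vector cPhi)) cPhi) in *.
  set (c0 := - (Sf eta h * Sf eta h / v)).
  assert (Hk := kappa_neq).
  assert (Ek : kappa = c0 * Derive Mel phi0) by reflexivity.
  assert (Hc0 : c0 <> 0) by (intros H0; apply Hk; rewrite Ek, H0; ring).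
  assert (Hg : forall phi, Mel phi = (phi - g (phi - phi0)) * (kappa / c0)).
  { intros phi. unfold g. simpl F. rewrite closing_defect_melnikov. fold c0.
    unfold comb; simpl. field. split; assumption. }
  assert (HM : is_derive Mel phi0 ((1 - a) * (kappa / c0))).
  { apply is_derive_ext with (fun phi => (phi - g (phi - phi0)) * (kappa / c0)).
    - intros; symmetry; apply Hg.
    - assert (Hg0 : is_derive g (phi0 - phi0) a) by (rewrite Rminus_diag; exact Hd).
      auto_derive.
      + repeat split. exists a. exact Hg0.
      + change (Derive (fun x => g x) (phi0 + - phi0)) with (Derive g (phi0 - phi0)).
        rewrite (is_derive_unique _ _ _ Hg0). ring. }
  apply is_derive_unique in HM. rewrite Ek in HM.
  assert (HM' : Derive Mel phi0 = (1 - a) * Derive Mel phi0).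
  { rewrite HM at 1. field. exact Hc0. }
  apply Rmult_eq_reg_r with (Derive Mel phi0); [|exact M1]. lra.
Qed.
End BaseDerivative.

(** Each row of the derivative involves only coordinates of an earlier group,
    whose weight is smaller by a factor at most lam; the derivative thus has
    norm O(lam). *)
Definition weight (lam : R) (i : coord) : R :=
  match i with
  | cEps => lam ^ 3 | cTau | cY0 => lam ^ 2 | cPhi => lam | cG _ _ => 1
  end.

Lemma weight_bounds lam i : 0 < lam <= 1 -> lam ^ 3 <= weight lam i <= 1.
Proof.
  intros [H1 H2]. assert (lam ^ 2 <= lam) by nra. assert (lam ^ 3 <= lam ^ 2) by nra.
  destruct i; simpl weight; lra.
Qed.

Lemma weight_pos lam i : 0 < lam <= 1 -> 0 < weight lam i.
Proof.
  intros H. assert (0 < lam ^ 3) by (apply pow_lt; lra).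
  generalize (weight_bounds lam i H). lra.
Qed.

Definition force_part (z : state) : state :=
  fun i => match i with cG _ _ => z i | _ => 0 end.

Lemma state_decomposition (z : state) : z =
  comb 1 (comb (z cEps) (unit_vector cEps) (z cTau) (unit_vector cTau)) 1
    (comb 1 (comb (z cPhi) (unit_vector cPhi) (z cY0) (unit_vector cY0)) 1 (force_part z)).
Proof.
  apply functional_extensionality. intros i. unfold comb, force_part. destruct i; simpl; ring.
Qed.

Lemma wnear_near lam d p q : 0 < lam <= 1 -> 0 <= d ->
  wnear (weight lam) d p q -> near d p q.
Proof.
  intros Hl Hd H i. specialize (H i). generalize (weight_bounds lam i Hl). nra.
Qed.

Lemma near_wnear lam d p q : 0 < lam <= 1 -> 0 <= d ->
  near (lam ^ 3 * d) p q -> wnear (weight lam) d p q.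
Proof.
  intros Hl Hd H i. specialize (H i). generalize (weight_bounds lam i Hl). nra.
Qed.

(** The derivative A at the unperturbed state is small in the weighted norm,
    and strict differentiability transfers this to differences of the map
    itself on a small ball. *)
Lemma rows_contract : exists lam r, 0 < lam <= 1 /\ 0 < r /\
  forall e1 e2 p q d, good p -> good q ->
    wnear (weight lam) r p base -> wnear (weight lam) r q base ->
    wnear (weight lam) d p q ->
    wnear (weight lam) (d / 2 + / lam ^ 3 * Rabs (e1 - e2)) (F e1 p) (F e2 q).
Proof.
  destruct (rows_strict base good_base) as [A [Alin [[K [HK AK]] [Astr Ader]]]].
  (* K bounds the entries of A; with 16 lam K <= 1 the at most four entries of
     a row contribute at most 1/4, and the nonlinear remainder gets the other
     1/4 *)
  set (lam := / (16 * (K + 1))).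
  assert (Hlam0 : 0 < lam) by (apply Rinv_0_lt_compat; lra).
  assert (HlK : lam * (16 * (K + 1)) = 1) by (unfold lam; field; lra).
  assert (Hlam : 0 < lam <= 1) by (split; [lra|nra]).
  assert (Hl3 : 0 < lam ^ 3) by (apply pow_lt; lra).
  (* the smallest weight is lam^3 *)
  destruct (Astr (lam ^ 3 / 4) ltac:(lra)) as [dl [Hdl HS]].
  exists lam, dl. split; [exact Hlam|]. split; [exact Hdl|].
  intros e1 e2 p q d Gp Gq Bp Bq Bpq i.
  assert (Hd : 0 <= d).
  { specialize (Bpq i). generalize (weight_pos lam i Hlam) (Rabs_pos (p i - q i)). nra. }
  assert (Hw := weight_bounds lam i Hlam).
  destruct (Rle_dec 0 (Rabs (e1 - e2))) as [He|He]; [|generalize (Rabs_pos (e1 - e2)); lra].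
  assert (Hwe : Rabs (e1 - e2) <= weight lam i * (/ lam ^ 3 * Rabs (e1 - e2))).
  { rewrite <- (Rmult_1_l (Rabs (e1 - e2))) at 1. rewrite <- Rmult_assoc.
    apply Rmult_le_compat_r; [exact He|]. apply Rmult_le_reg_r with (lam ^ 3); [exact Hl3|].
    rewrite Rmult_assoc, Rinv_l by lra. lra. }
  assert (Hcase : i = cEps \/ i <> cEps) by (destruct i; (left; reflexivity) || (right; congruence)).
  destruct Hcase as [->|Hi].
  - simpl F. assert (0 <= weight lam cEps * (d / 2)); [|lra].
    apply Rmult_le_pos; [generalize (weight_pos lam cEps Hlam)|]; lra.
  - assert (Np := wnear_near lam dl p base Hlam ltac:(lra) Bp).
    assert (Nq := wnear_near lam dl q base Hlam ltac:(lra) Bq).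
    assert (Npq := wnear_near lam d p q Hlam Hd Bpq).
    specialize (HS e1 e2 p q d Gp Gq Np Nq Npq i).
    replace (match i with cEps => 1 | _ => 0 end) with 0 in HS by (destruct i; congruence).
    rewrite Rmult_0_l, Rminus_0_r in HS.
    set (z := comb 1 p (-1) q) in *.
    assert (Gz : good z) by (apply good_comb; assumption).
    assert (Bz : forall j, Rabs (z j) <= weight lam j * d).
    { intros j. unfold z, comb. replace (1 * p j + -1 * q j) with (p j - q j) by ring. apply Bpq. }
    assert (Gfp : good (force_part z)).
    { intros s. destruct (Gz s). split; assumption. }
    assert (Afp : A (force_part z) i = 0).
    (* directional derivatives are known for directions bounded by 1 *)
    { set (z1 := comb (/ (d + 1)) (force_part z) 0 (force_part z)).
      assert (G1 : good z1) by (apply good_comb; assumption).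
      assert (Hz1 : A z1 i = 0).
      { apply base_derivative_force; auto; try (unfold z1, comb; simpl; ring).
        intros j. unfold z1, comb. rewrite Rmult_0_l, Rplus_0_r, Rabs_mult, Rabs_inv, (Rabs_pos_eq (d + 1)) by lra.
        apply Rmult_le_reg_l with (d + 1); [lra|]. rewrite <- Rmult_assoc, Rinv_r, Rmult_1_l, Rmult_1_r by lra.
        destruct j; simpl; rewrite ?Rabs_R0; try lra. specialize (Bz (cG s u)). simpl in Bz. lra. }
      unfold z1 in Hz1. rewrite Alin, Rmult_0_l, Rplus_0_r in Hz1 by assumption.
      apply Rmult_integral in Hz1. destruct Hz1 as [H0|H0]; [|exact H0].
      exfalso. revert H0. apply Rinv_neq_0_compat. lra. }
    assert (EA : A z i = z cEps * A (unit_vector cEps) i + z cTau * A (unit_vector cTau) i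
      + z cPhi * A (unit_vector cPhi) i + z cY0 * A (unit_vector cY0) i).
    { rewrite (state_decomposition z) at 1.
      rewrite !Alin; auto using good_unit, good_comb. rewrite Afp. ring. }
    assert (AU : forall c, Rabs (A (unit_vector c) i) <= K).
    { intros c. rewrite <- (Rmult_1_r K). apply AK; [apply good_unit|lra|apply bounded_unit]. }
    assert (HAz : Rabs (A z i) <= weight lam i * (d / 4)).
    { assert (Bp4 : forall c, Rabs (z c * A (unit_vector c) i) <= weight lam c * d * K).
      { intros c. rewrite Rabs_mult. apply Rmult_le_compat; auto using Rabs_pos. }
      assert (L1 : lam ^ 3 * K <= lam ^ 2 / 4) by (simpl; nra).
      assert (L2 : lam ^ 3 * K + 2 * (lam ^ 2 * K) <= lam / 4).
      { assert (lam * K <= 1 / 16) by nra. assert (lam ^ 2 * K <= lam / 16) by (simpl; nra).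
        assert (lam ^ 3 * K <= lam / 16) by (simpl; nra). lra. }
      assert (L3 : lam ^ 3 * K + 2 * (lam ^ 2 * K) + lam * K <= 1 / 4) by nra.
      assert (BE := Bp4 cEps). assert (BT := Bp4 cTau). assert (BP := Bp4 cPhi). assert (BY := Bp4 cY0).
      simpl weight in BE, BT, BP, BY. rewrite EA.
      destruct i as [| | | |s u]; [congruence| | | |].
      - rewrite (base_derivative_Tau A Ader cTau), (base_derivative_Tau A Ader cPhi),
          (base_derivative_Tau A Ader cY0) by auto. rewrite !Rmult_0_r, !Rplus_0_r.
        simpl weight. nra.
      - rewrite (base_derivative_Phi A Ader), Rmult_0_r, Rplus_0_r.
        eapply Rle_trans; [apply Rabs_triang|].
        eapply Rle_trans; [apply Rplus_le_compat_r, Rabs_triang|]. simpl weight. nra.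
      - rewrite (base_derivative_Y0 A Ader cTau), (base_derivative_Y0 A Ader cPhi),
          (base_derivative_Y0 A Ader cY0) by auto. rewrite !Rmult_0_r, !Rplus_0_r.
        simpl weight. nra.
      - eapply Rle_trans; [apply Rabs_triang|].
        eapply Rle_trans; [apply Rplus_le_compat_r, Rabs_triang|].
        eapply Rle_trans; [apply Rplus_le_compat_r, Rplus_le_compat_r, Rabs_triang|].
        simpl weight. nra. }
    replace (F e1 p i - F e2 q i) with ((F e1 p i - F e2 q i - A z i) + A z i) by ring.
    eapply Rle_trans; [apply Rabs_triang|]. nra.
Qed.

Lemma good_limit lam (u : nat -> state) p : 0 < lam <= 1 -> (forall n, good (u n)) ->
  (forall e, 0 < e -> exists N, forall n, (N <= n)%nat -> wnear (weight lam) e (u n) p) -> good p.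
Proof.
  intros Hlam Gu Hu s. split.
  - intros x. apply continuous_eps_delta. intros e He.
    destruct (Hu (e / 3) ltac:(lra)) as [n Hn]. specialize (Hn n (Nat.le_refl n)).
    destruct (proj1 (continuous_eps_delta _ x) (proj1 (Gu n s) x) (e / 3) ltac:(lra)) as [d [Hd H]].
    exists d. split; [exact Hd|]. intros y Hy. specialize (H y Hy).
    assert (H1 := Hn (cG s x)). assert (H2 := Hn (cG s y)). simpl in H1, H2.
    apply Rabs_def2 in H. apply Rabs_le_between in H1, H2. apply Rabs_def1; lra.
  - intros x. apply cond_eq. intros e He.
    destruct (Hu (e / 3) ltac:(lra)) as [n Hn]. specialize (Hn n (Nat.le_refl n)).
    assert (H1 := Hn (cG s x)). assert (H2 := Hn (cG s (clamp x))). simpl in H1, H2.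
    rewrite (proj2 (Gu n s) x) in H1.
    apply Rabs_le_between in H1, H2. apply Rabs_def1; lra.
Qed.

(** Besides existence and strict differentiability, the branch contains every
    fixed point near the unperturbed state; isolation and uniqueness rest on
    this. *)
Lemma branch_of_states : exists (rho r L : R) (zz : R -> state), 0 < rho /\ 0 < r /\ 0 <= L /\
  (forall e, Rabs e < rho -> good (zz e) /\ (forall i, F e (zz e) i = zz e i)) /\
  (forall e p, Rabs e < rho -> good p -> near r p base -> (forall i, F e p i = p i) ->
     forall i, p i = zz e i) /\
  (forall e1 e2, Rabs e1 < rho -> Rabs e2 < rho -> near (L * Rabs (e1 - e2)) (zz e1) (zz e2)) /\
  (forall i, zz 0 i = base i) /\
  (forall e0, Rabs e0 < rho -> exists xi, good xi /\ forall om, 0 < om -> exists dl, 0 < dl /\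
    forall e1 e2, Rabs (e1 - e0) <= dl -> Rabs (e2 - e0) <= dl ->
    forall i, Rabs (zz e1 i - zz e2 i - xi i * (e1 - e2)) <= om * Rabs (e1 - e2)).
Proof.
  destruct rows_contract as [lam [r [Hlam [Hr HC]]]].
  assert (Hl3 : 0 < lam ^ 3) by (apply pow_lt; lra).
  set (L := / lam ^ 3). assert (HL : 0 < L) by (apply Rinv_0_lt_compat, Hl3).
  set (w := weight lam).
  assert (Hw : forall i, 0 < w i) by (intros; apply weight_pos, Hlam).
  assert (HC' : forall e1 e2 p q d, Rabs e1 <= r -> Rabs e2 <= r ->
     good p -> good q -> wnear w r p base -> wnear w r q base -> wnear w d p q ->
     wnear w (d / 2 + L * Rabs (e1 - e2)) (F e1 p) (F e2 q)) by (intros; apply HC; assumption).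
  assert (Hlim : forall (u : nat -> state) p, (forall n, good (u n)) ->
     (forall e, 0 < e -> exists N, forall n, (N <= n)%nat -> wnear w e (u n) p) -> good p)
    by (intros; eapply good_limit; eauto).
  set (rho := contraction_radius r L). assert (HL0 : 0 <= L) by lra.
  assert (Hrho := contraction_radius_pos r L Hr HL0).
  assert (Hsmall := fun e => small_parameter r L Hr HL0 e).
  set (zz := branch F base).
  assert (Zg := good_branch w good F base r L Hw Hr HL0 Hlim good_base good_F F_base HC').
  assert (Zb := branch_in_ball w good F base r L Hw Hr HL0 good_base good_F F_base HC').
  assert (Zf := branch_fixed w good F base r L Hw Hr HL0 Hlim good_base good_F F_base HC').
  assert (Zl := branch_lipschitz w good F base r L Hw Hr HL0 Hlim good_base good_F F_base HC').
  assert (Zu := fixed_point_unique w good F base r L HC').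
  assert (Hstr : forall e0 p, Rabs e0 < r -> good p -> wnear w (r / 2) p base ->
    exists (A : state -> state) (b : state),
    (forall a c p q i, good p -> good q ->
       A (fun j => a * p j + c * q j) i = a * A p i + c * A q i) /\
    forall om, 0 < om -> exists dl, 0 < dl /\
      forall e1 e2 q1 q2 d, good q1 -> good q2 ->
        Rabs (e1 - e0) <= dl -> Rabs (e2 - e0) <= dl ->
        wnear w dl q1 p -> wnear w dl q2 p -> wnear w d q1 q2 ->
        forall i, Rabs (F e1 q1 i - F e2 q2 i - A (fun j => 1 * q1 j + -1 * q2 j) i
                        - b i * (e1 - e2)) <= w i * (om * (d + Rabs (e1 - e2)))).
  { intros e0 p _ Gp _. destruct (rows_strict p Gp) as [A [Alin [_ [Astr _]]]].
    exists A, (fun i => match i with cEps => 1 | _ => 0 end). split; [exact Alin|].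
    intros om Hom. destruct (Astr (lam ^ 3 * om) ltac:(nra)) as [dl [Hdl HS]].
    exists dl. split; [exact Hdl|].
    intros e1 e2 q1 q2 d G1 G2 _ _ B1 B2 B12 i.
    assert (Hd : 0 <= d).
    { specialize (B12 i). generalize (Hw i) (Rabs_pos (q1 i - q2 i)). nra. }
    specialize (HS e1 e2 q1 q2 d G1 G2 (wnear_near lam dl _ _ Hlam ltac:(lra) B1)
      (wnear_near lam dl _ _ Hlam ltac:(lra) B2) (wnear_near lam d _ _ Hlam Hd B12) i).
    eapply Rle_trans; [exact HS|].
    generalize (weight_bounds lam i Hlam) (Rabs_pos (e1 - e2)). fold w. intros [W1 _] He.
    assert (Hp : 0 <= om * (d + Rabs (e1 - e2))) by (apply Rmult_le_pos; lra).
    apply Rle_trans with (lam ^ 3 * (om * (d + Rabs (e1 - e2)))).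
    - rewrite (Rmult_assoc (lam ^ 3)). apply Rmult_le_compat_l; [lra|].
      apply Rmult_le_compat_l; lra.
    - apply Rmult_le_compat_r; assumption. }
  assert (Zd := branch_strictly_differentiable w good F base r L Hw Hr HL0 good_comb Hlim good_base
    good_F F_base HC' Hstr).
  fold rho in Hrho, Zg, Zb, Zf, Zl, Zd. fold zz in Zg, Zb, Zf, Zl, Zd.
  exists rho, (lam ^ 3 * r), (2 * L), zz.
  split; [exact Hrho|]. split; [nra|]. split; [lra|]. split; [|split; [|split; [|split]]].
  - intros e He. split; [apply Zg|apply Zf]; lra.
  - intros e p He Gp Np Fp. destruct (Hsmall e (Rlt_le _ _ He)).
    apply (Zu e); auto; [apply Zg; lra| |apply Zb; lra|apply Zf; lra].
    apply near_wnear; auto; lra.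
  - intros e1 e2 H1 H2. apply (wnear_near lam); auto.
    + generalize (Rabs_pos (e1 - e2)). nra.
    + rewrite Rmult_assoc. apply Zl; lra.
  - intros i. symmetry. apply (Zu 0 base (zz 0)); auto using good_base, F_base.
    + rewrite Rabs_R0. lra.
    + apply Zg. rewrite Rabs_R0. lra.
    + apply wnear_refl; [exact Hw|lra].
    + apply Zb. rewrite Rabs_R0. lra.
    + apply Zf. rewrite Rabs_R0. lra.
  - intros e0 He0. destruct (Zd e0 He0) as [xi [Gxi Hxi]]. exists xi. split; [exact Gxi|].
    intros om Hom. destruct (Hxi om Hom) as [dl [Hdl H]]. exists dl. split; [exact Hdl|].
    intros e1 e2 H1 H2 i. eapply Rle_trans; [apply (H e1 e2 H1 H2)|].
    generalize (weight_bounds lam i Hlam) (Rabs_pos (e1 - e2)). fold w. intros.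
    rewrite <- (Rmult_1_l (om * Rabs (e1 - e2))) at 2.
    apply Rmult_le_compat_r; [apply Rmult_le_pos; lra|lra].
Qed.

End Rows.

(** * From a state to a function of time *)

Section Profiles.
Context (eta alpha h : R) (f : R -> R -> R -> R).
Local Notation tau := (phase_length h).
Local Notation X := (position_profile eta alpha h).
Local Notation Y := (velocity_profile eta alpha h).
Local Notation IC := (C_moment eta h).
Local Notation IS := (S_moment eta h).
Local Notation N := (force_profile eta alpha h f).
Local Notation B := (closing_moment eta alpha h f).

Ltac derivable_side_conditions :=
  repeat lazymatch goal with |- _ /\ _ => split | |- True => exact I end;
  lazymatch goal with
  | |- context [Sf] => exact (ex_intro _ _ (Sf_derive _ _))
  | |- context [Cf] => exact (ex_intro _ _ (Cf_derive _ _))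
  | |- context [Qf] => exact (ex_intro _ _ (Qf_derive _ _))
  | _ => eexists; eassumption
  end.

Lemma clamp_loc u : 0 < u < 1 -> locally u (fun w => clamp w = w).
Proof.
  intros Hu. assert (Hd : 0 < Rmin u (1 - u)) by (apply Rmin_glb_lt; lra).
  exists (mkposreal _ Hd). intros y Hy. change (Rabs (y - u) < Rmin u (1 - u)) in Hy.
  generalize (Rmin_l u (1 - u)) (Rmin_r u (1 - u)). apply Rabs_def2 in Hy. intros.
  apply clamp_id. lra.
Qed.

Lemma integral_clamp_derive (k : R -> R) u : (forall w, continuous k w) -> 0 < u < 1 ->
  is_derive (fun u => RInt k 0 (clamp u)) u (k u).
Proof.
  intros Hk Hu. apply is_derive_ext_loc with (fun u => RInt k 0 u).
  - generalize (clamp_loc u Hu). apply filter_imp. intros w Hw. rewrite Hw. reflexivity.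
  - apply is_derive_RInt_continuous, Hk.
Qed.

Lemma kernel_continuous (q : R -> R) (t : R) (z : state) s w : (forall x, continuous q x) -> good z ->
  continuous (fun w => q (t * clamp w) * z (cG s w)) w.
Proof.
  intros Hq Gz. apply continuous_Rmult.
  - apply (continuous_comp (fun w => t * clamp w) q); [|apply Hq].
    apply (continuous_Rscal t clamp w (clamp_continuous w)).
  - apply (proj1 (Gz s)).
Qed.

Lemma IC_derive s u z : good z -> 0 < u < 1 ->
  is_derive (fun u => IC s u z) u (Cf eta (tau s z * u) * z (cG s u)).
Proof.
  intros Gz Hu. replace (tau s z * u) with (tau s z * clamp u) by (rewrite clamp_id; lra).
  apply (integral_clamp_derive (fun w => Cf eta (tau s z * clamp w) * z (cG s w))); [|exact Hu].
  intros w. apply kernel_continuous; [apply Cf_continuous|exact Gz].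
Qed.

Lemma IS_derive s u z : good z -> 0 < u < 1 ->
  is_derive (fun u => IS s u z) u (Sf eta (tau s z * u) * z (cG s u)).
Proof.
  intros Gz Hu. replace (tau s z * u) with (tau s z * clamp u) by (rewrite clamp_id; lra).
  apply (integral_clamp_derive (fun w => Sf eta (tau s z * clamp w) * z (cG s w))); [|exact Hu].
  intros w. apply kernel_continuous; [apply Sf_continuous|exact Gz].
Qed.

(** Together with [Y_derive]: the profiles solve the forced equation, with time
    rescaled by the length of the phase. *)
Lemma X_derive s u z : good z -> 0 < u < 1 ->
  is_derive (fun u => X s u z) u (tau s z * Y s u z).
Proof.
  intros Gz Hu.
  apply is_derive_ext_loc with (fun u => z cY0 * Sf eta (tau s z * u) - alpha * Qf eta (tau s z * u)
    + z cEps * (tau s z * (Sf eta (tau s z * u) * IC s u z - Cf eta (tau s z * u) * IS s u z))).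
  - generalize (clamp_loc u Hu). apply filter_imp. intros w Hw. unfold position_profile. rewrite Hw. reflexivity.
  - assert (HC := IC_derive s u z Gz Hu). assert (HS := IS_derive s u z Gz Hu).
    set (t := tau s z) in *. set (iC := fun u => IC s u z) in *. set (iS := fun u => IS s u z) in *.
    change (is_derive (fun u => z cY0 * Sf eta (t * u) - alpha * Qf eta (t * u)
      + z cEps * (t * (Sf eta (t * u) * iC u - Cf eta (t * u) * iS u))) u (t * Y s u z)).
    assert (DS : Derive (Sf eta) (t * u) = Cf eta (t * u)) by apply is_derive_unique, Sf_derive.
    assert (DC : Derive (Cf eta) (t * u) = eta * Sf eta (t * u)) by apply is_derive_unique, Cf_derive.
    assert (DQ : Derive (Qf eta) (t * u) = Sf eta (t * u)) by apply is_derive_unique, Qf_derive.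
    assert (DiC : Derive iC u = Cf eta (t * u) * z (cG s u)) by exact (is_derive_unique _ _ _ HC).
    assert (DiS : Derive iS u = Sf eta (t * u) * z (cG s u)) by exact (is_derive_unique _ _ _ HS).
    auto_derive.
    + derivable_side_conditions.
    + change (Derive (fun x => Sf eta x)) with (Derive (Sf eta)).
      change (Derive (fun x => Cf eta x)) with (Derive (Cf eta)).
      change (Derive (fun x => Qf eta x)) with (Derive (Qf eta)).
      change (Derive (fun x => iC x) u) with (Derive iC u).
      change (Derive (fun x => iS x) u) with (Derive iS u).
      rewrite DS, DC, DQ, DiC, DiS. unfold velocity_profile. rewrite clamp_id by lra. fold t.
      change (IC s u z) with (iC u). change (IS s u z) with (iS u). ring.
Qed.

Lemma Y_derive s u z : good z -> 0 < u < 1 ->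
  is_derive (fun u => Y s u z) u (tau s z * (eta * X s u z - alpha + z cEps * z (cG s u))).
Proof.
  intros Gz Hu.
  apply is_derive_ext_loc with (fun u => z cY0 * Cf eta (tau s z * u) - alpha * Sf eta (tau s z * u)
    + z cEps * (tau s z * (Cf eta (tau s z * u) * IC s u z - eta * (Sf eta (tau s z * u) * IS s u z)))).
  - generalize (clamp_loc u Hu). apply filter_imp. intros w Hw. unfold velocity_profile. rewrite Hw. reflexivity.
  - assert (HC := IC_derive s u z Gz Hu). assert (HS := IS_derive s u z Gz Hu).
    set (t := tau s z) in *. set (iC := fun u => IC s u z) in *. set (iS := fun u => IS s u z) in *.
    change (is_derive (fun u => z cY0 * Cf eta (t * u) - alpha * Sf eta (t * u)
      + z cEps * (t * (Cf eta (t * u) * iC u - eta * (Sf eta (t * u) * iS u)))) u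
      (t * (eta * X s u z - alpha + z cEps * z (cG s u)))).
    assert (DS : Derive (Sf eta) (t * u) = Cf eta (t * u)) by apply is_derive_unique, Sf_derive.
    assert (DC : Derive (Cf eta) (t * u) = eta * Sf eta (t * u)) by apply is_derive_unique, Cf_derive.
    assert (DiC : Derive iC u = Cf eta (t * u) * z (cG s u)) by exact (is_derive_unique _ _ _ HC).
    assert (DiS : Derive iS u = Sf eta (t * u) * z (cG s u)) by exact (is_derive_unique _ _ _ HS).
    assert (Hpy := Cf_Sf_pythagoras eta (t * u)). assert (HQ := Cf_Qf eta (t * u)).
    auto_derive.
    + derivable_side_conditions.
    + change (Derive (fun x => Sf eta x)) with (Derive (Sf eta)).
      change (Derive (fun x => Cf eta x)) with (Derive (Cf eta)).
      change (Derive (fun x => iC x) u) with (Derive iC u).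
      change (Derive (fun x => iS x) u) with (Derive iS u).
      rewrite DS, DC, DiC, DiS. unfold position_profile. rewrite clamp_id by lra. fold t.
      change (IC s u z) with (iC u). change (IS s u z) with (iS u).
      transitivity (t * (eta * (z cY0 * Sf eta (t * u)) - alpha * Cf eta (t * u)
        + z cEps * (t * (eta * (Sf eta (t * u) * iC u - Cf eta (t * u) * iS u))
          + (Cf eta (t * u) * Cf eta (t * u) - eta * (Sf eta (t * u) * Sf eta (t * u))) * z (cG s u)))).
      * ring.
      * rewrite Hpy, HQ. ring.
Qed.

Lemma clamp_0 : clamp 0 = 0.
Proof. apply clamp_id. lra. Qed.

Lemma IC_0 s z : IC s 0 z = 0.
Proof. unfold C_moment. rewrite clamp_0. apply (RInt_point (V := R_CompleteNormedModule)). Qed.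

Lemma IS_0 s z : IS s 0 z = 0.
Proof. unfold S_moment. rewrite clamp_0. apply (RInt_point (V := R_CompleteNormedModule)). Qed.

Lemma X_0 s z : X s 0 z = 0.
Proof. unfold position_profile. rewrite IC_0, IS_0, clamp_0, !Rmult_0_r, Sf_0, Qf_0. ring. Qed.

Lemma Y_0 s z : Y s 0 z = z cY0.
Proof. unfold velocity_profile. rewrite IC_0, IS_0, clamp_0, !Rmult_0_r, Sf_0, Cf_0. ring. Qed.

(** Eliminate cY0 S from the arrival condition and use C^2 - eta S^2 = 1 and Q
    (1 + C) = S^2: what does not carry the factor eps cancels. This is where
    the degeneracy at eps = 0 is made explicit. *)
Lemma arrival_velocity s z : (forall u, N s u z = z (cG s u)) -> X s 1 z = 0 ->
  Sf eta (tau s z) * (z cY0 + Y s 1 z) = z cEps * B s z.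
Proof.
  intros HN HX.
  assert (EB : B s z = tau s z * ((1 + Cf eta (tau s z)) * IS s 1 z - Sf eta (tau s z) * IC s 1 z)).
  { unfold closing_moment, S_moment, C_moment. f_equal. f_equal; f_equal; apply RInt_ext; intros; rewrite HN; reflexivity. }
  rewrite EB. unfold position_profile in HX. unfold velocity_profile. rewrite clamp_id, Rmult_1_r in HX |- * by lra.
  set (S := Sf eta (tau s z)) in *. set (C := Cf eta (tau s z)) in *. set (Q := Qf eta (tau s z)) in *.
  assert (Hpy : C * C - eta * (S * S) = 1) by apply Cf_Sf_pythagoras.
  assert (HQ : Q * (1 + C) = S * S) by apply Qf_Cf.
  set (iC := IC s 1 z) in *. set (iS := IS s 1 z) in *. set (t := tau s z) in *.
  replace (S * (z cY0 + (z cY0 * C - alpha * S + z cEps * (t * (C * iC - eta * (S * iS)))))) with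
    ((z cY0 * S) * (1 + C) - alpha * (S * S) + z cEps * (t * (S * C * iC - (eta * (S * S)) * iS))) by ring.
  replace (z cY0 * S) with (alpha * Q - z cEps * (t * (S * iC - C * iS))) by lra.
  replace (eta * (S * S)) with (C * C - 1) by lra. rewrite <- HQ. ring.
Qed.

(** The two phases close up to an orbit of period 2 h: both end at the crossing
    where the orbit leaves x > 0, so the last condition is continuity of the
    velocity there. That the profiles are positive is a separate, open
    condition. *)
Record periodic_state (z : state) : Prop := {
  cl_good : good z;
  cl_tau : forall s, 0 < tau s z;
  cl_N : forall s u, N s u z = z (cG s u);
  cl_X1 : forall s, X s 1 z = 0;
  cl_Y1 : Y true 1 z = Y false 1 z }.

Lemma XY_continuous s z : good z -> forall u, continuous (fun u => X s u z) u /\ continuous (fun u => Y s u z) u.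
Proof.
  intros Gz u. destruct (sdiff_X eta alpha h z Gz s) as [L1 H1].
  destruct (sdiff_Y eta alpha h z Gz s) as [L2 H2].
  split; [apply (sd_continuous _ _ _ H1 z Gz)|apply (sd_continuous _ _ _ H2 z Gz)].
Qed.

Lemma increment_bound_01 (g dg : R -> R) K : (forall u, continuous g u) ->
  (forall u, 0 < u < 1 -> is_derive g u (dg u)) ->
  (forall u, 0 <= u <= 1 -> Rabs (dg u) <= K) ->
  forall u w, 0 <= u <= 1 -> 0 <= w <= 1 -> Rabs (g u - g w) <= K * Rabs (u - w).
Proof.
  intros Hc Hd HK.
  assert (H : forall u w, 0 <= u -> u < w -> w <= 1 -> Rabs (g w - g u) <= K * (w - u)).
  { intros u w H1 H2 H3. destruct (MVT_gen g u w dg) as [c [Hc1 Hc2]].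
    - intros x Hx. rewrite Rmin_left, Rmax_right in Hx by lra. apply Hd. lra.
    - intros x _. apply continuity_pt_filterlim, Hc.
    - rewrite Rmin_left, Rmax_right in Hc1 by lra. rewrite Hc2, Rabs_mult, (Rabs_pos_eq (w - u)) by lra.
      apply Rmult_le_compat_r; [lra|]. apply HK. lra. }
  intros u w Hu Hw. destruct (Rtotal_order u w) as [Hlt|[->|Hlt]].
  - rewrite Rabs_minus_sym, (Rabs_minus_sym u w), (Rabs_pos_eq (w - u)) by lra. apply H; lra.
  - rewrite !Rminus_diag, Rabs_R0. lra.
  - rewrite (Rabs_pos_eq (u - w)) by lra. apply H; lra.
Qed.

Lemma XY_lipschitz s z : good z -> exists K, 0 <= K /\
  forall u w, 0 <= u <= 1 -> 0 <= w <= 1 ->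
    Rabs (X s u z - X s w z) <= K * Rabs (u - w) /\
    Rabs (Y s u z - Y s w z) <= K * Rabs (u - w).
Proof.
  intros Gz.
  assert (HX : forall u, continuous (fun u => X s u z) u) by (intros; apply (proj1 (XY_continuous s z Gz u))).
  assert (HY : forall u, continuous (fun u => Y s u z) u) by (intros; apply (proj2 (XY_continuous s z Gz u))).
  destruct (bounded_on_01 (fun u => tau s z * Y s u z)) as [K1 [P1 B1]].
  { intros u. apply (continuous_Rscal (tau s z) (fun u => Y s u z) u (HY u)). }
  destruct (bounded_on_01 (fun u => tau s z * (eta * X s u z - alpha + z cEps * z (cG s u)))) as [K2 [P2 B2]].
  { intros u. apply continuous_Rscal.
    apply continuous_Rplus.
    - apply continuous_Rminus; [|apply continuous_const].
      apply (continuous_Rscal eta (fun u => X s u z) u (HX u)).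
    - apply (continuous_Rscal (z cEps) (fun u => z (cG s u)) u (proj1 (Gz s) u)). }
  exists (K1 + K2). split; [lra|]. intros u w Hu Hw. split.
  - apply (increment_bound_01 (fun u => X s u z) (fun u => tau s z * Y s u z)); auto.
    + intros x Hx. apply X_derive; auto.
    + intros x Hx. specialize (B1 x Hx). lra.
  - apply (increment_bound_01 (fun u => Y s u z) (fun u => tau s z * (eta * X s u z - alpha + z cEps * z (cG s u)))); auto.
    + intros x Hx. apply Y_derive; auto.
    + intros x Hx. specialize (B2 x Hx). lra.
Qed.

(** Time is reduced to the period that starts with the entry into x > 0. *)
Definition turns (z : state) (t : R) : Z := Int_part ((t - z cPhi) / (2 * h)).
Definition reduced (z : state) (t : R) : R := t - IZR (turns z t) * (2 * h).

Definition upper_time (z : state) (t : R) : R := (t - z cPhi) / tau true z.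
(** Counted backwards from the end of the period. *)
Definition lower_time (z : state) (t : R) : R := (z cPhi + 2 * h - t) / tau false z.

Definition position_at (z : state) (t : R) : R :=
  if Rle_dec (reduced z t) (z cPhi + tau true z) then X true (upper_time z (reduced z t)) z
  else - X false (lower_time z (reduced z t)) z.
(** The reversal of time and the reflection in x < 0 cancel in the velocity. *)
Definition velocity_at (z : state) (t : R) : R :=
  if Rle_dec (reduced z t) (z cPhi + tau true z) then Y true (upper_time z (reduced z t)) z
  else Y false (lower_time z (reduced z t)) z.

Context (h_pos : 0 < h).

Lemma turns_spec z t k : z cPhi + IZR k * (2 * h) <= t < z cPhi + (IZR k + 1) * (2 * h) -> turns z t = k.
Proof.
  intros H. symmetry. apply Int_part_spec.
  assert (E : (t - z cPhi) / (2 * h) * (2 * h) = t - z cPhi) by (field; lra).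
  split.
  - apply Rmult_lt_reg_r with (2 * h); [lra|]. rewrite Rmult_minus_distr_r, E. lra.
  - apply Rmult_le_reg_r with (2 * h); [lra|]. rewrite E. lra.
Qed.

Lemma turns_bounds z t : z cPhi + IZR (turns z t) * (2 * h) <= t < z cPhi + (IZR (turns z t) + 1) * (2 * h).
Proof.
  destruct (base_Int_part ((t - z cPhi) / (2 * h))) as [H1 H2]. fold (turns z t) in H1, H2.
  assert (E : (t - z cPhi) / (2 * h) * (2 * h) = t - z cPhi) by (field; lra).
  apply (Rmult_le_compat_r (2 * h)) in H1; [|lra]. rewrite E in H1.
  apply Rgt_lt, (Rmult_lt_compat_r (2 * h)) in H2; [|lra].
  rewrite Rmult_minus_distr_r, E in H2. lra.
Qed.

Lemma reduced_shift z t k : reduced z (t + IZR k * (2 * h)) = reduced z t.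
Proof.
  unfold reduced. assert (E : turns z (t + IZR k * (2 * h)) = (turns z t + k)%Z).
  { apply turns_spec. rewrite plus_IZR. generalize (turns_bounds z t). lra. }
  rewrite E, plus_IZR. ring.
Qed.

Lemma position_velocity_shift z t k : position_at z (t + IZR k * (2 * h)) = position_at z t /\ velocity_at z (t + IZR k * (2 * h)) = velocity_at z t.
Proof. unfold position_at, velocity_at. rewrite reduced_shift. auto. Qed.

Lemma reduced_id z t : z cPhi <= t < z cPhi + 2 * h -> reduced z t = t.
Proof.
  intros H. unfold reduced. rewrite (turns_spec z t 0) by lra. ring.
Qed.

Lemma reduced_range z t : z cPhi <= reduced z t < z cPhi + 2 * h.
Proof. unfold reduced. generalize (turns_bounds z t). lra. Qed.

Lemma tau_sum z : tau true z + tau false z = 2 * h.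
Proof. simpl. ring. Qed.

Section ClosedState.
Context (z : state) (Cz : periodic_state z).

Lemma upper_piece t : z cPhi <= t <= z cPhi + tau true z ->
  position_at z t = X true (upper_time z t) z /\ velocity_at z t = Y true (upper_time z t) z.
Proof.
  intros H. generalize (cl_tau z Cz true) (cl_tau z Cz false) (tau_sum z). intros.
  unfold position_at, velocity_at. rewrite reduced_id by lra.
  destruct (Rle_dec t (z cPhi + tau true z)); [auto|lra].
Qed.

Lemma lower_piece t : z cPhi + tau true z <= t <= z cPhi + 2 * h ->
  position_at z t = - X false (lower_time z t) z /\ velocity_at z t = Y false (lower_time z t) z.
Proof.
  intros H. assert (T1 := cl_tau z Cz true). assert (T2 := cl_tau z Cz false). assert (T3 := tau_sum z).
  destruct (Req_dec t (z cPhi + 2 * h)) as [E|Hn].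
  - replace t with (z cPhi + IZR 1 * (2 * h)) by (rewrite E; ring).
    destruct (position_velocity_shift z (z cPhi) 1) as [-> ->].
    destruct (upper_piece (z cPhi)) as [-> ->]; [lra|].
    replace (lower_time z (z cPhi + IZR 1 * (2 * h))) with 0 by (unfold lower_time; field; lra).
    replace (upper_time z (z cPhi)) with 0 by (unfold upper_time; field; lra).
    rewrite !X_0, !Y_0. split; ring.
  - unfold position_at, velocity_at. rewrite reduced_id by lra.
    destruct (Rle_dec t (z cPhi + tau true z)) as [Hle|]; [|auto].
    assert (E : t = z cPhi + tau true z) by lra.
    replace (upper_time z t) with 1 by (unfold upper_time; rewrite E; field; lra).
    assert (E' : z cPhi + 2 * h - t = tau false z) by lra.
    replace (lower_time z t) with 1 by (unfold lower_time; rewrite E'; field; lra).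
    rewrite !(cl_X1 z Cz), (cl_Y1 z Cz). split; ring.
Qed.

Lemma upper_time_range t : z cPhi <= t <= z cPhi + tau true z -> 0 <= upper_time z t <= 1.
Proof.
  intros H. assert (T1 := cl_tau z Cz true). unfold upper_time. split.
  - apply Rmult_le_reg_r with (tau true z); [exact T1|]. field_simplify; lra.
  - apply Rmult_le_reg_r with (tau true z); [exact T1|]. field_simplify; lra.
Qed.

Lemma lower_time_range t : z cPhi + tau true z <= t <= z cPhi + 2 * h -> 0 <= lower_time z t <= 1.
Proof.
  intros H. assert (T1 := cl_tau z Cz false). assert (T3 := tau_sum z). unfold lower_time. split.
  - apply Rmult_le_reg_r with (tau false z); [exact T1|]. field_simplify; lra.
  - apply Rmult_le_reg_r with (tau false z); [exact T1|]. field_simplify; lra.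
Qed.

(** A Lipschitz bound needs to be checked only inside the phases, since it is
    local and its constant is the same on both sides of a crossing. *)
Lemma piecewise_lipschitz (q : R -> R) K : (forall t k, q (t + IZR k * (2 * h)) = q t) ->
  (forall u w, z cPhi <= u -> u <= w -> w <= z cPhi + tau true z -> Rabs (q w - q u) <= K * (w - u)) ->
  (forall u w, z cPhi + tau true z <= u -> u <= w -> w <= z cPhi + 2 * h -> Rabs (q w - q u) <= K * (w - u)) ->
  forall u w, u <= w -> Rabs (q w - q u) <= K * (w - u).
Proof.
  intros Hper H1 H2. apply lipschitz_of_local. intros t.
  assert (T1 := cl_tau z Cz true). assert (T2 := cl_tau z Cz false). assert (T3 := tau_sum z).
  set (k := turns z t). set (t' := t - IZR k * (2 * h)).
  assert (Ht' : z cPhi <= t' < z cPhi + 2 * h) by apply (reduced_range z t).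
  assert (Hloc : exists d, 0 < d /\ forall u w, t' - d < u -> u <= t' -> t' <= w -> w < t' + d ->
    Rabs (q w - q t') <= K * (w - t') /\ Rabs (q t' - q u) <= K * (t' - u)).
  { destruct (Rlt_le_dec t' (z cPhi + tau true z)) as [Hlt|Hge].
    - destruct (Req_dec t' (z cPhi)) as [E|Hn].
      + exists (Rmin (tau true z) (tau false z)). split; [apply Rmin_glb_lt; assumption|].
        generalize (Rmin_l (tau true z) (tau false z)) (Rmin_r (tau true z) (tau false z)). intros M1 M2.
        intros u w Hu1 Hu2 Hw1 Hw2. split.
        * apply H1; lra.
        * rewrite <- (Hper t' 1%Z), <- (Hper u 1%Z).
          replace (t' - u) with (t' + 1 * (2 * h) - (u + 1 * (2 * h))) by ring. apply H2; lra.
      + exists (Rmin (t' - z cPhi) (z cPhi + tau true z - t')). split; [apply Rmin_glb_lt; lra|].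
        generalize (Rmin_l (t' - z cPhi) (z cPhi + tau true z - t')) (Rmin_r (t' - z cPhi) (z cPhi + tau true z - t')). intros M1 M2.
        intros u w Hu1 Hu2 Hw1 Hw2. split; apply H1; lra.
    - destruct (Req_dec t' (z cPhi + tau true z)) as [E|Hn].
      + exists (Rmin (tau true z) (tau false z)). split; [apply Rmin_glb_lt; assumption|].
        generalize (Rmin_l (tau true z) (tau false z)) (Rmin_r (tau true z) (tau false z)). intros M1 M2.
        intros u w Hu1 Hu2 Hw1 Hw2. split; [apply H2|apply H1]; lra.
      + exists (Rmin (t' - z cPhi - tau true z) (z cPhi + 2 * h - t')). split; [apply Rmin_glb_lt; lra|].
        generalize (Rmin_l (t' - z cPhi - tau true z) (z cPhi + 2 * h - t')) (Rmin_r (t' - z cPhi - tau true z) (z cPhi + 2 * h - t')). intros M1 M2.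
        intros u w Hu1 Hu2 Hw1 Hw2. split; apply H2; lra. }
  destruct Hloc as [d [Hd Hl]]. exists d. split; [exact Hd|]. intros u w Hu1 Hu2 Hw1 Hw2.
  specialize (Hl (u - IZR k * (2 * h)) (w - IZR k * (2 * h))).
  destruct Hl as [L1 L2]; unfold t' in *; try lra.
  assert (E : forall x, q (x - IZR k * (2 * h)) = q x).
  { intros x. rewrite <- (Hper (x - IZR k * (2 * h)) k). f_equal. ring. }
  rewrite !E in L1, L2.
  replace (q w - q u) with ((q w - q t) + (q t - q u)) by ring.
  eapply Rle_trans; [apply Rabs_triang|]. lra.
Qed.

Lemma position_velocity_lipschitz : exists K, 0 <= K /\ forall u w, u <= w ->
  Rabs (position_at z w - position_at z u) <= K * (w - u) /\ Rabs (velocity_at z w - velocity_at z u) <= K * (w - u).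
Proof.
  assert (T1 := cl_tau z Cz true). assert (T2 := cl_tau z Cz false).
  destruct (XY_lipschitz true z (cl_good z Cz)) as [K1 [P1 B1]].
  destruct (XY_lipschitz false z (cl_good z Cz)) as [K2 [P2 B2]].
  set (K := K1 / tau true z + K2 / tau false z).
  assert (Q1 : 0 <= K1 / tau true z) by (apply Rdiv_le_0_compat; lra).
  assert (Q2 : 0 <= K2 / tau false z) by (apply Rdiv_le_0_compat; lra).
  assert (E1 : forall u w, u <= w -> K1 * Rabs (upper_time z w - upper_time z u) <= K * (w - u)).
  { intros u w Huw. replace (upper_time z w - upper_time z u) with ((w - u) / tau true z)
      by (unfold upper_time; field; lra).
    rewrite Rabs_pos_eq by (apply Rdiv_le_0_compat; lra).
    replace (K1 * ((w - u) / tau true z)) with (K1 / tau true z * (w - u)) by (field; lra).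
    apply Rmult_le_compat_r; unfold K; lra. }
  assert (E2 : forall u w, u <= w -> K2 * Rabs (lower_time z w - lower_time z u) <= K * (w - u)).
  { intros u w Huw. replace (lower_time z w - lower_time z u) with (- ((w - u) / tau false z))
      by (unfold lower_time; field; lra).
    rewrite Rabs_Ropp, Rabs_pos_eq by (apply Rdiv_le_0_compat; lra).
    replace (K2 * ((w - u) / tau false z)) with (K2 / tau false z * (w - u)) by (field; lra).
    apply Rmult_le_compat_r; unfold K; lra. }
  exists K. split; [unfold K; lra|]. intros a b Hab. split.
  - apply (piecewise_lipschitz (position_at z) K); auto; intros.
    + apply position_velocity_shift.
    + destruct (upper_piece u) as [-> _]; [lra|]. destruct (upper_piece w) as [-> _]; [lra|].
      eapply Rle_trans; [apply B1; apply upper_time_range; lra|]. apply E1; lra.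
    + destruct (lower_piece u) as [-> _]; [lra|]. destruct (lower_piece w) as [-> _]; [lra|].
      replace (- X false (lower_time z w) z - - X false (lower_time z u) z) with
        (- (X false (lower_time z w) z - X false (lower_time z u) z)) by ring.
      rewrite Rabs_Ropp.
      eapply Rle_trans; [apply B2; apply lower_time_range; lra|]. apply E2; lra.
  - apply (piecewise_lipschitz (velocity_at z) K); auto; intros.
    + apply position_velocity_shift.
    + destruct (upper_piece u) as [_ ->]; [lra|]. destruct (upper_piece w) as [_ ->]; [lra|].
      eapply Rle_trans; [apply B1; apply upper_time_range; lra|]. apply E1; lra.
    + destruct (lower_piece u) as [_ ->]; [lra|]. destruct (lower_piece w) as [_ ->]; [lra|].
      eapply Rle_trans; [apply B2; apply lower_time_range; lra|]. apply E2; lra.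
Qed.
End ClosedState.
End Profiles.

(** * Strict differentiability in two variables *)

Definition close2 (d e0 t0 e t : R) : Prop := Rabs (e - e0) < d /\ Rabs (t - t0) < d.

Definition sd1 (c : R -> R) (e0 c' : R) : Prop :=
  forall om, 0 < om -> exists dl, 0 < dl /\ forall e1 e2,
    Rabs (e1 - e0) < dl -> Rabs (e2 - e0) < dl ->
    Rabs (c e1 - c e2 - c' * (e1 - e2)) <= om * Rabs (e1 - e2).

(** Strict differentiability at (e0, t0) relative to a domain D. Relative
    domains are needed because a phase is defined only between two curves that
    move with e. *)
Definition sd2 (D : R -> R -> Prop) (P : R -> R -> R) (e0 t0 a b : R) : Prop :=
  forall om, 0 < om -> exists dl, 0 < dl /\ forall e1 t1 e2 t2,
    D e1 t1 -> D e2 t2 -> close2 dl e0 t0 e1 t1 -> close2 dl e0 t0 e2 t2 ->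
    Rabs (P e1 t1 - P e2 t2 - (a * (e1 - e2) + b * (t1 - t2)))
    <= om * (Rabs (e1 - e2) + Rabs (t1 - t2)).

Lemma close2_le d d' e0 t0 e t : d <= d' -> close2 d e0 t0 e t -> close2 d' e0 t0 e t.
Proof. unfold close2. lra. Qed.

Lemma close2_refl d e0 t0 : 0 < d -> close2 d e0 t0 e0 t0.
Proof. intros Hd. unfold close2. rewrite !Rminus_diag, Rabs_R0. lra. Qed.

Lemma linear_part_bound a b x y :
  Rabs (a * x + b * y) <= (Rabs a + Rabs b) * (Rabs x + Rabs y).
Proof.
  eapply Rle_trans; [apply Rabs_triang|]. rewrite !Rabs_mult.
  generalize (Rabs_pos a) (Rabs_pos b) (Rabs_pos x) (Rabs_pos y). nra.
Qed.

Lemma sd2_lipschitz D P e0 t0 a b : sd2 D P e0 t0 a b ->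
  exists K dl, 0 < K /\ 0 < dl /\ forall e1 t1 e2 t2,
    D e1 t1 -> D e2 t2 -> close2 dl e0 t0 e1 t1 -> close2 dl e0 t0 e2 t2 ->
    Rabs (P e1 t1 - P e2 t2) <= K * (Rabs (e1 - e2) + Rabs (t1 - t2)).
Proof.
  intros H. destruct (H 1 ltac:(lra)) as [dl [Hdl H']].
  exists (Rabs a + Rabs b + 1), dl.
  split; [generalize (Rabs_pos a) (Rabs_pos b); lra|]. split; [exact Hdl|].
  intros e1 t1 e2 t2 D1 D2 C1 C2. specialize (H' e1 t1 e2 t2 D1 D2 C1 C2).
  replace (P e1 t1 - P e2 t2) with ((P e1 t1 - P e2 t2 - (a * (e1 - e2) + b * (t1 - t2)))
    + (a * (e1 - e2) + b * (t1 - t2))) by ring.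
  eapply Rle_trans; [apply Rabs_triang|].
  generalize (linear_part_bound a b (e1 - e2) (t1 - t2)). lra.
Qed.

Lemma sd1_lipschitz c e0 c' : sd1 c e0 c' -> exists K dl, 0 < K /\ 0 < dl /\ forall e1 e2,
  Rabs (e1 - e0) < dl -> Rabs (e2 - e0) < dl -> Rabs (c e1 - c e2) <= K * Rabs (e1 - e2).
Proof.
  intros H. destruct (H 1 ltac:(lra)) as [dl [Hdl H']].
  exists (Rabs c' + 1), dl. split; [generalize (Rabs_pos c'); lra|]. split; [exact Hdl|].
  intros e1 e2 H1 H2. specialize (H' e1 e2 H1 H2).
  replace (c e1 - c e2) with ((c e1 - c e2 - c' * (e1 - e2)) + c' * (e1 - e2)) by ring.
  eapply Rle_trans; [apply Rabs_triang|]. rewrite Rabs_mult. lra.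
Qed.

Lemma sd1_continuous c e0 c' : sd1 c e0 c' -> continuous c e0.
Proof.
  intros H. destruct (sd1_lipschitz c e0 c' H) as [K [dl [HK [Hdl HL]]]].
  apply continuous_eps_delta. intros e He.
  exists (Rmin dl (e / K)). split; [apply Rmin_glb_lt; [lra|apply Rdiv_lt_0_compat; lra]|].
  intros y Hy. apply Rmin_Rgt in Hy. destruct Hy as [H1 H2].
  eapply Rle_lt_trans; [apply HL; [exact H1|rewrite Rminus_diag, Rabs_R0; lra]|].
  apply Rgt_lt, (Rmult_lt_compat_l K) in H2; [|exact HK].
  replace (K * (e / K)) with e in H2 by (field; lra). exact H2.
Qed.

(** The reciprocal, needed to rescale time by the length of a phase. *)
Lemma sd1_inv c e0 c' : sd1 c e0 c' -> 0 < c e0 ->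
  sd1 (fun e => / c e) e0 (- c' / (c e0 * c e0)).
Proof.
  intros H Hc om Hom.
  destruct (sd1_lipschitz c e0 c' H) as [K [d1 [HK [Hd1 HL]]]].
  set (m := c e0) in *.
  (* near e0 the function stays above half its value *)
  set (om1 := om * (m * m) / 8). assert (Hom1 : 0 < om1) by (unfold om1; repeat apply Rmult_lt_0_compat; lra).
  destruct (H om1 Hom1) as [d2 [Hd2 HS]].
  set (d3 := Rmin (m / (2 * K)) (om * (m * m) * m / (16 * (Rabs c' + 1) * K))).
  assert (Hc' : 0 < Rabs c' + 1) by (generalize (Rabs_pos c'); lra).
  assert (Hd3 : 0 < d3).
  { unfold d3. apply Rmin_glb_lt; apply Rdiv_lt_0_compat; try nra.
    repeat apply Rmult_lt_0_compat; lra. }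
  exists (Rmin d1 (Rmin d2 d3)). split; [repeat (assumption || apply Rmin_glb_lt)|].
  assert (Hval : forall e, Rabs (e - e0) < Rmin d1 (Rmin d2 d3) ->
    Rabs (e - e0) < d2 /\ m / 2 <= c e /\ Rabs (c e - m) <= om * (m * m) * m / (16 * (Rabs c' + 1))).
  { intros e He. apply Rmin_Rgt in He. destruct He as [H1 H2]. apply Rmin_Rgt in H2. destruct H2 as [H2 H3].
    unfold d3 in H3. apply Rmin_Rgt in H3. destruct H3 as [H3 H4].
    split; [exact H2|].
    assert (HL' := HL e e0 H1 ltac:(rewrite Rminus_diag, Rabs_R0; lra)). fold m in HL'.
    apply Rgt_lt, (Rmult_lt_compat_l K) in H3; [|exact HK].
    apply Rgt_lt, (Rmult_lt_compat_l K) in H4; [|exact HK].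
    replace (K * (m / (2 * K))) with (m / 2) in H3 by (field; lra).
    replace (K * (om * (m * m) * m / (16 * (Rabs c' + 1) * K))) with
      (om * (m * m) * m / (16 * (Rabs c' + 1))) in H4 by (field; lra).
    split; [|lra]. assert (Hab : Rabs (c e - m) < m / 2) by lra. apply Rabs_def2 in Hab. lra. }
  intros e1 e2 H1 H2. destruct (Hval e1 H1) as [A1 [A2 A3]]. destruct (Hval e2 H2) as [B1 [B2 B3]].
  specialize (HS e1 e2 A1 B1).
  set (x := c e1) in *. set (y := c e2) in *.
  (* 1/x - 1/y = -(x-y)/(xy); compare with -(x-y)/m^2 *)
  assert (Hxy : m * m / 4 <= x * y) by nra.
  assert (Hxy0 : 0 < x * y) by nra.
  replace (/ x - / y - - c' / (m * m) * (e1 - e2)) with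
    (- (x - y - c' * (e1 - e2)) / (x * y) + c' * (e1 - e2) * ((x - m) * y + m * (y - m)) / (m * m * (x * y)))
    by (field; repeat split; lra).
  eapply Rle_trans; [apply Rabs_triang|].
  assert (T1 : Rabs (- (x - y - c' * (e1 - e2)) / (x * y)) <= om / 2 * Rabs (e1 - e2)).
  { unfold Rdiv. rewrite Rabs_mult, Rabs_Ropp, Rabs_inv, (Rabs_pos_eq (x * y)) by lra.
    apply Rmult_le_reg_r with (x * y); [exact Hxy0|]. rewrite Rmult_assoc, Rinv_l, Rmult_1_r by lra.
    eapply Rle_trans; [exact HS|]. unfold om1.
    assert (0 <= om * Rabs (e1 - e2)) by (apply Rmult_le_pos; [lra|apply Rabs_pos]). nra. }
  assert (Hy2 : y <= 2 * m \/ 2 * m < y) by lra.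
  assert (T2 : Rabs (c' * (e1 - e2) * ((x - m) * y + m * (y - m)) / (m * m * (x * y))) <= om / 2 * Rabs (e1 - e2)).
  { set (q := om * (m * m) * m / (16 * (Rabs c' + 1))) in *.
    assert (Hq : q * (16 * (Rabs c' + 1)) = om * (m * m) * m) by (unfold q; field; lra).
    replace ((x - m) * y + m * (y - m)) with ((x - m) * y + (y - m) * m) by ring.
    assert (Hnum : Rabs ((x - m) * y + (y - m) * m) <= q * (y + m)).
    { eapply Rle_trans; [apply Rabs_triang|]. rewrite !Rabs_mult, (Rabs_pos_eq y), (Rabs_pos_eq m) by lra. nra. }
    assert (Hden : 0 < m * m * (x * y)) by (repeat (assumption || apply Rmult_lt_0_compat)).
    unfold Rdiv. rewrite 2!Rabs_mult, Rabs_inv, (Rabs_pos_eq (m * m * (x * y))), (Rabs_mult c') by lra.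
    apply Rmult_le_reg_r with (m * m * (x * y)); [exact Hden|].
    rewrite Rmult_assoc, Rinv_l, Rmult_1_r by lra.
    assert (Hq0 : 0 <= q) by (unfold q; apply Rlt_le, Rdiv_lt_0_compat; [|lra]; repeat apply Rmult_lt_0_compat; lra).
    assert (Hc1 : Rabs c' * (q * (y + m)) <= om / 2 * (m * m * (x * y))).
    { assert (y + m <= 3 * y) by lra. assert (Rabs c' * q <= om * (m * m) * m / 16) by lra.
      apply Rle_trans with (om * (m * m) * m / 16 * (3 * y)).
      - rewrite <- Rmult_assoc. apply Rmult_le_compat; try lra.
        apply Rmult_le_pos; [apply Rabs_pos|lra].
      - replace (om * (m * m) * m / 16 * (3 * y)) with (om * (m * m) * y * (3 * m / 16)) by field.
        replace (om / 2 * (m * m * (x * y))) with (om * (m * m) * y * (x / 2)) by field.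
        apply Rmult_le_compat_l; [|lra]. repeat apply Rmult_le_pos; lra. }
    assert (0 <= Rabs (e1 - e2)) by apply Rabs_pos.
    apply Rle_trans with (Rabs (e1 - e2) * (Rabs c' * (q * (y + m)))).
    - rewrite (Rmult_comm (Rabs c')), Rmult_assoc. apply Rmult_le_compat_l; [assumption|].
      apply Rmult_le_compat_l; [apply Rabs_pos|exact Hnum].
    - rewrite (Rmult_comm (om / 2)), (Rmult_assoc (Rabs (e1 - e2))). apply Rmult_le_compat_l; assumption. }
  lra.
Qed.

Lemma sd2_of_sd1 D c e0 t0 c' : sd1 c e0 c' -> sd2 D (fun e _ => c e) e0 t0 c' 0.
Proof.
  intros H om Hom. destruct (H om Hom) as [dl [Hdl H']]. exists dl. split; [exact Hdl|].
  intros e1 t1 e2 t2 _ _ [C1 _] [C2 _]. specialize (H' e1 e2 C1 C2).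
  rewrite Rmult_0_l, Rplus_0_r. generalize (Rabs_pos (t1 - t2)). nra.
Qed.

Lemma sd2_snd D e0 t0 : sd2 D (fun _ t => t) e0 t0 0 1.
Proof.
  intros om Hom. exists 1. split; [lra|]. intros e1 t1 e2 t2 _ _ _ _.
  replace (t1 - t2 - (0 * (e1 - e2) + 1 * (t1 - t2))) with 0 by ring. rewrite Rabs_R0.
  generalize (Rabs_pos (e1 - e2)) (Rabs_pos (t1 - t2)). nra.
Qed.

Lemma sd2_scal_minus D k P Q e0 t0 a b a' b' : sd2 D P e0 t0 a b -> sd2 D Q e0 t0 a' b' ->
  sd2 D (fun e t => k * (P e t - Q e t)) e0 t0 (k * (a - a')) (k * (b - b')).
Proof.
  intros HP HQ om Hom.
  assert (Hk : 0 < 2 * (Rabs k + 1)) by (generalize (Rabs_pos k); lra).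
  set (om' := om / (2 * (Rabs k + 1))).
  assert (Hom' : 0 < om') by (apply Rdiv_lt_0_compat; lra).
  destruct (HP om' Hom') as [d1 [P1 H1]]. destruct (HQ om' Hom') as [d2 [P2 H2]].
  exists (Rmin d1 d2). split; [apply Rmin_glb_lt; assumption|].
  intros e1 t1 e2 t2 D1 D2 C1 C2.
  specialize (H1 e1 t1 e2 t2 D1 D2 (close2_le _ _ _ _ _ _ (Rmin_l d1 d2) C1) (close2_le _ _ _ _ _ _ (Rmin_l d1 d2) C2)).
  specialize (H2 e1 t1 e2 t2 D1 D2 (close2_le _ _ _ _ _ _ (Rmin_r d1 d2) C1) (close2_le _ _ _ _ _ _ (Rmin_r d1 d2) C2)).
  set (m := Rabs (e1 - e2) + Rabs (t1 - t2)) in *.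
  replace (k * (P e1 t1 - Q e1 t1) - k * (P e2 t2 - Q e2 t2) -
    (k * (a - a') * (e1 - e2) + k * (b - b') * (t1 - t2))) with
    (k * ((P e1 t1 - P e2 t2 - (a * (e1 - e2) + b * (t1 - t2)))
      - (Q e1 t1 - Q e2 t2 - (a' * (e1 - e2) + b' * (t1 - t2))))) by ring.
  rewrite Rabs_mult.
  apply Rle_trans with (Rabs k * (om' * m + om' * m)).
  - apply Rmult_le_compat_l; [apply Rabs_pos|]. eapply Rle_trans; [apply Rabs_triang|].
    rewrite Rabs_Ropp. lra.
  - assert (Hm : 0 <= m) by (unfold m; generalize (Rabs_pos (e1 - e2)) (Rabs_pos (t1 - t2)); lra).
    replace (om * m) with ((Rabs k + 1) * (om' * m + om' * m)) by (unfold om'; field; lra).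
    apply Rmult_le_compat_r; [|lra]. nra.
Qed.

Lemma sd2_mult D P Q e0 t0 a b a' b' : D e0 t0 -> sd2 D P e0 t0 a b -> sd2 D Q e0 t0 a' b' ->
  sd2 D (fun e t => P e t * Q e t) e0 t0
    (a * Q e0 t0 + P e0 t0 * a') (b * Q e0 t0 + P e0 t0 * b').
Proof.
  intros D0 HP HQ om Hom.
  destruct (sd2_lipschitz _ _ _ _ _ _ HP) as [K1 [g1 [PK1 [Pg1 L1]]]].
  destruct (sd2_lipschitz _ _ _ _ _ _ HQ) as [K2 [g2 [PK2 [Pg2 L2]]]].
  set (M := Rabs (P e0 t0) + Rabs (Q e0 t0) + 1).
  assert (HM : 0 < M) by (unfold M; generalize (Rabs_pos (P e0 t0)) (Rabs_pos (Q e0 t0)); lra).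
  set (om' := om / (4 * M)). assert (Hom' : 0 < om') by (apply Rdiv_lt_0_compat; lra).
  destruct (HP om' Hom') as [d1 [P1 H1]]. destruct (HQ om' Hom') as [d2 [P2 H2]].
  set (g3 := om / (8 * K1 * K2)).
  assert (Pg3 : 0 < g3) by (apply Rdiv_lt_0_compat; [lra|]; repeat apply Rmult_lt_0_compat; lra).
  destruct (below5 g1 g2 d1 d2 g3) as [dl [Hdl [Q1 [Q2 [Q3 [Q4 Q5]]]]]]; try assumption.
  exists dl. split; [exact Hdl|].
  intros e1 t1 e2 t2 D1 D2 C1 C2.
  assert (C0 := close2_refl dl e0 t0 Hdl).
  assert (Lw := fun d (H : dl <= d) e t C => close2_le dl d e0 t0 e t H C).
  specialize (H1 e1 t1 e2 t2 D1 D2 (Lw _ Q3 _ _ C1) (Lw _ Q3 _ _ C2)).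
  specialize (H2 e1 t1 e2 t2 D1 D2 (Lw _ Q4 _ _ C1) (Lw _ Q4 _ _ C2)).
  assert (LP12 := L1 e1 t1 e2 t2 D1 D2 (Lw _ Q1 _ _ C1) (Lw _ Q1 _ _ C2)).
  assert (LQ12 := L2 e1 t1 e2 t2 D1 D2 (Lw _ Q2 _ _ C1) (Lw _ Q2 _ _ C2)).
  assert (LP20 := L1 e2 t2 e0 t0 D2 D0 (Lw _ Q1 _ _ C2) (Lw _ Q1 _ _ C0)).
  assert (LQ10 := L2 e1 t1 e0 t0 D1 D0 (Lw _ Q2 _ _ C1) (Lw _ Q2 _ _ C0)).
  destruct C1 as [C1 C1']. destruct C2 as [C2 C2'].
  set (m := Rabs (e1 - e2) + Rabs (t1 - t2)) in *.
  assert (Hm : 0 <= m) by (unfold m; generalize (Rabs_pos (e1 - e2)) (Rabs_pos (t1 - t2)); lra).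
  assert (HP20 : Rabs (P e2 t2 - P e0 t0) <= K1 * (2 * g3)) by (eapply Rle_trans; [exact LP20|]; apply Rmult_le_compat_l; lra).
  assert (HQ10 : Rabs (Q e1 t1 - Q e0 t0) <= K2 * (2 * g3)) by (eapply Rle_trans; [exact LQ10|]; apply Rmult_le_compat_l; lra).
  assert (Hg3 : K1 * K2 * g3 = om / 8) by (unfold g3; field; lra).
  assert (Hom4 : om' * M = om / 4) by (unfold om'; field; lra).
  match goal with |- Rabs ?x <= _ => replace x with
    ((P e1 t1 - P e2 t2 - (a * (e1 - e2) + b * (t1 - t2))) * Q e0 t0
     + (P e1 t1 - P e2 t2) * (Q e1 t1 - Q e0 t0)
     + P e0 t0 * (Q e1 t1 - Q e2 t2 - (a' * (e1 - e2) + b' * (t1 - t2)))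
     + (P e2 t2 - P e0 t0) * (Q e1 t1 - Q e2 t2)) by ring end.
  eapply Rle_trans; [apply Rabs_triang|].
  eapply Rle_trans; [apply Rplus_le_compat_r, Rabs_triang|].
  eapply Rle_trans; [apply Rplus_le_compat_r, Rplus_le_compat_r, Rabs_triang|].
  rewrite !Rabs_mult.
  assert (T1 : Rabs (P e1 t1 - P e2 t2 - (a * (e1 - e2) + b * (t1 - t2))) * Rabs (Q e0 t0) <= om / 4 * m).
  { rewrite <- Hom4. apply Rle_trans with (om' * m * M); [|right; ring].
    apply Rmult_le_compat; auto using Rabs_pos. unfold M; generalize (Rabs_pos (P e0 t0)); lra. }
  assert (T3 : Rabs (P e0 t0) * Rabs (Q e1 t1 - Q e2 t2 - (a' * (e1 - e2) + b' * (t1 - t2))) <= om / 4 * m).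
  { rewrite <- Hom4. apply Rle_trans with (M * (om' * m)); [|right; ring].
    apply Rmult_le_compat; auto using Rabs_pos. unfold M; generalize (Rabs_pos (Q e0 t0)); lra. }
  assert (T2 : Rabs (P e1 t1 - P e2 t2) * Rabs (Q e1 t1 - Q e0 t0) <= om / 4 * m).
  { apply Rle_trans with (K1 * m * (K2 * (2 * g3))); [apply Rmult_le_compat; auto using Rabs_pos|].
    replace (K1 * m * (K2 * (2 * g3))) with (2 * (K1 * K2 * g3) * m) by ring. rewrite Hg3. lra. }
  assert (T4 : Rabs (P e2 t2 - P e0 t0) * Rabs (Q e1 t1 - Q e2 t2) <= om / 4 * m).
  { apply Rle_trans with (K1 * (2 * g3) * (K2 * m)); [apply Rmult_le_compat; auto using Rabs_pos|].
    replace (K1 * (2 * g3) * (K2 * m)) with (2 * (K1 * K2 * g3) * m) by ring. rewrite Hg3. lra. }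
  lra.
Qed.

Lemma sd2_comp D D' P V e0 t0 u0 a b a' b' : D' e0 t0 -> V e0 t0 = u0 ->
  sd2 D P e0 u0 a b -> sd2 D' V e0 t0 a' b' ->
  (forall e t, D' e t -> D e (V e t)) ->
  sd2 D' (fun e t => P e (V e t)) e0 t0 (a + b * a') (b * b').
Proof.
  intros D0 E0 HP HV HD om Hom.
  destruct (sd2_lipschitz _ _ _ _ _ _ HV) as [K [g [PK [Pg L]]]].
  set (om1 := om / (2 * (1 + K))). assert (Hom1 : 0 < om1) by (apply Rdiv_lt_0_compat; lra).
  assert (Hb : 0 < Rabs b + 1) by (generalize (Rabs_pos b); lra).
  set (om2 := om / (2 * (Rabs b + 1))). assert (Hom2 : 0 < om2) by (apply Rdiv_lt_0_compat; lra).
  destruct (HP om1 Hom1) as [d1 [P1 H1]]. destruct (HV om2 Hom2) as [d2 [P2 H2]].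
  set (d3 := d1 / (2 * K)). assert (Hd3 : 0 < d3) by (apply Rdiv_lt_0_compat; lra).
  destruct (below4 g d1 d2 d3) as [dl [Hdl [Q1 [Q2 [Q3 Q4]]]]]; try assumption.
  exists dl. split; [exact Hdl|]. intros e1 t1 e2 t2 D1 D2 C1 C2.
  assert (Hin : forall e t, D' e t -> close2 dl e0 t0 e t -> close2 d1 e0 u0 e (V e t)).
  { intros e t De Ce. assert (Le := L e t e0 t0 De D0 (close2_le _ _ _ _ _ _ Q1 Ce)
      (close2_le _ _ _ _ _ _ Q1 (close2_refl dl e0 t0 Hdl))).
    destruct Ce as [A1 A2]. split; [lra|]. rewrite <- E0.
    eapply Rle_lt_trans; [exact Le|].
    replace d1 with (K * (2 * d3)) by (unfold d3; field; lra). apply Rmult_lt_compat_l; lra. }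
  specialize (H1 e1 (V e1 t1) e2 (V e2 t2) (HD _ _ D1) (HD _ _ D2) (Hin _ _ D1 C1) (Hin _ _ D2 C2)).
  specialize (H2 e1 t1 e2 t2 D1 D2 (close2_le _ _ _ _ _ _ Q3 C1) (close2_le _ _ _ _ _ _ Q3 C2)).
  specialize (L e1 t1 e2 t2 D1 D2 (close2_le _ _ _ _ _ _ Q1 C1) (close2_le _ _ _ _ _ _ Q1 C2)).
  set (m := Rabs (e1 - e2) + Rabs (t1 - t2)) in *.
  assert (Hem : Rabs (e1 - e2) <= m) by (unfold m; generalize (Rabs_pos (t1 - t2)); lra).
  assert (Hm : 0 <= m) by (generalize (Rabs_pos (e1 - e2)); lra).
  replace (P e1 (V e1 t1) - P e2 (V e2 t2) - ((a + b * a') * (e1 - e2) + b * b' * (t1 - t2))) with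
    ((P e1 (V e1 t1) - P e2 (V e2 t2) - (a * (e1 - e2) + b * (V e1 t1 - V e2 t2)))
     + b * (V e1 t1 - V e2 t2 - (a' * (e1 - e2) + b' * (t1 - t2)))) by ring.
  eapply Rle_trans; [apply Rabs_triang|]. rewrite Rabs_mult.
  assert (T1 : om1 * (Rabs (e1 - e2) + Rabs (V e1 t1 - V e2 t2)) <= om / 2 * m).
  { apply Rle_trans with (om1 * ((1 + K) * m)); [apply Rmult_le_compat_l; lra|].
    right. unfold om1. field. lra. }
  assert (T2 : Rabs b * Rabs (V e1 t1 - V e2 t2 - (a' * (e1 - e2) + b' * (t1 - t2))) <= om / 2 * m).
  { apply Rle_trans with ((Rabs b + 1) * (om2 * m)).
    - apply Rmult_le_compat; auto using Rabs_pos. lra.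
    - right. unfold om2. field. lra. }
  lra.
Qed.

Lemma sd2_local D D' P P' e0 t0 a b r : 0 < r ->
  (forall e t, close2 r e0 t0 e t -> D' e t -> D e t /\ P' e t = P e t) ->
  sd2 D P e0 t0 a b -> sd2 D' P' e0 t0 a b.
Proof.
  intros Hr HD H om Hom. destruct (H om Hom) as [dl [Hdl H']].
  exists (Rmin r dl). split; [apply Rmin_glb_lt; assumption|].
  intros e1 t1 e2 t2 D1 D2 C1 C2.
  destruct (HD e1 t1 (close2_le _ _ _ _ _ _ (Rmin_l r dl) C1) D1) as [A1 ->].
  destruct (HD e2 t2 (close2_le _ _ _ _ _ _ (Rmin_l r dl) C2) D2) as [A2 ->].
  apply H'; auto; eapply close2_le; eauto; apply Rmin_r.
Qed.

Lemma convex_combination_bound a b s r : Rabs a < r -> Rabs b < r -> 0 <= s <= 1 ->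
  Rabs ((1 - s) * a + s * b) < r.
Proof.
  intros Ha Hb Hs. apply Rle_lt_trans with (Rmax (Rabs a) (Rabs b)); [|apply Rmax_lub_lt; assumption].
  eapply Rle_trans; [apply Rabs_triang|]. rewrite !Rabs_mult, (Rabs_pos_eq s), (Rabs_pos_eq (1 - s)) by lra.
  generalize (Rmax_l (Rabs a) (Rabs b)) (Rmax_r (Rabs a) (Rabs b)). nra.
Qed.

(** A segment that joins the two sides of the curve t = c e meets the curve, by
    the intermediate value theorem. *)
Lemma path_crossing (c : R -> R) r e0 e1 t1 e2 t2 :
  (forall e, Rabs (e - e0) < r -> continuous c e) ->
  Rabs (e1 - e0) < r -> Rabs (e2 - e0) < r -> t1 <= c e1 -> c e2 <= t2 ->
  exists s, 0 <= s <= 1 /\ t1 + s * (t2 - t1) = c (e1 + s * (e2 - e1)).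
Proof.
  intros Hc H1 H2 Ht1 Ht2.
  set (g := fun s => (t1 + clamp s * (t2 - t1)) - c (e1 + clamp s * (e2 - e1))).
  assert (Hin : forall s, Rabs (e1 + clamp s * (e2 - e1) - e0) < r).
  { intros s. generalize (clamp_range s). intros Hs.
    replace (e1 + clamp s * (e2 - e1) - e0) with ((1 - clamp s) * (e1 - e0) + clamp s * (e2 - e0)) by ring.
    apply convex_combination_bound; auto. }
  assert (Hg : continuity g).
  { intros s. apply continuity_pt_filterlim.
    assert (Hp : forall p q, continuous (fun s => p + clamp s * (q - p)) s).
    { intros p q. apply (continuous_comp clamp (fun x => p + x * (q - p))); [apply clamp_continuous|].
      apply (is_derive_continuous _ _ (q - p)). auto_derive; auto; ring. }
    apply continuous_Rminus; [apply Hp|].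
    apply (continuous_comp (fun s => e1 + clamp s * (e2 - e1)) c); [apply Hp|apply Hc, Hin]. }
  assert (G0 : g 0 <= 0).
  { unfold g. rewrite clamp_id, !Rmult_0_l, !Rplus_0_r by lra. lra. }
  assert (G1 : 0 <= g 1).
  { unfold g. rewrite clamp_id, !Rmult_1_l by lra.
    replace (e1 + (e2 - e1)) with e2 by ring. lra. }
  destruct (IVT_gen g 0 1 0 Hg) as [s [Hs Hgs]].
  { rewrite Rmin_left, Rmax_right; lra. }
  rewrite Rmin_left, Rmax_right in Hs by lra.
  exists s. split; [exact Hs|]. unfold g in Hgs. rewrite clamp_id in Hgs by exact Hs. lra.
Qed.

(** Two points on different sides of the curve are compared through the point
    where the segment between them crosses it; increments are additive along a
    segment and so are the norms of its two parts. *)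
Lemma sd2_glue P (c : R -> R) e0 t0 a b r : 0 < r ->
  (forall e, Rabs (e - e0) < r -> continuous c e) ->
  sd2 (fun e t => t <= c e) P e0 t0 a b -> sd2 (fun e t => c e <= t) P e0 t0 a b ->
  sd2 (fun _ _ => True) P e0 t0 a b.
Proof.
  intros Hr Hc HL HU om Hom.
  destruct (HL om Hom) as [d1 [P1 H1]]. destruct (HU om Hom) as [d2 [P2 H2]].
  destruct (below3 r d1 d2) as [dl [Hdl [Q1 [Q2 Q3]]]]; try assumption.
  assert (Hmain : forall e1 t1 e2 t2, t1 <= c e1 -> c e2 <= t2 ->
    close2 dl e0 t0 e1 t1 -> close2 dl e0 t0 e2 t2 ->
    Rabs (P e1 t1 - P e2 t2 - (a * (e1 - e2) + b * (t1 - t2))) <= om * (Rabs (e1 - e2) + Rabs (t1 - t2))).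
  { intros e1 t1 e2 t2 L1 L2 C1 C2.
    destruct (path_crossing c r e0 e1 t1 e2 t2) as [s [Hs Es]]; auto; try (destruct C1, C2; lra).
    set (es := e1 + s * (e2 - e1)) in *. set (ts := t1 + s * (t2 - t1)) in *.
    assert (Cs : close2 dl e0 t0 es ts).
    { destruct C1 as [A1 A2], C2 as [B1 B2]. split; unfold es, ts.
      - replace (e1 + s * (e2 - e1) - e0) with ((1 - s) * (e1 - e0) + s * (e2 - e0)) by ring.
        apply convex_combination_bound; assumption.
      - replace (t1 + s * (t2 - t1) - t0) with ((1 - s) * (t1 - t0) + s * (t2 - t0)) by ring.
        apply convex_combination_bound; assumption. }
    assert (X1 := H1 e1 t1 es ts L1 (Req_le _ _ Es) (close2_le _ _ _ _ _ _ Q2 C1) (close2_le _ _ _ _ _ _ Q2 Cs)).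
    assert (X2 := H2 es ts e2 t2 (Req_le _ _ (eq_sym Es)) L2 (close2_le _ _ _ _ _ _ Q3 Cs) (close2_le _ _ _ _ _ _ Q3 C2)).
    replace (P e1 t1 - P e2 t2 - (a * (e1 - e2) + b * (t1 - t2))) with
      ((P e1 t1 - P es ts - (a * (e1 - es) + b * (t1 - ts)))
       + (P es ts - P e2 t2 - (a * (es - e2) + b * (ts - t2)))) by ring.
    eapply Rle_trans; [apply Rabs_triang|].
    replace (e1 - es) with (s * (e1 - e2)) in X1 by (unfold es; ring).
    replace (t1 - ts) with (s * (t1 - t2)) in X1 by (unfold ts; ring).
    replace (es - e2) with ((1 - s) * (e1 - e2)) in X2 by (unfold es; ring).
    replace (ts - t2) with ((1 - s) * (t1 - t2)) in X2 by (unfold ts; ring).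
    replace (e1 - es) with (s * (e1 - e2)) by (unfold es; ring).
    replace (t1 - ts) with (s * (t1 - t2)) by (unfold ts; ring).
    replace (es - e2) with ((1 - s) * (e1 - e2)) by (unfold es; ring).
    replace (ts - t2) with ((1 - s) * (t1 - t2)) by (unfold ts; ring).
    rewrite !(Rabs_mult s), !(Rabs_pos_eq s) in X1 by lra.
    rewrite !(Rabs_mult (1 - s)), !(Rabs_pos_eq (1 - s)) in X2 by lra.
    lra. }
  exists dl. split; [exact Hdl|]. intros e1 t1 e2 t2 _ _ C1 C2.
  destruct (Rle_lt_dec t1 (c e1)) as [A|A], (Rle_lt_dec t2 (c e2)) as [A'|A'].
  - apply H1; auto; eapply close2_le; eauto.
  - apply Hmain; auto; lra.
  - replace (P e1 t1 - P e2 t2 - (a * (e1 - e2) + b * (t1 - t2))) with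
      (- (P e2 t2 - P e1 t1 - (a * (e2 - e1) + b * (t2 - t1)))) by ring.
    rewrite Rabs_Ropp, (Rabs_minus_sym e1), (Rabs_minus_sym t1). apply Hmain; auto; lra.
  - apply H2; try lra; eapply close2_le; eauto.
Qed.

(** Differentiating P e (c e) = 0 gives a + b c' = 0: on such a curve the
    derivative in t determines the derivative in e. *)
Lemma sd2_along_zero_curve D P c e0 t0 a b c' r : 0 < r -> c e0 = t0 -> sd1 c e0 c' ->
  sd2 D P e0 t0 a b ->
  (forall e, Rabs (e - e0) < r -> D e (c e) /\ P e (c e) = 0) ->
  a = - (b * c').
Proof.
  intros Hr E0 Hc HP HD.
  assert (H : a + b * c' = 0); [|lra].
  apply cond_eq. intros om Hom. rewrite Rminus_0_r.
  destruct (sd1_lipschitz c e0 c' Hc) as [K [d1 [HK [Hd1 HL]]]].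
  set (om1 := om / (4 * (1 + K))). assert (Hom1 : 0 < om1) by (apply Rdiv_lt_0_compat; lra).
  assert (Hb : 0 < Rabs b + 1) by (generalize (Rabs_pos b); lra).
  set (om2 := om / (4 * (Rabs b + 1))). assert (Hom2 : 0 < om2) by (apply Rdiv_lt_0_compat; lra).
  destruct (HP om1 Hom1) as [d2 [Hd2 HS]]. destruct (Hc om2 Hom2) as [d3 [Hd3 HC]].
  destruct (below5 r d1 d2 d3 (d2 / K)) as [dl [Hdl [Q1 [Q2 [Q3 [Q4 Q5]]]]]];
    try assumption; [apply Rdiv_lt_0_compat; lra|].
  set (s := dl / 2). set (e := e0 + s).
  assert (Hs : 0 < s < dl) by (unfold s; lra).
  assert (He : Rabs (e - e0) = s) by (unfold e; replace (e0 + s - e0) with s by ring; apply Rabs_pos_eq; lra).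
  destruct (HD e ltac:(lra)) as [De Pe].
  destruct (HD e0 ltac:(rewrite Rminus_diag, Rabs_R0; lra)) as [D0 P0].
  assert (HLe := HL e e0 ltac:(lra) ltac:(rewrite Rminus_diag, Rabs_R0; lra)).
  assert (HCe := HC e e0 ltac:(lra) ltac:(rewrite Rminus_diag, Rabs_R0; lra)).
  assert (HSe := HS e (c e) e0 (c e0) De D0).
  rewrite E0 in HSe, HLe, HCe.
  specialize (HSe). rewrite He in *.
  assert (Cl : close2 d2 e0 t0 e (c e)).
  { split; [lra|]. eapply Rle_lt_trans; [exact HLe|].
    replace d2 with (K * (d2 / K)) by (field; lra). apply Rmult_lt_compat_l; lra. }
  specialize (HSe Cl (close2_refl d2 e0 t0 Hd2)).
  rewrite Pe, <- E0, P0, E0 in HSe.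
  assert (Ee : e - e0 = s) by (unfold e; ring). rewrite Ee in *.
  assert (T : Rabs ((a + b * c') * s) <= om / 2 * s).
  { replace ((a + b * c') * s) with (- (0 - 0 - (a * s + b * (c e - t0))) - b * (c e - t0 - c' * s)) by ring.
    eapply Rle_trans; [apply Rabs_triang|]. rewrite !Rabs_Ropp, Rabs_mult.
    assert (T1 : om1 * (s + Rabs (c e - t0)) <= om / 4 * s).
    { apply Rle_trans with (om1 * ((1 + K) * s)); [apply Rmult_le_compat_l; lra|].
      right. unfold om1. field. lra. }
    assert (T2 : Rabs b * Rabs (c e - t0 - c' * s) <= om / 4 * s).
    { apply Rle_trans with ((Rabs b + 1) * (om2 * s)).
      - apply Rmult_le_compat; auto using Rabs_pos. lra.
      - right. unfold om2. field. lra. }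
    lra. }
  rewrite Rabs_mult, (Rabs_pos_eq s) in T by lra.
  apply Rmult_le_reg_r in T; lra.
Qed.

Lemma sd2_is_derive P e0 t0 a b : sd2 (fun _ _ => True) P e0 t0 a b ->
  is_derive (fun e => P e t0) e0 a /\ is_derive (fun t => P e0 t) t0 b.
Proof.
  intros H. split; apply is_derive_Reals; intros om Hom;
    destruct (H (om / 2) ltac:(lra)) as [dl [Hdl H']];
    exists (mkposreal dl Hdl); intros s Hs Hsd; simpl in Hsd;
    assert (Hp : 0 < Rabs s) by (apply Rabs_pos_lt, Hs);
    apply Rmult_lt_reg_r with (Rabs s); try exact Hp; rewrite <- Rabs_mult.
  - specialize (H' (e0 + s) t0 e0 t0 I I).
    replace (((P (e0 + s) t0 - P e0 t0) / s - a) * s) with (P (e0 + s) t0 - P e0 t0 - (a * s + b * 0)) by (field; exact Hs).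
    replace (e0 + s - e0) with s in H' by ring. rewrite Rminus_diag, Rabs_R0 in H'.
    eapply Rle_lt_trans; [apply H'|nra]; unfold close2;
      replace (e0 + s - e0) with s by ring; rewrite ?Rminus_diag, ?Rabs_R0; lra.
  - specialize (H' e0 (t0 + s) e0 t0 I I).
    replace (((P e0 (t0 + s) - P e0 t0) / s - b) * s) with (P e0 (t0 + s) - P e0 t0 - (a * 0 + b * s)) by (field; exact Hs).
    replace (t0 + s - t0) with s in H' by ring. rewrite Rminus_diag, Rabs_R0 in H'.
    eapply Rle_lt_trans; [apply H'|nra]; unfold close2;
      replace (t0 + s - t0) with s by ring; rewrite ?Rminus_diag, ?Rabs_R0; lra.
Qed.

(** Strict differentiability at one point controls the derivatives at all
    neighbouring points that have a strict derivative; this is what makes a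
    function that is strictly differentiable everywhere C1. *)
Lemma sd2_partials_close P e0 t0 a b om : sd2 (fun _ _ => True) P e0 t0 a b -> 0 < om ->
  exists dl, 0 < dl /\ forall e1 t1 a1 b1, close2 dl e0 t0 e1 t1 ->
    sd2 (fun _ _ => True) P e1 t1 a1 b1 -> Rabs (a1 - a) <= om /\ Rabs (b1 - b) <= om.
Proof.
  intros H Hom. destruct (H (om / 2) ltac:(lra)) as [dl [Hdl H0]].
  exists (dl / 2). split; [lra|]. intros e1 t1 a1 b1 [C1 C2] H1.
  destruct (H1 (om / 2) ltac:(lra)) as [d1 [Hd1 H1']].
  set (s := Rmin (d1 / 2) (dl / 4)).
  assert (Hs : 0 < s /\ s <= d1 / 2 /\ s <= dl / 4).
  { unfold s. split; [apply Rmin_glb_lt; lra|]. split; [apply Rmin_l|apply Rmin_r]. }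
  apply Rabs_def2 in C1, C2.
  assert (Hab : Rabs s = s) by (apply Rabs_pos_eq; lra).
  split.
  - specialize (H0 (e1 + s) t1 e1 t1 I I). specialize (H1' (e1 + s) t1 e1 t1 I I).
    replace (e1 + s - e1) with s in * by ring. rewrite Rminus_diag, Rabs_R0, Hab in *.
    assert (A0 := H0 ltac:(split; apply Rabs_def1; lra) ltac:(split; apply Rabs_def1; lra)).
    assert (A1 := H1' ltac:(split; apply Rabs_def1; lra) ltac:(split; apply Rabs_def1; lra)).
    apply Rmult_le_reg_r with s; [lra|]. rewrite <- Hab at 1. rewrite <- Rabs_mult.
    replace ((a1 - a) * s) with ((P (e1 + s) t1 - P e1 t1 - (a * s + b * 0))
      - (P (e1 + s) t1 - P e1 t1 - (a1 * s + b1 * 0))) by ring.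
    eapply Rle_trans; [apply Rabs_triang|]. rewrite Rabs_Ropp. lra.
  - specialize (H0 e1 (t1 + s) e1 t1 I I). specialize (H1' e1 (t1 + s) e1 t1 I I).
    replace (t1 + s - t1) with s in * by ring. rewrite Rminus_diag, Rabs_R0, Hab in *.
    assert (A0 := H0 ltac:(split; apply Rabs_def1; lra) ltac:(split; apply Rabs_def1; lra)).
    assert (A1 := H1' ltac:(split; apply Rabs_def1; lra) ltac:(split; apply Rabs_def1; lra)).
    apply Rmult_le_reg_r with s; [lra|]. rewrite <- Hab at 1. rewrite <- Rabs_mult.
    replace ((b1 - b) * s) with ((P e1 (t1 + s) - P e1 t1 - (a * 0 + b * s))
      - (P e1 (t1 + s) - P e1 t1 - (a1 * 0 + b1 * s))) by ring.
    eapply Rle_trans; [apply Rabs_triang|]. rewrite Rabs_Ropp. lra.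
Qed.

Lemma C1_strip_of_sd2 eb P :
  (forall e t, Rabs e < eb -> exists a b, sd2 (fun _ _ => True) P e t a b) -> C1_strip eb P.
Proof.
  intros H e0 t0 He0. destruct (H e0 t0 He0) as [a [b H0]].
  destruct (sd2_is_derive P e0 t0 a b H0) as [D1 D2].
  split; [exists a; exact D1|]. split; [exists b; exact D2|].
  assert (Hc : forall om : posreal, locally_2d (fun e t =>
    Rabs (Derive (fun e' => P e' t) e - a) < om /\ Rabs (Derive (fun t' => P e t') t - b) < om) e0 t0).
  { intros om. destruct (sd2_partials_close P e0 t0 a b (om / 2) H0) as [dl [Hdl HC]].
    { generalize (cond_pos om). lra. }
    assert (Hr : 0 < Rmin dl (eb - Rabs e0)) by (apply Rmin_glb_lt; lra).
    exists (mkposreal _ Hr). intros e t He Ht. simpl in He, Ht.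
    assert (Hdl' := Rmin_l dl (eb - Rabs e0)). assert (Hdl'' := Rmin_r dl (eb - Rabs e0)).
    assert (Heb : Rabs e < eb).
    { replace e with ((e - e0) + e0) by ring. eapply Rle_lt_trans; [apply Rabs_triang|]. lra. }
    destruct (H e t Heb) as [a1 [b1 H1]].
    destruct (sd2_is_derive P e t a1 b1 H1) as [E1 E2].
    replace (Derive (fun e' => P e' t) e) with a1 by (symmetry; exact (is_derive_unique _ _ _ E1)).
    replace (Derive (fun t' => P e t') t) with b1 by (symmetry; exact (is_derive_unique _ _ _ E2)).
    destruct (HC e t a1 b1 ltac:(split; lra) H1). generalize (cond_pos om). lra. }
  assert (E1 : Derive (fun e' => P e' t0) e0 = a) by exact (is_derive_unique _ _ _ D1).
  assert (E2 : Derive (fun t' => P e0 t') t0 = b) by exact (is_derive_unique _ _ _ D2).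
  split; intros om; destruct (Hc om) as [d Hd]; exists d; intros e t He Ht;
    rewrite ?E1, ?E2; apply Hd; assumption.
Qed.

Lemma sd2_shift P e0 t0 a b T : (forall e t, P e (t + T) = P e t) ->
  sd2 (fun _ _ => True) P e0 t0 a b -> sd2 (fun _ _ => True) P e0 (t0 + T) a b.
Proof.
  intros HT H om Hom. destruct (H om Hom) as [dl [Hdl H']]. exists dl. split; [exact Hdl|].
  intros e1 t1 e2 t2 _ _ [A1 A2] [B1 B2].
  specialize (H' e1 (t1 - T) e2 (t2 - T) I I).
  replace (t1 - T - (t2 - T)) with (t1 - t2) in H' by ring.
  replace (t1 - T + T) with t1 by ring. replace (t2 - T + T) with t2 by ring.
  replace t1 with (t1 - T + T) at 1 by ring. replace t2 with (t2 - T + T) at 1 by ring.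
  rewrite !HT. apply H'.
  - split; [exact A1|]. replace (t1 - T - t0) with (t1 - (t0 + T)) by ring. exact A2.
  - split; [exact B1|]. replace (t2 - T - t0) with (t2 - (t0 + T)) by ring. exact B2.
Qed.

(** * The branch of closed orbits *)

(** A function that is C1-close to a positive arch p0 and vanishes at both ends
    is positive inside: away from the ends by closeness of the values, near the
    ends by the slopes, which are bounded away from 0. *)
Lemma positive_profile (p0 dp0 : R -> R) :
  (forall u, continuous p0 u) -> (forall u, continuous dp0 u) ->
  (forall u, 0 < u < 1 -> 0 < p0 u) -> 0 < dp0 0 -> dp0 1 < 0 ->
  exists k, 0 < k /\ forall p dp : R -> R, (forall u, continuous p u) ->
    (forall u, 0 < u < 1 -> is_derive p u (dp u)) -> p 0 = 0 -> p 1 = 0 ->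
    (forall u, 0 <= u <= 1 -> Rabs (p u - p0 u) <= k /\ Rabs (dp u - dp0 u) <= k) ->
    forall u, 0 < u < 1 -> 0 < p u.
Proof.
  intros Hp0 Hd0 Hpos H0 H1.
  destruct (proj1 (continuous_eps_delta dp0 0) (Hd0 0) (dp0 0 / 2) ltac:(lra)) as [a1 [A1 B1]].
  destruct (proj1 (continuous_eps_delta dp0 1) (Hd0 1) (- dp0 1 / 2) ltac:(lra)) as [a2 [A2 B2]].
  destruct (below3 (1 / 4) (a1 / 2) (a2 / 2)) as [a Ha]; try lra.
  destruct (continuity_ab_min p0 a (1 - a)) as [m [Hm1 Hm2]].
  { lra. } { intros c _. apply continuity_pt_filterlim, Hp0. }
  assert (Pm := Hpos m ltac:(lra)).
  destruct (below3 (p0 m / 2) (dp0 0 / 4) (- dp0 1 / 4)) as [k Hk]; try lra.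
  exists k. split; [lra|]. intros p dp Hp Hd P0 P1 Hc u Hu.
  assert (Hmvt : forall x y, 0 <= x -> x < y -> y <= 1 -> exists c, x <= c <= y /\ p y - p x = dp c * (y - x)).
  { intros x y X1 X2 X3. destruct (MVT_gen p x y dp) as [c [C1 C2]].
    - intros w Hw. rewrite Rmin_left, Rmax_right in Hw by lra. apply Hd. lra.
    - intros w _. apply continuity_pt_filterlim, Hp.
    - rewrite Rmin_left, Rmax_right in C1 by lra. exists c. auto. }
  destruct (Rle_lt_dec u a) as [L|L]; [|destruct (Rle_lt_dec u (1 - a)) as [L'|L']].
  - destruct (Hmvt 0 u) as [c [C1 C2]]; try lra.
    specialize (B1 c ltac:(rewrite Rminus_0_r, Rabs_pos_eq; lra)). apply Rabs_def2 in B1.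
    destruct (Hc c ltac:(lra)) as [_ E]. apply Rabs_le_between in E.
    rewrite P0, Rminus_0_r, Rminus_0_r in C2. rewrite C2. apply Rmult_lt_0_compat; lra.
  - destruct (Hc u ltac:(lra)) as [E _]. apply Rabs_le_between in E. specialize (Hm1 u ltac:(lra)). lra.
  - destruct (Hmvt u 1) as [c [C1 C2]]; try lra.
    specialize (B2 c ltac:(apply Rabs_def1; lra)). apply Rabs_def2 in B2.
    destruct (Hc c ltac:(lra)) as [_ E]. apply Rabs_le_between in E.
    rewrite P1 in C2. assert (dp c * (1 - u) < 0) by nra. lra.
Qed.

Section Branch.
Context (eta alpha h v : R) (f : R -> R -> R -> R) (phi0 : R).
Local Notation tau := (phase_length h).
Local Notation X := (position_profile eta alpha h).
Local Notation Y := (velocity_profile eta alpha h).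
Local Notation N := (force_profile eta alpha h f).
Local Notation B := (closing_moment eta alpha h f).
Local Notation E3 := (closing_defect eta alpha h f).
Local Notation F := (newton_map eta alpha h v f phi0).
Local Notation base := (base_state eta alpha h v f phi0).
Local Notation Mel := (melnikov_SCQ eta alpha h v f).
Local Notation periodic_state := (periodic_state eta alpha h f).

Context (hf : C1_R3 f) (D : half_period_data eta alpha h v)
  (M0 : Mel phi0 = 0) (M1 : Derive Mel phi0 <> 0).

Lemma h_pos : 0 < h.
Proof. apply (hp_pos _ _ _ _ D). Qed.

(** The derivative of the position profile with respect to the fraction u. *)
Definition stretched_velocity (s : bool) (u : R) (z : state) : R := tau s z * Y s u z.
Local Notation stretched := stretched_velocity.

Lemma sdiff_stretched z s : good z -> sdiff z (stretched s).
Proof. intros Gz. apply (sdiff_mult z Gz); [apply sdiff_tau|apply sdiff_Y]; exact Gz. Qed.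

Lemma X_base_profile s u : X s u base = orbit_x eta alpha v (h * clamp u).
Proof. rewrite X_unforced, tau_base by reflexivity. reflexivity. Qed.

Lemma Y_base_profile s u : Y s u base = orbit_y eta alpha v (h * clamp u).
Proof. rewrite Y_unforced, tau_base by reflexivity. reflexivity. Qed.

Lemma base_profile_positive : exists k, 0 < k /\ forall p dp : R -> R, (forall u, continuous p u) ->
    (forall u, 0 < u < 1 -> is_derive p u (dp u)) -> p 0 = 0 -> p 1 = 0 ->
    (forall u, 0 <= u <= 1 -> Rabs (p u - orbit_x eta alpha v (h * u)) <= k /\
       Rabs (dp u - h * orbit_y eta alpha v (h * u)) <= k) ->
    forall u, 0 < u < 1 -> 0 < p u.
Proof.
  generalize h_pos (hp_v_pos _ _ _ _ D). intros Hh Hv.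
  assert (Hs : forall u, continuous (fun u => h * u) u).
  { intros u. apply (is_derive_continuous _ _ h). auto_derive; auto; ring. }
  apply (positive_profile (fun u => orbit_x eta alpha v (h * u)) (fun u => h * orbit_y eta alpha v (h * u))).
  - intros u. apply (continuous_comp (fun u => h * u) (orbit_x eta alpha v)); [apply Hs|apply x0_continuous].
  - intros u. apply continuous_Rscal.
    apply (continuous_comp (fun u => h * u) (orbit_y eta alpha v)); [apply Hs|apply y0_continuous].
  - intros u Hu. apply (hp_positive _ _ _ _ D). nra.
  - unfold orbit_y. rewrite Rmult_0_r, Sf_0, Cf_0. nra.
  - rewrite Rmult_1_r, (y0_h eta alpha h v D). nra.
Qed.

Lemma fixed_point_rows e z : (forall i, F e z i = z i) ->
  (forall s, X s 1 z = 0) /\ E3 z = 0 /\ (forall s u, N s u z = z (cG s u)) /\ z cEps = e.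
Proof.
  intros H. assert (Hv := hp_v_pos _ _ _ _ D). assert (HS := hp_S_full_neq _ _ _ _ D).
  assert (HT := H cTau). assert (HY := H cY0). assert (HP := H cPhi). assert (HE := H cEps).
  simpl in HT, HY, HP, HE.
  assert (H1 : (X true 1 z - X false 1 z) * / (2 * v) = 0) by lra.
  assert (H2 : (X true 1 z + X false 1 z) * / (2 * Sf eta h) = 0) by lra.
  assert (H3 : E3 z * / kappa eta alpha h v f phi0 = 0) by lra.
  apply Rmult_integral in H1, H2, H3.
  destruct H1 as [H1|H1]; [|exfalso; revert H1; apply Rinv_neq_0_compat; lra].
  destruct H2 as [H2|H2]; [|exfalso; revert H2; apply Rinv_neq_0_compat; lra].
  destruct H3 as [H3|H3]; [|exfalso; revert H3; apply Rinv_neq_0_compat, (kappa_neq eta alpha h v f phi0 D M1)].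
  split; [intros [|]; lra|]. split; [exact H3|]. split; [|auto].
  intros s u. apply (H (cG s u)).
Qed.

(** The rows give arrival at x = 0 and a vanishing closing defect; multiplied
    by eps, the latter says that the arrival velocities agree, also when eps =
    0. *)
Lemma closed_of_fixed_point e z : (forall i, F e z i = z i) -> good z ->
  (forall s, 0 < tau s z) -> (forall s, Sf eta (tau s z) <> 0) -> periodic_state z.
Proof.
  intros H Gz Ht HS. destruct (fixed_point_rows e z H) as [HX [HE [HN _]]].
  split; auto.
  assert (At := arrival_velocity eta alpha h f true z (HN true) (HX true)).
  assert (Af := arrival_velocity eta alpha h f false z (HN false) (HX false)).
  unfold closing_defect in HE. assert (St := HS true). assert (Sfl := HS false).
  set (a := Sf eta (tau true z)) in *. set (b := Sf eta (tau false z)) in *.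
  assert (E : a * b * (z cY0 + Y true 1 z) = a * b * (z cY0 + Y false 1 z)).
  { replace (a * b * (z cY0 + Y true 1 z)) with (b * (a * (z cY0 + Y true 1 z))) by ring.
    replace (a * b * (z cY0 + Y false 1 z)) with (a * (b * (z cY0 + Y false 1 z))) by ring.
    rewrite At, Af. replace (b * (z cEps * B true z)) with (z cEps * (b * B true z)) by ring.
    replace (b * B true z) with (a * B false z) by lra. ring. }
  apply Rmult_eq_reg_l in E; [lra|]. apply Rmult_integral_contrapositive_currified; assumption.
Qed.

(** Near the unperturbed orbit the phases have positive lengths, S does not
    vanish at them, and the profiles are C1-close to the unperturbed arch,
    hence positive. *)
Lemma closed_branch : exists (rho r L : R) (zz : R -> state), 0 < rho /\ 0 < r /\ 0 <= L /\
  (forall e, Rabs e < rho -> periodic_state (zz e) /\ zz e cEps = e /\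
     (forall s u, 0 < u < 1 -> 0 < X s u (zz e))) /\
  (forall e p, Rabs e < rho -> good p -> near r p base -> (forall i, F e p i = p i) ->
     forall i, p i = zz e i) /\
  (forall e1 e2, Rabs e1 < rho -> Rabs e2 < rho -> near (L * Rabs (e1 - e2)) (zz e1) (zz e2)) /\
  (forall i, zz 0 i = base i) /\
  (forall e0, Rabs e0 < rho -> exists xi, good xi /\ forall om, 0 < om -> exists dl, 0 < dl /\
    forall e1 e2, Rabs (e1 - e0) <= dl -> Rabs (e2 - e0) <= dl ->
    forall i, Rabs (zz e1 i - zz e2 i - xi i * (e1 - e2)) <= om * Rabs (e1 - e2)).
Proof.
  destruct (branch_of_states eta alpha h v f phi0 hf D M0 M1)
    as [rho [r [L [zz [Hrho [Hr [HL [Zf [Zu [Zl [Zb Zd]]]]]]]]]]].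
  assert (Hh := h_pos). assert (HSh := hp_S_full_neq _ _ _ _ D).
  assert (Gb := good_base eta alpha h v f phi0 hf).
  destruct (proj1 (continuous_eps_delta (Sf eta) h) (Sf_continuous eta h) (Rabs (Sf eta h)))
    as [dS [HdS HS]]. { apply Rabs_pos_lt, HSh. }
  destruct base_profile_positive as [k [Hk Hpos]].
  assert (Hprof : forall s, exists K dl, 0 <= K /\ 0 < dl /\ forall p d u, good p -> near dl p base ->
    near d p base -> Rabs (X s u p - X s u base) <= K * d /\
      Rabs (stretched s u p - stretched s u base) <= K * d).
  { intros s. destruct (sdiff_X eta alpha h base Gb s) as [L1 H1].
    destruct (sdiff_stretched base s Gb) as [L2 H2].
    destruct (strict_diff_lipschitz _ _ _ H1) as [K1 [d1 [PK1 [Pd1 Lp1]]]].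
    destruct (strict_diff_lipschitz _ _ _ H2) as [K2 [d2 [PK2 [Pd2 Lp2]]]].
    exists (K1 + K2), (Rmin d1 d2). split; [lra|]. split; [apply Rmin_glb_lt; assumption|].
    intros p d u Gp Np Nd. assert (Hd := near_d_nonneg _ _ _ Nd).
    assert (T1 := Lp1 p base d u Gp Gb (near_le _ _ _ _ (Rmin_l d1 d2) Np) (near_refl _ _ (Rlt_le _ _ Pd1)) Nd).
    assert (T2 := Lp2 p base d u Gp Gb (near_le _ _ _ _ (Rmin_r d1 d2) Np) (near_refl _ _ (Rlt_le _ _ Pd2)) Nd).
    split; nra. }
  destruct (Hprof true) as [K1 [d1 [PK1 [Pd1 Lp1]]]]. destruct (Hprof false) as [K2 [d2 [PK2 [Pd2 Lp2]]]].
  assert (Hm0 : 0 < k / (K1 + K2 + 1)) by (apply Rdiv_lt_0_compat; lra).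
  destruct (below5 (h / 2) (dS / 2) d1 d2 (k / (K1 + K2 + 1))) as [m [Q0 [Q1 [Q2 [Q3 [Q4 Q5]]]]]]; try lra.
  set (rho' := Rmin rho (m / (L + 1))).
  assert (Hrho' : 0 < rho') by (apply Rmin_glb_lt; [lra|apply Rdiv_lt_0_compat; lra]).
  assert (Hle : rho' <= rho) by apply Rmin_l.
  exists rho', r, L, zz. split; [exact Hrho'|]. split; [exact Hr|]. split; [exact HL|].
  split; [|split; [|split; [|split]]].
  - intros e He. destruct (Zf e ltac:(lra)) as [Gz Fz].
    assert (Nz : near m (zz e) base).
    { intros i. rewrite <- Zb. assert (Hi := Zl e 0 ltac:(lra) ltac:(rewrite Rabs_R0; lra) i).
      rewrite Rminus_0_r in Hi. eapply Rle_trans; [exact Hi|].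
      apply Rle_trans with ((L + 1) * (m / (L + 1))); [|right; field; lra].
      assert (Rabs e < m / (L + 1)) by (eapply Rlt_le_trans; [exact He|apply Rmin_r]).
      apply Rmult_le_compat; try lra. apply Rabs_pos. }
    assert (Htau : forall s, Rabs (tau s (zz e) - h) <= m).
    { intros s. specialize (Nz cTau). simpl in Nz.
      destruct s; simpl; [exact Nz|]. rewrite Rabs_minus_sym.
      replace (h - (2 * h - zz e cTau)) with (zz e cTau - h) by ring. exact Nz. }
    assert (Htpos : forall s, 0 < tau s (zz e)).
    { intros s. specialize (Htau s). apply Rabs_le_between in Htau. lra. }
    assert (Cz : periodic_state (zz e)).
    { apply (closed_of_fixed_point e); auto. intros s H0.
      specialize (HS (tau s (zz e)) ltac:(specialize (Htau s); lra)).
      rewrite H0, Rminus_0_l, Rabs_Ropp in HS. lra. }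
    split; [exact Cz|]. split; [apply (fixed_point_rows e (zz e) Fz)|].
    intros s. apply (Hpos (fun u => X s u (zz e)) (fun u => stretched s u (zz e))).
    + intros u. apply (XY_continuous eta alpha h s (zz e) Gz u).
    + intros u Hu. apply X_derive; assumption.
    + apply X_0.
    + apply (cl_X1 _ _ _ _ _ Cz).
    + intros u Hu.
      assert (HX : orbit_x eta alpha v (h * u) = X s u base) by (rewrite X_base_profile, clamp_id; auto).
      assert (HY : h * orbit_y eta alpha v (h * u) = stretched s u base)
        by (unfold stretched; rewrite Y_base_profile, clamp_id, tau_base; auto).
      rewrite HX, HY.
      assert (HK : K1 * m <= k /\ K2 * m <= k).
      { assert ((K1 + K2 + 1) * m <= k).
        { apply Rle_trans with ((K1 + K2 + 1) * (k / (K1 + K2 + 1))); [|right; field; lra].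
          apply Rmult_le_compat_l; lra. }
        split; nra. }
      destruct s.
      * destruct (Lp1 (zz e) m u Gz (near_le _ _ _ _ Q3 Nz) Nz). lra.
      * destruct (Lp2 (zz e) m u Gz (near_le _ _ _ _ Q4 Nz) Nz). lra.
  - intros e p He. apply Zu. lra.
  - intros e1 e2 H1 H2. apply Zl; lra.
  - exact Zb.
  - intros e0 He0. apply Zd. lra.
Qed.
End Branch.

(** * Smoothness of the branch across the switching times *)

Section JointSmoothness.
Context (eta alpha h : R) (f : R -> R -> R -> R) (h_pos : 0 < h).
Local Notation tau := (phase_length h).
Local Notation X := (position_profile eta alpha h).
Local Notation Y := (velocity_profile eta alpha h).
Local Notation periodic_state := (periodic_state eta alpha h f).
Local Notation position_at := (position_at eta alpha h).
Local Notation velocity_at := (velocity_at eta alpha h).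
Local Notation stretched := (stretched_velocity eta alpha h).

Context (rho L : R) (zz : R -> state) (HL : 0 <= L)
  (Zc : forall e, Rabs e < rho -> periodic_state (zz e))
  (Zl : forall e1 e2, Rabs e1 < rho -> Rabs e2 < rho -> near (L * Rabs (e1 - e2)) (zz e1) (zz e2))
  (Zd : forall e0, Rabs e0 < rho -> exists xi, good xi /\ forall om, 0 < om -> exists dl, 0 < dl /\
    forall e1 e2, Rabs (e1 - e0) <= dl -> Rabs (e2 - e0) <= dl ->
    forall i, Rabs (zz e1 i - zz e2 i - xi i * (e1 - e2)) <= om * Rabs (e1 - e2)).

Lemma coord_sd1 e0 i : Rabs e0 < rho -> exists c', sd1 (fun e => zz e i) e0 c'.
Proof.
  intros He0. destruct (Zd e0 He0) as [xi [_ H]]. exists (xi i).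
  intros om Hom. destruct (H om Hom) as [dl [Hdl H']]. exists dl. split; [exact Hdl|].
  intros e1 e2 H1 H2. apply H'; lra.
Qed.

Lemma tau_sd1 e0 s : Rabs e0 < rho -> exists c', sd1 (fun e => tau s (zz e)) e0 c'.
Proof.
  intros He0. destruct (coord_sd1 e0 cTau He0) as [c' Hc]. destruct s.
  - exists c'. exact Hc.
  - exists (- c'). intros om Hom. destruct (Hc om Hom) as [dl [Hdl H]]. exists dl. split; [exact Hdl|].
    intros e1 e2 H1 H2. simpl.
    replace (2 * h - zz e1 cTau - (2 * h - zz e2 cTau) - - c' * (e1 - e2)) with
      (- (zz e1 cTau - zz e2 cTau - c' * (e1 - e2))) by ring.
    rewrite Rabs_Ropp. apply H; assumption.
Qed.

Lemma sd1_plus c1 c2 e0 a b : sd1 c1 e0 a -> sd1 c2 e0 b -> sd1 (fun e => c1 e + c2 e) e0 (a + b).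
Proof.
  intros H1 H2 om Hom.
  destruct (H1 (om / 2) ltac:(lra)) as [d1 [P1 K1]]. destruct (H2 (om / 2) ltac:(lra)) as [d2 [P2 K2]].
  exists (Rmin d1 d2). split; [apply Rmin_glb_lt; assumption|].
  intros e1 e2 E1 E2. apply Rmin_Rgt in E1, E2.
  specialize (K1 e1 e2 ltac:(lra) ltac:(lra)). specialize (K2 e1 e2 ltac:(lra) ltac:(lra)).
  replace (c1 e1 + c2 e1 - (c1 e2 + c2 e2) - (a + b) * (e1 - e2)) with
    ((c1 e1 - c1 e2 - a * (e1 - e2)) + (c2 e1 - c2 e2 - b * (e1 - e2))) by ring.
  eapply Rle_trans; [apply Rabs_triang|]. lra.
Qed.

Lemma sd1_const k e0 : sd1 (fun _ => k) e0 0.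
Proof.
  intros om Hom. exists 1. split; [lra|]. intros e1 e2 _ _.
  replace (k - k - 0 * (e1 - e2)) with 0 by ring. rewrite Rabs_R0.
  apply Rmult_le_pos; [lra|apply Rabs_pos].
Qed.

(** Combine the strict derivative of the profile in the state, the strict
    derivative of the state in e, and the continuity of the velocity in both
    variables. *)
Lemma profile_sd2 s e0 u0 : Rabs e0 < rho -> 0 <= u0 <= 1 -> exists a,
  sd2 (fun e u => Rabs e < rho /\ 0 <= u <= 1) (fun e u => X s u (zz e)) e0 u0
    a (stretched s u0 (zz e0)).
Proof.
  intros He0 Hu0. set (z := zz e0).
  assert (Gz : good z) by apply (cl_good _ _ _ _ _ (Zc e0 He0)).
  destruct (sdiff_X eta alpha h z Gz s) as [L1 H1].
  destruct (sdiff_stretched eta alpha h z s Gz) as [L2 H2].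
  destruct (Zd e0 He0) as [xi [Gxi Hxi]].
  exists (L1 u0 xi). intros om Hom.
  destruct (sd_bounded _ _ _ H1) as [K1 [PK1 B1]].
  destruct (strict_diff_lipschitz _ _ _ H2) as [K2 [g2 [PK2 [Pg2 Lp2]]]].
  set (om1 := om / (4 * (L + 1))). assert (Pom1 : 0 < om1) by (apply Rdiv_lt_0_compat; lra).
  set (om2 := om / (4 * (K1 + 1))). assert (Pom2 : 0 < om2) by (apply Rdiv_lt_0_compat; lra).
  destruct (sd_strict _ _ _ H1 om1 Pom1) as [g1 [Pg1 S1]].
  destruct (Hxi om2 Pom2) as [g3 [Pg3 S3]].
  destruct (proj1 (continuous_eps_delta _ u0) (sd_lin_continuous _ _ _ H1 xi Gxi u0) (om / 4) ltac:(lra)) as [g4 [Pg4 S4]].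
  destruct (proj1 (continuous_eps_delta _ u0) (sd_continuous _ _ _ H2 z Gz u0) (om / 2) ltac:(lra)) as [g5 [Pg5 S5]].
  destruct (below3 g1 g2 (om / (2 * (K2 + 1)))) as [q [Pq Hq]]; try assumption;
    [apply Rdiv_lt_0_compat; lra|].
  assert (Pql : 0 < q / (L + 1)) by (apply Rdiv_lt_0_compat; lra).
  destruct (below4 g3 (q / (L + 1)) g4 g5) as [dl [Pdl Hdl]]; try assumption.
  exists dl. split; [exact Pdl|].
  intros e1 u1 e2 u2 [R1 U1] [R2 U2] [C1 C1'] [C2 C2'].
  assert (Hnear : forall e, Rabs e < rho -> Rabs (e - e0) < dl -> near q (zz e) z).
  { intros e He Hc i. eapply Rle_trans; [apply (Zl e e0 He He0)|].
    apply Rle_trans with ((L + 1) * (q / (L + 1))); [|right; field; lra].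
    apply Rmult_le_compat; try lra. apply Rabs_pos. }
  assert (G1 : good (zz e1)) by apply (cl_good _ _ _ _ _ (Zc e1 R1)).
  assert (G2 : good (zz e2)) by apply (cl_good _ _ _ _ _ (Zc e2 R2)).
  assert (N1 := Hnear e1 R1 C1). assert (N2 := Hnear e2 R2 C2).
  assert (N12 := Zl e1 e2 R1 R2).
  assert (T1 := S1 (zz e1) (zz e2) _ u1 G1 G2 (near_le _ _ _ _ (proj1 Hq) N1) (near_le _ _ _ _ (proj1 Hq) N2) N12).
  set (k := comb 1 (zz e1) (-1) (zz e2)) in *.
  assert (Gk : good k) by (apply good_comb; assumption).
  assert (T2 : Rabs (L1 u1 k - (e1 - e2) * L1 u1 xi) <= K1 * (om2 * Rabs (e1 - e2))).
  { replace (L1 u1 k - (e1 - e2) * L1 u1 xi) with (L1 u1 (comb 1 k (- (e1 - e2)) xi))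
      by (rewrite (sd_linear _ _ _ H1) by assumption; ring).
    apply B1; [apply good_comb; assumption|]. intros i. unfold comb, k.
    replace (1 * comb 1 (zz e1) (-1) (zz e2) i + - (e1 - e2) * xi i) with
      (zz e1 i - zz e2 i - xi i * (e1 - e2)) by (unfold comb; ring).
    apply S3; lra. }
  assert (T3 := S4 u1 ltac:(lra)).
  assert (T4 : Rabs (X s u1 (zz e2) - X s u2 (zz e2) - stretched s u0 z * (u1 - u2)) <= om * Rabs (u1 - u2)).
  { set (w := fun u => X s u (zz e2) - stretched s u0 z * u).
    replace (X s u1 (zz e2) - X s u2 (zz e2) - stretched s u0 z * (u1 - u2)) with (w u1 - w u2) by (unfold w; ring).
    destruct (MVT_gen w u2 u1 (fun u => stretched s u (zz e2) - stretched s u0 z)) as [c [Hc1 Hc2]].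
    - intros u Hu. assert (0 < u < 1).
      { revert Hu. unfold Rmin, Rmax. destruct (Rle_dec u2 u1); lra. }
      apply (is_derive_Rminus (fun u => X s u (zz e2)) (fun u => stretched s u0 z * u)).
      + apply X_derive; assumption.
      + auto_derive; auto; ring.
    - intros u _. apply continuity_pt_filterlim.
      apply (continuous_Rminus (fun u => X s u (zz e2)) (fun u => stretched s u0 z * u)).
      + apply (XY_continuous eta alpha h s (zz e2) G2 u).
      + apply (is_derive_continuous _ _ (stretched s u0 z)). auto_derive; auto; ring.
    - rewrite Hc2, Rabs_mult. apply Rmult_le_compat_r; [apply Rabs_pos|].
      assert (Hcu : Rabs (c - u0) < g5).
      { assert (Hc3 := between_box u1 u2 c u0 dl C1' C2' Hc1). lra. }
      specialize (S5 c Hcu).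
      assert (Lp := Lp2 (zz e2) z q c G2 Gz (near_le _ _ _ _ (proj1 (proj2 Hq)) N2)
        (near_refl _ _ (Rlt_le _ _ Pg2)) N2).
      assert (K2 * q <= om / 2).
      { apply Rle_trans with ((K2 + 1) * (om / (2 * (K2 + 1)))); [|right; field; lra].
        apply Rmult_le_compat; lra. }
      replace (stretched s c (zz e2) - stretched s u0 z) with
        ((stretched s c (zz e2) - stretched s c z) + (stretched s c z - stretched s u0 z)) by ring.
      eapply Rle_trans; [apply Rabs_triang|]. lra. }
  fold z. set (W := stretched s u0 z) in *.
  set (de := Rabs (e1 - e2)) in *. assert (Pde : 0 <= de) by apply Rabs_pos.
  replace (X s u1 (zz e1) - X s u2 (zz e2) - (L1 u0 xi * (e1 - e2) + W * (u1 - u2))) with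
    ((X s u1 (zz e1) - X s u1 (zz e2) - L1 u1 k) + (L1 u1 k - (e1 - e2) * L1 u1 xi)
     + (L1 u1 xi - L1 u0 xi) * (e1 - e2)
     + (X s u1 (zz e2) - X s u2 (zz e2) - W * (u1 - u2))) by ring.
  eapply Rle_trans; [apply Rabs_triang|].
  eapply Rle_trans; [apply Rplus_le_compat_r, Rabs_triang|].
  eapply Rle_trans; [apply Rplus_le_compat_r, Rplus_le_compat_r, Rabs_triang|].
  rewrite (Rabs_mult (L1 u1 xi - L1 u0 xi)). fold de.
  assert (E1 : om1 * (L * de) <= om / 4 * de).
  { apply Rle_trans with (om1 * ((L + 1) * de)); [apply Rmult_le_compat_l; nra|]. right. unfold om1. field. lra. }
  assert (E2 : K1 * (om2 * de) <= om / 4 * de).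
  { apply Rle_trans with ((K1 + 1) * (om2 * de)); [apply Rmult_le_compat_r; nra|]. right. unfold om2. field. lra. }
  assert (E3 : Rabs (L1 u1 xi - L1 u0 xi) * de <= om / 4 * de) by (apply Rmult_le_compat_r; lra).
  assert (0 <= om * de) by (apply Rmult_le_pos; lra). lra.
Qed.

(** The fraction of phase s elapsed at time t, when the phase starts (in its
    own direction of time) at the crossing cPhi + T. *)
Definition phase_time (s : bool) (T e t : R) : R := sg s * (t - (zz e cPhi + T)) * / tau s (zz e).
Definition phase_domain (s : bool) (T e t : R) : Prop :=
  Rabs e < rho /\ 0 <= sg s * (t - (zz e cPhi + T)) <= tau s (zz e).

Lemma phase_time_range s T e t : phase_domain s T e t -> 0 <= phase_time s T e t <= 1.
Proof.
  intros [He [H1 H2]]. assert (Ht := cl_tau _ _ _ _ _ (Zc e He) s). unfold phase_time. split.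
  - apply Rmult_le_pos; [exact H1|]. apply Rlt_le, Rinv_0_lt_compat, Ht.
  - apply Rmult_le_reg_r with (tau s (zz e)); [exact Ht|]. rewrite Rmult_assoc, Rinv_l by lra. lra.
Qed.

Lemma phase_sd2 s T e0 t0 : phase_domain s T e0 t0 -> exists a,
  sd2 (phase_domain s T) (fun e t => sg s * X s (phase_time s T e t) (zz e)) e0 t0
    a (Y s (phase_time s T e0 t0) (zz e0)).
Proof.
  intros HD. assert (He0 := proj1 HD). assert (Ht := cl_tau _ _ _ _ _ (Zc e0 He0) s).
  destruct (coord_sd1 e0 cPhi He0) as [p' Hp]. destruct (tau_sd1 e0 s He0) as [t' Htau].
  assert (Hpsi := sd1_plus _ _ _ _ _ Hp (sd1_const T e0)).
  assert (Hlin := sd2_scal_minus (phase_domain s T) (sg s) _ _ _ _ _ _ _ _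
    (sd2_snd (phase_domain s T) e0 t0) (sd2_of_sd1 (phase_domain s T) _ e0 t0 _ Hpsi)).
  assert (Hinv := sd2_of_sd1 (phase_domain s T) _ e0 t0 _ (sd1_inv _ _ _ Htau Ht)).
  assert (Hu := sd2_mult _ _ _ _ _ _ _ _ _ HD Hlin Hinv).
  destruct (profile_sd2 s e0 (phase_time s T e0 t0) He0 (phase_time_range _ _ _ _ HD)) as [a Ha].
  assert (Hc := sd2_comp _ (phase_domain s T) _ (phase_time s T) e0 t0 _ _ _ _ _ HD eq_refl Ha Hu).
  specialize (Hc (fun e t H => conj (proj1 H) (phase_time_range s T e t H))).
  assert (Hs := sd2_scal_minus (phase_domain s T) (sg s) _ _ _ _ _ _ _ _ Hc
    (sd2_of_sd1 (phase_domain s T) _ e0 t0 _ (sd1_const 0 e0))).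
  eexists. intros om Hom. destruct (Hs om Hom) as [dl [Hdl H]]. exists dl. split; [exact Hdl|].
  intros e1 t1 e2 t2 D1 D2 C1 C2. specialize (H e1 t1 e2 t2 D1 D2 C1 C2).
  rewrite !Rminus_0_r in H.
  match type of H with Rabs (_ - (?A * _ + ?B * _)) <= _ =>
    replace B with (Y s (phase_time s T e0 t0) (zz e0)) in H end.
  - exact H.
  - unfold stretched_velocity. assert (Hsg : sg s * sg s = 1) by (destruct s; simpl; ring).
    transitivity (sg s * sg s * Y s (phase_time s T e0 t0) (zz e0)); [rewrite Hsg; ring|].
    field. lra.
Qed.

Lemma phase_upper e t : phase_domain true 0 e t ->
  position_at (zz e) t = sg true * X true (phase_time true 0 e t) (zz e) /\
  velocity_at (zz e) t = Y true (phase_time true 0 e t) (zz e).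
Proof.
  intros [He Hd]. simpl sg in *. destruct (upper_piece eta alpha h f h_pos (zz e) (Zc e He) t) as [-> ->]; [lra|].
  replace (phase_time true 0 e t) with (upper_time h (zz e) t)
    by (unfold phase_time, upper_time, Rdiv; simpl; ring).
  simpl; split; ring.
Qed.

Lemma phase_lower e t : phase_domain false (2 * h) e t ->
  position_at (zz e) t = sg false * X false (phase_time false (2 * h) e t) (zz e) /\
  velocity_at (zz e) t = Y false (phase_time false (2 * h) e t) (zz e).
Proof.
  intros [He Hd]. simpl sg in *. assert (Hs := tau_sum h (zz e)).
  destruct (lower_piece eta alpha h f h_pos (zz e) (Zc e He) t) as [-> ->]; [lra|].
  replace (phase_time false (2 * h) e t) with (lower_time h (zz e) t)
    by (unfold phase_time, lower_time, Rdiv; simpl; ring).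
  simpl sg; split; ring.
Qed.

(** The phase in x < 0 that precedes the entry at cPhi, needed for a
    neighbourhood of that crossing. *)
Lemma phase_previous e t : phase_domain false 0 e t ->
  position_at (zz e) t = sg false * X false (phase_time false 0 e t) (zz e) /\
  velocity_at (zz e) t = Y false (phase_time false 0 e t) (zz e).
Proof.
  intros [He Hd]. destruct (position_velocity_shift eta alpha h h_pos (zz e) t 1) as [<- <-].
  destruct (phase_lower e (t + 1 * (2 * h))) as [-> ->].
  - split; [exact He|]. simpl sg in *. lra.
  - replace (phase_time false (2 * h) e (t + 1 * (2 * h))) with (phase_time false 0 e t)
      by (unfold phase_time; f_equal; ring). auto.
Qed.

Lemma below_curve (c : R -> R) e0 t0 : continuous c e0 -> t0 < c e0 ->
  exists r, 0 < r /\ forall e t, close2 r e0 t0 e t -> t < c e.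
Proof.
  intros Hc Ht. destruct (proj1 (continuous_eps_delta c e0) Hc ((c e0 - t0) / 2) ltac:(lra)) as [d [Hd H]].
  exists (Rmin d ((c e0 - t0) / 2)). split; [apply Rmin_glb_lt; lra|].
  intros e t [H1 H2]. apply Rmin_Rgt in H1, H2. specialize (H e ltac:(lra)).
  destruct H1 as [_ H1], H2 as [_ H2]. apply Rgt_lt, Rabs_def2 in H2. apply Rabs_def2 in H. lra.
Qed.

Lemma above_curve (c : R -> R) e0 t0 : continuous c e0 -> c e0 < t0 ->
  exists r, 0 < r /\ forall e t, close2 r e0 t0 e t -> c e < t.
Proof.
  intros Hc Ht. destruct (proj1 (continuous_eps_delta c e0) Hc ((t0 - c e0) / 2) ltac:(lra)) as [d [Hd H]].
  exists (Rmin d ((t0 - c e0) / 2)). split; [apply Rmin_glb_lt; lra|].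
  intros e t [H1 H2]. apply Rmin_Rgt in H1, H2. specialize (H e ltac:(lra)).
  destruct H1 as [_ H1], H2 as [_ H2]. apply Rgt_lt, Rabs_def2 in H2. apply Rabs_def2 in H. lra.
Qed.

Lemma parameter_open e0 : Rabs e0 < rho -> exists r, 0 < r /\ forall e, Rabs (e - e0) < r -> Rabs e < rho.
Proof.
  intros He0. exists (rho - Rabs e0). split; [lra|]. intros e He.
  replace e with ((e - e0) + e0) by ring. eapply Rle_lt_trans; [apply Rabs_triang|]. lra.
Qed.

Let joint : R -> R -> R := fun e t => position_at (zz e) t.

Lemma onset_continuous e : Rabs e < rho -> continuous (fun e => zz e cPhi) e.
Proof. intros He. destruct (coord_sd1 e cPhi He) as [c' H]. exact (sd1_continuous _ _ _ H). Qed.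

Lemma switch_sd1 e : Rabs e < rho -> exists c', sd1 (fun e => zz e cPhi + tau true (zz e)) e c'.
Proof.
  intros He. destruct (coord_sd1 e cPhi He) as [a Ha]. destruct (tau_sd1 e true He) as [b Hb].
  exists (a + b). apply sd1_plus; assumption.
Qed.

Lemma switch_continuous e : Rabs e < rho -> continuous (fun e => zz e cPhi + tau true (zz e)) e.
Proof. intros He. destruct (switch_sd1 e He) as [c' H]. exact (sd1_continuous _ _ _ H). Qed.

(** Both pieces vanish on the curve of entry times and have the same velocity
    there, so they have the same strict derivative and can be glued along that
    curve. *)
Lemma position_at_sd2_onset e0 : Rabs e0 < rho -> exists a,
  sd2 (fun _ _ => True) joint e0 (zz e0 cPhi) a (velocity_at (zz e0) (zz e0 cPhi)).
Proof.
  intros He0. set (t0 := zz e0 cPhi).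
  destruct (parameter_open e0 He0) as [r0 [Pr0 R0]].
  destruct (coord_sd1 e0 cPhi He0) as [c' Hc].
  assert (T1 := cl_tau _ _ _ _ _ (Zc e0 He0) true). assert (T2 := cl_tau _ _ _ _ _ (Zc e0 He0) false).
  assert (Du : phase_domain true 0 e0 t0) by (split; [exact He0|simpl sg; unfold t0; lra]).
  assert (Dl : phase_domain false 0 e0 t0) by (split; [exact He0|simpl sg; unfold t0; lra]).
  destruct (phase_sd2 true 0 e0 t0 Du) as [a Ha]. destruct (phase_sd2 false 0 e0 t0 Dl) as [b Hb].
  rewrite <- (proj2 (phase_upper e0 t0 Du)) in Ha. rewrite <- (proj2 (phase_previous e0 t0 Dl)) in Hb.
  assert (Ea : a = - (velocity_at (zz e0) t0 * c')).
  { apply (sd2_along_zero_curve _ _ (fun e => zz e cPhi) e0 t0 _ _ _ r0 Pr0 eq_refl Hc Ha).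
    intros e He. assert (He' := R0 e He). split.
    - split; [exact He'|]. assert (T := cl_tau _ _ _ _ _ (Zc e He') true). simpl sg. lra.
    - replace (phase_time true 0 e (zz e cPhi)) with 0 by (unfold phase_time; ring). rewrite X_0. ring. }
  assert (Eb : b = - (velocity_at (zz e0) t0 * c')).
  { apply (sd2_along_zero_curve _ _ (fun e => zz e cPhi) e0 t0 _ _ _ r0 Pr0 eq_refl Hc Hb).
    intros e He. assert (He' := R0 e He). split.
    - split; [exact He'|]. assert (T := cl_tau _ _ _ _ _ (Zc e He') false). simpl sg. lra.
    - replace (phase_time false 0 e (zz e cPhi)) with 0 by (unfold phase_time; ring). rewrite X_0. ring. }
  exists a. apply (sd2_glue joint (fun e => zz e cPhi) e0 t0 _ _ r0 Pr0).
  - intros e He. apply onset_continuous, R0, He.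
  - rewrite Ea, <- Eb.
    destruct (above_curve (fun e => zz e cPhi + - tau false (zz e)) e0 t0) as [r1 [Pr1 R1]].
    { destruct (tau_sd1 e0 false He0) as [d' Hd'].
      apply continuous_Rplus; [apply onset_continuous, He0|].
      apply (continuous_opp (V := R_NormedModule)). exact (sd1_continuous _ _ _ Hd'). }
    { unfold t0. lra. }
    apply (sd2_local (phase_domain false 0) _ (fun e t => sg false * X false (phase_time false 0 e t) (zz e))
      _ _ _ _ _ (Rmin r0 r1)); [apply Rmin_glb_lt; assumption| |exact Hb].
    intros e t Hcl Ht. assert (C0 := close2_le _ _ _ _ _ _ (Rmin_l r0 r1) Hcl).
    assert (C1 := R1 e t (close2_le _ _ _ _ _ _ (Rmin_r r0 r1) Hcl)).
    assert (Hd : phase_domain false 0 e t) by (split; [apply R0, C0|simpl sg; lra]).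
    split; [exact Hd|apply phase_previous, Hd].
  - destruct (below_curve (fun e => zz e cPhi + tau true (zz e)) e0 t0) as [r1 [Pr1 R1]].
    { apply switch_continuous, He0. } { unfold t0. lra. }
    apply (sd2_local (phase_domain true 0) _ (fun e t => sg true * X true (phase_time true 0 e t) (zz e))
      _ _ _ _ _ (Rmin r0 r1)); [apply Rmin_glb_lt; assumption| |exact Ha].
    intros e t Hcl Ht. assert (C0 := close2_le _ _ _ _ _ _ (Rmin_l r0 r1) Hcl).
    assert (C1 := R1 e t (close2_le _ _ _ _ _ _ (Rmin_r r0 r1) Hcl)).
    assert (Hd : phase_domain true 0 e t) by (split; [apply R0, C0|simpl sg; lra]).
    split; [exact Hd|apply phase_upper, Hd].
Qed.

(** The same argument on the curve of exit times, where the equality of the two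
    velocities is the closing condition. *)
Lemma position_at_sd2_switch e0 : Rabs e0 < rho -> exists a,
  sd2 (fun _ _ => True) joint e0 (zz e0 cPhi + tau true (zz e0)) a (velocity_at (zz e0) (zz e0 cPhi + tau true (zz e0))).
Proof.
  intros He0. set (t0 := zz e0 cPhi + tau true (zz e0)).
  destruct (parameter_open e0 He0) as [r0 [Pr0 R0]].
  destruct (switch_sd1 e0 He0) as [c' Hc].
  assert (T1 := cl_tau _ _ _ _ _ (Zc e0 He0) true). assert (T2 := cl_tau _ _ _ _ _ (Zc e0 He0) false).
  assert (T3 := tau_sum h (zz e0)).
  assert (Du : phase_domain true 0 e0 t0) by (split; [exact He0|simpl sg; unfold t0; lra]).
  assert (Dl : phase_domain false (2 * h) e0 t0) by (split; [exact He0|simpl sg; unfold t0; lra]).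
  destruct (phase_sd2 true 0 e0 t0 Du) as [a Ha]. destruct (phase_sd2 false (2 * h) e0 t0 Dl) as [b Hb].
  rewrite <- (proj2 (phase_upper e0 t0 Du)) in Ha. rewrite <- (proj2 (phase_lower e0 t0 Dl)) in Hb.
  assert (Ea : a = - (velocity_at (zz e0) t0 * c')).
  { apply (sd2_along_zero_curve _ _ (fun e => zz e cPhi + tau true (zz e)) e0 t0 _ _ _ r0 Pr0 eq_refl Hc Ha).
    intros e He. assert (He' := R0 e He). assert (Cz := Zc e He'). assert (T := cl_tau _ _ _ _ _ Cz true). split.
    - split; [exact He'|]. simpl sg. lra.
    - replace (phase_time true 0 e (zz e cPhi + tau true (zz e))) with 1
        by (unfold phase_time; simpl sg; field; lra).
      rewrite (cl_X1 _ _ _ _ _ Cz). ring. }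
  assert (Eb : b = - (velocity_at (zz e0) t0 * c')).
  { apply (sd2_along_zero_curve _ _ (fun e => zz e cPhi + tau true (zz e)) e0 t0 _ _ _ r0 Pr0 eq_refl Hc Hb).
    intros e He. assert (He' := R0 e He). assert (Cz := Zc e He'). assert (T := cl_tau _ _ _ _ _ Cz false).
    assert (Ts := tau_sum h (zz e)). split.
    - split; [exact He'|]. simpl sg. lra.
    - replace (phase_time false (2 * h) e (zz e cPhi + tau true (zz e))) with 1.
      + rewrite (cl_X1 _ _ _ _ _ Cz). ring.
      + unfold phase_time. replace (sg false * (zz e cPhi + tau true (zz e) - (zz e cPhi + 2 * h)))
          with (tau false (zz e)) by (simpl sg; lra). field. lra. }
  exists a. apply (sd2_glue joint (fun e => zz e cPhi + tau true (zz e)) e0 t0 _ _ r0 Pr0).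
  - intros e He. apply switch_continuous, R0, He.
  - destruct (above_curve (fun e => zz e cPhi) e0 t0) as [r1 [Pr1 R1]].
    { apply onset_continuous, He0. } { unfold t0. lra. }
    apply (sd2_local (phase_domain true 0) _ (fun e t => sg true * X true (phase_time true 0 e t) (zz e))
      _ _ _ _ _ (Rmin r0 r1)); [apply Rmin_glb_lt; assumption| |exact Ha].
    intros e t Hcl Ht. assert (C0 := close2_le _ _ _ _ _ _ (Rmin_l r0 r1) Hcl).
    assert (C1 := R1 e t (close2_le _ _ _ _ _ _ (Rmin_r r0 r1) Hcl)).
    assert (Hd : phase_domain true 0 e t) by (split; [apply R0, C0|simpl sg; lra]).
    split; [exact Hd|apply phase_upper, Hd].
  - rewrite Ea, <- Eb.
    destruct (below_curve (fun e => zz e cPhi + 2 * h) e0 t0) as [r1 [Pr1 R1]].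
    { apply continuous_Rplus; [apply onset_continuous, He0|apply continuous_const]. }
    { unfold t0. lra. }
    apply (sd2_local (phase_domain false (2 * h)) _ (fun e t => sg false * X false (phase_time false (2 * h) e t) (zz e))
      _ _ _ _ _ (Rmin r0 r1)); [apply Rmin_glb_lt; assumption| |exact Hb].
    intros e t Hcl Ht. assert (C0 := close2_le _ _ _ _ _ _ (Rmin_l r0 r1) Hcl).
    assert (C1 := R1 e t (close2_le _ _ _ _ _ _ (Rmin_r r0 r1) Hcl)).
    assert (Hd : phase_domain false (2 * h) e t).
    { split; [apply R0, C0|]. assert (Ts := tau_sum h (zz e)). simpl sg. lra. }
    split; [exact Hd|apply phase_lower, Hd].
Qed.

Lemma position_at_sd2_interior s T e0 t0 : Rabs e0 < rho ->
  (forall e t, phase_domain s T e t -> position_at (zz e) t = sg s * X s (phase_time s T e t) (zz e) /\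
     velocity_at (zz e) t = Y s (phase_time s T e t) (zz e)) ->
  0 < sg s * (t0 - (zz e0 cPhi + T)) < tau s (zz e0) ->
  exists a, sd2 (fun _ _ => True) joint e0 t0 a (velocity_at (zz e0) t0).
Proof.
  intros He0 Hph Hin. destruct (parameter_open e0 He0) as [r0 [Pr0 R0]].
  assert (Hd0 : phase_domain s T e0 t0) by (split; [exact He0|lra]).
  destruct (phase_sd2 s T e0 t0 Hd0) as [a Ha]. rewrite <- (proj2 (Hph e0 t0 Hd0)) in Ha.
  exists a.
  assert (Hc1 : continuous (fun e => zz e cPhi + T) e0).
  { apply continuous_Rplus; [apply onset_continuous, He0|apply continuous_const]. }
  assert (Hc2 : continuous (fun e => zz e cPhi + T + sg s * tau s (zz e)) e0).
  { destruct (tau_sd1 e0 s He0) as [d' Hd'].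
    apply continuous_Rplus; [exact Hc1|].
    apply continuous_Rscal. exact (sd1_continuous _ _ _ Hd'). }
  assert (Hr : exists r, 0 < r /\ forall e t, close2 r e0 t0 e t -> 0 <= sg s * (t - (zz e cPhi + T)) <= tau s (zz e)).
  { destruct s; simpl sg in *.
    - destruct (above_curve _ e0 t0 Hc1 ltac:(lra)) as [r1 [P1 Q1]].
      destruct (below_curve _ e0 t0 Hc2 ltac:(lra)) as [r2 [P2 Q2]].
      exists (Rmin r1 r2). split; [apply Rmin_glb_lt; assumption|]. intros e t Hcl.
      specialize (Q1 e t (close2_le _ _ _ _ _ _ (Rmin_l r1 r2) Hcl)).
      specialize (Q2 e t (close2_le _ _ _ _ _ _ (Rmin_r r1 r2) Hcl)). lra.
    - destruct (below_curve _ e0 t0 Hc1 ltac:(lra)) as [r1 [P1 Q1]].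
      destruct (above_curve _ e0 t0 Hc2 ltac:(lra)) as [r2 [P2 Q2]].
      exists (Rmin r1 r2). split; [apply Rmin_glb_lt; assumption|]. intros e t Hcl.
      specialize (Q1 e t (close2_le _ _ _ _ _ _ (Rmin_l r1 r2) Hcl)).
      specialize (Q2 e t (close2_le _ _ _ _ _ _ (Rmin_r r1 r2) Hcl)). lra. }
  destruct Hr as [r1 [Pr1 R1]].
  apply (sd2_local (phase_domain s T) _ (fun e t => sg s * X s (phase_time s T e t) (zz e))
    _ _ _ _ _ (Rmin r0 r1)); [apply Rmin_glb_lt; assumption| |exact Ha].
  intros e t Hcl _. assert (C0 := close2_le _ _ _ _ _ _ (Rmin_l r0 r1) Hcl).
  assert (C1 := R1 e t (close2_le _ _ _ _ _ _ (Rmin_r r0 r1) Hcl)).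
  assert (Hd : phase_domain s T e t) by (split; [apply R0, C0|exact C1]).
  split; [exact Hd|apply Hph, Hd].
Qed.

Theorem position_at_sd2 e0 t0 : Rabs e0 < rho -> exists a,
  sd2 (fun _ _ => True) joint e0 t0 a (velocity_at (zz e0) t0).
Proof.
  intros He0.
  assert (Hmain : forall t, zz e0 cPhi <= t < zz e0 cPhi + 2 * h -> exists a,
    sd2 (fun _ _ => True) joint e0 t a (velocity_at (zz e0) t)).
  { intros t Ht. assert (Ts := tau_sum h (zz e0)).
    destruct (Req_dec t (zz e0 cPhi)) as [->|Hn]; [apply position_at_sd2_onset, He0|].
    destruct (Rtotal_order t (zz e0 cPhi + tau true (zz e0))) as [Hlt|[->|Hgt]].
    - apply (position_at_sd2_interior true 0 e0 t He0 phase_upper). simpl sg. lra.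
    - apply position_at_sd2_switch, He0.
    - apply (position_at_sd2_interior false (2 * h) e0 t He0 phase_lower). simpl sg. lra. }
  set (k := turns h (zz e0) t0).
  assert (Hr := reduced_range h h_pos (zz e0) t0). unfold reduced in Hr. fold k in Hr.
  destruct (Hmain _ Hr) as [a Ha]. exists a.
  replace t0 with ((t0 - IZR k * (2 * h)) + IZR k * (2 * h)) by ring.
  rewrite (proj2 (position_velocity_shift eta alpha h h_pos (zz e0) _ k)).
  apply sd2_shift; [|exact Ha].
  intros e t. apply (position_velocity_shift eta alpha h h_pos (zz e) t k).
Qed.
End JointSmoothness.

(** * Closed orbits are Filippov solutions *)

Lemma null_set_subset (E E' : R -> Prop) : (forall t, E t -> E' t) -> null_set E' -> null_set E.
Proof.
  intros H HE e He. destruct (HE e He) as [u [v [H1 [H2 H3]]]].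
  exists u, v. split; [exact H1|]. split; [auto|exact H3].
Qed.

(** The interval around p n has length e / 2^(n+1). *)
Lemma null_set_range (p : nat -> R) : null_set (fun t => exists n, t = p n).
Proof.
  intros e He.
  assert (Hs : is_series (fun n => e / 2 * (/ 2) ^ n) e).
  { assert (Hg : is_series (fun n => (/ 2) ^ n) (/ (1 - / 2)))
      by (apply is_series_geom; rewrite Rabs_pos_eq; lra).
    assert (H := is_series_scal (V := R_NormedModule) (e / 2) _ _ Hg).
    refine (eq_ind _ (fun l => is_series (fun n => e / 2 * (/ 2) ^ n) l) H e _).
    change (e / 2 * / (1 - / 2) = e). field. }
  exists (fun n => p n - e / 4 * (/ 2) ^ n), (fun n => p n + e / 4 * (/ 2) ^ n).
  assert (Hp : forall n, 0 < (/ 2) ^ n) by (intros; apply pow_lt; lra).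
  assert (Hs' : is_series (fun n => p n + e / 4 * (/ 2) ^ n - (p n - e / 4 * (/ 2) ^ n)) e).
  { apply is_series_ext with (2 := Hs). intros n. eq_in_R. field. }
  repeat split.
  - intros n. specialize (Hp n). nra.
  - intros t [n ->]. exists n. specialize (Hp n). nra.
  - exists e. exact Hs'.
  - rewrite (is_series_unique _ _ Hs'). lra.
Qed.

(** The quantities p C - q S and q C - eta p S are conserved and vanish at a;
    since C^2 - eta S^2 = 1 they determine p and q. *)
Lemma linear_uniqueness eta c (p q : R -> R) a b :
  (forall u, continuous p u) -> (forall u, continuous q u) ->
  (forall u, a < u < b -> is_derive p u (c * q u) /\ is_derive q u (c * (eta * p u))) ->
  p a = 0 -> q a = 0 -> forall u, a <= u <= b -> p u = 0 /\ q u = 0.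
Proof.
  intros Cp Cq Hd Pa Qa u Hu.
  destruct (Req_dec u a) as [->|Hn]; [auto|].
  set (S := fun w => Sf eta (c * (w - a))). set (C := fun w => Cf eta (c * (w - a))).
  assert (HS : forall w, is_derive S w (c * C w)).
  { intros w. unfold S, C.
    assert (H := is_derive_comp (V := R_NormedModule) (Sf eta) (fun w => c * (w - a)) w (Cf eta (c * (w - a))) c).
    apply H; [apply Sf_derive|]. auto_derive; auto; ring. }
  assert (HC : forall w, is_derive C w (c * (eta * S w))).
  { intros w. unfold S, C.
    assert (H := is_derive_comp (V := R_NormedModule) (Cf eta) (fun w => c * (w - a)) w (eta * Sf eta (c * (w - a))) c).
    apply H; [apply Cf_derive|]. auto_derive; auto; ring. }
  assert (CS : forall w, continuous S w) by (intros w; exact (is_derive_continuous _ _ _ (HS w))).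
  assert (CC : forall w, continuous C w) by (intros w; exact (is_derive_continuous _ _ _ (HC w))).
  assert (Hconst : forall (k1 k2 : R -> R) (dk : R -> R),
    (forall w, continuous k1 w) -> (forall w, a < w < b -> is_derive k1 w 0) -> k1 a = 0 -> k1 u = 0).
  { intros k1 _ _ Ck Dk K0. destruct (MVT_gen k1 a u (fun _ => 0)) as [x [_ E]].
    - intros w Hw. rewrite Rmin_left, Rmax_right in Hw by lra. apply Dk. lra.
    - intros w _. apply continuity_pt_filterlim, Ck.
    - lra. }
  assert (E1 : p u * C u - q u * S u = 0).
  { apply (Hconst (fun w => p w * C w - q w * S w) p p).
    - intros w. apply continuous_Rminus;
        apply continuous_Rmult; auto.
    - intros w Hw. destruct (Hd w Hw) as [D1 D2].
      replace 0 with ((c * q w * C w + p w * (c * (eta * S w))) - (c * (eta * p w) * S w + q w * (c * C w))) by ring.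
      apply (is_derive_Rminus (fun w => p w * C w) (fun w => q w * S w)).
      + apply (is_derive_mult p C w); auto. intros; apply Rmult_comm.
      + apply (is_derive_mult q S w); auto. intros; apply Rmult_comm.
    - rewrite Pa, Qa. ring. }
  assert (E2 : q u * C u - eta * (p u * S u) = 0).
  { apply (Hconst (fun w => q w * C w - eta * (p w * S w)) p p).
    - intros w. apply continuous_Rminus.
      + apply continuous_Rmult; auto.
      + apply continuous_Rscal, continuous_Rmult; auto.
    - intros w Hw. destruct (Hd w Hw) as [D1 D2].
      replace 0 with ((c * (eta * p w) * C w + q w * (c * (eta * S w))) - eta * (c * q w * S w + p w * (c * C w))) by ring.
      apply (is_derive_Rminus (fun w => q w * C w) (fun w => eta * (p w * S w))).
      + apply (is_derive_mult q C w); auto. intros; apply Rmult_comm.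
      + apply (is_derive_scal (fun w => p w * S w)).
        apply (is_derive_mult p S w); auto. intros; apply Rmult_comm.
    - rewrite Pa, Qa. ring. }
  assert (Hpy : C u * C u - eta * (S u * S u) = 1) by apply Cf_Sf_pythagoras.
  split.
  - replace (p u) with (p u * (C u * C u - eta * (S u * S u))) by (rewrite Hpy; ring).
    replace (p u * (C u * C u - eta * (S u * S u))) with
      (C u * (p u * C u - q u * S u) + S u * (q u * C u - eta * (p u * S u))) by ring.
    rewrite E1, E2. ring.
  - replace (q u) with (q u * (C u * C u - eta * (S u * S u))) by (rewrite Hpy; ring).
    replace (q u * (C u * C u - eta * (S u * S u))) with
      (C u * (q u * C u - eta * (p u * S u)) + eta * S u * (p u * C u - q u * S u)) by ring.
    rewrite E1, E2. ring.
Qed.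

Section Filippov.
Context (eta alpha h : R) (f : R -> R -> R -> R) (h_pos : 0 < h) (hf : C1_R3 f)
  (hper : forall t x y, f (t + 2 * h) x y = f t x y).
Local Notation tau := (phase_length h).
Local Notation X := (position_profile eta alpha h).
Local Notation Y := (velocity_profile eta alpha h).
Local Notation N := (force_profile eta alpha h f).
Local Notation periodic_state := (periodic_state eta alpha h f).
Local Notation position_at := (position_at eta alpha h).
Local Notation velocity_at := (velocity_at eta alpha h).

Lemma periodic_shift {A : Type} (g : R -> A) T k : (forall t, g (t + T) = g t) ->
  forall t, g (t + IZR k * T) = g t.
Proof.
  intros H.
  assert (Hn : forall n t, g (t + INR n * T) = g t).
  { induction n; intros t.
    - simpl. f_equal. ring.
    - rewrite S_INR. replace (t + (INR n + 1) * T) with ((t + T) + INR n * T) by ring.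
      rewrite IHn. apply H. }
  intros t. destruct (Z_le_dec 0 k) as [Hk|Hk].
  - rewrite <- (Hn (Z.to_nat k) t), INR_IZR_INZ, Z2Nat.id by exact Hk. reflexivity.
  - rewrite <- (Hn (Z.to_nat (- k)) (t + IZR k * T)), INR_IZR_INZ, Z2Nat.id by lia.
    f_equal. rewrite opp_IZR. ring.
Qed.

Lemma f_shift t x y k : f (t + IZR k * (2 * h)) x y = f t x y.
Proof. apply (periodic_shift (fun t => f t x y)). intros; apply hper. Qed.

Section ClosedToSolution.
Context (z : state) (Cz : periodic_state z) (xy : forall t, is_derive (position_at z) t (velocity_at z t))
  (Xpos : forall s u, 0 < u < 1 -> 0 < X s u z).

Lemma velocity_at_derive_upper t : z cPhi < t < z cPhi + tau true z ->
  0 < position_at z t /\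
  is_derive (velocity_at z) t (eta * position_at z t - alpha + z cEps * f t (position_at z t) (velocity_at z t)).
Proof.
  intros Ht. assert (T1 := cl_tau _ _ _ _ _ Cz true).
  set (u := upper_time h z t).
  assert (Eu : tau true z * u = t - z cPhi) by (unfold u, upper_time; field; lra).
  assert (Hu : 0 < u < 1).
  { split; apply Rmult_lt_reg_l with (tau true z); lra. }
  destruct (upper_piece eta alpha h f h_pos z Cz t) as [Ex Ey]; [lra|]. fold u in Ex, Ey.
  split; [rewrite Ex; apply Xpos, Hu|].
  apply is_derive_ext_loc with (fun t => Y true (upper_time h z t) z).
  - assert (Hr : 0 < Rmin (t - z cPhi) (z cPhi + tau true z - t)) by (apply Rmin_glb_lt; lra).
    exists (mkposreal _ Hr). intros y Hy. change (Rabs (y - t) < Rmin (t - z cPhi) (z cPhi + tau true z - t)) in Hy.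
    apply Rmin_Rgt in Hy. destruct Hy as [A B]. apply Rgt_lt, Rabs_def2 in A, B.
    symmetry. apply (upper_piece eta alpha h f h_pos z Cz y). lra.
  - assert (HN := cl_N _ _ _ _ _ Cz true u). unfold force_profile in HN. simpl sg in HN.
    rewrite clamp_id in HN by lra. rewrite !Rmult_1_l in HN.
    replace (z cPhi + tau true z * u) with t in HN by lra.
    rewrite Ex, Ey, HN.
    assert (Hc := is_derive_comp (V := R_NormedModule) (fun u => Y true u z) (upper_time h z) t
      (tau true z * (eta * X true u z - alpha + z cEps * z (cG true u))) (/ tau true z)).
    replace (eta * X true u z - alpha + z cEps * z (cG true u)) with
      (scal (/ tau true z) (tau true z * (eta * X true u z - alpha + z cEps * z (cG true u)))).
    + apply Hc; [apply Y_derive; [apply (cl_good _ _ _ _ _ Cz)|exact Hu]|].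
      unfold upper_time. generalize (tau true z). intros T. auto_derive; auto; unfold Rdiv; ring.
    + match goal with |- scal ?a ?b = ?c => change (a * b = c) end. field. lra.
Qed.

Lemma velocity_at_derive_lower t : z cPhi + tau true z < t < z cPhi + 2 * h ->
  position_at z t < 0 /\
  is_derive (velocity_at z) t (eta * position_at z t + alpha + z cEps * f t (position_at z t) (velocity_at z t)).
Proof.
  intros Ht. assert (T1 := cl_tau _ _ _ _ _ Cz false). assert (Ts := tau_sum h z).
  set (u := lower_time h z t).
  assert (Eu : tau false z * u = z cPhi + 2 * h - t) by (unfold u, lower_time; field; lra).
  assert (Hu : 0 < u < 1).
  { split; apply Rmult_lt_reg_l with (tau false z); lra. }
  destruct (lower_piece eta alpha h f h_pos z Cz t) as [Ex Ey]; [lra|]. fold u in Ex, Ey.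
  split; [rewrite Ex; specialize (Xpos false u Hu); lra|].
  apply is_derive_ext_loc with (fun t => Y false (lower_time h z t) z).
  - assert (Hr : 0 < Rmin (t - (z cPhi + tau true z)) (z cPhi + 2 * h - t)) by (apply Rmin_glb_lt; lra).
    exists (mkposreal _ Hr). intros y Hy. change (Rabs (y - t) < Rmin (t - (z cPhi + tau true z)) (z cPhi + 2 * h - t)) in Hy.
    apply Rmin_Rgt in Hy. destruct Hy as [A B]. apply Rgt_lt, Rabs_def2 in A, B.
    symmetry. apply (lower_piece eta alpha h f h_pos z Cz y). lra.
  - assert (HN := cl_N _ _ _ _ _ Cz false u). unfold force_profile in HN.
    rewrite clamp_id in HN by lra. simpl sg in HN.
    replace (z cPhi + -1 * (tau false z * u)) with (t - 2 * h) in HN by lra.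
    rewrite <- (hper (t - 2 * h)) in HN. replace (t - 2 * h + 2 * h) with t in HN by ring.
    replace (-1 * X false u z) with (- X false u z) in HN by ring.
    rewrite Ex, Ey. replace (f t (- X false u z) (Y false u z)) with (- z (cG false u)) by lra.
    assert (Hc := is_derive_comp (V := R_NormedModule) (fun u => Y false u z) (lower_time h z) t
      (tau false z * (eta * X false u z - alpha + z cEps * z (cG false u))) (- / tau false z)).
    replace (eta * - X false u z + alpha + z cEps * - z (cG false u)) with
      (scal (- / tau false z) (tau false z * (eta * X false u z - alpha + z cEps * z (cG false u)))).
    + apply Hc; [apply Y_derive; [apply (cl_good _ _ _ _ _ Cz)|exact Hu]|].
      unfold lower_time. generalize (tau false z). intros T. auto_derive; auto; unfold Rdiv; ring.
    + match goal with |- scal ?a ?b = ?c => change (a * b = c) end. field. lra.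
Qed.

Lemma Derive_position_at : Derive (position_at z) = velocity_at z.
Proof. apply functional_extensionality. intros t. apply is_derive_unique, xy. Qed.

Definition crossing (t : R) : Prop :=
  exists k : Z, t = z cPhi + IZR k * (2 * h) \/ t = z cPhi + tau true z + IZR k * (2 * h).

(** The crossings are enumerated by two copies of the integers, each integer
    written as a difference of naturals. *)
Lemma crossing_null : null_set crossing.
Proof.
  set (p := fun n => let (m, j) := of_nat n in let (a, b) := of_nat m in
    (if (j =? 0)%nat then z cPhi else z cPhi + tau true z) + IZR (Z.of_nat a - Z.of_nat b) * (2 * h)).
  apply null_set_subset with (2 := null_set_range p).
  intros t [k Hk].
  assert (Ek : (Z.of_nat (Z.to_nat k) - Z.of_nat (Z.to_nat (- k)))%Z = k) by lia.
  destruct Hk as [->| ->].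
  - exists (to_nat (to_nat (Z.to_nat k, Z.to_nat (- k)), 0%nat)). unfold p. rewrite !cancel_of_to, Ek. reflexivity.
  - exists (to_nat (to_nat (Z.to_nat k, Z.to_nat (- k)), 1%nat)). unfold p. rewrite !cancel_of_to, Ek. reflexivity.
Qed.

Lemma is_derive_periodic_shift (g : R -> R) (T : R) (k : Z) (t l : R) : (forall t, g (t + T) = g t) ->
  is_derive g t l -> is_derive g (t + IZR k * T) l.
Proof.
  intros Hg Hd.
  apply is_derive_ext with (fun x => g (x - IZR k * T)).
  - intros x. rewrite <- (periodic_shift g T k Hg (x - IZR k * T)). f_equal. ring.
  - assert (Hc := is_derive_comp (V := R_NormedModule) g (fun x => x - IZR k * T) (t + IZR k * T) l 1).
    replace l with (scal 1 l) by exact (Rmult_1_l l).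
    apply Hc.
    + replace (t + IZR k * T - IZR k * T) with t by ring. exact Hd.
    + auto_derive; auto; ring.
Qed.

(** The orbit and its velocity are Lipschitz, and the equation holds except at
    the crossings. *)
Lemma periodic_solution_of_closed : periodic_solution (2 * h) eta alpha f (z cEps) (position_at z).
Proof.
  assert (Hxper : forall t, position_at z (t + 2 * h) = position_at z t).
  { intros t. replace (t + 2 * h) with (t + IZR 1 * (2 * h)) by ring. apply position_velocity_shift, h_pos. }
  assert (Hyper : forall t, velocity_at z (t + 2 * h) = velocity_at z t).
  { intros t. replace (t + 2 * h) with (t + IZR 1 * (2 * h)) by ring. apply position_velocity_shift, h_pos. }
  split; [|exact Hxper].
  destruct (position_velocity_lipschitz eta alpha h f h_pos z Cz) as [K [HK HL]].
  unfold oscillator_solution, filippov_solution. rewrite Derive_position_at.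
  split; [apply lipschitz_locally_AC with K; intros; apply HL; assumption|].
  split; [apply lipschitz_locally_AC with K; intros; apply HL; assumption|].
  apply null_set_subset with (2 := crossing_null).
  intros t Ht. apply NNPP. intros Hnc. apply Ht. clear Ht.
  set (k := turns h z t). set (t' := t - IZR k * (2 * h)).
  assert (Et : t = t' + IZR k * (2 * h)) by (unfold t'; ring).
  assert (Hr : z cPhi <= t' < z cPhi + 2 * h) by apply (reduced_range h h_pos z t).
  assert (N1 : t' <> z cPhi) by (intros E; apply Hnc; exists k; left; lra).
  assert (N2 : t' <> z cPhi + tau true z) by (intros E; apply Hnc; exists k; right; lra).
  assert (Ex : position_at z t = position_at z t') by (rewrite Et; apply position_velocity_shift, h_pos).
  assert (Ey : velocity_at z t = velocity_at z t') by (rewrite Et; apply position_velocity_shift, h_pos).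
  assert (Ef : f t (position_at z t) (velocity_at z t) = f t' (position_at z t') (velocity_at z t')) by (rewrite Ex, Ey, Et; apply f_shift).
  destruct (Rlt_le_dec t' (z cPhi + tau true z)) as [Hlt|Hge].
  - destruct (velocity_at_derive_upper t' ltac:(lra)) as [Hp Hd].
    exists (velocity_at z t, eta * position_at z t - alpha + z cEps * f t (position_at z t) (velocity_at z t)). simpl.
    split; [apply xy|]. split.
    + rewrite Ef, Ex. rewrite Et. apply is_derive_periodic_shift; assumption.
    + unfold filippov_set, oscillator_field. simpl. rewrite Ex in *.
      split; [intros _; f_equal; ring|]. split; intros; lra.
  - destruct (velocity_at_derive_lower t' ltac:(lra)) as [Hp Hd].
    exists (velocity_at z t, eta * position_at z t + alpha + z cEps * f t (position_at z t) (velocity_at z t)). simpl.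
    split; [apply xy|]. split.
    + rewrite Ef, Ex. rewrite Et. apply is_derive_periodic_shift; assumption.
    + unfold filippov_set, oscillator_field. simpl. rewrite Ex in *.
      split; [intros; lra|]. split; [intros _; f_equal; ring|]. intros; lra.
Qed.
End ClosedToSolution.

(** * The state of a periodic solution *)

Section SolutionToState.
Context (e : R) (x : R -> R) (Hx : oscillator_solution eta alpha f e x).

Lemma velocity_continuous t : continuous (Derive x) t.
Proof. apply locally_AC_continuous. apply Hx. Qed.

(** The velocity of a Filippov solution is continuous, so the position is
    differentiable everywhere and not only almost everywhere. *)
Lemma velocity_correct t : is_derive x t (Derive x t).
Proof.
  destruct Hx as [H1 [H2 H3]].
  apply (AC_ae_derive_continuous x (Derive x) _ (t - 1) (t + 1) H1 H3 velocity_continuous); [|lra].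
  intros y _ [w [Hw _]]. rewrite (is_derive_unique _ _ _ Hw). exact Hw.
Qed.

Lemma position_continuous t : continuous x t.
Proof. exact (is_derive_continuous _ _ _ (velocity_correct t)). Qed.

(** On one side of x = 0 the Filippov set is a single continuous vector field. *)
Lemma acceleration_in_phase s a b : (forall t, a < t < b -> 0 < sg s * x t) ->
  forall t, a < t < b -> is_derive (Derive x) t (eta * x t - sg s * alpha + e * f t (x t) (Derive x t)).
Proof.
  intros Hs. destruct Hx as [H1 [H2 H3]].
  apply (AC_ae_derive_continuous (Derive x)
    (fun t => eta * x t - sg s * alpha + e * f t (x t) (Derive x t)) _ a b H2 H3).
  - intros t. apply continuous_Rplus.
    + apply continuous_Rminus; [|apply continuous_const].
      apply (continuous_Rscal eta x t (position_continuous t)).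
    + apply continuous_Rscal.
      apply (C1_comp_continuous f hf (fun t => t)); [apply continuous_id|apply position_continuous|apply velocity_continuous].
  - intros t Ht [w [Hw1 [Hw2 [F1 [F2 _]]]]]. specialize (Hs t Ht).
    replace (eta * x t - sg s * alpha + e * f t (x t) (Derive x t)) with (snd w); [exact Hw2|].
    unfold oscillator_field in F1, F2. simpl fst in F1, F2. simpl snd in F1, F2.
    destruct s; simpl sg in *.
    + rewrite F1 by lra. simpl. ring.
    + rewrite F2 by lra. simpl. ring.
Qed.

Context (Hper : forall t, x (t + 2 * h) = x t).

Lemma velocity_periodic t : Derive x (t + 2 * h) = Derive x t.
Proof.
  apply is_derive_unique.
  assert (H := is_derive_periodic_shift x (2 * h) 1 t _ Hper (velocity_correct t)).
  rewrite Rmult_1_l in H. exact H.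
Qed.

Context (a b : R) (Hab : a < b < a + 2 * h) (Xa : x a = 0) (Xb : x b = 0)
  (Xup : forall t, a < t < b -> 0 < x t) (Xlow : forall t, b - 2 * h < t < a -> x t < 0).

Definition duration (s : bool) : R := if s then b - a else 2 * h - (b - a).
Definition phase_point (s : bool) (u : R) : R := a + sg s * (duration s * clamp u).

(** A solution that is positive between the zeros a and b and negative for the
    rest of the period, read as a state. *)
Definition state_of_solution : state := fun i =>
  match i with
  | cEps => e | cTau => b - a | cPhi => a | cY0 => Derive x a
  | cG s u => sg s * f (phase_point s u) (x (phase_point s u)) (Derive x (phase_point s u))
  end.
Local Notation st := state_of_solution.

Lemma duration_pos s : 0 < duration s.
Proof. destruct s; unfold duration; lra. Qed.

Lemma tau_state s : tau s st = duration s.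
Proof. destruct s; reflexivity. Qed.

Lemma phase_point_continuous s u : continuous (phase_point s) u.
Proof.
  unfold phase_point.
  apply (continuous_comp clamp (fun c => a + sg s * (duration s * c))); [apply clamp_continuous|].
  apply (is_derive_continuous _ _ (sg s * duration s)). auto_derive; auto; ring.
Qed.

Lemma good_state : good st.
Proof.
  intros s. split; intros u.
  - simpl. apply continuous_Rscal.
    apply (C1_comp_continuous f hf).
    + apply phase_point_continuous.
    + apply (continuous_comp (phase_point s) x); [apply phase_point_continuous|apply position_continuous].
    + apply (continuous_comp (phase_point s) (Derive x)); [apply phase_point_continuous|apply velocity_continuous].
  - simpl. unfold phase_point. rewrite clamp_idem. reflexivity.
Qed.

Lemma phase_sign s u : 0 < u < 1 -> 0 < sg s * x (a + sg s * (duration s * u)).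
Proof.
  intros Hu. assert (Hd := duration_pos s). destruct s; simpl sg; unfold duration in *.
  - rewrite !Rmult_1_l. apply Xup. nra.
  - assert (x (a + -1 * ((2 * h - (b - a)) * u)) < 0); [apply Xlow; nra|lra].
Qed.

(** The solution and the profile solve the same linear equation with the same
    forcing and initial values; their difference is zero by
    [linear_uniqueness]. *)
Lemma profile_of_solution s u : 0 <= u <= 1 ->
  sg s * X s u st = x (a + sg s * (duration s * u)) /\
  Y s u st = Derive x (a + sg s * (duration s * u)).
Proof.
  intros Hu. set (d := duration s). set (q := fun u => a + sg s * (d * u)).
  assert (Hsg : sg s * sg s = 1) by (destruct s; simpl; ring).
  assert (Dq : forall w, is_derive q w (sg s * d)) by (intros w; unfold q; auto_derive; auto; ring).
  assert (Cq : forall w, continuous q w) by (intros w; exact (is_derive_continuous _ _ _ (Dq w))).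
  assert (Hcomp : forall (g : R -> R) w l, is_derive g (q w) l -> is_derive (fun w => g (q w)) w (sg s * d * l)).
  { intros g w l Hg. exact (is_derive_Rcomp g q w l (sg s * d) Hg (Dq w)). }
  set (p1 := fun w => X s w st - sg s * x (q w)). set (p2 := fun w => Y s w st - Derive x (q w)).
  destruct (linear_uniqueness eta d p1 p2 0 1) with (u := u) as [R1 R2]; try exact Hu.
  - intros w. apply continuous_Rminus.
    + apply (XY_continuous eta alpha h s st good_state w).
    + apply continuous_Rscal.
      apply (continuous_comp q x); [apply Cq|apply position_continuous].
  - intros w. apply continuous_Rminus.
    + apply (XY_continuous eta alpha h s st good_state w).
    + apply (continuous_comp q (Derive x)); [apply Cq|apply velocity_continuous].
  - intros w Hw.
    assert (DX := X_derive eta alpha h s w st good_state Hw).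
    assert (DY := Y_derive eta alpha h s w st good_state Hw).
    rewrite tau_state in DX, DY. fold d in DX, DY.
    assert (Dx := Hcomp x w _ (velocity_correct (q w))).
    assert (Dv : is_derive (Derive x) (q w) (eta * x (q w) - sg s * alpha + e * f (q w) (x (q w)) (Derive x (q w)))).
    { assert (Hd := duration_pos s). fold d in Hd.
      set (m := Rmin w (1 - w) / 2). assert (Hm : 0 < m /\ m < w /\ m < 1 - w).
      { unfold m. generalize (Rmin_l w (1 - w)) (Rmin_r w (1 - w)).
        assert (0 < Rmin w (1 - w)) by (apply Rmin_glb_lt; lra). lra. }
      apply (acceleration_in_phase s (q w - d * m) (q w + d * m)); [|nra].
      intros t Ht. replace t with (a + sg s * (d * (sg s * (t - a) / d))).
      - apply phase_sign. unfold q in Ht.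
        assert (E : sg s * (t - a) = d * (sg s * (t - a) / d)) by (field; lra).
        set (w' := sg s * (t - a) / d) in *.
        assert (Hw' : w - m < w' < w + m).
        { destruct s; simpl sg in *; split; apply Rmult_lt_reg_l with d; nra. }
        lra.
      - replace (sg s * (d * (sg s * (t - a) / d))) with (sg s * sg s * (t - a)) by (field; lra).
        rewrite Hsg. ring. }
    apply Hcomp in Dv.
    split.
    + replace (d * p2 w) with (d * Y s w st - sg s * (sg s * d * Derive x (q w)))
        by (unfold p2; replace (sg s * (sg s * d * Derive x (q w))) with (sg s * sg s * d * Derive x (q w)) by ring; rewrite Hsg; ring).
      apply (is_derive_Rminus (fun w => X s w st) (fun w => sg s * x (q w))); [exact DX|].
      apply (is_derive_scal (fun w => x (q w))). exact Dx.
    + replace (d * (eta * p1 w)) with (d * (eta * X s w st - alpha + st cEps * st (cG s w))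
        - sg s * d * (eta * x (q w) - sg s * alpha + e * f (q w) (x (q w)) (Derive x (q w)))).
      * apply (is_derive_Rminus (fun w => Y s w st) (fun w => Derive x (q w))); assumption.
      * simpl st. unfold phase_point. rewrite clamp_id by lra. fold d. change (a + sg s * (d * w)) with (q w).
        unfold p1. transitivity (d * (eta * X s w st) - d * alpha + sg s * sg s * d * alpha - sg s * d * (eta * x (q w))); [ring|].
        rewrite Hsg. ring.
  - unfold p1, q. rewrite X_0, !Rmult_0_r, Rplus_0_r, Xa. ring.
  - unfold p2, q. rewrite Y_0, !Rmult_0_r, Rplus_0_r. simpl. ring.
  - unfold p1 in R1. unfold p2 in R2. split; [|unfold q in R2; lra].
    replace (X s u st) with (sg s * x (q u)) by lra.
    rewrite <- Rmult_assoc, Hsg, Rmult_1_l. reflexivity.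
Qed.

(** The recorded forcing is by definition f along the solution, and the profile
    is the solution. *)
Lemma N_state s u : N s u st = st (cG s u).
Proof.
  assert (Hc := clamp_range u).
  assert (EX : X s u st = X s (clamp u) st) by (unfold position_profile, C_moment, S_moment; rewrite clamp_idem; reflexivity).
  assert (EY : Y s u st = Y s (clamp u) st) by (unfold velocity_profile, C_moment, S_moment; rewrite clamp_idem; reflexivity).
  destruct (profile_of_solution s (clamp u) Hc) as [PX PY].
  unfold force_profile. rewrite EX, EY, PX, PY, tau_state. reflexivity.
Qed.

Lemma X1_state s : X s 1 st = 0.
Proof.
  destruct (profile_of_solution s 1 ltac:(lra)) as [PX _]. rewrite Rmult_1_r in PX.
  assert (E : x (a + sg s * duration s) = 0).
  { destruct s; simpl sg; unfold duration.
    - replace (a + 1 * (b - a)) with b by ring. exact Xb.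
    - rewrite <- Hper. replace (a + -1 * (2 * h - (b - a)) + 2 * h) with b by ring. exact Xb. }
  rewrite E in PX. destruct s; simpl sg in PX; lra.
Qed.

Lemma Y1_state : Y true 1 st = Y false 1 st.
Proof.
  destruct (profile_of_solution true 1 ltac:(lra)) as [_ ->].
  destruct (profile_of_solution false 1 ltac:(lra)) as [_ ->].
  rewrite <- (velocity_periodic (a + sg false * _)). f_equal. simpl sg. unfold duration. ring.
Qed.

Lemma closed_state : periodic_state st.
Proof.
  split; [apply good_state| |apply N_state|apply X1_state|apply Y1_state].
  intros s. rewrite tau_state. apply duration_pos.
Qed.

Lemma solution_is_position_at t : x t = position_at st t.
Proof.
  assert (Hmain : forall t, a <= t < a + 2 * h -> x t = position_at st t).
  { clear t. intros t Ht. destruct (Rle_lt_dec t b) as [L|L].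
    - destruct (upper_piece eta alpha h f h_pos st closed_state t) as [-> _]; [simpl; lra|].
      assert (Hu := upper_time_range eta alpha h f st closed_state t ltac:(simpl; lra)).
      destruct (profile_of_solution true _ Hu) as [PX _]. simpl sg in PX. rewrite !Rmult_1_l in PX.
      rewrite PX. f_equal. unfold upper_time, duration. simpl. field. lra.
    - destruct (lower_piece eta alpha h f h_pos st closed_state t) as [-> _]; [simpl; lra|].
      assert (Hu := lower_time_range eta alpha h f st closed_state t ltac:(simpl; lra)).
      destruct (profile_of_solution false _ Hu) as [PX _]. simpl sg in PX.
      replace (- X false (lower_time h st t) st) with (-1 * X false (lower_time h st t) st) by ring.
      rewrite PX, <- (Hper (a + _)). f_equal. unfold lower_time, duration. simpl. field. lra. }
  set (k := turns h st t).
  assert (Hr := reduced_range h h_pos st t). unfold reduced in Hr. fold k in Hr. simpl in Hr.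
  rewrite <- (periodic_shift x (2 * h) (- k) Hper t).
  rewrite <- (proj1 (position_velocity_shift eta alpha h h_pos st t (- k))).
  apply Hmain. rewrite opp_IZR. lra.
Qed.

End SolutionToState.
End Filippov.

(** * Uniqueness in a tube around the unperturbed orbit *)

Lemma zero_near (z dz : R -> R) c r m d : 0 < r -> 0 < m -> d < m * r ->
  (forall t, is_derive z t (dz t)) -> (forall t, Rabs (t - c) <= r -> m <= dz t) ->
  Rabs (z c) <= d -> exists t, Rabs (t - c) <= r /\ z t = 0.
Proof.
  intros Hr Hm Hd Hz Hdz Hc. apply Rabs_le_between in Hc.
  assert (Cz : continuity z).
  { intros t. apply continuity_pt_filterlim. exact (is_derive_continuous _ _ _ (Hz t)). }
  assert (Hmvt : forall a b, c - r <= a -> a < b -> b <= c + r -> m * (b - a) <= z b - z a).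
  { intros a b H1 H2 H3. destruct (MVT_gen z a b dz) as [x [Hx E]].
    - intros; apply Hz.
    - intros; apply Cz.
    - rewrite Rmin_left, Rmax_right in Hx by lra. rewrite E. apply Rmult_le_compat_r; [lra|].
      apply Hdz. apply Rabs_le. lra. }
  assert (Hp := Hmvt c (c + r) ltac:(lra) ltac:(lra) ltac:(lra)).
  assert (Hn := Hmvt (c - r) c ltac:(lra) ltac:(lra) ltac:(lra)).
  replace (c + r - c) with r in Hp by ring. replace (c - (c - r)) with r in Hn by ring.
  destruct (IVT_gen z (c - r) (c + r) 0 Cz) as [t [Ht Et]].
  { rewrite Rmin_left, Rmax_right by lra. lra. }
  rewrite Rmin_left, Rmax_right in Ht by lra.
  exists t. split; [apply Rabs_le; lra|exact Et].
Qed.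

Section TubeUniqueness.
Context (eta alpha h v : R) (f : R -> R -> R -> R) (phi0 : R).
Local Notation tau := (phase_length h).
Local Notation F := (newton_map eta alpha h v f phi0).
Local Notation base := (base_state eta alpha h v f phi0).
Local Notation periodic_state := (periodic_state eta alpha h f).
Local Notation position_at := (position_at eta alpha h).
Local Notation velocity_at := (velocity_at eta alpha h).
Local Notation x0 := (orbit_x eta alpha v).
Local Notation y0 := (orbit_y eta alpha v).

Context (hf : C1_R3 f) (hper : forall t x y, f (t + 2 * h) x y = f t x y)
  (D : half_period_data eta alpha h v) (Cb : periodic_state base).

Lemma base_orbit s u : 0 <= u <= 1 ->
  position_at base (phi0 + sg s * (h * u)) = sg s * x0 (h * u) /\
  velocity_at base (phi0 + sg s * (h * u)) = y0 (h * u).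
Proof.
  intros Hu. assert (Hh := hp_pos _ _ _ _ D). destruct s; simpl sg.
  - destruct (upper_piece eta alpha h f Hh base Cb (phi0 + 1 * (h * u))) as [-> ->]; [simpl; nra|].
    rewrite X_base_profile, Y_base_profile.
    replace (upper_time h base (phi0 + 1 * (h * u))) with u by (unfold upper_time; simpl; field; lra).
    rewrite clamp_id by exact Hu. split; ring.
  - destruct (position_velocity_shift eta alpha h Hh base (phi0 + -1 * (h * u)) 1) as [<- <-].
    destruct (lower_piece eta alpha h f Hh base Cb (phi0 + -1 * (h * u) + 1 * (2 * h))) as [-> ->]; [simpl; nra|].
    rewrite X_base_profile, Y_base_profile.
    replace (lower_time h base (phi0 + -1 * (h * u) + 1 * (2 * h))) with u by (unfold lower_time; simpl; field; lra).
    rewrite clamp_id by exact Hu. split; ring.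
Qed.

(** Continuity of f, made uniform along the compact unperturbed orbit. *)
Lemma force_near_orbit r : 0 < r -> exists dl, 0 < dl /\ forall s u t x y, 0 <= u <= 1 ->
  Rabs (t - (phi0 + sg s * (h * u))) < dl -> Rabs (x - sg s * x0 (h * u)) < dl ->
  Rabs (y - y0 (h * u)) < dl ->
  Rabs (f t x y - f (phi0 + sg s * (h * u)) (sg s * x0 (h * u)) (y0 (h * u))) <= r.
Proof.
  intros Hr.
  assert (Hs : forall s, exists dl, 0 < dl /\ forall u, 0 <= u <= 1 -> forall t x y,
    Rabs (t - (phi0 + sg s * (h * u))) < dl -> Rabs (x - sg s * x0 (h * u)) < dl ->
    Rabs (y - y0 (h * u)) < dl ->
    Rabs (f t x y - f (phi0 + sg s * (h * u)) (sg s * x0 (h * u)) (y0 (h * u))) <= r).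
  { intros s. apply (uniform_on_interval (fun u dl => forall t x y,
    Rabs (t - (phi0 + sg s * (h * u))) < dl -> Rabs (x - sg s * x0 (h * u)) < dl ->
    Rabs (y - y0 (h * u)) < dl ->
    Rabs (f t x y - f (phi0 + sg s * (h * u)) (sg s * x0 (h * u)) (y0 (h * u))) <= r) 0 1); [lra| |].
    - intros u d d' Hd' Hdd H t x y H1 H2 H3. apply H; lra.
    - intros w _. set (g1 := fun u => phi0 + sg s * (h * u)). set (g2 := fun u => sg s * x0 (h * u)). set (g3 := fun u => y0 (h * u)).
      assert (Hlin : continuous (fun u => h * u) w).
      { apply (is_derive_continuous _ _ h). auto_derive; auto; ring. }
      assert (C1' : continuous g1 w).
      { apply (is_derive_continuous _ _ (sg s * h)). unfold g1. auto_derive; auto; ring. }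
      assert (C2' : continuous g2 w).
      { apply continuous_Rscal.
        apply (continuous_comp (fun u => h * u) x0); [exact Hlin|apply x0_continuous]. }
      assert (C3' : continuous g3 w).
      { apply (continuous_comp (fun u => h * u) y0); [exact Hlin|apply y0_continuous]. }
      destruct (continuous_R3_eps_delta _ _ _ _ (r / 2) (C1_continuous f hf (g1 w, g2 w, g3 w)) ltac:(lra)) as [d [Hd H]].
      simpl in H.
      destruct (proj1 (continuous_eps_delta g1 w) C1' (d / 2) ltac:(lra)) as [d1 [Hd1 H1]].
      destruct (proj1 (continuous_eps_delta g2 w) C2' (d / 2) ltac:(lra)) as [d2 [Hd2 H2]].
      destruct (proj1 (continuous_eps_delta g3 w) C3' (d / 2) ltac:(lra)) as [d3 [Hd3 H3]].
      exists (Rmin (d / 2) (Rmin d1 (Rmin d2 d3))). split; [repeat apply Rmin_glb_lt; lra|].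
      intros u _ Hu t x y K1 K2 K3.
      fold (g1 u) in *. fold (g2 u) in *. fold (g3 u) in *.
      change (phi0 + sg s * (h * u)) with (g1 u) in *. change (sg s * x0 (h * u)) with (g2 u) in *.
      change (y0 (h * u)) with (g3 u) in *.
      apply Rmin_Rgt in Hu. destruct Hu as [_ Hu]. apply Rmin_Rgt in Hu. destruct Hu as [Y1 Hu].
      apply Rmin_Rgt in Hu. destruct Hu as [Y2 Y3].
      specialize (H1 u Y1). specialize (H2 u Y2). specialize (H3 u Y3).
      apply Rmin_Rgt in K1, K2, K3. destruct K1 as [K1 _], K2 as [K2 _], K3 as [K3 _].
      apply Rgt_lt, Rabs_def2 in K1, K2, K3. 
      assert (B1 : in_box d (g1 u) (g2 u) (g3 u) (g1 w) (g2 w) (g3 w)) by (unfold in_box; lra).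
      assert (B2 : in_box d t x y (g1 w) (g2 w) (g3 w)).
      { apply Rabs_def2 in H1, H2, H3. repeat split; apply Rabs_def1; lra. }
      assert (E1 := H _ _ _ B1). assert (E2 := H _ _ _ B2).
      apply Rabs_def2 in E1, E2. apply Rabs_le. lra. }
  destruct (Hs true) as [a [Pa Ha]]. destruct (Hs false) as [b [Pb Hb]].
  exists (Rmin a b). split; [apply Rmin_glb_lt; assumption|].
  intros s u t x y Hu K1 K2 K3. apply Rmin_Rgt in K1, K2, K3. destruct s; [apply Ha|apply Hb]; tauto || lra.
Qed.

Context (rho r : R) (zz : R -> state) (Hr : 0 < r)
  (Zu : forall e p, Rabs e < rho -> good p -> near r p base -> (forall i, F e p i = p i) ->
     forall i, p i = zz e i).

(** In a thin tube the solution crosses x = 0 near the two crossings of the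
    unperturbed orbit and, being C1-close to the arch, nowhere else. Its state
    is then periodic, and the closing defect vanishes because eps times it does
    and eps <> 0; so the state is a fixed point near the unperturbed one. *)
Theorem tube_uniqueness : exists d0, 0 < d0 /\ forall e z, Rabs e < rho -> Rabs e <= r -> e <> 0 ->
  periodic_solution (2 * h) eta alpha f e z ->
  (forall t, Rabs (z t - position_at base t) < d0 /\ Rabs (Derive z t - velocity_at base t) < d0) ->
  forall t, z t = position_at (zz e) t.
Proof.
  assert (Hh := hp_pos _ _ _ _ D). assert (Hv := hp_v_pos _ _ _ _ D).
  destruct (position_velocity_lipschitz eta alpha h f Hh base Cb) as [K [HK HL]].
  assert (HL' : forall u w, Rabs (position_at base w - position_at base u) <= K * Rabs (w - u) /\
    Rabs (velocity_at base w - velocity_at base u) <= K * Rabs (w - u)).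
  { intros u w. destruct (Rle_lt_dec u w) as [Huw|Huw].
    - rewrite (Rabs_pos_eq (w - u)) by lra. apply HL, Huw.
    - rewrite Rabs_minus_sym, (Rabs_minus_sym (velocity_at base w)), (Rabs_minus_sym w), (Rabs_pos_eq (u - w)) by lra.
      apply HL. lra. }
  destruct (base_profile_positive eta alpha h v D) as [k [Hk Hpos]].
  destruct (bounded_on_01 (fun u => y0 (h * u))) as [Ym [HYm BY]].
  { intros u. apply (continuous_comp (fun u => h * u) y0); [|apply y0_continuous].
    apply (is_derive_continuous _ _ h). auto_derive; auto; ring. }
  destruct (force_near_orbit r Hr) as [dl [Hdl Hforce]].
  assert (Pk4 : 0 < k / (4 * h)) by (apply Rdiv_lt_0_compat; lra).
  (* m: allowed distance, in position and velocity, between z and the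
     unperturbed orbit at the same fraction of a phase *)
  destruct (below5 k (k / (4 * h)) (dl / 2) r (v / 4)) as [m [Pm [Q1 [Q2 [Q3 [Q4 Q5]]]]]]; try lra.
  assert (Pa : 0 < m / (6 * (K + 1))) by (apply Rdiv_lt_0_compat; lra).
  assert (Pb : 0 < k / (4 * (Ym + 1))) by (apply Rdiv_lt_0_compat; lra).
  (* w0: allowed displacement of the two crossings; fractions then displace
     time by at most 3 w0 *)
  destruct (below5 (h / 8) (m / (6 * (K + 1))) (k / (4 * (Ym + 1))) (dl / 6) (r / 3))
    as [w0 [Pw [W1 [W2 [W3 [W4 W5]]]]]]; try lra.
  assert (KW : 3 * K * w0 <= m / 2).
  { apply Rle_trans with (3 * (K + 1) * (m / (6 * (K + 1)))); [|right; field; lra].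
    apply Rmult_le_compat; lra. }
  assert (YW : 2 * w0 * Ym <= k / 2).
  { apply Rle_trans with (2 * (k / (4 * (Ym + 1))) * (Ym + 1)); [|right; field; lra].
    apply Rmult_le_compat; try lra. }
  assert (HW : 2 * h * m <= k / 2).
  { apply Rle_trans with (2 * h * (k / (4 * h))); [|right; field; lra]. apply Rmult_le_compat_l; lra. }
  (* d0: the radius of the tube; near a crossing the slope of z is at least v
     / 2, so a value below v w0 / 4 forces a zero within w0 *)
  destruct (below2 (m / 2) (v * w0 / 4)) as [d0 [Pd0 [D1 D2]]]; try nra.
  exists d0. split; [exact Pd0|]. intros e z He Her Hne [Hz Hzper] Htube.
  assert (Vz := velocity_correct eta alpha f e z Hz).
  assert (Cv := velocity_continuous eta alpha f e z Hz).
  assert (Cz := position_continuous eta alpha f e z Hz).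
  assert (Hclose : forall s u q, 0 <= u <= 1 -> Rabs (q - (phi0 + sg s * (h * u))) <= 3 * w0 ->
    Rabs (z q - sg s * x0 (h * u)) <= m /\ Rabs (Derive z q - y0 (h * u)) <= m).
  { intros s u q Hu Hq. destruct (Htube q) as [T1 T2].
    destruct (HL' (phi0 + sg s * (h * u)) q) as [L1 L2].
    destruct (base_orbit s u Hu) as [E1 E2]. rewrite E1 in L1. rewrite E2 in L2.
    assert (K * Rabs (q - (phi0 + sg s * (h * u))) <= m / 2).
    { apply Rle_trans with (K * (3 * w0)); [apply Rmult_le_compat_l; lra|lra]. }
    split.
    - replace (z q - sg s * x0 (h * u)) with ((z q - position_at base q) + (position_at base q - sg s * x0 (h * u))) by ring.
      eapply Rle_trans; [apply Rabs_triang|]. lra.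
    - replace (Derive z q - y0 (h * u)) with ((Derive z q - velocity_at base q) + (velocity_at base q - y0 (h * u))) by ring.
      eapply Rle_trans; [apply Rabs_triang|]. lra. }
  assert (Hx00 : x0 (h * 0) = 0) by (unfold orbit_x; rewrite Rmult_0_r, Sf_0, Qf_0; ring).
  assert (Hy00 : y0 (h * 0) = v) by (unfold orbit_y; rewrite Rmult_0_r, Sf_0, Cf_0; ring).
  assert (Hx01 : x0 (h * 1) = 0).
  { unfold orbit_x. rewrite Rmult_1_r, (hp_closing _ _ _ _ D). ring. }
  assert (Hy01 : y0 (h * 1) = - v) by (rewrite Rmult_1_r; apply (y0_h eta alpha h v D)).
  assert (Horb0 := base_orbit true 0 ltac:(lra)). assert (Horb1 := base_orbit true 1 ltac:(lra)).
  simpl sg in Horb0, Horb1. rewrite Hx00, Hy00 in Horb0. rewrite Hx01, Hy01 in Horb1.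
  replace (phi0 + 1 * (h * 0)) with phi0 in Horb0 by ring.
  replace (phi0 + 1 * (h * 1)) with (phi0 + h) in Horb1 by ring.
  assert (Hza : exists a, Rabs (a - phi0) <= w0 /\ z a = 0).
  { apply (zero_near z (Derive z) phi0 w0 (v / 2) d0); try lra; try nra.
    - exact Vz.
    - intros t Ht. destruct (Hclose true 0 t ltac:(lra)) as [_ Hc].
      + replace (phi0 + sg true * (h * 0)) with phi0 by (simpl; ring). lra.
      + rewrite Hy00 in Hc. apply Rabs_le_between in Hc. lra.
    - destruct (Htube phi0) as [T _]. rewrite (proj1 Horb0) in T.
      replace (z phi0 - 1 * 0) with (z phi0) in T by ring. lra. }
  assert (Hzb : exists b, Rabs (b - (phi0 + h)) <= w0 /\ z b = 0).
  { destruct (zero_near (fun t => - z t) (fun t => - Derive z t) (phi0 + h) w0 (v / 2) d0) as [b [Hb1 Hb2]]; try lra; try nra.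
    - intros t. apply (is_derive_opp (V := R_NormedModule) z t), Vz.
    - intros t Ht. destruct (Hclose true 1 t ltac:(lra)) as [_ Hc].
      + replace (phi0 + sg true * (h * 1)) with (phi0 + h) by (simpl; ring). lra.
      + rewrite Hy01 in Hc. apply Rabs_le_between in Hc. lra.
    - destruct (Htube (phi0 + h)) as [T _]. rewrite (proj1 Horb1) in T.
      replace (z (phi0 + h) - 1 * 0) with (z (phi0 + h)) in T by ring. rewrite Rabs_Ropp. lra.
    - exists b. split; [exact Hb1|lra]. }
  destruct Hza as [a [Ha Za]]. destruct Hzb as [b [Hb Zb']].
  assert (Ha' := Ha). assert (Hb' := Hb). apply Rabs_le_between in Ha', Hb'.
  assert (Hab : a < b < a + 2 * h) by lra.
  set (du := duration h a b).
  assert (Hdu : forall s, Rabs (du s - h) <= 2 * w0).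
  { intros s. apply Rabs_le. destruct s; unfold du, duration; lra. }
  assert (Pdu : forall s, 0 < du s <= 2 * h).
  { intros s. specialize (Hdu s). apply Rabs_le_between in Hdu. lra. }
  assert (Hpt : forall s u, 0 <= u <= 1 ->
    Rabs (a + sg s * (du s * u) - (phi0 + sg s * (h * u))) <= 3 * w0).
  { intros s u Hu. replace (a + sg s * (du s * u) - (phi0 + sg s * (h * u))) with
      ((a - phi0) + sg s * ((du s - h) * u)) by ring.
    eapply Rle_trans; [apply Rabs_triang|]. rewrite !Rabs_mult.
    replace (Rabs (sg s)) with 1 by (destruct s; simpl; unfold Rabs; destruct Rcase_abs; lra).
    rewrite (Rabs_pos_eq u) by lra. specialize (Hdu s).
    assert (Rabs (du s - h) * u <= 2 * w0 * 1) by (apply Rmult_le_compat; try lra; apply Rabs_pos). lra. }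
  assert (Hcl : forall s u, 0 <= u <= 1 ->
    Rabs (z (a + sg s * (du s * u)) - sg s * x0 (h * u)) <= m /\
    Rabs (Derive z (a + sg s * (du s * u)) - y0 (h * u)) <= m)
    by (intros s u Hu; apply Hclose; [exact Hu|apply Hpt, Hu]).
  assert (Hsg : forall s, sg s * sg s = 1) by (intros [|]; simpl; ring).
  assert (Hsgabs : forall s x, Rabs (sg s * x) = Rabs x).
  { intros s x. destruct s; simpl; [f_equal; ring|]. rewrite <- (Rabs_Ropp x). f_equal. ring. }
  assert (Hsign : forall s u, 0 < u < 1 -> 0 < sg s * z (a + sg s * (du s * u))).
  { intros s. set (q := fun u => a + sg s * (du s * u)).
    assert (Dq : forall u, is_derive q u (sg s * du s)) by (intros u; unfold q; auto_derive; auto; ring).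
    apply (Hpos (fun u => sg s * z (q u)) (fun u => du s * Derive z (q u))).
    - intros u. apply continuous_Rscal.
      apply (continuous_comp q z); [exact (is_derive_continuous _ _ _ (Dq u))|apply Cz].
    - intros u _. replace (du s * Derive z (q u)) with (sg s * (sg s * du s * Derive z (q u)))
        by (rewrite <- (Rmult_1_l (du s * Derive z (q u))), <- (Hsg s); ring).
      apply (is_derive_scal (fun u => z (q u))).
      exact (is_derive_Rcomp z q u _ _ (Vz (q u)) (Dq u)).
    - unfold q. rewrite !Rmult_0_r, Rplus_0_r, Za. ring.
    - replace (z (q 1)) with 0; [ring|]. unfold q, du, duration. destruct s; simpl sg.
      + replace (a + 1 * ((b - a) * 1)) with b by ring. auto.
      + rewrite <- Hzper. replace (a + -1 * ((2 * h - (b - a)) * 1) + 2 * h) with b by ring. auto.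
    - intros u Hu. destruct (Hcl s u Hu) as [C1' C2']. fold (q u) in C1', C2'. split.
      + replace (sg s * z (q u) - x0 (h * u)) with (sg s * (z (q u) - sg s * x0 (h * u))).
        * rewrite Hsgabs. lra.
        * rewrite Rmult_minus_distr_l, <- Rmult_assoc, Hsg. ring.
      + replace (du s * Derive z (q u) - h * y0 (h * u)) with
          ((du s - h) * y0 (h * u) + du s * (Derive z (q u) - y0 (h * u))) by ring.
        eapply Rle_trans; [apply Rabs_triang|]. rewrite !Rabs_mult, (Rabs_pos_eq (du s)) by (specialize (Pdu s); lra).
        specialize (BY u Hu). specialize (Hdu s). specialize (Pdu s).
        assert (Rabs (du s - h) * Rabs (y0 (h * u)) <= 2 * w0 * Ym) by (apply Rmult_le_compat; auto using Rabs_pos).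
        assert (du s * Rabs (Derive z (q u) - y0 (h * u)) <= 2 * h * m) by (apply Rmult_le_compat; try lra; apply Rabs_pos).
        lra. }
  assert (Hup : forall t, a < t < b -> 0 < z t).
  { intros t Ht. assert (Hu : 0 < (t - a) / (b - a) < 1).
    { split; apply Rmult_lt_reg_r with (b - a); try lra; unfold Rdiv; rewrite Rmult_assoc, Rinv_l; lra. }
    assert (H := Hsign true _ Hu). simpl sg in H. unfold du, duration in H.
    replace (a + 1 * ((b - a) * ((t - a) / (b - a)))) with t in H by (field; lra). lra. }
  assert (Hlow : forall t, b - 2 * h < t < a -> z t < 0).
  { intros t Ht. assert (Hu : 0 < (a - t) / (2 * h - (b - a)) < 1).
    { split; apply Rmult_lt_reg_r with (2 * h - (b - a)); try lra; unfold Rdiv; rewrite Rmult_assoc, Rinv_l; lra. }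
    assert (H := Hsign false _ Hu). simpl sg in H. unfold du, duration in H.
    replace (a + -1 * ((2 * h - (b - a)) * ((a - t) / (2 * h - (b - a))))) with t in H by (field; lra). lra. }
  set (st := state_of_solution h f e z a b).
  assert (SN := N_state eta alpha h f hf e z Hz a b Hab Za Hup Hlow). fold st in SN.
  assert (SX := X1_state eta alpha h f hf e z Hz Hzper a b Hab Za Zb' Hup Hlow). fold st in SX.
  assert (SY := Y1_state eta alpha h f hf e z Hz Hzper a b Hab Za Hup Hlow). fold st in SY.
  assert (SE : closing_defect eta alpha h f st = 0).
  { assert (At := arrival_velocity eta alpha h f true st (SN true) (SX true)).
    assert (Af := arrival_velocity eta alpha h f false st (SN false) (SX false)).
    apply Rmult_eq_reg_l with e; [|exact Hne]. rewrite Rmult_0_r.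
    change (st cEps) with e in At, Af. unfold closing_defect. rewrite Rmult_minus_distr_l.
    replace (e * (Sf eta (tau false st) * closing_moment eta alpha h f true st)) with
      (Sf eta (tau false st) * (e * closing_moment eta alpha h f true st)) by ring.
    replace (e * (Sf eta (tau true st) * closing_moment eta alpha h f false st)) with
      (Sf eta (tau true st) * (e * closing_moment eta alpha h f false st)) by ring.
    rewrite <- At, <- Af, SY. ring. }
  assert (SF : forall i, F e st i = st i).
  { intros i. destruct i as [| | | |s u]; unfold newton_map.
    - reflexivity.
    - rewrite !SX. ring.
    - rewrite SE. ring.
    - rewrite !SX. ring.
    - apply SN. }
  assert (Snear : near r st base).
  { intros i. destruct i as [| | | |s u]; simpl.
    - rewrite Rminus_0_r. exact Her.
    - apply Rabs_le. lra.
    - apply Rle_trans with w0; lra.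
    - destruct (Hcl true 0 ltac:(lra)) as [_ Hc].
      replace (a + sg true * (du true * 0)) with a in Hc by (simpl; ring). rewrite Hy00 in Hc. lra.
    - rewrite <- Rmult_minus_distr_l, Hsgabs. assert (Hc := clamp_range u). unfold phase_point. fold du.
      destruct (Hcl s (clamp u) Hc) as [C1' C2']. assert (C0 := Hpt s (clamp u) Hc).
      apply Hforce; try exact Hc; lra. }
  assert (Est : st = zz e).
  { apply functional_extensionality. apply Zu; auto.
    exact (good_state eta alpha h f hf e z Hz a b). }
  intros t. rewrite <- Est.
  exact (solution_is_position_at eta alpha h f Hh hf e z Hz Hzper a b Hab Za Zb' Hup Hlow t).
Qed.

End TubeUniqueness.

(** * Uniqueness of the branch *)

(** The velocity v > 0 carries the solution off x = 0, and as long as it keeps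
    its sign it coincides with the unperturbed phase, which is positive up to
    time h. Interval induction turns this into agreement on the whole
    half-turn. *)
Lemma unperturbed_half_turn eta alpha h v f z t0 s : C1_R3 f -> half_period_data eta alpha h v ->
  oscillator_solution eta alpha f 0 z -> z t0 = 0 -> sg s * Derive z t0 = v ->
  forall u, 0 <= u <= h -> sg s * z (t0 + u) = orbit_x eta alpha v u /\ sg s * Derive z (t0 + u) = orbit_y eta alpha v u.
Proof.
  intros hf D Hz Z0 V0. assert (Hh := hp_pos _ _ _ _ D). assert (Hv := hp_v_pos _ _ _ _ D).
  assert (Vz := velocity_correct eta alpha f 0 z Hz).
  assert (Cv := velocity_continuous eta alpha f 0 z Hz).
  assert (Cz := position_continuous eta alpha f 0 z Hz).
  set (X0 := orbit_x eta alpha v). set (Y0 := orbit_y eta alpha v).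
  assert (Hsg : sg s * sg s = 1) by (destruct s; simpl; ring).
  set (p := fun u => sg s * z (t0 + u)). set (q := fun u => sg s * Derive z (t0 + u)).
  assert (Dsh : forall u, is_derive (fun u => t0 + u) u 1) by (intros u; auto_derive; auto).
  assert (Csh : forall u, continuous (fun u => t0 + u) u) by (intros u; exact (is_derive_continuous _ _ _ (Dsh u))).
  assert (Cp : forall u, continuous p u).
  { intros u. apply continuous_Rscal. apply (continuous_comp (fun u => t0 + u) z); [apply Csh|apply Cz]. }
  assert (Cq : forall u, continuous q u).
  { intros u. apply continuous_Rscal. apply (continuous_comp (fun u => t0 + u) (Derive z)); [apply Csh|apply Cv]. }
  assert (Hshift : forall (g : R -> R) u l, is_derive g (t0 + u) l -> is_derive (fun u => sg s * g (t0 + u)) u (sg s * l)).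
  { intros g u l Hg. apply (is_derive_scal (fun u => g (t0 + u))).
    assert (H := is_derive_comp (V := R_NormedModule) g (fun u => t0 + u) u l 1 Hg (Dsh u)).
    refine (eq_ind _ (fun l => is_derive (fun u => g (t0 + u)) u l) H l _). exact (Rmult_1_l l). }
  assert (Dp : forall u, is_derive p u (q u)) by (intros u; apply Hshift, Vz).
  (* while z keeps its sign, agreement at the left end propagates *)
  assert (Hprop : forall a b, a <= b -> (forall u, a < u < b -> 0 < p u) -> p a = X0 a -> q a = Y0 a ->
    forall u, a <= u <= b -> p u = X0 u /\ q u = Y0 u).
  { intros a b Hab Hpos Ea Eb u Hu.
    destruct (linear_uniqueness eta 1 (fun u => p u - X0 u) (fun u => q u - Y0 u) a b) with (u := u) as [R1 R2]; try exact Hu.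
    - intros w. apply continuous_Rminus; [apply Cp|apply x0_continuous].
    - intros w. apply continuous_Rminus; [apply Cq|apply y0_continuous].
    - intros w Hw.
      assert (Dq : is_derive q w (sg s * (eta * z (t0 + w) - sg s * alpha + 0 * f (t0 + w) (z (t0 + w)) (Derive z (t0 + w))))).
      { apply Hshift. apply (acceleration_in_phase eta alpha f hf 0 z Hz s (t0 + a) (t0 + b)); [|lra].
        intros t Ht. specialize (Hpos (t - t0) ltac:(lra)). unfold p in Hpos.
        replace (t0 + (t - t0)) with t in Hpos by ring. exact Hpos. }
      split.
      + rewrite Rmult_1_l. apply (is_derive_Rminus p X0); [apply Dp|apply x0_derive].
      + replace (1 * (eta * (p w - X0 w))) with
          (sg s * (eta * z (t0 + w) - sg s * alpha + 0 * f (t0 + w) (z (t0 + w)) (Derive z (t0 + w))) - (eta * X0 w - alpha)).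
        * apply (is_derive_Rminus q Y0); [exact Dq|apply y0_derive].
        * unfold p. transitivity (eta * (sg s * z (t0 + w)) - sg s * sg s * alpha - eta * X0 w + alpha); [ring|].
          rewrite Hsg. ring.
    - lra.
    - lra.
    - lra. }
  assert (P0 : p 0 = X0 0).
  { unfold p, X0, orbit_x. rewrite Rplus_0_r, Z0, Sf_0, Qf_0. ring. }
  assert (Q0 : q 0 = Y0 0).
  { unfold q, Y0, orbit_y. rewrite Rplus_0_r, V0, Sf_0, Cf_0. ring. }
  assert (Hpartial : forall c, 0 <= c < h -> p c = X0 c /\ q c = Y0 c).
  { intros c Hc.
    assert (Hind : (p 0 = X0 0 /\ q 0 = Y0 0) -> forall u, 0 <= u <= c -> p u = X0 u /\ q u = Y0 u).
    { apply (interval_induction (fun a b => (p a = X0 a /\ q a = Y0 a) -> forall u, a <= u <= b -> p u = X0 u /\ q u = Y0 u) 0 c); [lra| |].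
      - intros t Ht. destruct (Req_dec t 0) as [->|Hn].
        + destruct (proj1 (continuous_eps_delta q 0) (Cq 0) v Hv) as [d [Hd H]].
          exists d. split; [exact Hd|]. intros a b A1 A2 A3 A4 A5 A6 [Ea Eb] u Hu.
          assert (a = 0) by lra. subst a.
          apply (Hprop 0 b); auto. intros w Hw.
          destruct (MVT_gen p 0 w q) as [x [Hx E]].
          * intros; apply Dp.
          * intros x _. apply continuity_pt_filterlim, Cp.
          * rewrite Rmin_left, Rmax_right in Hx by lra.
            assert (X00 : X0 0 = 0) by (unfold X0, orbit_x; rewrite Sf_0, Qf_0; ring).
            assert (Y00 : Y0 0 = v) by (unfold Y0, orbit_y; rewrite Sf_0, Cf_0; ring).
            specialize (H x ltac:(rewrite Rminus_0_r, Rabs_pos_eq; lra)). rewrite Eb, Y00 in H.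
            apply Rabs_def2 in H. rewrite Ea, X00 in E.
            assert (0 < q x * (w - 0)) by (apply Rmult_lt_0_compat; lra). lra.
        + assert (Hxt : 0 < X0 t) by (apply (hp_positive _ _ _ _ D); lra).
          destruct (proj1 (continuous_eps_delta p t) (Cp t) (X0 t / 4) ltac:(lra)) as [d1 [Hd1 H1]].
          destruct (proj1 (continuous_eps_delta X0 t) (x0_continuous eta alpha v t) (X0 t / 4) ltac:(lra)) as [d2 [Hd2 H2]].
          exists (Rmin d1 d2). split; [apply Rmin_glb_lt; assumption|].
          generalize (Rmin_l d1 d2) (Rmin_r d1 d2). intros M1 M2.
          intros a b A1 A2 A3 A4 A5 A6 [Ea Eb] u Hu. apply (Hprop a b); auto; try lra.
          assert (K1 := H1 a ltac:(apply Rabs_def1; lra)). assert (K2 := H2 a ltac:(apply Rabs_def1; lra)).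
          rewrite Ea in K1. apply Rabs_def2 in K1, K2.
          intros w Hw. assert (K3 := H1 w ltac:(apply Rabs_def1; lra)). apply Rabs_def2 in K3. lra.
      - intros a b d _ Hab Hbd _ P1 P2 Ha u Hu. destruct (Rle_dec u b) as [L|L].
        + apply P1; auto; lra.
        + apply P2; [apply P1; auto; lra|lra]. }
    apply Hind; auto; lra. }
  intros u Hu. change (p u = X0 u /\ q u = Y0 u).
  destruct (Rlt_le_dec u h) as [Hlt|Hge]; [apply Hpartial; lra|].
  apply (Hprop 0 u); auto; try lra. intros w Hw.
  destruct (Hpartial w ltac:(lra)) as [-> _]. apply (hp_positive _ _ _ _ D). lra.
Qed.

(** Two half-turns, one on each side of x = 0, fill a period. *)
Lemma unperturbed_uniqueness eta alpha h v f z1 z2 t0 : C1_R3 f -> half_period_data eta alpha h v ->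
  periodic_solution (2 * h) eta alpha f 0 z1 -> periodic_solution (2 * h) eta alpha f 0 z2 ->
  z1 t0 = 0 -> Derive z1 t0 = v -> z2 t0 = 0 -> Derive z2 t0 = v -> forall t, z1 t = z2 t.
Proof.
  intros hf D [S1 P1] [S2 P2] A1 A2 B1 B2. assert (Hh := hp_pos _ _ _ _ D).
  assert (Hturn : forall z, oscillator_solution eta alpha f 0 z -> z t0 = 0 -> Derive z t0 = v ->
    (forall u, 0 <= u <= h -> z (t0 + u) = orbit_x eta alpha v u) /\
    (forall u, 0 <= u <= h -> z (t0 + h + u) = - orbit_x eta alpha v u)).
  { intros z Sz Z0 V0.
    assert (H1 := unperturbed_half_turn eta alpha h v f z t0 true hf D Sz Z0 ltac:(simpl; lra)).
    destruct (H1 h ltac:(lra)) as [Xh Yh]. simpl sg in Xh, Yh.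
    assert (Zh : z (t0 + h) = 0).
    { unfold orbit_x in Xh. rewrite (hp_closing _ _ _ _ D) in Xh. lra. }
    assert (Vh : sg false * Derive z (t0 + h) = v).
    { rewrite (y0_h eta alpha h v D) in Yh. simpl. lra. }
    assert (H2 := unperturbed_half_turn eta alpha h v f z (t0 + h) false hf D Sz Zh Vh).
    split; intros u Hu.
    - destruct (H1 u Hu) as [E _]. simpl in E. lra.
    - destruct (H2 u Hu) as [E _]. simpl in E. lra. }
  destruct (Hturn z1 S1 A1 A2) as [U1 L1]. destruct (Hturn z2 S2 B1 B2) as [U2 L2].
  assert (Hmain : forall t, t0 <= t < t0 + 2 * h -> z1 t = z2 t).
  { intros t Ht. destruct (Rle_lt_dec t (t0 + h)) as [Hl|Hg].
    - replace t with (t0 + (t - t0)) by ring. rewrite U1, U2 by lra. reflexivity.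
    - replace t with (t0 + h + (t - t0 - h)) by ring. rewrite L1, L2 by lra. reflexivity. }
  intros t. set (k := Int_part ((t - t0) / (2 * h))).
  destruct (base_Int_part ((t - t0) / (2 * h))) as [H1 H2]. fold k in H1, H2.
  assert (E : (t - t0) / (2 * h) * (2 * h) = t - t0) by (field; lra).
  apply (Rmult_le_compat_r (2 * h)) in H1; [|lra]. rewrite E in H1.
  apply Rgt_lt, (Rmult_lt_compat_r (2 * h)) in H2; [|lra]. rewrite Rmult_minus_distr_r, E in H2.
  rewrite <- (periodic_shift z1 (2 * h) (- k) P1 t), <- (periodic_shift z2 (2 * h) (- k) P2 t).
  apply Hmain. rewrite opp_IZR. lra.
Qed.

(** Continuity in e of x e and of its velocity, uniformly in time: compactness
    of a period for the velocity, and integration of it for the position. *)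
Lemma C1_strip_uniform eb x T : 0 < T -> C1_strip eb x ->
  (forall e t, Rabs e < eb -> x e (t + T) = x e t) ->
  forall e1 d, Rabs e1 < eb -> 0 < d -> exists dl, 0 < dl /\ forall e, Rabs (e - e1) < dl -> Rabs e < eb ->
    forall t, Rabs (x e t - x e1 t) < d /\ Rabs (Derive (x e) t - Derive (x e1) t) < d.
Proof.
  intros HT HC Hper e1 d He1 Hd.
  set (d' := d / (2 * (T + 1))). assert (Pd' : 0 < d') by (apply Rdiv_lt_0_compat; lra).
  assert (Ed' : d' * (2 * (T + 1)) = d) by (unfold d'; field; lra).
  assert (Hdper : forall e t, Rabs e < eb -> Derive (x e) (t + T) = Derive (x e) t).
  { intros e t He. apply is_derive_unique.
    assert (H := is_derive_periodic_shift (x e) T 1 t (Derive (x e) t) (fun t => Hper e t He)).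
    rewrite Rmult_1_l in H. apply H. apply Derive_correct. apply (HC e t He). }
  destruct (uniform_on_interval (fun t dl => forall e, Rabs (e - e1) < dl -> Rabs e < eb ->
    Rabs (Derive (x e) t - Derive (x e1) t) < d') 0 T) as [g [Pg Hg]].
  { lra. } { intros u a b Hb Hba H e He1' He2. apply H; lra. }
  { intros t _. destruct (HC e1 t He1) as [_ [_ [_ Hc]]].
    destruct (Hc (mkposreal (d' / 2) ltac:(lra))) as [g Hg]. simpl in Hg.
    exists g. split; [apply cond_pos|]. intros u _ Hu e He He'.
    assert (K1 : Rabs (Derive (x e) u - Derive (x e1) t) < d' / 2) by exact (Hg e u He Hu).
    assert (K2 : Rabs (Derive (x e1) u - Derive (x e1) t) < d' / 2).
    { apply (Hg e1 u); [rewrite Rminus_diag, Rabs_R0; apply cond_pos|exact Hu]. }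
    apply Rabs_def2 in K1, K2. apply Rabs_def1; lra. }
  assert (Cx : continuous (fun e => x e 0) e1).
  { apply (ex_derive_continuous (V := R_NormedModule)). apply (HC e1 0 He1). }
  destruct (proj1 (continuous_eps_delta _ _) Cx (d / 2) ltac:(lra)) as [g2 [Pg2 Hg2]].
  exists (Rmin g g2). split; [apply Rmin_glb_lt; assumption|].
  intros e He He'. apply Rmin_Rgt in He. destruct He as [Ha Hb].
  assert (Hmain : forall t, 0 <= t <= T -> Rabs (x e t - x e1 t) < d /\ Rabs (Derive (x e) t - Derive (x e1) t) < d).
  { intros t Ht. assert (Hdt := Hg t Ht e Ha He'). split; [|nra].
    set (w := fun t => x e t - x e1 t).
    assert (Dw : forall t, is_derive w t (Derive (x e) t - Derive (x e1) t)).
    { intros y. apply (is_derive_Rminus (x e) (x e1)).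
      - apply Derive_correct. apply (HC e y He').
      - apply Derive_correct. apply (HC e1 y He1). }
    destruct (MVT_gen w 0 t (fun t => Derive (x e) t - Derive (x e1) t)) as [c [Hc E]].
    - intros; apply Dw.
    - intros y _. apply continuity_pt_filterlim. exact (is_derive_continuous _ _ _ (Dw y)).
    - rewrite Rmin_left, Rmax_right in Hc by lra.
      change (x e t - x e1 t) with (w t). replace (w t) with (w 0 + (Derive (x e) c - Derive (x e1) c) * (t - 0)) by lra.
      eapply Rle_lt_trans; [apply Rabs_triang|]. rewrite Rabs_mult, (Rabs_pos_eq (t - 0)) by lra.
      assert (K := Hg2 e Hb). change (Rabs (w 0) < d / 2) in K.
      assert (K2 := Hg c ltac:(lra) e Ha He').
      assert (Rabs (Derive (x e) c - Derive (x e1) c) * (t - 0) <= d' * T).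
      { apply Rmult_le_compat; try lra. apply Rabs_pos. }
      nra. }
  intros t. set (k := Int_part (t / T)).
  destruct (base_Int_part (t / T)) as [H1 H2]. fold k in H1, H2.
  assert (E : t / T * T = t) by (field; lra).
  apply (Rmult_le_compat_r T) in H1; [|lra]. rewrite E in H1.
  apply Rgt_lt, (Rmult_lt_compat_r T) in H2; [|lra]. rewrite Rmult_minus_distr_r, E in H2.
  rewrite <- (periodic_shift (x e) T (- k) (fun t => Hper e t He') t),
    <- (periodic_shift (x e1) T (- k) (fun t => Hper e1 t He1) t),
    <- (periodic_shift (Derive (x e)) T (- k) (fun t => Hdper e t He') t),
    <- (periodic_shift (Derive (x e1)) T (- k) (fun t => Hdper e1 t He1) t).
  apply Hmain. rewrite opp_IZR. lra.
Qed.

Lemma C1_strip_le eb eb' x : eb' <= eb -> C1_strip eb x -> C1_strip eb' x.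
Proof. intros Hle H e t He. apply H. lra. Qed.

(** Agreement at one parameter c0 spreads to a neighbourhood of fixed size near
    any s: close to s the other branch moves little, and at c0 it coincides
    with the first one, which stays in the tube of radius d0 / 2; so it stays
    in the tube of radius d0, where the first branch is the only solution.
    Starting from 0, this reaches the whole parameter interval. *)
Lemma branch_uniqueness eb x z T (Q : R -> (R -> R) -> Prop) d0 : 0 < T -> 0 < d0 ->
  C1_strip eb x -> C1_strip eb z ->
  (forall e t, Rabs e < eb -> x e (t + T) = x e t) -> (forall e t, Rabs e < eb -> z e (t + T) = z e t) ->
  (forall e, Rabs e < eb -> Q e (z e)) ->
  (forall e, Rabs e < eb -> forall t, Rabs (x e t - x 0 t) < d0 / 2 /\ Rabs (Derive (x e) t - Derive (x 0) t) < d0 / 2) ->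
  (forall e y, Rabs e < eb -> e <> 0 -> Q e y ->
     (forall t, Rabs (y t - x 0 t) < d0 /\ Rabs (Derive y t - Derive (x 0) t) < d0) -> forall t, y t = x e t) ->
  (forall t, z 0 t = x 0 t) ->
  forall e t, Rabs e < eb -> z e t = x e t.
Proof.
  intros HT Hd0 Cx Cz Px Pz HQ Htube Huniq H0 e t He.
  set (agree := fun e => forall t, z e t = x e t).
  assert (Heb : - Rabs e <= Rabs e) by (generalize (Rabs_pos e); lra).
  assert (Hind : (exists c, - Rabs e <= c <= Rabs e /\ agree c) -> forall c, - Rabs e <= c <= Rabs e -> agree c).
  { apply (interval_induction (fun a b => (exists c, a <= c <= b /\ agree c) -> forall c, a <= c <= b -> agree c)
      (- Rabs e) (Rabs e) Heb).
    - intros s Hs. assert (Hse : Rabs s < eb) by (apply Rle_lt_trans with (Rabs e); [apply Rabs_le; lra|exact He]).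
      destruct (C1_strip_uniform eb z T HT Cz Pz s (d0 / 4) Hse ltac:(lra)) as [dl [Pdl Hdl]].
      exists dl. split; [exact Pdl|]. intros a b A1 A2 A3 A4 A5 A6 [c0 [Hc0 Ac0]] c Hc.
      assert (Hin : forall c, a <= c <= b -> Rabs c < eb /\ Rabs (c - s) < dl).
      { intros y Hy. split; [apply Rle_lt_trans with (Rabs e); [apply Rabs_le; lra|exact He]|apply Rabs_def1; lra]. }
      destruct (Hin c Hc) as [B1 B2]. destruct (Hin c0 Hc0) as [B3 B4].
      destruct (Req_dec c 0) as [->|Hn]; [exact H0|].
      refine (Huniq c (z c) B1 Hn (HQ c B1) _). intros y.
      (* z c is close to z c0 = x c0, which is in the smaller tube around x 0 *)
      assert (Ez : z c0 = x c0) by (apply functional_extensionality; exact Ac0).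
      destruct (Hdl c B2 B1 y) as [K1 K2]. destruct (Hdl c0 B4 B3 y) as [K3 K4].
      destruct (Htube c0 B3 y) as [K5 K6]. rewrite Ez in K3, K4.
      apply Rabs_def2 in K1, K2, K3, K4, K5, K6. split; apply Rabs_def1; lra.
    - intros a b d _ Hab Hbd _ P1 P2 [c0 [Hc0 A0]] c Hc.
      assert (Ab : agree b).
      { destruct (Rle_lt_dec c0 b) as [L|L].
        - apply P1; [exists c0; split; [lra|exact A0]|lra].
        - apply P2; [exists c0; split; [lra|exact A0]|lra]. }
      destruct (Rle_lt_dec c b) as [L|L].
      + apply P1; [exists b; split; [lra|exact Ab]|lra].
      + apply P2; [exists b; split; [lra|exact Ab]|lra]. }
  apply Hind.
  - exists 0. split; [generalize (Rabs_pos e); lra|exact H0].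
  - generalize (Rle_abs e) (Rle_abs (- e)). rewrite Rabs_Ropp. lra.
Qed.

Theorem theoremA (sigma alpha eta : R) (f : R -> R -> R -> R) (c : param_case)
    (hsigma : 0 < sigma)
    (hf : C1_R3 f)
    (hper : forall t x y, f (t + sigma) x y = f t x y)
    (hc : param_cond c eta alpha)
    (hrange : half_period_range c eta (sigma / 2))
    (phi : R) (hphi : 0 <= phi <= sigma)
    (hM : melnikov c sigma eta alpha f phi = 0)
    (hM' : Derive (melnikov c sigma eta alpha f) phi <> 0) :
  exists eb : R, 0 < eb /\
  exists x : R -> R -> R,
    smooth_branch sigma eta alpha f phi
      (half_period_inv c eta alpha (sigma / 2)) eb x /\
    forall z : R -> R -> R,
      smooth_branch sigma eta alpha f phi
        (half_period_inv c eta alpha (sigma / 2)) eb z ->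
      forall eps t, Rabs eps < eb -> z eps t = x eps t.
Proof.
  set (h := sigma / 2) in *.
  assert (Es : sigma = 2 * h) by (unfold h; field).
  set (v := half_period_inv c eta alpha h).
  assert (D : half_period_data eta alpha h v) by (apply half_period_data_of_case; assumption).
  assert (EM : melnikov c sigma eta alpha f = melnikov_SCQ eta alpha h v f).
  { apply functional_extensionality. intros p. unfold melnikov, melnikov_SCQ. fold h. fold v.
    apply RInt_ext. intros t _. rewrite Gamma_SCQ. reflexivity. }
  rewrite EM in hM, hM'. clear EM hphi. rewrite Es in hper |- *. clear hsigma Es hrange. clearbody v h.
  assert (Hh := hp_pos _ _ _ _ D).
  destruct (closed_branch eta alpha h v f phi hf D hM hM')
    as [rho [r [L [zz [Hrho [Hr [HL [Zc [Zu [Zl [Zb Zd]]]]]]]]]]].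
  assert (E0 : zz 0 = base_state eta alpha h v f phi) by (apply functional_extensionality, Zb).
  assert (Hz0 : Rabs 0 < rho) by (rewrite Rabs_R0; exact Hrho).
  assert (Cb : periodic_state eta alpha h f (base_state eta alpha h v f phi)) by (rewrite <- E0; apply Zc, Hz0).
  set (x := fun e => position_at eta alpha h (zz e)).
  assert (Zc' : forall e, Rabs e < rho -> periodic_state eta alpha h f (zz e)) by (intros e He; apply Zc, He).
  assert (Sx := position_at_sd2 eta alpha h f Hh rho L zz HL Zc' Zl Zd).
  assert (xy : forall e t, Rabs e < rho -> is_derive (x e) t (velocity_at eta alpha h (zz e) t)).
  { intros e t He. destruct (Sx e t He) as [a Ha]. exact (proj2 (sd2_is_derive _ _ _ _ _ Ha)). }
  assert (Dx : forall e, Rabs e < rho -> Derive (x e) = velocity_at eta alpha h (zz e)).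
  { intros e He. apply functional_extensionality. intros t. apply is_derive_unique, xy, He. }
  assert (Hx : forall e, Rabs e < rho -> periodic_solution (2 * h) eta alpha f e (x e)).
  { intros e He. destruct (Zc e He) as [Cz [Ee Pz]]. rewrite <- Ee at 1.
    apply periodic_solution_of_closed with (f := f); auto. intros t. apply xy, He. }
  assert (Cx : C1_strip rho x).
  { apply C1_strip_of_sd2. intros e t He. destruct (Sx e t He) as [a Ha].
    exists a. eexists. exact Ha. }
  destruct (tube_uniqueness eta alpha h v f phi hf D Cb rho r zz Hr Zu) as [d0 [Hd0 Htube]].
  rewrite <- E0 in Htube. fold (x 0) in Htube. rewrite <- (Dx 0 Hz0) in Htube.
  destruct (C1_strip_uniform rho x (2 * h) ltac:(lra) Cx (fun e t He => proj2 (Hx e He) t) 0 (d0 / 2) Hz0 ltac:(lra))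
    as [dl [Hdl Hclose]].
  set (eb := Rmin (Rmin rho r) dl).
  assert (Heb : 0 < eb) by (unfold eb; repeat apply Rmin_glb_lt; assumption).
  assert (Hsmall : forall e, Rabs e < eb -> Rabs e < rho /\ Rabs e <= r /\ Rabs (e - 0) < dl).
  { intros e He. unfold eb in He. apply Rmin_Rgt in He. destruct He as [H1 H2].
    apply Rmin_Rgt in H1. rewrite Rminus_0_r. lra. }
  assert (Hnear : forall e, Rabs e < eb -> forall t,
    Rabs (x e t - x 0 t) < d0 / 2 /\ Rabs (Derive (x e) t - Derive (x 0) t) < d0 / 2).
  { intros e He. destruct (Hsmall e He) as [H1 [_ H2]]. apply Hclose; assumption. }
  assert (Hle : eb <= rho) by (unfold eb; eapply Rle_trans; [apply Rmin_l|apply Rmin_l]).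
  assert (X0 : x 0 phi = 0 /\ Derive (x 0) phi = v).
  { rewrite (Dx 0 Hz0). unfold x. rewrite E0.
    destruct (base_orbit eta alpha h v f phi D Cb true 0 ltac:(lra)) as [A1 A2].
    replace (phi + sg true * (h * 0)) with phi in A1, A2 by (simpl; ring).
    rewrite A1, A2. unfold orbit_x, orbit_y. rewrite Rmult_0_r, Sf_0, Cf_0, Qf_0. split; ring. }
  exists eb. split; [exact Heb|]. exists x. split.
  - split; [apply C1_strip_le with rho; assumption|].
    split; [intros e He; apply Hx; lra|]. split; [|exact X0].
    intros e He Hne. split; [apply Hx; lra|].
    exists (d0 / 2). split; [lra|]. intros z Hz Hzt.
    destruct (Hsmall e He) as [H1 [H2 _]].
    apply (Htube e z H1 H2 Hne Hz). intros t.
    destruct (Hzt t) as [K1 K2]. destruct (Hnear e He t) as [K3 K4].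
    apply Rabs_def2 in K1, K2, K3, K4. split; apply Rabs_def1; lra.
  - intros z [Cz [Hz [_ [Z0 V0]]]].
    apply (branch_uniqueness eb x z (2 * h) (fun e y => periodic_solution (2 * h) eta alpha f e y) d0);
      auto; try lra.
    + apply C1_strip_le with rho; assumption.
    + intros e t He. apply Hx. lra.
    + intros e t He. apply Hz, He.
    + intros e y He Hne Hy Hyt. destruct (Hsmall e He) as [H1 [H2 _]]. apply (Htube e y H1 H2 Hne Hy Hyt).
    + apply (unperturbed_uniqueness eta alpha h v f (z 0) (x 0) phi hf D); try tauto.
      * apply Hz. rewrite Rabs_R0. exact Heb.
      * apply Hx, Hz0.
Qed.
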